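(* Let $E$ be a Hermite–Biehler function such that the de Branges space $\mathcal{H}(E^2)$ is closed by differentiation (i.e. $F'\in\mathcal{H}(E^2)$ whenever $F\in\mathcal{H}(E^2)$). Suppose that for a real number $\alpha$ we have $A_\alpha B_\alpha\notin\mathcal{H}(E^2)$ and that $\varphi'(x)$ is bounded away from zero for $x\in\mathcal{T}(\alpha)$. Then, if $p\in[1,2]$ and $F\in\mathcal{H}^p(E^2)$, we have $$F(z)=B_\alpha(z)^2\sum_{t\in\mathcal{T}(\alpha)}\bigg\{\frac{F(t)}{B_\alpha'(t)^2(z-t)^2}+\frac{F'(t)B_\alpha'(t)-F(t)B_\alpha''(t)}{B_\alpha'(t)^3(z-t)}\bigg\},$$ where the sum converges uniformly on compact subsets of $\mathbb{C}$. This formula is also valid for $p\in(2,\infty)$ if one additionally assumes that $v(E^*/E)<0$.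
   Context: $\mathcal{U}=\{z:\mathrm{Im}\,z>0\}$. An analytic $F:\mathcal{U}\to\mathbb{C}$ has bounded type if it is a quotient of two bounded analytic functions on $\mathcal{U}$; its mean type is $v(F)=\limsup_{y\to\infty}y^{-1}\log|F(iy)|$. For entire $E$, $E^*(z)=\overline{E(\bar z)}$. $E$ is Hermite–Biehler if it is entire and $|E^*(z)|<|E(z)|$ for all $z\in\mathcal{U}$. For real $\alpha$, write $e^{i\alpha}E(z)=A_\alpha(z)-iB_\alpha(z)$ with $A_\alpha=\frac12(e^{i\alpha}E+e^{-i\alpha}E^* )$, $B_\alpha=\frac i2(e^{i\alpha}E-e^{-i\alpha}E^* )$ real entire functions. The phase function $\varphi$ of $E$ is a real analytic function on $\mathbb{R}$ with $e^{i\varphi(x)}E(x)\in\mathbb{R}$ for all real $x$ (it satisfies $\varphi'>0$; any two choices differ by an integer multiple of $\pi$); $\mathcal{T}(\alpha)=\{x\in\mathbb{R}:\varphi(x)\equiv\alpha \pmod \pi\}$. Note $E^2$ is again Hermite–Biehler. For a Hermite–Biehler $E$ and $p\in(0,\infty]$, $\mathcal{H}^p(E)$ is the space of entire $F$ such that $F/E$ and $F^*/E$ have bounded type in $\mathcal{U}$ with non-positive mean type and $\|F\|_{E,p}=(\int_{\mathbb{R}}|F(x)/E(x)|^p\,dx)^{1/p}<\infty$ (for $p=\infty$: $\sup_{x\in\mathbb{R}}|F(x)/E(x)|<\infty$); $\mathcal{H}(E)=\mathcal{H}^2(E)$, a Hilbert space with inner product $\langle F,G\rangle_E=\int_{\mathbb{R}}F\overline{G}|E|^{-2}dx$.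 *)

(* Defs.v *)
From Stdlib Require Import Reals List.
From Coquelicot Require Import Coquelicot.
Open Scope R_scope.

Definition in_U (z : C) : Prop := 0 < Im z.

Definition Cdiff (f : C -> C) (z : C) : Prop := exists l : C, is_derive f z l.

Definition entire (f : C -> C) : Prop := forall z, Cdiff f z.

Definition analytic_on_U (f : C -> C) : Prop := forall z, in_U z -> Cdiff f z.

Definition bounded_on_U (f : C -> C) : Prop :=
  exists M : R, forall z, in_U z -> Cmod (f z) <= M.

Definition bounded_type (F : C -> C) : Prop :=
  analytic_on_U F /\
  exists G H : C -> C,
    analytic_on_U G /\ analytic_on_U H /\ bounded_on_U G /\ bounded_on_U H /\
    (exists z0, in_U z0 /\ H z0 <> 0%C) /\
    (forall z, in_U z -> (F z * H z)%C = G z).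

(* v(F) <= c, where v(F) = limsup_{y -> +oo} y^{-1} log |F(iy)|
   (unfolded: for every eps > 0, eventually log|F(iy)| <= (c + eps) y) *)
Definition mean_type_le (F : C -> C) (c : R) : Prop :=
  forall eps : R, 0 < eps ->
    exists Y : R, forall y : R, Y <= y -> Cmod (F (0, y)) <= exp ((c + eps) * y).

Definition mean_type_lt (F : C -> C) (c : R) : Prop :=
  exists c' : R, c' < c /\ mean_type_le F c'.

Definition Cstar (E : C -> C) : C -> C := fun z => Cconj (E (Cconj z)).

Definition Hermite_Biehler (E : C -> C) : Prop :=
  entire E /\ forall z, in_U z -> Cmod (Cstar E z) < Cmod (E z).

Definition Csq (E : C -> C) : C -> C := fun z => (E z * E z)%C.

(* x^p for x >= 0, p > 0, with 0^p = 0 *)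
Definition powp (x p : R) : R := if Rlt_dec 0 x then Rpower x p else 0.

Definition Hp (E : C -> C) (p : R) (F : C -> C) : Prop :=
  entire F /\
  bounded_type (fun z => (F z / E z)%C) /\ mean_type_le (fun z => (F z / E z)%C) 0 /\
  bounded_type (fun z => (Cstar F z / E z)%C) /\ mean_type_le (fun z => (Cstar F z / E z)%C) 0 /\
  ex_RInt_gen (fun x : R => powp (Cmod (F (RtoC x) / E (RtoC x))%C) p)
    (Rbar_locally m_infty) (Rbar_locally p_infty).

Definition HdB (E : C -> C) (F : C -> C) : Prop := Hp E 2 F.

Definition eia (a : R) : C := (cos a, sin a).

Definition A_alpha (E : C -> C) (a : R) : C -> C :=
  fun z => ((/ 2) * (eia a * E z + eia (- a) * Cstar E z))%C.

Definition B_alpha (E : C -> C) (a : R) : C -> C :=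
  fun z => ((Ci / 2) * (eia a * E z - eia (- a) * Cstar E z))%C.

Definition real_analytic (f : R -> R) : Prop :=
  forall x0 : R, exists (a : nat -> R) (r : R), 0 < r /\
    forall x, Rabs (x - x0) < r -> is_pseries a (x - x0) (f x).

Definition phase_function (E : C -> C) (phi : R -> R) : Prop :=
  real_analytic phi /\ forall x : R, Im (eia (phi x) * E (RtoC x))%C = 0.

Definition T_set (phi : R -> R) (a : R) (x : R) : Prop :=
  exists k : Z, phi x = a + IZR k * PI.

Definition interp_term (F dF B dB ddB : C -> C) (t : R) (z : C) : C :=
  (F (RtoC t) / (dB (RtoC t) * dB (RtoC t) * ((z - RtoC t) * (z - RtoC t)))
   + (dF (RtoC t) * dB (RtoC t) - F (RtoC t) * ddB (RtoC t))
     / (dB (RtoC t) * dB (RtoC t) * dB (RtoC t) * (z - RtoC t)))%C.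

Definition Csum_list (l : list R) (g : R -> C) : C :=
  fold_right (fun t acc => (g t + acc)%C) 0%C l.

(* Unconditional convergence of sum_{t in T} g t z to S z, uniformly for z in the
   set K: the net of finite partial sums (finite subsets of T, as duplicate-free
   lists) converges uniformly on K. *)
Definition unif_sum_conv (T : R -> Prop) (g : R -> C -> C) (S : C -> C)
    (K : C -> Prop) : Prop :=
  forall eps : R, 0 < eps ->
    exists l0 : list R, NoDup l0 /\ (forall t, In t l0 -> T t) /\
      forall l : list R, NoDup l -> (forall t, In t l -> T t) ->
        (forall t, In t l0 -> In t l) ->
        forall z, K z -> Cmod (S z - Csum_list l (fun t => g t z))%C < eps.

(* Main.v *)
Require Import Defs.
From Stdlib Require Import Permutation Wf_nat Reals Lra Lia List ClassicalEpsilon FunctionalExtensionality.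
From Coquelicot Require Import Coquelicot.
Open Scope R_scope.

(* Write Theta = E^*/E and g = F/E^2. Closure under differentiation first forbids real zeros of E:
   with the kernel K(z) = (E(z) - conj(Theta(i)) E^*(z))/(z + i), the function E K lies in H(E^2), and
   so do all its derivatives, which would all vanish at a real zero. It also forbids the phase to
   increase by 1/2 on arbitrarily short intervals: otherwise a lacunary series of such kernels,
   multiplied by E and by E^*, would produce two elements of H(E^2) whose derivatives are not
   square integrable against |E|^{-4}. Hence Theta is bounded below in a strip above the real axis,
   E has no zeros in a strip below it, and Theta', Theta'' are bounded on R.
   Since Phragmen-Lindelof bounds on differences of a primitive of g turn the L^p condition
   into summability of (|g(t)| + |g'(t)|)/(1 + |t|) over T(alpha), the series converges to a
   function S, and F/B^2 - S is entire of polynomial growth, hence quadratic. Evaluating on iy it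
   vanishes: |g(iy)| <= C y^{-1/p}, while A/B has an expansion over T(alpha) without linear term (a
   linear term would put A B into H(E^2)), so that E/B grows on iy slower than any power of y. *)

(** * Complex differentiation and integration along segments *)

(** Bounded type yields only the growth exp (c (1 + |z|^2) / Im z), which blows up at the real axis,
    while membership in the space yields only integrals of |g|^p over R. The maximum principle joins
    the two: explicit barriers on half and quarter discs play the role of harmonic measure, and
    differences of a primitive of g that of the mean values of |g|^p. The exponent p enters through
    pointwise splittings of x into a constant and a multiple of x^p. The increase 1/2 of the phase
    is a rotation of Theta by one radian. It is large enough for the n-th kernel of the lacunary
    series to produce a definite increment, and small enough that Re (conj (Theta x) Theta) >= cos 1
    >= 1/2 wherever no such increase occurs. At the end g(iy) decays only like y^{-1/p}, whereas E/B
    enters squared. Hence E/B has to grow slower than y^{1/(2p)} on iy, with p arbitrarily large;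
    this is why the partial fractions of A/B are estimated by y^kappa for every kappa > 0. The value
    kappa = 1/(4p) then leaves y^{-1/(2p)}. *)

(* The explicit form avoids Coquelicot's two distinct normed-module structures on C. *)
Definition cd (f : C -> C) (z l : C) : Prop :=
  forall eps, 0 < eps -> exists d, 0 < d /\ forall w, Cmod (w - z) < d ->
    Cmod (f w - f z - l * (w - z)) <= eps * Cmod (w - z).

Lemma C_locally (z : C) (P : C -> Prop) :
  locally (T := AbsRing_UniformSpace C_AbsRing) z P <->
  exists d, 0 < d /\ forall w, Cmod (w - z) < d -> P w.
Proof.
  split.
  - intros [d H]. exists d. split; [apply cond_pos|]. intros w Hw. apply H. exact Hw.
  - intros [d [Hd H]]. exists (mkposreal d Hd). intros w Hw. apply H. exact Hw.
Qed.

(** One script serves both structures, since each unfolds to the same inequality up to the order of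
    the factors [l] and [w - z]. The limit point of the filter is identified with [z] before the
    epsilon is used. *)
Ltac is_derive_eps_delta := split;
  [ intros [_ H] eps He; specialize (H _ (fun P HP => HP) (mkposreal eps He));
    apply C_locally in H; destruct H as [d [Hd H]]; exists d; split; [assumption|]; intros w Hw; specialize (H w Hw); simpl in H;
    rewrite (Cmult_comm _ (w - _)%C); exact H
  | intros H; split; [apply is_linear_scal_l|]; intros x Hx eps;
    rewrite <- (is_filter_lim_locally_unique (K := C_AbsRing) (V := AbsRing_NormedModule C_AbsRing) _ x Hx);
    apply C_locally; destruct (H eps (cond_pos eps)) as [d [Hd H']]; exists d; split; [assumption|]; intros w Hw; specialize (H' w Hw);
    rewrite (Cmult_comm _ (w - _)%C) in H'; exact H' ].

Lemma is_derive_cd (f : C -> C) (z l : C) : is_derive f z l <-> cd f z l.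
Proof. is_derive_eps_delta. Qed.

(** The product and chain rules come for C as a module over itself, linear combinations for the
    other structure; with both equivalences [cd] inherits all of them. *)
Lemma is_derive_cd_ring (f : C -> C) (z l : C) :
  @is_derive C_AbsRing (AbsRing_NormedModule C_AbsRing) f z l <-> cd f z l.
Proof. is_derive_eps_delta. Qed.

Lemma cd_Cdiff f z l : cd f z l -> Cdiff f z.
Proof. intros H. exists l. now apply is_derive_cd. Qed.

Lemma cd_C_derive f z : Cdiff f z -> cd f z (C_derive f z).
Proof. intros H. apply is_derive_cd. now apply (C_derive_correct f z 0%C). Qed.

Lemma C_derive_cd f z l : cd f z l -> C_derive f z = l.
Proof. intros H. apply is_C_derive_unique. now apply is_derive_cd. Qed.

Lemma cd_const c z : cd (fun _ => c) z 0.
Proof. apply is_derive_cd. exact (@is_derive_const C_AbsRing C_NormedModule c z). Qed.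

Lemma cd_id z : cd (fun w => w) z 1.
Proof. apply is_derive_cd_ring. exact (@is_derive_id C_AbsRing z). Qed.

Lemma cd_plus f g z l m : cd f z l -> cd g z m -> cd (fun w => f w + g w)%C z (l + m).
Proof. rewrite <- !is_derive_cd. exact (@is_derive_plus C_AbsRing C_NormedModule f g z l m). Qed.

Lemma cd_minus f g z l m : cd f z l -> cd g z m -> cd (fun w => f w - g w)%C z (l - m).
Proof. rewrite <- !is_derive_cd. exact (@is_derive_minus C_AbsRing C_NormedModule f g z l m). Qed.

Lemma cd_mult f g z l m : cd f z l -> cd g z m -> cd (fun w => f w * g w)%C z (l * g z + f z * m).
Proof.
  rewrite <- !is_derive_cd_ring. intros H1 H2.
  exact (@is_derive_mult C_AbsRing f g z l m H1 H2 Cmult_comm).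
Qed.

Lemma cd_scal c f z l : cd f z l -> cd (fun w => c * f w)%C z (c * l).
Proof.
  intros H. replace (c * l)%C with (0 * f z + c * l)%C by ring.
  apply (cd_mult (fun _ => c) f); [apply cd_const|assumption].
Qed.

Lemma cd_comp f g z l m : cd f (g z) l -> cd g z m -> cd (fun w => f (g w)) z (l * m).
Proof.
  rewrite <- !is_derive_cd_ring. intros H1 H2. rewrite Cmult_comm.
  exact (@is_derive_comp C_AbsRing (AbsRing_NormedModule C_AbsRing) f g z l m H1 H2).
Qed.

Lemma cd_loc f g z l d : 0 < d -> (forall w, Cmod (w - z) < d -> f w = g w) -> cd f z l -> cd g z l.
Proof.
  intros Hd He H eps Heps. destruct (H eps Heps) as [d' [Hd' H']].
  exists (Rmin d d'). split; [now apply Rmin_glb_lt|]. intros w Hw.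
  assert (Hz : f z = g z).
  { apply He. replace (z - z)%C with (RtoC 0) by ring. rewrite Cmod_0. assumption. }
  rewrite <- He, <- Hz. apply H'.
  - eapply Rlt_le_trans; [exact Hw|apply Rmin_r].
  - eapply Rlt_le_trans; [exact Hw|apply Rmin_l].
Qed.

Lemma cd_ext f g z l : (forall w, f w = g w) -> cd f z l -> cd g z l.
Proof. intros He. apply (cd_loc f g z l 1); [lra|auto]. Qed.

Definition ccont (f : C -> C) (z : C) : Prop :=
  forall eps, 0 < eps -> exists d, 0 < d /\ forall w, Cmod (w - z) < d -> Cmod (f w - f z) < eps.

Lemma cd_ccont f z l : cd f z l -> ccont f z.
Proof.
  intros H eps He. destruct (H 1 Rlt_0_1) as [d [Hd H']].
  pose proof (Cmod_ge_0 l) as Hl.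
  assert (Hpos : 0 < eps / (2 + Cmod l)) by (apply Rdiv_lt_0_compat; lra).
  exists (Rmin d (eps / (2 + Cmod l))). split; [now apply Rmin_glb_lt|].
  intros w Hw.
  assert (H1 : Cmod (w - z) < d) by (eapply Rlt_le_trans; [exact Hw|apply Rmin_l]).
  assert (H2 : Cmod (w - z) < eps / (2 + Cmod l)) by (eapply Rlt_le_trans; [exact Hw|apply Rmin_r]).
  specialize (H' w H1).
  replace (f w - f z)%C with ((f w - f z - l * (w - z)) + l * (w - z))%C by ring.
  eapply Rle_lt_trans; [apply Cmod_triangle|]. rewrite Cmod_mult.
  assert (H3 : Cmod (w - z) * (2 + Cmod l) < eps).
  { apply Rmult_lt_reg_r with (/ (2 + Cmod l)).
    - apply Rinv_0_lt_compat. lra.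
    - rewrite Rmult_assoc, Rinv_r by lra. unfold Rdiv in H2. lra. }
  pose proof (Cmod_ge_0 (w - z)). nra.
Qed.

Lemma Cdiff_ccont f z : Cdiff f z -> ccont f z.
Proof. intros H. exact (cd_ccont _ _ _ (cd_C_derive f z H)). Qed.

Lemma ccont_neq0 f z : ccont f z -> f z <> 0%C ->
  exists d, 0 < d /\ forall w, Cmod (w - z) < d -> Cmod (f z) / 2 < Cmod (f w).
Proof.
  intros H Hz. apply Cmod_gt_0 in Hz.
  destruct (H (Cmod (f z) / 2)) as [d [Hd Hw]]; [lra|].
  exists d. split; [assumption|]. intros w Hw'. specialize (Hw w Hw').
  pose proof (Cmod_triangle (f w) (f z - f w)) as Ht.
  replace (f w + (f z - f w))%C with (f z) in Ht by ring.
  replace (f z - f w)%C with (- (f w - f z))%C in Ht by ring. rewrite Cmod_opp in Ht. lra.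
Qed.

Lemma Cmod_pos_neq (z : C) : 0 < Cmod z -> z <> 0%C.
Proof. apply Cmod_gt_0. Qed.

Ltac Cext := apply injective_projections; simpl; ring.

Lemma Cmod_Ci : Cmod Ci = 1.
Proof. unfold Cmod; simpl. replace (0 * (0 * 1) + 1 * (1 * 1)) with 1 by ring. apply sqrt_1. Qed.
Lemma Ci_ne : Ci <> 0%C.
Proof. apply Cmod_pos_neq. rewrite Cmod_Ci. lra. Qed.
Lemma C2_ne : RtoC 2 <> 0%C.
Proof. apply Cmod_pos_neq; rewrite Cmod_R; apply Rabs_pos_lt; lra. Qed.
Lemma Cmod_iy y : 0 <= y -> Cmod (0, y) = y.
Proof. intros H. unfold Cmod; simpl. replace (0 * (0 * 1) + y * (y * 1)) with (y ^ 2) by ring. now apply sqrt_pow2. Qed.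
Lemma Cconj_neq0 (z : C) : z <> 0%C -> Cconj z <> 0%C.
Proof. intros H E. apply H. rewrite <- (Cconj_conj z), E. unfold Cconj. Cext. Qed.

Lemma cd_inv (z : C) : z <> 0%C -> cd (fun w => / w)%C z (- / (z * z))%C.
Proof.
  intros Hz eps He. pose proof (proj1 (Cmod_gt_0 z) Hz) as Hz'.
  assert (Hcp : 0 < eps * (Cmod z ^ 3 / 2)) by (apply Rmult_lt_0_compat; [lra|]; pose proof (pow_lt _ 3 Hz'); lra).
  exists (Rmin (Cmod z / 2) (eps * (Cmod z ^ 3 / 2))). split; [apply Rmin_glb_lt; lra|].
  intros w Hw.
  assert (H1 : Cmod (w - z) < Cmod z / 2) by (eapply Rlt_le_trans; [exact Hw|apply Rmin_l]).
  assert (H2 : Cmod (w - z) < eps * (Cmod z ^ 3 / 2)) by (eapply Rlt_le_trans; [exact Hw|apply Rmin_r]).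
  pose proof (Cmod_triangle w (z - w)) as Ht.
  replace (w + (z - w))%C with z in Ht by ring.
  replace (z - w)%C with (- (w - z))%C in Ht by ring. rewrite Cmod_opp in Ht.
  assert (Hw0 : Cmod z / 2 < Cmod w) by lra.
  assert (w <> 0%C) by (apply Cmod_pos_neq; lra).
  (* The first-order remainder of 1/w is exactly this square over w z^2. As |w| > |z|/2, the radius
     eps |z|^3 / 2 bounds it. *)
  replace (/ w - / z - - / (z * z) * (w - z))%C with ((w - z) * (w - z) / (w * z * z))%C by (field; auto).
  rewrite Cmod_div, !Cmod_mult by (repeat apply Cmult_neq_0; auto).
  apply Rle_div_l; [apply Rmult_lt_0_compat; [apply Rmult_lt_0_compat|]; lra|].
  pose proof (Cmod_ge_0 (w - z)) as Hg.
  assert (eps * (Cmod z ^ 3 / 2) <= eps * (Cmod w * Cmod z * Cmod z)).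
  { apply Rmult_le_compat_l; [lra|]. nra. }
  nra.
Qed.

Lemma cd_div f g z l m : cd f z l -> cd g z m -> g z <> 0%C ->
  cd (fun w => f w / g w)%C z ((l * g z - f z * m) / (g z * g z)).
Proof.
  intros Hf Hg Hz.
  replace ((l * g z - f z * m) / (g z * g z))%C
    with (l * / g z + f z * (- / (g z * g z) * m))%C by (field; auto).
  apply (cd_mult f (fun w => / g w)%C); [assumption|].
  apply (cd_comp Cinv g); [now apply cd_inv|assumption].
Qed.

Lemma cd_star f z l : cd f (Cconj z) l -> cd (Cstar f) z (Cconj l).
Proof.
  intros H eps He. destruct (H eps He) as [d [Hd H']]. exists d. split; [assumption|].
  intros w Hw. unfold Cstar.
  rewrite <- Cmod_conj in Hw. rewrite Cminus_conj in Hw. specialize (H' _ Hw).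
  rewrite <- (Cmod_conj (w - z)), Cminus_conj.
  rewrite <- (Cmod_conj (_ - _ - _)%C), !Cminus_conj, Cmult_conj, !Cconj_conj, Cminus_conj. exact H'.
Qed.

Lemma Cdiff_ext f g z : (forall w, f w = g w) -> Cdiff f z -> Cdiff g z.
Proof. intros He H. eapply cd_Cdiff, cd_ext, cd_C_derive; eassumption. Qed.
Lemma Cdiff_loc f g z d : 0 < d -> (forall w, Cmod (w - z) < d -> f w = g w) -> Cdiff f z -> Cdiff g z.
Proof. intros Hd He H. eapply cd_Cdiff, cd_loc, cd_C_derive; eassumption. Qed.
Lemma Cdiff_const c z : Cdiff (fun _ => c) z.
Proof. eapply cd_Cdiff, cd_const. Qed.
Lemma Cdiff_id z : Cdiff (fun w => w) z.
Proof. eapply cd_Cdiff, cd_id. Qed.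
Lemma Cdiff_plus f g z : Cdiff f z -> Cdiff g z -> Cdiff (fun w => f w + g w)%C z.
Proof. intros Hf Hg. eapply cd_Cdiff, cd_plus; apply cd_C_derive; assumption. Qed.
Lemma Cdiff_minus f g z : Cdiff f z -> Cdiff g z -> Cdiff (fun w => f w - g w)%C z.
Proof. intros Hf Hg. eapply cd_Cdiff, cd_minus; apply cd_C_derive; assumption. Qed.
Lemma Cdiff_mult f g z : Cdiff f z -> Cdiff g z -> Cdiff (fun w => f w * g w)%C z.
Proof. intros Hf Hg. eapply cd_Cdiff, cd_mult; apply cd_C_derive; assumption. Qed.
Lemma Cdiff_opp f z : Cdiff f z -> Cdiff (fun w => - f w)%C z.
Proof.
  intros Hf. apply (Cdiff_ext (fun w => 0 - f w)%C).
  - intros w. ring.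
  - apply Cdiff_minus; [apply Cdiff_const|assumption].
Qed.
Lemma Cdiff_div f g z : Cdiff f z -> Cdiff g z -> g z <> 0%C -> Cdiff (fun w => f w / g w)%C z.
Proof. intros Hf Hg Hz. eapply cd_Cdiff, cd_div; [apply cd_C_derive..|]; assumption. Qed.
Lemma Cdiff_comp f g z : Cdiff f (g z) -> Cdiff g z -> Cdiff (fun w => f (g w)) z.
Proof. intros Hf Hg. eapply cd_Cdiff, cd_comp; apply cd_C_derive; assumption. Qed.
Lemma Cdiff_star f z : Cdiff f (Cconj z) -> Cdiff (Cstar f) z.
Proof. intros Hf. eapply cd_Cdiff, cd_star, cd_C_derive; eassumption. Qed.

#[export] Hint Resolve Cdiff_const Cdiff_id Cdiff_plus Cdiff_minus Cdiff_mult Cdiff_opp Cdiff_div : cdiff.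

Lemma Cmod_minus_sym (a b : C) : Cmod (a - b) = Cmod (b - a).
Proof. rewrite <- Cmod_opp. f_equal. ring. Qed.

Lemma Cmod_tri3 (a b c : C) : Cmod (a - c) <= Cmod (a - b) + Cmod (b - c).
Proof. replace (a - c)%C with ((a - b) + (b - c))%C by ring. apply Cmod_triangle. Qed.

Lemma Cmod_rev (a b : C) : Cmod a - Cmod b <= Cmod (a - b).
Proof.
  pose proof (Cmod_triangle (a - b) b) as H. replace (a - b + b)%C with a in H by ring. lra.
Qed.

(** Equations coming from integrals live in a normed-module carrier convertible to C; restated in C
    they are open to [ring] and [field]. *)
Ltac Ceq := match goal with |- ?x = ?y => change (@eq C x y) end.

Definition CI (h : R -> C) (a b : R) : C := RInt (V := C_R_CompleteNormedModule) h a b.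

Definition rcont (h : R -> C) (s : R) : Prop :=
  forall eps, 0 < eps -> exists d, 0 < d /\ forall t, Rabs (t - s) < d -> Cmod (h t - h s) < eps.

Lemma rcont_continuous h s : rcont h s -> continuous (T := R_UniformSpace) (U := C_R_NormedModule) h s.
Proof.
  intros H. apply filterlim_locally. intros eps.
  destruct (H eps (cond_pos eps)) as [d [Hd H']].
  exists (mkposreal d Hd). intros t Ht. specialize (H' t Ht).
  apply (C_NormedModule_mixin_compat1 (h s) (h t) eps H').
Qed.

Lemma continuous_R_eps (h : R -> R) (s : R) :
  (forall eps, 0 < eps -> exists d, 0 < d /\ forall t, Rabs (t - s) < d -> Rabs (h t - h s) < eps) ->
  continuous h s.
Proof.
  intros H. apply filterlim_locally. intros eps.
  destruct (H eps (cond_pos eps)) as [d [Hd H']].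
  exists (mkposreal d Hd). intros t Ht. exact (H' t Ht).
Qed.

Lemma rcont_ex_RInt h a b : (forall s, Rmin a b <= s <= Rmax a b -> rcont h s) ->
  ex_RInt (V := C_R_CompleteNormedModule) h a b.
Proof. intros H. apply (ex_RInt_continuous (V := C_R_CompleteNormedModule)). intros s Hs. now apply rcont_continuous, H. Qed.

Lemma CI_is h a b : (forall s, Rmin a b <= s <= Rmax a b -> rcont h s) ->
  is_RInt (V := C_R_CompleteNormedModule) h a b (CI h a b).
Proof. intros H. apply (RInt_correct (V := C_R_CompleteNormedModule)). now apply rcont_ex_RInt. Qed.

Lemma rcont_Cmod h s : rcont h s -> continuous (fun t => Cmod (h t)) s.
Proof.
  intros H. apply continuous_R_eps. intros eps He. destruct (H eps He) as [d [Hd H']].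
  exists d. split; [assumption|]. intros t Ht. specialize (H' t Ht).
  pose proof (Cmod_rev (h t) (h s)). pose proof (Cmod_rev (h s) (h t)).
  rewrite Cmod_minus_sym in H1. apply Rabs_def1; lra.
Qed.

Lemma CI_le h (g : R -> R) a b : a <= b -> (forall s, a <= s <= b -> rcont h s) -> ex_RInt g a b ->
  (forall s, a <= s <= b -> Cmod (h s) <= g s) -> Cmod (CI h a b) <= RInt g a b.
Proof.
  intros Hab Hc Hg H.
  rewrite Cmod_norm.
  apply (norm_RInt_le (V := C_R_NormedModule) h g a b).
  - assumption.
  - intros s Hs. rewrite <- Cmod_norm. now apply H.
  - apply CI_is. intros s. rewrite Rmin_left, Rmax_right by assumption. apply Hc.
  - exact (RInt_correct (V := R_CompleteNormedModule) g a b Hg).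
Qed.

Lemma CI_bound h M a b : a <= b -> (forall s, a <= s <= b -> rcont h s) ->
  (forall s, a <= s <= b -> Cmod (h s) <= M) -> Cmod (CI h a b) <= M * (b - a).
Proof.
  intros Hab Hc H. eapply Rle_trans.
  - apply (CI_le h (fun _ => M) a b); try assumption. apply ex_RInt_const.
  - rewrite RInt_const. unfold scal; simpl. unfold mult; simpl. lra.
Qed.

Lemma rcont_ext h k s : (forall t, h t = k t) -> rcont h s -> rcont k s.
Proof. intros He H eps Heps. destruct (H eps Heps) as [d [Hd H']]. exists d. split; [assumption|]. intros t Ht. rewrite <- !He. now apply H'. Qed.

Lemma rcont_const c s : rcont (fun _ => c) s.
Proof. intros eps He. exists 1. split; [lra|]. intros t _. replace (c - c)%C with (RtoC 0) by ring. now rewrite Cmod_0. Qed.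

Lemma rcont_plus h k s : rcont h s -> rcont k s -> rcont (fun t => h t + k t)%C s.
Proof.
  intros H1 H2 eps He. destruct (H1 (eps/2)) as [d1 [Hd1 H1']]; [lra|]. destruct (H2 (eps/2)) as [d2 [Hd2 H2']]; [lra|].
  exists (Rmin d1 d2). split; [now apply Rmin_glb_lt|]. intros t Ht.
  specialize (H1' t (Rlt_le_trans _ _ _ Ht (Rmin_l _ _))). specialize (H2' t (Rlt_le_trans _ _ _ Ht (Rmin_r _ _))).
  replace (h t + k t - (h s + k s))%C with ((h t - h s) + (k t - k s))%C by ring.
  eapply Rle_lt_trans; [apply Cmod_triangle|]. lra.
Qed.

Lemma rcont_scal c h s : rcont h s -> rcont (fun t => c * h t)%C s.
Proof.
  intros H eps He. pose proof (Cmod_ge_0 c).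
  destruct (H (eps / (Cmod c + 1))) as [d [Hd H']]; [apply Rdiv_lt_0_compat; lra|].
  exists d. split; [assumption|]. intros t Ht. specialize (H' t Ht).
  replace (c * h t - c * h s)%C with (c * (h t - h s))%C by ring. rewrite Cmod_mult.
  apply Rlt_div_r in H'; [|lra]. pose proof (Cmod_ge_0 (h t - h s)). nra.
Qed.

Lemma rcont_mult h k s : rcont h s -> rcont k s -> rcont (fun t => h t * k t)%C s.
Proof.
  intros H1 H2 eps He. pose proof (Cmod_ge_0 (h s)) as P1. pose proof (Cmod_ge_0 (k s)) as P2.
  set (M := Cmod (h s) + Cmod (k s) + 2).
  assert (HM : 0 < eps / M) by (apply Rdiv_lt_0_compat; unfold M; lra).
  destruct (H1 (eps/M)) as [d1 [Hd1 H1']]; [lra|]. destruct (H2 (Rmin 1 (eps/M))) as [d2 [Hd2 H2']]; [apply Rmin_glb_lt; lra|].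
  exists (Rmin d1 d2). split; [now apply Rmin_glb_lt|]. intros t Ht.
  specialize (H1' t (Rlt_le_trans _ _ _ Ht (Rmin_l _ _))). specialize (H2' t (Rlt_le_trans _ _ _ Ht (Rmin_r _ _))).
  pose proof (Rmin_l 1 (eps/M)). pose proof (Rmin_r 1 (eps/M)).
  replace (h t * k t - h s * k s)%C with ((h t - h s) * k t + h s * (k t - k s))%C by ring.
  eapply Rle_lt_trans; [apply Cmod_triangle|]. rewrite !Cmod_mult.
  pose proof (Cmod_rev (k t) (k s)). pose proof (Cmod_ge_0 (h t - h s)). pose proof (Cmod_ge_0 (k t - k s)). pose proof (Cmod_ge_0 (k t)).
  assert (E : eps = eps / M * M) by (field; unfold M; lra).
  rewrite E. set (e := eps / M) in *. unfold M.
  assert (Cmod (h t - h s) * Cmod (k t) <= e * (Cmod (k s) + 1)) by (apply Rmult_le_compat; lra).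
  assert (Cmod (h s) * Cmod (k t - k s) <= e * Cmod (h s)) by (rewrite (Rmult_comm e); apply Rmult_le_compat_l; lra).
  nra.
Qed.

Lemma rcont_comp f (p : R -> C) s : ccont f (p s) -> rcont p s -> rcont (fun t => f (p t)) s.
Proof.
  intros Hf Hp eps He. destruct (Hf eps He) as [d [Hd H]]. destruct (Hp d Hd) as [d' [Hd' H']].
  exists d'. split; [assumption|]. intros t Ht. apply H, H', Ht.
Qed.

Lemma rcont_RtoC s : rcont (fun t => RtoC t) s.
Proof.
  intros eps He. exists eps. split; [assumption|]. intros t Ht.
  rewrite <- RtoC_minus, Cmod_R. exact Ht.
Qed.

Lemma rcont_line a v s : rcont (fun t => a + t * v)%C s.
Proof.
  apply rcont_plus; [apply rcont_const|].
  apply (rcont_mult (fun t => RtoC t) (fun _ => v)); [apply rcont_RtoC|apply rcont_const].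
Qed.

Lemma CI_ext h k a b : (forall s, Rmin a b < s < Rmax a b -> h s = k s) -> CI h a b = CI k a b.
Proof. intros H. now apply (RInt_ext (V := C_R_CompleteNormedModule)). Qed.

Lemma CI_minus h k a b : (forall s, Rmin a b <= s <= Rmax a b -> rcont h s) ->
  (forall s, Rmin a b <= s <= Rmax a b -> rcont k s) ->
  CI (fun t => h t - k t)%C a b = (CI h a b - CI k a b)%C.
Proof.
  intros H1 H2. apply (RInt_minus (V := C_R_CompleteNormedModule)); now apply rcont_ex_RInt.
Qed.

Lemma CI_plus h k a b : (forall s, Rmin a b <= s <= Rmax a b -> rcont h s) ->
  (forall s, Rmin a b <= s <= Rmax a b -> rcont k s) ->
  CI (fun t => h t + k t)%C a b = (CI h a b + CI k a b)%C.
Proof.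
  intros H1 H2. apply (RInt_plus (V := C_R_CompleteNormedModule)); now apply rcont_ex_RInt.
Qed.

(** The scalar is complex while the integral is taken in a real module, so the product is integrated
    component by component. *)
Lemma CI_scal c h a b : (forall s, Rmin a b <= s <= Rmax a b -> rcont h s) ->
  CI (fun t => c * h t)%C a b = (c * CI h a b)%C.
Proof.
  intros H. pose proof (CI_is h a b H) as Hi.
  apply (is_RInt_unique (V := C_R_CompleteNormedModule)). set (I := CI h a b) in *.
  pose proof (is_RInt_fct_extend_fst (U := R_NormedModule) (V := R_NormedModule) h a b I Hi) as H1.
  pose proof (is_RInt_fct_extend_snd (U := R_NormedModule) (V := R_NormedModule) h a b I Hi) as H2.
  apply (is_RInt_fct_extend_pair (U := R_NormedModule) (V := R_NormedModule)); simpl.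
  - apply (is_RInt_minus (V := R_NormedModule) (fun t => fst c * fst (h t)) (fun t => snd c * snd (h t)));
      apply (is_RInt_scal (V := R_NormedModule)); assumption.
  - apply (is_RInt_plus (V := R_NormedModule) (fun t => fst c * snd (h t)) (fun t => snd c * fst (h t)));
      apply (is_RInt_scal (V := R_NormedModule)); assumption.
Qed.

Lemma CI_FTC F f p v a b :
  (forall s, Rmin a b <= s <= Rmax a b -> cd F (p + s * v)%C (f (p + s * v)%C)) ->
  (forall s, Rmin a b <= s <= Rmax a b -> ccont f (p + s * v)%C) ->
  CI (fun s => f (p + s * v) * v)%C a b = (F (p + b * v) - F (p + a * v))%C.
Proof.
  intros H1 H2. apply (is_RInt_unique (V := C_R_CompleteNormedModule)).
  apply (is_RInt_derive (V := C_R_CompleteNormedModule) (fun s => F (p + s * v)%C)).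
  - intros s Hs. split; [apply is_linear_scal_l|].
    intros x Hx eps.
    rewrite <- (is_filter_lim_locally_unique (K := R_AbsRing) (V := R_NormedModule) s x Hx).
    specialize (H1 s Hs). pose proof (Cmod_ge_0 v).
    (* The added 1 covers a constant path, where [v] is zero. *)
    assert (Hp : 0 < eps / (Cmod v + 1)) by (apply Rdiv_lt_0_compat; [apply cond_pos|lra]).
    destruct (H1 _ Hp) as [d [Hd Hd']].
    assert (Hd2 : 0 < d / (Cmod v + 1)) by (apply Rdiv_lt_0_compat; lra).
    exists (mkposreal _ Hd2). intros t Ht. change (Rabs (t - s) < d / (Cmod v + 1)) in Ht.
    assert (E : (p + t * v - (p + s * v))%C = ((t - s)%R * v)%C) by (rewrite RtoC_minus; ring).
    specialize (Hd' (p + t * v)%C). rewrite E, Cmod_mult, Cmod_R in Hd'.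
    rewrite <- Cmod_norm.
    change (Cmod (F (p + t * v) - F (p + s * v) - @scal R_AbsRing C_R_ModuleSpace (t - s)%R (f (p + s * v) * v))%C <= eps * Rabs (t - s)).
    rewrite scal_R_Cmult.
    replace (F (p + t * v) - F (p + s * v) - (t - s)%R * (f (p + s * v) * v))%C with
      (F (p + t * v) - F (p + s * v) - f (p + s * v) * ((t - s)%R * v))%C by ring.
    apply Rlt_div_r in Ht; [|lra]. pose proof (Rabs_pos (t - s)).
    eapply Rle_trans; [apply Hd'; nra|].
    apply Rle_trans with (eps / (Cmod v + 1) * (Rabs (t - s) * (Cmod v + 1))).
    + apply Rmult_le_compat_l; [lra|nra].
    + right. field. lra.
  - intros s Hs. apply rcont_continuous.
    apply (rcont_mult (fun t => f (p + t * v)%C) (fun _ => v)); [|apply rcont_const].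
    apply (rcont_comp f (fun t => p + t * v)%C); [now apply H2|apply rcont_line].
Qed.

Definition seg (f : C -> C) (a b : C) : C := CI (fun s => f (a + s * (b - a)) * (b - a))%C 0 1.

Definition sgcont (f : C -> C) (a b : C) : Prop :=
  forall s, 0 <= s <= 1 -> ccont f (a + s * (b - a))%C.

Lemma seg_rcont f a b s : sgcont f a b -> 0 <= s <= 1 ->
  rcont (fun s => f (a + s * (b - a)) * (b - a))%C s.
Proof.
  intros H Hs. apply (rcont_mult (fun t => f (a + t * (b - a))%C) (fun _ => (b - a)%C)); [|apply rcont_const].
  apply (rcont_comp f (fun t => a + t * (b - a))%C); [now apply H|apply rcont_line].
Qed.

Lemma seg_rcont' f a b : sgcont f a b -> forall s, Rmin 0 1 <= s <= Rmax 0 1 ->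
  rcont (fun s => f (a + s * (b - a)) * (b - a))%C s.
Proof. intros H s. rewrite Rmin_left, Rmax_right by lra. now apply seg_rcont. Qed.

Lemma seg_bound f a b M : sgcont f a b -> (forall s, 0 <= s <= 1 -> Cmod (f (a + s * (b - a))%C) <= M) ->
  Cmod (seg f a b) <= M * Cmod (b - a).
Proof.
  intros Hc H. unfold seg. replace (M * Cmod (b - a)) with (M * Cmod (b - a) * (1 - 0)) by ring.
  apply CI_bound; [lra|intros; now apply seg_rcont|].
  intros s Hs. rewrite Cmod_mult. apply Rmult_le_compat_r; [apply Cmod_ge_0|now apply H].
Qed.

Lemma seg_FTC F f a b : (forall s, 0 <= s <= 1 -> cd F (a + s * (b - a))%C (f (a + s * (b - a))%C)) ->
  sgcont f a b -> seg f a b = (F b - F a)%C.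
Proof.
  intros H1 H2. unfold seg. rewrite (CI_FTC F f a (b - a)%C 0 1).
  - f_equal; [f_equal; ring|f_equal; f_equal; ring].
  - intros s. rewrite Rmin_left, Rmax_right by lra. apply H1.
  - intros s. rewrite Rmin_left, Rmax_right by lra. apply H2.
Qed.

Lemma seg_minus f g a b : sgcont f a b -> sgcont g a b ->
  seg (fun z => f z - g z)%C a b = (seg f a b - seg g a b)%C.
Proof.
  intros H1 H2. unfold seg. rewrite <- CI_minus; [|now apply seg_rcont'..].
  apply CI_ext. intros s _. ring.
Qed.

Lemma seg_rev f a b : sgcont f a b -> seg f b a = (- seg f a b)%C.
Proof.
  intros H. unfold seg at 2.
  set (g := fun s : R => (f (a + s * (b - a)) * (b - a))%C).
  pose proof (RInt_comp_lin (V := C_R_CompleteNormedModule) g (-1) 1 0 1) as E.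
  replace (-1 * 0 + 1) with 1 in E by ring. replace (-1 * 1 + 1) with 0 in E by ring.
  transitivity (CI g 1 0).
  - unfold CI, seg. rewrite <- E.
    + apply (RInt_ext (V := C_R_CompleteNormedModule)). intros s _. rewrite scal_R_Cmult. unfold g.
      rewrite RtoC_plus, RtoC_mult. change (RtoC (-1)) with (RtoC (- (1))). rewrite RtoC_opp.
      assert (E' : (a + (- RtoC 1 * s + RtoC 1) * (b - a) = b + s * (a - b))%C) by ring.
      rewrite E'. Ceq. ring.
    + apply rcont_ex_RInt. intros s. rewrite Rmin_right, Rmax_left by lra. now apply seg_rcont.
  - symmetry. apply (opp_RInt_swap (V := C_R_CompleteNormedModule)).
    apply rcont_ex_RInt. now apply seg_rcont'.
Qed.

Lemma seg_mid f a b m : sgcont f a b -> m = ((a + b) / 2)%C -> seg f a b = (seg f a m + seg f m b)%C.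
Proof.
  intros H ->. unfold seg at 1.
  set (g := fun s : R => (f (a + s * (b - a)) * (b - a))%C).
  assert (Hr : forall s, 0 <= s <= 1 -> rcont g s) by (intros; now apply seg_rcont).
  assert (Hx : forall u v, 0 <= u <= v -> v <= 1 -> ex_RInt (V := C_R_CompleteNormedModule) g u v).
  { intros u v Hu Hv. apply rcont_ex_RInt. intros s. rewrite Rmin_left, Rmax_right by lra. intros. apply Hr. lra. }
  unfold CI. rewrite <- (RInt_Chasles (V := C_R_CompleteNormedModule) g 0 (/2) 1) by (apply Hx; lra).
  change (RInt (V := C_R_CompleteNormedModule) g 0 (/2) + RInt (V := C_R_CompleteNormedModule) g (/2) 1 = seg f a ((a + b) / 2) + seg f ((a + b) / 2) b)%C.
  assert (E2 : RtoC (/2) = (/ 2)%C) by (rewrite RtoC_inv; [reflexivity|lra]).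
  f_equal.
  - pose proof (RInt_comp_lin (V := C_R_CompleteNormedModule) g (/2) 0 0 1) as E.
    replace (/2 * 0 + 0) with 0 in E by ring. replace (/2 * 1 + 0) with (/2) in E by ring.
    rewrite <- E by (apply Hx; lra). apply (RInt_ext (V := C_R_CompleteNormedModule)). intros s _. rewrite scal_R_Cmult. unfold g.
    rewrite RtoC_plus, RtoC_mult, E2.
    replace (a + (/ 2 * s + 0) * (b - a))%C with (a + s * ((a + b) / 2 - a))%C by field. Ceq. field.
  - pose proof (RInt_comp_lin (V := C_R_CompleteNormedModule) g (/2) (/2) 0 1) as E.
    replace (/2 * 0 + /2) with (/2) in E by ring. replace (/2 * 1 + /2) with 1 in E by field.
    rewrite <- E by (apply Hx; lra). apply (RInt_ext (V := C_R_CompleteNormedModule)). intros s _. rewrite scal_R_Cmult. unfold g.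
    rewrite RtoC_plus, RtoC_mult, E2.
    replace (a + (/ 2 * s + / 2) * (b - a))%C with ((a + b) / 2 + s * (b - (a + b) / 2))%C by field. Ceq. field.
Qed.

Lemma im_le_Cmod (z : C) : Rabs (Im z) <= Cmod z.
Proof. eapply Rle_trans; [apply Rmax_r|apply (Rmax_Cmod z)]. Qed.

Lemma Cmod_le_ReIm (z : C) : Cmod z <= Rabs (Re z) + Rabs (Im z).
Proof.
  pose proof (Cmod2_alt z) as H. pose proof (Cmod_ge_0 z). pose proof (Rabs_pos (Re z)). pose proof (Rabs_pos (Im z)).
  assert (E1 := pow2_abs (Re z)). assert (E2 := pow2_abs (Im z)). nra.
Qed.

Lemma C_complete (q : nat -> C) :
  (forall eps, 0 < eps -> exists N, forall n m, (N <= n)%nat -> (N <= m)%nat -> Cmod (q n - q m) < eps) ->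
  exists l, forall eps, 0 < eps -> exists N, forall n, (N <= n)%nat -> Cmod (q n - l) < eps.
Proof.
  intros H.
  assert (H1 : Cauchy_crit (fun n => Re (q n))).
  { intros e He. destruct (H e He) as [N HN]. exists N. intros n m Hn Hm.
    specialize (HN n m Hn Hm). unfold Rdist. eapply Rle_lt_trans; [|exact HN].
    apply (re_le_Cmod (q n - q m)). }
  assert (H2 : Cauchy_crit (fun n => Im (q n))).
  { intros e He. destruct (H e He) as [N HN]. exists N. intros n m Hn Hm.
    specialize (HN n m Hn Hm). unfold Rdist. eapply Rle_lt_trans; [|exact HN].
    apply (im_le_Cmod (q n - q m)). }
  destruct (Rcomplete.R_complete _ H1) as [l1 L1]. destruct (Rcomplete.R_complete _ H2) as [l2 L2].
  exists (l1, l2). intros eps He.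
  destruct (L1 (eps/2)) as [N1 HN1]; [lra|]. destruct (L2 (eps/2)) as [N2 HN2]; [lra|].
  exists (Nat.max N1 N2). intros n Hn.
  specialize (HN1 n ltac:(lia)). specialize (HN2 n ltac:(lia)). unfold Rdist in *.
  eapply Rle_lt_trans; [apply Cmod_le_ReIm|].
  change (Re (q n - (l1, l2))) with (Re (q n) - l1). change (Im (q n - (l1, l2))) with (Im (q n) - l2). lra.
Qed.

Lemma pow_half_lt eps : 0 < eps -> exists N, forall n, (N <= n)%nat -> (/2)^n < eps.
Proof.
  intros He. destruct (pow_lt_1_zero (/2) ltac:(rewrite Rabs_pos_eq; lra) eps He) as [N HN].
  exists N. intros n Hn. specialize (HN n Hn). rewrite Rabs_pos_eq in HN; [assumption|].
  apply pow_le; lra.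
Qed.

(** The rate is kept in the conclusion because later limits, of nested triangles, kernel series and
    partial fractions, are compared with their n-th approximants. *)
Lemma C_geom (q : nat -> C) K : (forall n, Cmod (q (S n) - q n) <= K * (/2)^n) ->
  exists l, forall n, Cmod (q n - l) <= 2 * K * (/2)^n.
Proof.
  intros H.
  assert (HK : 0 <= K). { pose proof (H O) as H0. pose proof (Cmod_ge_0 (q 1%nat - q O)). simpl in H0. lra. }
  assert (H1 : forall k n, Cmod (q (n + k)%nat - q n) <= 2 * K * (/2)^n - 2 * K * (/2)^(n + k)).
  { induction k; intros n.
    - rewrite Nat.add_0_r. replace (q n - q n)%C with (RtoC 0) by ring. rewrite Cmod_0. lra.
    - eapply Rle_trans; [apply (Cmod_tri3 _ (q (n + k)%nat))|].
      specialize (IHk n). replace (n + S k)%nat with (S (n + k)) by lia. specialize (H (n + k)%nat).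
      simpl pow. lra. }
  assert (H2 : forall n m, (n <= m)%nat -> Cmod (q m - q n) <= 2 * K * (/2)^n).
  { intros n m Hnm. specialize (H1 (m - n)%nat n). replace (n + (m - n))%nat with m in H1 by lia.
    assert (0 <= (/2)^m) by (apply pow_le; lra). nra. }
  destruct (C_complete q) as [l Hl].
  { intros eps He. destruct (pow_half_lt (eps / (4 * (K + 1)))) as [N HN]; [apply Rdiv_lt_0_compat; lra|].
    exists N. intros n m Hn Hm. specialize (HN N (le_n N)).
    apply Rlt_div_r in HN; [|lra]. assert (0 <= (/2)^N) by (apply pow_le; lra).
    eapply Rle_lt_trans; [apply (Cmod_tri3 _ (q N))|]. rewrite (Cmod_minus_sym (q N)).
    pose proof (H2 N n Hn). pose proof (H2 N m Hm). nra. }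
  exists l. intros n. apply Rle_plus_epsilon. intros eps He. destruct (Hl eps He) as [N HN].
  specialize (HN (Nat.max n N) ltac:(lia)). specialize (H2 n (Nat.max n N) ltac:(lia)).
  eapply Rle_trans; [apply (Cmod_tri3 _ (q (Nat.max n N)))|]. rewrite Cmod_minus_sym. lra.
Qed.

(** * Goursat, Cauchy, Weierstrass *)

Definition openC (O : C -> Prop) : Prop :=
  forall z, O z -> exists r, 0 < r /\ forall w, Cmod (w - z) < r -> O w.
Definition convC (O : C -> Prop) : Prop :=
  forall z w (s : R), O z -> O w -> 0 <= s <= 1 -> O (z + s * (w - z))%C.

Definition tri (f : C -> C) (a b c : C) : C := (seg f a b + seg f b c + seg f c a)%C.

Lemma Cmod_seg (u v p : C) (s r : R) : 0 <= s <= 1 -> Cmod (u - p) <= r -> Cmod (v - p) <= r -> Cmod (u + s * (v - u) - p) <= r.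
Proof.
  intros Hs Hu Hv.
  replace (u + s * (v - u) - p)%C with ((1 - s)%R * (u - p) + s * (v - p))%C by (rewrite RtoC_minus; ring).
  eapply Rle_trans; [apply Cmod_triangle|]. rewrite !Cmod_mult, !Cmod_R, !Rabs_pos_eq by lra. nra.
Qed.

(** The affine function [g] has the explicit primitive [G], so its integrals around the triangle
    cancel, and only the deviation of f from [g], at most e, has to be integrated. *)
Lemma tri_small f p l u v w r e : 0 <= r -> sgcont f u v -> sgcont f v w -> sgcont f w u ->
  Cmod (u - p) <= r -> Cmod (v - p) <= r -> Cmod (w - p) <= r ->
  (forall z, Cmod (z - p) <= r -> Cmod (f z - f p - l * (z - p)) <= e) ->
  Cmod (tri f u v w) <= e * (Cmod (v - u) + Cmod (w - v) + Cmod (u - w)).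
Proof.
  intros Hr H1 H2 H3 Hu Hv Hw He.
  set (g := fun z => (f p + l * (z - p))%C). set (G := fun z => (f p * z + l * (/ 2 * (z * z) - p * z))%C).
  assert (HG : forall z, cd G z (g z)).
  { intros z. unfold G, g. replace (f p + l * (z - p))%C with (f p * 1 + l * (/ 2 * (1 * z + z * 1) - p * 1))%C by field.
    apply cd_plus; [apply cd_scal, cd_id|apply cd_scal, cd_minus; apply cd_scal; [apply cd_mult|]; apply cd_id]. }
  assert (Hg : forall z, ccont g z).
  { intros z. apply Cdiff_ccont. unfold g. auto with cdiff. }
  assert (Hsg : forall x y, sgcont g x y) by (intros x y s _; apply Hg).
  assert (HI : forall x y, seg g x y = (G y - G x)%C) by (intros; apply seg_FTC; auto).
  assert (E : forall x y, sgcont f x y -> Cmod (x - p) <= r -> Cmod (y - p) <= r ->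
    Cmod (seg f x y - (G y - G x)) <= e * Cmod (y - x)).
  { intros x y Hxy Hx Hy. rewrite <- HI, <- seg_minus by auto. apply seg_bound.
    - intros s Hs. intros eps Heps. destruct (Hxy s Hs (eps/2)) as [d1 [Hd1 H1']]; [lra|].
      destruct (Hg (x + s * (y - x))%C (eps/2)) as [d2 [Hd2 H2']]; [lra|].
      exists (Rmin d1 d2). split; [now apply Rmin_glb_lt|]. intros z Hz.
      specialize (H1' z (Rlt_le_trans _ _ _ Hz (Rmin_l _ _))). specialize (H2' z (Rlt_le_trans _ _ _ Hz (Rmin_r _ _))).
      match goal with |- Cmod (?a - ?b - (?c - ?d))%C < _ => replace (a - b - (c - d))%C with ((a - c) - (b - d))%C by ring end.
      eapply Rle_lt_trans; [apply Cmod_triangle|]. rewrite Cmod_opp. lra.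
    - intros s Hs. unfold g. match goal with |- Cmod (?a - (?b + ?c))%C <= _ => replace (a - (b + c))%C with (a - b - c)%C by ring end.
      apply He, Cmod_seg; auto. }
  unfold tri.
  replace (seg f u v + seg f v w + seg f w u)%C with
    ((seg f u v - (G v - G u)) + (seg f v w - (G w - G v)) + (seg f w u - (G u - G w)))%C by ring.
  eapply Rle_trans; [apply Cmod_triangle|].
  eapply Rle_trans; [apply Rplus_le_compat_r, Cmod_triangle|].
  pose proof (E u v H1 Hu Hv). pose proof (E v w H2 Hv Hw). pose proof (E w u H3 Hw Hu). lra.
Qed.

Section Goursat.
Variables (O : C -> Prop) (f : C -> C) (a b c : C).
Hypothesis HO : convC O.
Hypothesis Hf : forall z, O z -> Cdiff f z.
Hypothesis Ha : O a.
Hypothesis Hb : O b.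
Hypothesis Hc : O c.

(** Barycentric coordinates, stored as the two components of a complex number. Subdivision takes
    place in the fixed simplex [S], so degenerate triangles a, b, c are treated like all others. *)
Let L (q : C) : C := (a + Re q * (b - a) + Im q * (c - a))%C.
Let S (q : C) : Prop := 0 <= Re q /\ 0 <= Im q /\ Re q + Im q <= 1.
Let Lam := Cmod (b - a) + Cmod (c - a).

Lemma gt_L_in q : S q -> O (L q).
Proof.
  intros [H1 [H2 H3]]. destruct (Req_dec (Re q + Im q) 0) as [E|E].
  - unfold L. replace (Re q) with 0 by lra. replace (Im q) with 0 by lra.
    replace (a + 0 * (b - a) + 0 * (c - a))%C with a by ring. exact Ha.
  - set (s := Re q + Im q) in *. assert (Hs : 0 < s) by (unfold s in *; lra).
    assert (Hs' : RtoC s <> 0%C) by (intros E'; apply RtoC_inj in E'; lra).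
    replace (L q) with (a + s * ((b + (Im q / s)%R * (c - b)) - a))%C.
    + apply HO; [exact Ha| |lra]. apply HO; [exact Hb|exact Hc|].
      split; [apply Rdiv_le_0_compat; lra|apply Rle_div_l; [lra|unfold s; lra]].
    + unfold L. rewrite RtoC_div by lra. replace (RtoC (Re q)) with (s - Im q)%C.
      * field. assumption.
      * unfold s. rewrite RtoC_plus. ring.
Qed.

Lemma gt_S_conv q q' s : S q -> S q' -> 0 <= s <= 1 -> S (q + s * (q' - q))%C.
Proof.
  intros [H1 [H2 H3]] [H1' [H2' H3']] Hs. unfold S.
  replace (Re (q + s * (q' - q))) with ((1 - s) * Re q + s * Re q') by (unfold Re; simpl; ring).
  replace (Im (q + s * (q' - q))) with ((1 - s) * Im q + s * Im q') by (unfold Im; simpl; ring).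
  repeat split; nra.
Qed.

Lemma gt_L_aff q q' (s : R) : L (q + s * (q' - q))%C = (L q + s * (L q' - L q))%C.
Proof.
  unfold L.
  replace (Re (q + s * (q' - q))) with ((1 - s) * Re q + s * Re q') by (unfold Re; simpl; ring).
  replace (Im (q + s * (q' - q))) with ((1 - s) * Im q + s * Im q') by (unfold Im; simpl; ring).
  rewrite !RtoC_plus, !RtoC_mult, !RtoC_minus. ring.
Qed.

Lemma gt_L_dist q q' : Cmod (L q - L q') <= Lam * Cmod (q - q').
Proof.
  replace (L q - L q')%C with (Re (q - q') * (b - a) + Im (q - q') * (c - a))%C.
  - eapply Rle_trans; [apply Cmod_triangle|]. rewrite !Cmod_mult, !Cmod_R.
    pose proof (re_le_Cmod (q - q')). pose proof (im_le_Cmod (q - q')).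
    pose proof (Cmod_ge_0 (b - a)). pose proof (Cmod_ge_0 (c - a)). unfold Lam. nra.
  - unfold L. change (Re (q - q')) with (Re q - Re q'). change (Im (q - q')) with (Im q - Im q').
    rewrite !RtoC_minus. ring.
Qed.

Lemma gt_seg q q' : S q -> S q' -> sgcont f (L q) (L q').
Proof.
  intros H1 H2 s Hs. apply Cdiff_ccont, Hf. rewrite <- gt_L_aff. now apply gt_L_in, gt_S_conv.
Qed.

Let mid (q q' : C) : C := (q + (/2)%R * (q' - q))%C.
Lemma gt_mid q q' : L (mid q q') = ((L q + L q') / 2)%C.
Proof. unfold mid. rewrite gt_L_aff, RtoC_inv by lra. field. Qed.

Let tr (t : C * C * C) : C := tri f (L (fst (fst t))) (L (snd (fst t))) (L (snd t)).
Let t1 (t : C * C * C) := let '(p, q, r) := t in (p, mid p q, mid r p).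
Let t2 (t : C * C * C) := let '(p, q, r) := t in (mid p q, q, mid q r).
Let t3 (t : C * C * C) := let '(p, q, r) := t in (mid r p, mid q r, r).
Let t4 (t : C * C * C) := let '(p, q, r) := t in (mid p q, mid q r, mid r p).
Let St (t : C * C * C) := let '(p, q, r) := t in S p /\ S q /\ S r.
Let Dt (d : R) (t : C * C * C) := let '(p, q, r) := t in Cmod (p - q) <= d /\ Cmod (q - r) <= d /\ Cmod (r - p) <= d.

Lemma gt_midS q q' : S q -> S q' -> S (mid q q').
Proof. intros. apply gt_S_conv; auto; lra. Qed.

Lemma gt_split t : St t -> tr t = (tr (t1 t) + tr (t2 t) + tr (t3 t) + tr (t4 t))%C.
Proof.
  destruct t as [[p q] r]. intros [Hp [Hq Hr]]. unfold tr, tri, t1, t2, t3, t4; simpl fst; simpl snd.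
  pose proof (gt_midS p q Hp Hq). pose proof (gt_midS q r Hq Hr). pose proof (gt_midS r p Hr Hp).
  rewrite (seg_mid f (L p) (L q) (L (mid p q))) by (try apply gt_seg; auto; apply gt_mid).
  rewrite (seg_mid f (L q) (L r) (L (mid q r))) by (try apply gt_seg; auto; apply gt_mid).
  rewrite (seg_mid f (L r) (L p) (L (mid r p))) by (try apply gt_seg; auto; apply gt_mid).
  rewrite (seg_rev f (L (mid p q)) (L (mid r p))), (seg_rev f (L (mid q r)) (L (mid p q))), (seg_rev f (L (mid r p)) (L (mid q r)))
    by (apply gt_seg; auto).
  rewrite (seg_rev f (L (mid r p)) (L (mid p q))) by (apply gt_seg; auto).
  ring.
Qed.

(** A choice of a quarter whose integral keeps at least a fourth of the modulus: if the first three
    fail, the triangle inequality leaves it to [t4]. *)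
Let nxt (t : C * C * C) : C * C * C :=
  if excluded_middle_informative (Cmod (tr t) / 4 <= Cmod (tr (t1 t))) then t1 t else
  if excluded_middle_informative (Cmod (tr t) / 4 <= Cmod (tr (t2 t))) then t2 t else
  if excluded_middle_informative (Cmod (tr t) / 4 <= Cmod (tr (t3 t))) then t3 t else t4 t.

Lemma gt_nxt_cases t : nxt t = t1 t \/ nxt t = t2 t \/ nxt t = t3 t \/ nxt t = t4 t.
Proof. unfold nxt. repeat destruct excluded_middle_informative; tauto. Qed.

Lemma gt_nxt_tr t : St t -> Cmod (tr t) / 4 <= Cmod (tr (nxt t)).
Proof.
  intros H. unfold nxt. repeat destruct excluded_middle_informative; try assumption.
  pose proof (gt_split t H) as E.
  pose proof (Cmod_triangle (tr (t1 t) + tr (t2 t) + tr (t3 t)) (tr (t4 t))).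
  pose proof (Cmod_triangle (tr (t1 t) + tr (t2 t)) (tr (t3 t))).
  pose proof (Cmod_triangle (tr (t1 t)) (tr (t2 t))). rewrite <- E in H0. lra.
Qed.

Lemma gt_nxt_S t : St t -> St (nxt t).
Proof.
  intros H. destruct (gt_nxt_cases t) as [E|[E|[E|E]]]; rewrite E; destruct t as [[p q] r];
  destruct H as [Hp [Hq Hr]]; simpl; auto using gt_midS.
Qed.

Lemma gt_half (x y : C) d : Cmod (x - y) <= d -> forall u : C, (u = (/2)%R * (x - y) \/ u = - ((/2)%R * (x - y)))%C -> Cmod u <= d / 2.
Proof. intros H u [-> | ->]; rewrite ?Cmod_opp, Cmod_mult, Cmod_R, Rabs_pos_eq by lra; lra. Qed.

Lemma gt_nxt_D d t : Dt d t -> Dt (d/2) (nxt t).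
Proof.
  intros H. destruct (gt_nxt_cases t) as [E|[E|[E|E]]]; rewrite E; destruct t as [[p q] r];
  destruct H as [H1 [H2 H3]]; simpl; unfold mid; rewrite !RtoC_inv by lra;
  repeat split;
  ((apply (gt_half _ _ _ H1); rewrite !RtoC_inv by lra; first [left; field | right; field]) ||
   (apply (gt_half _ _ _ H2); rewrite !RtoC_inv by lra; first [left; field | right; field]) ||
   (apply (gt_half _ _ _ H3); rewrite !RtoC_inv by lra; first [left; field | right; field])).
Qed.

Lemma gt_nxt_move d t : Dt d t -> Cmod (fst (fst (nxt t)) - fst (fst t)) <= d.
Proof.
  intros H. assert (Hd : 0 <= d). { destruct t as [[p q] r]; destruct H as [H _]. pose proof (Cmod_ge_0 (p - q)). lra. }
  destruct (gt_nxt_cases t) as [E|[E|[E|E]]]; rewrite E; destruct t as [[p q] r];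
  destruct H as [H1 [H2 H3]]; simpl.
  - replace (p - p)%C with (RtoC 0) by ring. now rewrite Cmod_0.
  - apply Rle_trans with (d/2); [|lra]. apply (gt_half _ _ _ H1). right. unfold mid. ring.
  - apply Rle_trans with (d/2); [|lra]. apply (gt_half _ _ _ H3). left. unfold mid. rewrite RtoC_inv by lra. field.
  - apply Rle_trans with (d/2); [|lra]. apply (gt_half _ _ _ H1). right. unfold mid. ring.
Qed.

Theorem goursat_tri : tri f a b c = 0%C.
Proof.
  (* The triple (0, 1, i) holds the coordinates of a, b and c. *)
  set (ts := fix ts n := match n with Datatypes.O => ((RtoC 0, RtoC 1, Ci) : C * C * C) | Datatypes.S n => nxt (ts n) end).
  assert (E0 : tr (ts 0%nat) = tri f a b c).
  { unfold tr, L; simpl. f_equal; ring. }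
  assert (HS : forall n, St (ts n)).
  { induction n; [|now apply gt_nxt_S]. simpl. unfold S, Re, Im; simpl. repeat split; lra. }
  assert (HD : forall n, Dt (2 * (/2)^n) (ts n)).
  { induction n.
    - simpl. rewrite Rmult_1_r. repeat split; (eapply Rle_trans; [apply Cmod_le_ReIm|]); unfold Re, Im; simpl;
      repeat rewrite Rabs_pos_eq by lra; repeat rewrite Rabs_left1 by lra; lra.
    - simpl ts. replace (2 * (/2) ^ Datatypes.S n) with (2 * (/2)^n / 2) by (simpl; field). now apply gt_nxt_D. }
  assert (HT : forall n, Cmod (tri f a b c) <= 4 ^ n * Cmod (tr (ts n))).
  { induction n; [rewrite E0; simpl; lra|]. pose proof (gt_nxt_tr (ts n) (HS n)). simpl.
    pose proof (pow_lt 4 n ltac:(lra)). nra. }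
  destruct (C_geom (fun n => fst (fst (ts n))) 2) as [l Hl].
  { intros n. simpl. now apply gt_nxt_move. }
  assert (Sl : S l).
  { assert (Hp : forall n, S (fst (fst (ts n)))). { intros n. specialize (HS n). destruct (ts n) as [[p q] r]. apply HS. }
    assert (Hle : forall x, (forall n, x <= 8 * (/2)^n) -> x <= 0).
    { intros x Hx. apply Rle_plus_epsilon. intros eps He. destruct (pow_half_lt (eps/8)) as [N HN]; [lra|].
      specialize (HN N (le_n N)). specialize (Hx N). lra. }
    assert (Hd : forall n, Rabs (Re (fst (fst (ts n))) - Re l) <= 4 * (/2)^n /\ Rabs (Im (fst (fst (ts n))) - Im l) <= 4 * (/2)^n).
    { intros n. specialize (Hl n). replace (2 * 2 * (/2)^n) with (4 * (/2)^n) in Hl by ring. split; (eapply Rle_trans; [|exact Hl]).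
      - apply (re_le_Cmod (_ - _)).
      - apply (im_le_Cmod (_ - _)). }
    repeat split.
    - apply Ropp_le_cancel. rewrite Ropp_0. apply Hle. intros n. destruct (Hd n) as [H1 _]. destruct (Hp n) as [H2 _].
      apply Rabs_le_between in H1. pose proof (pow_le (/2) n ltac:(lra)). lra.
    - apply Ropp_le_cancel. rewrite Ropp_0. apply Hle. intros n. destruct (Hd n) as [_ H1]. destruct (Hp n) as [_ [H2 _]].
      apply Rabs_le_between in H1. pose proof (pow_le (/2) n ltac:(lra)). lra.
    - apply Rminus_le. apply Hle. intros n. destruct (Hd n) as [H1 H2]. destruct (Hp n) as [_ [_ H3]].
      apply Rabs_le_between in H1, H2. lra. }
  assert (HLam : 0 <= Lam) by (unfold Lam; pose proof (Cmod_ge_0 (b - a)); pose proof (Cmod_ge_0 (c - a)); lra).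
  pose proof (cd_C_derive f _ (Hf _ (gt_L_in l Sl))) as Hcd. set (d0 := C_derive f (L l)) in *.
  apply Cmod_eq_0. apply Rle_antisym; [|apply Cmod_ge_0]. apply Rle_plus_epsilon. intros eps0 Heps0. rewrite Rplus_0_l.
  set (eps := eps0 / (36 * (Lam + 1) * (Lam + 1))).
  assert (Heps : 0 < eps) by (apply Rdiv_lt_0_compat; nra).
  destruct (Hcd eps Heps) as [d [Hd Hd']].
  destruct (pow_half_lt (d / (6 * (Lam + 1)))) as [n Hn]; [apply Rdiv_lt_0_compat; lra|].
  specialize (Hn n (le_n n)). specialize (HT n). specialize (HS n). specialize (HD n). specialize (Hl n). simpl in Hl.
  apply Rlt_div_r in Hn; [|lra].
  set (h := (/2)^n) in *. assert (Hh : 0 < h) by (apply pow_lt; lra).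
  (* The factor 4^n of the subdivision cancels against diameter times perimeter, which is of order
     4^{-n}; only the differentiability error eps remains. *)
  assert (H4 : 4 ^ n * (h * h) = 1).
  { unfold h. rewrite <- Rpow_mult_distr, <- Rpow_mult_distr. replace (4 * (/2 * /2)) with 1 by field. apply pow1. }
  destruct (ts n) as [[p q] r]. destruct HS as [Sp [Sq Sr]]. destruct HD as [D1 [D2 D3]]. simpl in Hl.
  rewrite Cmod_minus_sym in D1, D3.
  assert (Hr : forall x, Cmod (x - p) <= 2 * h -> Cmod (L x - L l) <= 6 * Lam * h).
  { intros x Hx. eapply Rle_trans; [apply gt_L_dist|]. rewrite (Rmult_comm 6), Rmult_assoc.
    apply Rmult_le_compat_l; [assumption|]. eapply Rle_trans; [apply (Cmod_tri3 _ p)|]. lra. }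
  assert (Hb' : Cmod (tr (p, q, r)) <= (eps * (6 * Lam * h)) * (Cmod (L q - L p) + Cmod (L r - L q) + Cmod (L p - L r))).
  { unfold tr; simpl fst; simpl snd. apply (tri_small f (L l) d0 _ _ _ (6 * Lam * h)); try (apply gt_seg; assumption); try (apply Hr).
    - nra.
    - replace (p - p)%C with (RtoC 0) by ring. rewrite Cmod_0. lra.
    - assumption.
    - rewrite Cmod_minus_sym. assumption.
    - intros z Hz. eapply Rle_trans; [apply Hd'; nra|]. apply Rmult_le_compat_l; lra. }
  pose proof (gt_L_dist q p). pose proof (gt_L_dist r q). pose proof (gt_L_dist p r).
  rewrite (Cmod_minus_sym q r) in D2.
  assert (HB : Cmod (tr (p, q, r)) <= 36 * eps * (Lam * Lam) * (h * h)).
  { eapply Rle_trans; [exact Hb'|].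
    replace (36 * eps * (Lam * Lam) * (h * h)) with (eps * (6 * Lam * h) * (6 * Lam * h)) by ring.
    apply Rmult_le_compat_l; [apply Rmult_le_pos; [lra|nra]|].
    assert (Cmod (L q - L p) <= Lam * (2 * h)) by nra.
    assert (Cmod (L r - L q) <= Lam * (2 * h)) by nra.
    assert (Cmod (L p - L r) <= Lam * (2 * h)) by nra. lra. }
  apply Rle_trans with (36 * eps * (Lam * Lam)).
  - eapply Rle_trans; [exact HT|]. replace (36 * eps * (Lam * Lam)) with (36 * eps * (Lam * Lam) * (4^n * (h * h))) by (rewrite H4; ring).
    pose proof (pow_lt 4 n ltac:(lra)). nra.
  - replace eps0 with (36 * eps * ((Lam + 1) * (Lam + 1))) by (unfold eps; field; lra). nra.
Qed.
End Goursat.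

Lemma seg_const c a b : seg (fun _ => c) a b = (c * (b - a))%C.
Proof.
  rewrite (seg_FTC (fun z => c * z)%C (fun _ => c)).
  - ring.
  - intros s _. pose proof (cd_scal c (fun w => w) (a + s * (b - a))%C 1 (cd_id _)) as H.
    rewrite Cmult_1_r in H. exact H.
  - intros s _. apply Cdiff_ccont, Cdiff_const.
Qed.

(** The integral along the segment from z0 is the primitive: by Goursat on z0, z, w its increment is
    the integral over [z, w], where f is close to f(z). Convexity keeps the triangle inside [O]. *)
Lemma hol_primitive (O : C -> Prop) f z0 : convC O -> openC O -> O z0 -> (forall z, O z -> Cdiff f z) ->
  exists P, forall z, O z -> cd P z (f z).
Proof.
  intros Hc Ho H0 Hf. exists (fun z => seg f z0 z). intros z Hz eps He.
  destruct (Ho z Hz) as [r [Hr Hr']]. destruct (Cdiff_ccont f z (Hf z Hz) eps He) as [d [Hd Hd']].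
  exists (Rmin r d). split; [now apply Rmin_glb_lt|]. intros w Hw.
  assert (Hwr := Rlt_le_trans _ _ _ Hw (Rmin_l r d)). assert (Hwd := Rlt_le_trans _ _ _ Hw (Rmin_r r d)).
  assert (HwO : O w) by auto.
  assert (Hsg : forall x y, O x -> O y -> sgcont f x y).
  { intros x y Hx Hy s Hs. apply Cdiff_ccont, Hf, Hc; auto. }
  pose proof (goursat_tri O f z0 z w Hc Hf H0 Hz HwO) as E. unfold tri in E.
  rewrite (seg_rev f z0 w) in E by auto.
  replace (seg f z0 w - seg f z0 z - f z * (w - z))%C with (seg f z w - f z * (w - z))%C.
  2:{ replace (seg f z w) with (seg f z0 w - seg f z0 z + (seg f z0 z + seg f z w + - seg f z0 w))%C by ring.
      rewrite E. ring. }
  rewrite <- (seg_const (f z) z w). rewrite <- seg_minus; [|auto|].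
  2:{ intros s _. apply Cdiff_ccont, Cdiff_const. }
  assert (Hball : forall s, 0 <= s <= 1 -> Cmod (z + s * (w - z) - z) < d).
  { intros s Hs. replace (z + s * (w - z) - z)%C with (s * (w - z))%C by ring.
    rewrite Cmod_mult, Cmod_R, Rabs_pos_eq by lra. pose proof (Cmod_ge_0 (w - z)). nra. }
  apply seg_bound.
  - intros s Hs. intros e1 He1. destruct (Hsg z w Hz HwO s Hs e1 He1) as [d1 [Hd1 H1]].
    exists d1. split; [assumption|]. intros x Hx.
    match goal with |- Cmod (?a - ?b - (?c - ?b))%C < _ => replace (a - b - (c - b))%C with (a - c)%C by ring end. auto.
  - intros s Hs. left. apply Hd', Hball, Hs.
Qed.

(** Opens complex functions on a line to real one-variable calculus; the factor [c] selects the
    component under study. *)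
Lemma cd_real_line P (a v : C) (s : R) (l c : C) : cd P (a + s * v)%C l ->
  is_derive (fun t : R => Re (c * P (a + t * v)%C)) s (Re (c * (l * v))).
Proof.
  intros H. apply is_derive_Reals. intros eps He.
  pose proof (Cmod_ge_0 c) as P1. pose proof (Cmod_ge_0 v) as P2.
  set (K := (Cmod c + 1) * (Cmod v + 1)). assert (HK : 0 < K) by (unfold K; nra).
  destruct (H (eps / (2 * K))) as [d [Hd Hd']]; [apply Rdiv_lt_0_compat; lra|].
  assert (Hdd : 0 < d / (Cmod v + 1)) by (apply Rdiv_lt_0_compat; lra).
  exists (mkposreal _ Hdd). intros h Hh0 Hh. simpl in Hh. apply Rlt_div_r in Hh; [|lra].
  assert (E : (a + (s + h)%R * v - (a + s * v) = h * v)%C) by (rewrite RtoC_plus; ring).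
  specialize (Hd' (a + (s + h)%R * v)%C). rewrite E, Cmod_mult, Cmod_R in Hd'.
  pose proof (Rabs_pos_lt h Hh0) as Hp.
  specialize (Hd' ltac:(nra)).
  set (r := (P (a + (s + h)%R * v) - P (a + s * v) - l * (h * v))%C) in *.
  replace ((Re (c * P (a + (s + h)%R * v)%C) - Re (c * P (a + s * v)%C)) / h - Re (c * (l * v))) with (Re (c * r) / h).
  2:{ replace (Re (c * r)) with (Re (c * P (a + (s + h)%R * v)%C) - Re (c * P (a + s * v)%C) - h * Re (c * (l * v))).
      - field. assumption.
      - unfold r, Re; simpl; ring. }
  unfold Rdiv. rewrite Rabs_mult, Rabs_inv.
  apply Rle_lt_trans with (Cmod c * Cmod r * / Rabs h).
  - apply Rmult_le_compat_r; [left; now apply Rinv_0_lt_compat|]. rewrite <- Cmod_mult. apply re_le_Cmod.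
  - apply Rmult_lt_reg_r with (Rabs h); [assumption|]. rewrite Rmult_assoc, Rinv_l, Rmult_1_r by lra.
    apply Rle_lt_trans with (Cmod c * (eps / (2 * K) * (Rabs h * Cmod v))).
    + apply Rmult_le_compat_l; assumption.
    + replace (Cmod c * (eps / (2 * K) * (Rabs h * Cmod v))) with (eps * Rabs h * ((Cmod c * Cmod v) / (2 * K))) by (field; lra).
      rewrite <- (Rmult_1_r (eps * Rabs h)) at 2. apply Rmult_lt_compat_l; [now apply Rmult_lt_0_compat|].
      apply Rlt_div_l; [lra|]. unfold K. nra.
Qed.

(** With c the conjugate of P b - P a, the real function Re (c P) along the segment increases by |P
    b - P a|^2. The real mean value theorem applies to it, and one factor |P b - P a| cancels. *)
Lemma mean_value_ineq P (dP : C -> C) a b M : (forall s, 0 <= s <= 1 -> cd P (a + s * (b - a))%C (dP (a + s * (b - a))%C)) ->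
  (forall s, 0 <= s <= 1 -> Cmod (dP (a + s * (b - a))%C) <= M) -> Cmod (P b - P a) <= M * Cmod (b - a).
Proof.
  intros H1 H2. set (c := Cconj (P b - P a)).
  destruct (MVT_gen (fun t : R => Re (c * P (a + t * (b - a))%C)) 0 1 (fun t => Re (c * (dP (a + t * (b - a))%C * (b - a))%C)))
    as [s [Hs E]].
  - intros x Hx. rewrite Rmin_left, Rmax_right in Hx by lra. apply cd_real_line, H1. lra.
  - intros x Hx. rewrite Rmin_left, Rmax_right in Hx by lra.
    apply continuity_pt_filterlim. apply (ex_derive_continuous (V := R_NormedModule)). eexists. apply cd_real_line, H1. lra.
  - rewrite Rmin_left, Rmax_right in Hs by lra.
    replace (a + 1 * (b - a))%C with b in E by ring. replace (a + 0 * (b - a))%C with a in E by ring.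
    assert (E2 : Re (c * P b) - Re (c * P a) = Cmod (P b - P a) ^ 2).
    { rewrite Cmod2_alt. unfold c, Re, Im, Cconj; simpl. ring. }
    rewrite E2 in E. pose proof (re_le_Cmod (c * (dP (a + s * (b - a))%C * (b - a)))) as Hr.
    rewrite !Cmod_mult in Hr. unfold c in Hr. rewrite Cmod_conj in Hr. fold c in Hr.
    pose proof (Rle_abs (Re (c * (dP (a + s * (b - a))%C * (b - a))))) as Ha.
    specialize (H2 s Hs). pose proof (Cmod_ge_0 (P b - P a)). pose proof (Cmod_ge_0 (b - a)).
    destruct (Req_dec (Cmod (P b - P a)) 0) as [Z|Z].
    + rewrite Z. pose proof (Cmod_ge_0 (dP (a + s * (b - a))%C)). nra.
    + apply Rmult_le_reg_l with (Cmod (P b - P a)); [lra|].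
      apply Rle_trans with (Cmod (P b - P a) * (Cmod (dP (a + s * (b - a))%C) * Cmod (b - a))).
      * nra.
      * apply Rmult_le_compat_l; [lra|]. now apply Rmult_le_compat_r.
Qed.

(** * The complex exponential and Cauchy's estimate *)

Definition Cexp (z : C) : C := (exp (Re z) * cos (Im z), exp (Re z) * sin (Im z)).

Lemma Cexp_plus z w : Cexp (z + w) = (Cexp z * Cexp w)%C.
Proof.
  unfold Cexp, Re, Im; simpl. rewrite exp_plus, cos_plus, sin_plus.
  Cext.
Qed.
Lemma Cexp_0 : Cexp 0 = 1%C.
Proof. unfold Cexp, Re, Im; simpl. rewrite exp_0, cos_0, sin_0. Cext. Qed.
Lemma Cexp_opp_l z : (Cexp (- z) * Cexp z)%C = 1%C.
Proof. rewrite <- Cexp_plus. replace (- z + z)%C with (RtoC 0) by ring. apply Cexp_0. Qed.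
Lemma Cmod_Cexp z : Cmod (Cexp z) = exp (Re z).
Proof.
  assert (H : Cmod (Cexp z) ^ 2 = exp (Re z) ^ 2).
  { rewrite Cmod2_alt. unfold Cexp at 1 2. unfold Re at 1, Im at 2; simpl.
    pose proof (sin2_cos2 (Im z)) as E. unfold Rsqr in E. nra. }
  pose proof (Cmod_ge_0 (Cexp z)). pose proof (exp_pos (Re z)). nra.
Qed.
Lemma derivable_pt_lim_eps f x l : derivable_pt_lim f x l -> forall eps, 0 < eps -> exists d, 0 < d /\
  forall h, Rabs h < d -> Rabs (f (x + h) - f x - l * h) <= eps * Rabs h.
Proof.
  intros H eps He. destruct (H eps He) as [d Hd]. exists d. split; [apply cond_pos|]. intros h Hh.
  destruct (Req_dec h 0) as [->|Hz].
  - rewrite Rplus_0_r, Rmult_0_r, Rminus_0_r. replace (f x - f x) with 0 by ring. rewrite Rabs_R0. lra.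
  - specialize (Hd h Hz Hh). replace (f (x + h) - f x - l * h) with (((f (x + h) - f x) / h - l) * h) by (field; assumption).
    rewrite Rabs_mult. apply Rmult_le_compat_r; [apply Rabs_pos|lra].
Qed.

(** The addition formula reduces the claim to the origin, where the real derivatives of exp, cos and
    sin at 0 control both components of exp h - 1 - h. *)
Lemma cd_Cexp z : cd Cexp z (Cexp z).
Proof.
  intros eps He. pose proof (exp_pos (Re z)) as Hz.
  set (e := Rmin 1 (eps / (9 * exp (Re z)))).
  assert (Hpos : 0 < eps / (9 * exp (Re z))) by (apply Rdiv_lt_0_compat; lra).
  assert (He0 : 0 < e) by (unfold e; apply Rmin_glb_lt; lra).
  assert (He1 : e <= 1) by apply Rmin_l.
  destruct (derivable_pt_lim_eps exp 0 _ (derivable_pt_lim_exp 0) e He0) as [d1 [Hd1 H1]].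
  destruct (derivable_pt_lim_eps cos 0 _ (derivable_pt_lim_cos 0) e He0) as [d2 [Hd2 H2]].
  destruct (derivable_pt_lim_eps sin 0 _ (derivable_pt_lim_sin 0) e He0) as [d3 [Hd3 H3]].
  set (d := Rmin (Rmin d1 d2) (Rmin d3 (e / 2))).
  assert (Hd : 0 < d) by (unfold d; repeat apply Rmin_glb_lt; lra).
  exists d. split; [assumption|]. intros w Hw.
  set (h := (w - z)%C) in *. replace w with (z + h)%C by (unfold h; ring).
  rewrite Cexp_plus. replace (Cexp z * Cexp h - Cexp z - Cexp z * h)%C with (Cexp z * (Cexp h - 1 - h))%C by ring.
  rewrite Cmod_mult, Cmod_Cexp.
  set (x := Re h). set (y := Im h).
  assert (Hx : Rabs x <= Cmod h) by apply re_le_Cmod. assert (Hy : Rabs y <= Cmod h) by apply im_le_Cmod.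
  assert (Hdl : d <= d1 /\ d <= d2 /\ d <= d3 /\ d <= e / 2).
  { unfold d. pose proof (Rmin_l (Rmin d1 d2) (Rmin d3 (e/2))). pose proof (Rmin_r (Rmin d1 d2) (Rmin d3 (e/2))).
    pose proof (Rmin_l d1 d2). pose proof (Rmin_r d1 d2). pose proof (Rmin_l d3 (e/2)). pose proof (Rmin_r d3 (e/2)). lra. }
  specialize (H1 x ltac:(lra)). specialize (H2 y ltac:(lra)). specialize (H3 y ltac:(lra)).
  rewrite Rplus_0_l, exp_0 in H1. rewrite Rplus_0_l, cos_0, sin_0 in H2. rewrite Rplus_0_l, sin_0, cos_0 in H3.
  rewrite Rmult_1_l in H1. replace (cos y - 1 - - 0 * y) with (cos y - 1) in H2 by ring.
  replace (sin y - 0 - 1 * y) with (sin y - y) in H3 by ring.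
  set (u := Cmod h) in *. assert (Hu : 0 <= u) by apply Cmod_ge_0.
  assert (Hex : Rabs (exp x - 1) <= e).
  { replace (exp x - 1) with ((exp x - 1 - x) + x) by ring. eapply Rle_trans; [apply Rabs_triang|]. nra. }
  assert (Hex2 : 0 < exp x <= 2). { split; [apply exp_pos|]. apply Rabs_le_between in Hex. lra. }
  assert (Hm : Cmod (Cexp h - 1 - h) <= 9 * e * u).
  { eapply Rle_trans; [apply Cmod_le_ReIm|].
    replace (Re (Cexp h - 1 - h)) with ((exp x - 1 - x) + exp x * (cos y - 1)) by (unfold Cexp, x, y, Re, Im; simpl; ring).
    replace (Im (Cexp h - 1 - h)) with (exp x * (sin y - y) + (exp x - 1) * y) by (unfold Cexp, x, y, Re, Im; simpl; ring).
    pose proof (Rabs_triang (exp x - 1 - x) (exp x * (cos y - 1))) as T1.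
    pose proof (Rabs_triang (exp x * (sin y - y)) ((exp x - 1) * y)) as T2.
    rewrite !Rabs_mult in T1, T2. rewrite (Rabs_mult (exp x - 1) y) in T2. rewrite (Rabs_pos_eq (exp x)) in T1, T2 by lra.
    pose proof (Rabs_pos (cos y - 1)). pose proof (Rabs_pos (sin y - y)). pose proof (Rabs_pos y). pose proof (Rabs_pos (exp x - 1)).
    assert (exp x * Rabs (cos y - 1) <= 2 * (e * u)) by (apply Rmult_le_compat; nra).
    assert (exp x * Rabs (sin y - y) <= 2 * (e * u)) by (apply Rmult_le_compat; nra).
    assert (Rabs (exp x - 1) * Rabs y <= e * u) by (apply Rmult_le_compat; nra).
    assert (e * Rabs x <= e * u) by (apply Rmult_le_compat_l; lra). assert (0 <= e * u) by nra. lra. }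
  apply Rle_trans with (exp (Re z) * (9 * e * u)); [apply Rmult_le_compat_l; lra|].
  assert (e * (9 * exp (Re z)) <= eps).
  { apply Rle_div_r; [lra|]. apply Rmin_r. }
  nra.
Qed.

Lemma Cdiff_Cexp f z : Cdiff f z -> Cdiff (fun w => Cexp (f w)) z.
Proof. intros H. eapply cd_Cdiff, cd_comp; [apply cd_Cexp|now apply cd_C_derive]. Qed.
#[export] Hint Resolve Cdiff_Cexp : cdiff.

Lemma Cexp_per z : Cexp (z + (0, 2 * PI)) = Cexp z.
Proof. unfold Cexp, Re, Im; simpl. rewrite Rplus_0_r, cos_plus, sin_plus, cos_2PI, sin_2PI. f_equal; ring. Qed.

Lemma Cmod_self (z : C) : Cmod (z - z) = 0.
Proof. replace (z - z)%C with (RtoC 0) by ring. apply Cmod_0. Qed.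

Lemma convC_ball a r : convC (fun z => Cmod (z - a) < r).
Proof.
  intros z w s Hz Hw Hs. set (m := Rmax (Cmod (z - a)) (Cmod (w - a))).
  apply Rle_lt_trans with m.
  - apply Cmod_seg; [assumption|apply Rmax_l|apply Rmax_r].
  - now apply Rmax_lub_lt.
Qed.

Lemma openC_ball a r : openC (fun z => Cmod (z - a) < r).
Proof.
  intros z Hz. exists (r - Cmod (z - a)). split; [lra|]. intros w Hw.
  pose proof (Cmod_tri3 w z a). lra.
Qed.

Lemma convC_halfplane_lt c : convC (fun z => Re z < c).
Proof.
  intros z w s Hz Hw Hs. replace (Re (z + s * (w - z))) with ((1 - s) * Re z + s * Re w) by (unfold Re; simpl; ring).
  destruct (Req_dec s 1) as [->|Hs1]; [lra|].
  assert (0 < (1 - s) * (c - Re z)) by (apply Rmult_lt_0_compat; lra).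
  assert (0 <= s * (c - Re w)) by (apply Rmult_le_pos; lra). lra.
Qed.

(* the logarithmic substitution turns the circles |z - a| = e^s into vertical segments of a half-plane *)
Lemma cauchy_formula f a R0 sg : (forall z, Cmod (z - a) < R0 -> Cdiff f z) -> exp sg < R0 ->
  seg (fun z => f (a + Cexp z) * Cexp (- z))%C (sg, 0) (sg, (2 * PI)%R) = ((0, (2 * PI)%R) * C_derive f a)%C.
Proof.
  intros Hf Hsg. set (h := fun z => (f (a + Cexp z) * Cexp (- z))%C).
  assert (HR : 0 < R0) by (pose proof (exp_pos sg); lra).
  set (O := fun z => Re z < ln R0).
  assert (Hexp : forall z, O z -> exp (Re z) < R0).
  { intros z Hz. rewrite <- (exp_ln R0) by assumption. now apply exp_increasing. }
  assert (Hh : forall z, O z -> Cdiff h z).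
  { intros z Hz. unfold h. apply Cdiff_mult.
    - apply (Cdiff_comp f (fun w => a + Cexp w)%C).
      + apply Hf. replace (a + Cexp z - a)%C with (Cexp z) by ring. rewrite Cmod_Cexp. auto.
      + auto with cdiff.
    - apply Cdiff_Cexp, Cdiff_opp, Cdiff_id. }
  assert (Hc : convC O) by apply convC_halfplane_lt.
  assert (Hsgc : forall x y, O x -> O y -> sgcont h x y).
  { intros x y Hx Hy s Hs. apply Cdiff_ccont, Hh, Hc; auto. }
  assert (Hper : forall z, h (z + (0, (2 * PI)%R))%C = h z).
  { intros z. unfold h. rewrite Cexp_per. f_equal.
    rewrite <- (Cexp_per (- (z + (0, (2 * PI)%R)))). f_equal. ring. }
  (* The integral over a period does not depend on the abscissa: two triangles tile the rectangle
     between the vertical segments, and its horizontal sides cancel by periodicity. *)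
  assert (HJ : forall s1 s2, s1 < ln R0 -> s2 < ln R0 -> seg h (s1, 0) (s1, (2 * PI)%R) = seg h (s2, 0) (s2, (2 * PI)%R)).
  { intros s1 s2 H1 H2.
    pose proof (goursat_tri O h (s1, 0) (s2, 0) (s2, (2 * PI)%R) Hc Hh H1 H2 H2) as E1.
    pose proof (goursat_tri O h (s1, 0) (s2, (2 * PI)%R) (s1, (2 * PI)%R) Hc Hh H1 H2 H1) as E2.
    unfold tri in E1, E2.
    rewrite (seg_rev h (s1, 0) (s2, (2 * PI)%R)) in E1 by (apply Hsgc; assumption).
    rewrite (seg_rev h (s1, 0) (s1, (2 * PI)%R)) in E2 by (apply Hsgc; assumption).
    rewrite (seg_rev h (s1, (2 * PI)%R) (s2, (2 * PI)%R)) in E2 by (apply Hsgc; assumption).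
    assert (E3 : seg h (s1, (2 * PI)%R) (s2, (2 * PI)%R) = seg h (s1, 0) (s2, 0)).
    { unfold seg. apply CI_ext. intros s _.
      replace ((s2, (2 * PI)%R) - (s1, (2 * PI)%R))%C with ((s2, 0) - (s1, 0))%C by (Cext).
      f_equal. rewrite <- (Hper ((s1, 0) + s * ((s2, 0) - (s1, 0)))%C). f_equal.
      Cext. }
    rewrite E3 in E2.
    replace (seg h (s1, 0) (s1, (2 * PI)%R)) with (seg h (s2, 0) (s2, (2 * PI)%R) - (seg h (s1, 0) (s2, 0) + seg h (s2, 0) (s2, (2 * PI)%R) + - seg h (s1, 0) (s2, (2 * PI)%R))
      - (seg h (s1, 0) (s2, (2 * PI)%R) + - seg h (s1, 0) (s2, 0) + - seg h (s1, 0) (s1, (2 * PI)%R)))%C by ring.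
    rewrite E1, E2. ring. }
  assert (Hsg' : sg < ln R0) by (rewrite <- (ln_exp sg); apply ln_increasing; [apply exp_pos|assumption]).
  apply Ceq_minus, Cmod_eq_0. apply Rle_antisym; [|apply Cmod_ge_0]. apply Rle_plus_epsilon. intros eps0 He0. rewrite Rplus_0_l.
  pose proof PI_RGT_0 as Hpi.
  assert (Hfa : Cdiff f a) by (apply Hf; rewrite Cmod_self; assumption).
  destruct (cd_C_derive f a Hfa (eps0 / (2 * PI))) as [d [Hd Hd']]; [apply Rdiv_lt_0_compat; lra|].
  set (s0 := ln (Rmin (d / 2) (R0 / 2))).
  assert (Hm : 0 < Rmin (d / 2) (R0 / 2)) by (apply Rmin_glb_lt; lra).
  assert (Hs0 : exp s0 = Rmin (d / 2) (R0 / 2)) by (apply exp_ln; assumption).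
  assert (Hs0d : exp s0 < d) by (rewrite Hs0; eapply Rle_lt_trans; [apply Rmin_l|lra]).
  assert (Hs0R : s0 < ln R0).
  { apply ln_increasing; [assumption|]. eapply Rle_lt_trans; [apply Rmin_r|lra]. }
  rewrite (HJ sg s0) by assumption.
  (* This is the integrand with f replaced by its first-order expansion at a. Over one period the
     first term integrates to 0 and the second to 2 pi i f'(a). *)
  set (k := fun z => (f a * Cexp (- z) + C_derive f a)%C).
  set (K := fun z => (- f a * Cexp (- z) + C_derive f a * z)%C).
  assert (HK : forall z, cd K z (k z)).
  { intros z. unfold K, k.
    replace (f a * Cexp (- z) + C_derive f a)%C with (- f a * (Cexp (- z) * (0 - 1)) + C_derive f a * 1)%C by ring.
    apply cd_plus; [|apply cd_scal, cd_id]. apply cd_scal. apply (cd_comp Cexp); [apply cd_Cexp|].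
    apply (cd_ext (fun w => 0 - w)%C); [intros w; ring|].
    apply (cd_minus (fun _ => RtoC 0) (fun w => w)); [apply cd_const|apply cd_id]. }
  assert (Hk : sgcont k (s0, 0) (s0, (2 * PI)%R)).
  { intros s _. apply Cdiff_ccont. unfold k. auto with cdiff. }
  replace ((0, (2 * PI)%R) * C_derive f a)%C with (seg k (s0, 0) (s0, (2 * PI)%R)).
  2:{ rewrite (seg_FTC K k) by auto. unfold K.
      replace (Cexp (- (s0, (2 * PI)%R))) with (Cexp (- (s0, 0))).
      2:{ rewrite <- (Cexp_per (- (s0, (2 * PI)%R))). f_equal. Cext. }
      replace (s0, (2 * PI)%R) with ((s0, 0) + (0, (2 * PI)%R))%C at 1 by (Cext). ring. }
  rewrite <- seg_minus by auto.
  replace eps0 with ((eps0 / (2 * PI)) * Cmod ((s0, (2 * PI)%R) - (s0, 0))).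
  2:{ replace ((s0, (2 * PI)%R) - (s0, 0))%C with ((2 * PI)%R * Ci)%C by (Cext).
      rewrite Cmod_mult, Cmod_R, Cmod_Ci, Rabs_pos_eq by lra. field. lra. }
  apply seg_bound.
  - intros s Hs. apply Cdiff_ccont, Cdiff_minus.
    + apply Hh, Hc; auto.
    + unfold k. auto with cdiff.
  - intros s Hs. set (z := ((s0, 0) + s * ((s0, (2 * PI)%R) - (s0, 0)))%C).
    assert (Hz : Re z = s0) by (unfold z, Re; simpl; ring).
    unfold h, k.
    replace (f (a + Cexp z) * Cexp (- z) - (f a * Cexp (- z) + C_derive f a))%C with
      ((f (a + Cexp z) - f a - C_derive f a * (a + Cexp z - a)) * Cexp (- z))%C.
    2:{ transitivity ((f (a + Cexp z)%C - f a) * Cexp (- z) - C_derive f a * (Cexp (- z) * Cexp z))%C; [ring|].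
        rewrite Cexp_opp_l. ring. }
    rewrite Cmod_mult. rewrite <- (Rmult_1_r (eps0 / (2 * PI))).
    assert (E : Cmod (a + Cexp z - a) = exp s0) by (replace (a + Cexp z - a)%C with (Cexp z) by ring; rewrite Cmod_Cexp, Hz; reflexivity).
    specialize (Hd' (a + Cexp z)%C). rewrite E in Hd'. specialize (Hd' Hs0d).
    replace 1 with (exp s0 * Cmod (Cexp (- z))).
    + rewrite <- Rmult_assoc. apply Rmult_le_compat_r; [apply Cmod_ge_0|assumption].
    + rewrite Cmod_Cexp. replace (Re (- z)) with (- Re z) by reflexivity. rewrite Hz, exp_Ropp. apply Rinv_r. pose proof (exp_pos s0). lra.
Qed.

Lemma cauchy_est f a R0 M : 0 < R0 -> (forall z, Cmod (z - a) < R0 -> Cdiff f z) ->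
  (forall z, Cmod (z - a) < R0 -> Cmod (f z) <= M) -> Cmod (C_derive f a) <= M / R0.
Proof.
  intros HR Hf HM. assert (HM0 : 0 <= M).
  { eapply Rle_trans; [apply Cmod_ge_0|apply (HM a)]. rewrite Cmod_self. assumption. }
  assert (H : forall r, 0 < r < R0 -> Cmod (C_derive f a) * r <= M).
  { intros r Hr. pose proof (cauchy_formula f a R0 (ln r) Hf) as E. rewrite exp_ln in E by lra. specialize (E ltac:(lra)).
    pose proof PI_RGT_0 as Hpi.
    assert (Hlr : forall s : R, 0 <= s <= 1 -> Cmod (a + Cexp ((ln r, 0) + s * ((ln r, (2 * PI)%R) - (ln r, 0))) - a) = r).
    { intros s Hs. match goal with |- Cmod (a + ?x - a)%C = _ => replace (a + x - a)%C with x by ring end.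
      rewrite Cmod_Cexp. match goal with |- exp ?x = _ => replace x with (ln r) end; [apply exp_ln; lra|]. unfold Re; simpl; ring. }
    assert (E2 : Cmod ((0, (2 * PI)%R) * C_derive f a) <= M / r * Cmod ((ln r, (2 * PI)%R) - (ln r, 0))).
    { rewrite <- E. apply seg_bound.
      - intros s Hs. apply Cdiff_ccont, Cdiff_mult.
        + apply (Cdiff_comp f (fun w => a + Cexp w)%C); [|auto with cdiff]. apply Hf. rewrite Hlr; lra.
        + apply Cdiff_Cexp, Cdiff_opp, Cdiff_id.
      - intros s Hs. rewrite Cmod_mult. unfold Rdiv. apply Rmult_le_compat; try apply Cmod_ge_0.
        + apply HM. rewrite Hlr; lra.
        + rewrite Cmod_Cexp. match goal with |- exp ?x <= _ => replace x with (- ln r) by (unfold Re; simpl; ring) end.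
          rewrite exp_Ropp, exp_ln by lra. lra. }
    replace ((ln r, (2 * PI)%R) - (ln r, 0))%C with ((0, (2 * PI)%R))%C in E2 by (Cext).
    replace ((0, (2 * PI)%R)) with ((2 * PI)%R * Ci)%C in E2 by (Cext).
    rewrite !Cmod_mult, Cmod_R, Cmod_Ci, Rabs_pos_eq in E2 by lra.
    apply Rle_div_r; [lra|]. apply Rmult_le_reg_l with (2 * PI); lra. }
  apply Rle_div_r; [lra|]. destruct (Rle_lt_dec (Cmod (C_derive f a) * R0) M) as [Hle|Hlt]; [assumption|exfalso].
  pose proof (Cmod_ge_0 (C_derive f a)) as Hp. assert (0 < Cmod (C_derive f a)) by nra.
  (* The estimate is known for radii below R0. If |f'(a)| R0 exceeded M, this midpoint would be such
     a radius with |f'(a)| r > M. *)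
  set (r := (M / Cmod (C_derive f a) + R0) / 2).
  assert (H1 : M / Cmod (C_derive f a) < R0) by (apply Rlt_div_l; lra).
  assert (H2 : 0 <= M / Cmod (C_derive f a)) by (apply Rdiv_le_0_compat; lra).
  specialize (H r ltac:(unfold r; lra)).
  assert (M < Cmod (C_derive f a) * r); [|lra].
  rewrite Rmult_comm. apply Rlt_div_l; [lra|]. unfold r. lra.
Qed.

Lemma C_derive_minus f g z : Cdiff f z -> Cdiff g z -> C_derive (fun w => f w - g w)%C z = (C_derive f z - C_derive g z)%C.
Proof. intros. apply C_derive_cd, cd_minus; now apply cd_C_derive. Qed.

Lemma C_derive_shift f k z : Cdiff f (z + k)%C -> cd (fun w => f (w + k)%C) z (C_derive f (z + k)%C).
Proof.
  intros H. replace (C_derive f (z + k)%C) with (C_derive f (z + k)%C * (1 + 0))%C by ring.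
  apply (cd_comp f (fun w => w + k)%C); [now apply cd_C_derive|]. apply cd_plus; [apply cd_id|apply cd_const].
Qed.

(** * Taylor estimates with constants depending only on a local bound *)

Section LocalBounds.
Variables (f : C -> C) (a : C) (R0 M : R).
Hypothesis HR : 0 < R0.
Hypothesis Hf : forall z, Cmod (z - a) < R0 -> Cdiff f z.
Hypothesis HM : forall z, Cmod (z - a) < R0 -> Cmod (f z) <= M.

Lemma lb_deriv z : Cmod (z - a) <= R0 / 2 -> Cmod (C_derive f z) <= 2 * M / R0.
Proof.
  intros Hz. replace (2 * M / R0) with (M / (R0 / 2)) by (field; lra). apply cauchy_est; [lra| |];
  intros w Hw; pose proof (Cmod_tri3 w z a); [apply Hf|apply HM]; lra.
Qed.

Lemma lb_lip z w : Cmod (z - a) <= R0 / 2 -> Cmod (w - a) <= R0 / 2 -> Cmod (f w - f z) <= 2 * M / R0 * Cmod (w - z).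
Proof.
  intros Hz Hw. apply (mean_value_ineq f (C_derive f)).
  - intros s Hs. apply cd_C_derive, Hf. apply Rle_lt_trans with (R0 / 2); [now apply Cmod_seg|lra].
  - intros s Hs. apply lb_deriv. now apply Cmod_seg.
Qed.

(** The difference f'(w) - f'(z) is the derivative at z of x -> f (x + w - z) - f x, which [lb_lip]
    bounds near z; Cauchy's estimate follows. Differentiability of f' is itself derived from this
    bound later. *)
Lemma lb_deriv_lip z w : Cmod (z - a) <= R0 / 4 -> Cmod (w - a) <= R0 / 4 ->
  Cmod (C_derive f w - C_derive f z) <= 8 * M / (R0 * R0) * Cmod (w - z).
Proof.
  intros Hz Hw.
  pose proof (Cmod_tri3 w z a) as T0.
  assert (Hd1 : Cdiff f w) by (apply Hf; lra). assert (Hd2 : Cdiff f z) by (apply Hf; lra).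
  set (k := (w - z)%C). assert (Ew : (z + k)%C = w) by (unfold k; ring).
  assert (E : (C_derive f w - C_derive f z)%C = C_derive (fun x => f (x + k) - f x)%C z).
  { symmetry. apply C_derive_cd, cd_minus; [|now apply cd_C_derive]. rewrite <- Ew. apply C_derive_shift. now rewrite Ew. }
  rewrite E. fold k. replace (8 * M / (R0 * R0) * Cmod k) with ((2 * M / R0 * Cmod k) / (R0 / 4)) by (field; lra).
  assert (HH : forall x, Cmod (x - z) < R0 / 4 -> Cmod (x - a) <= R0 / 2 /\ Cmod (x + k - a) <= R0 / 2).
  { intros x Hx. split.
    - pose proof (Cmod_tri3 x z a). lra.
    - pose proof (Cmod_triangle (x - z) (w - a)) as T. replace (x - z + (w - a))%C with (x + k - a)%C in T by (unfold k; ring). lra. }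
  apply cauchy_est; [lra| |]; intros x Hx; destruct (HH x Hx) as [H1 H2].
  - apply Cdiff_minus; [|apply Hf; lra]. eapply cd_Cdiff, C_derive_shift, Hf. lra.
  - replace (Cmod k) with (Cmod (x + k - x)) by (f_equal; ring). now apply lb_lip.
Qed.

Lemma lb_taylor z w : Cmod (z - a) <= R0 / 4 -> Cmod (w - a) <= R0 / 4 ->
  Cmod (f w - f z - C_derive f z * (w - z)) <= 8 * M / (R0 * R0) * Cmod (w - z) ^ 2.
Proof.
  intros Hz Hw.
  assert (HM0 : 0 <= M). { eapply Rle_trans; [apply Cmod_ge_0|apply (HM a)]. rewrite Cmod_self. assumption. }
  replace (f w - f z - C_derive f z * (w - z))%C with ((f w - C_derive f z * w) - (f z - C_derive f z * z))%C by ring.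
  replace (8 * M / (R0 * R0) * Cmod (w - z) ^ 2) with (8 * M / (R0 * R0) * Cmod (w - z) * Cmod (w - z)) by (field; lra).
  apply (mean_value_ineq (fun x => f x - C_derive f z * x)%C (fun x => C_derive f x - C_derive f z * 1)%C).
  - intros s Hs. apply cd_minus; [|apply cd_scal, cd_id]. apply cd_C_derive, Hf.
    apply Rle_lt_trans with (R0 / 4); [now apply Cmod_seg|lra].
  - intros s Hs. rewrite Cmult_1_r. eapply Rle_trans; [apply lb_deriv_lip; [assumption|now apply Cmod_seg]|].
    apply Rmult_le_compat_l.
    + apply Rdiv_le_0_compat; nra.
    + replace (z + s * (w - z) - z)%C with (s * (w - z))%C by ring. rewrite Cmod_mult, Cmod_R, Rabs_pos_eq by lra.
      pose proof (Cmod_ge_0 (w - z)). nra.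
Qed.
End LocalBounds.

(** The derivatives at a are Cauchy by Cauchy's estimate. The constant in [lb_taylor] depends only
    on the common bound M, so the quadratic remainder estimate passes to the limit and shows that f
    is differentiable at a. *)
Lemma weierstrass (fn : nat -> C -> C) f a R0 : 0 < R0 ->
  (forall n z, Cmod (z - a) < R0 -> Cdiff (fn n) z) ->
  (exists M, forall n z, Cmod (z - a) < R0 -> Cmod (fn n z) <= M) ->
  (forall eps, 0 < eps -> exists N, forall n, (N <= n)%nat -> forall z, Cmod (z - a) < R0 -> Cmod (fn n z - f z) < eps) ->
  cd f a (C_derive f a) /\ forall eps, 0 < eps -> exists N, forall n, (N <= n)%nat -> Cmod (C_derive (fn n) a - C_derive f a) < eps.
Proof.
  intros HR Hd [M HM] Hu.
  assert (Ha0 : Cmod (a - a) < R0) by (rewrite Cmod_self; assumption).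
  destruct (C_complete (fun n => C_derive (fn n) a)) as [l Hl].
  { intros eps He. destruct (Hu (eps * R0 / 4)) as [N HN]; [nra|]. exists N. intros n m Hn Hm.
    rewrite <- C_derive_minus by (apply Hd; assumption).
    apply Rle_lt_trans with ((eps * R0 / 2) / R0); [|replace (eps * R0 / 2 / R0) with (eps / 2) by (field; lra); lra].
    apply cauchy_est; [assumption| |].
    - intros z Hz. apply Cdiff_minus; now apply Hd.
    - intros z Hz. eapply Rle_trans; [apply (Cmod_tri3 _ (f z))|]. rewrite (Cmod_minus_sym (f z)).
      pose proof (HN n Hn z Hz). pose proof (HN m Hm z Hz). lra. }
  assert (Hcd : cd f a l).
  { assert (HM0 : 0 <= M). { eapply Rle_trans; [apply Cmod_ge_0|apply (HM O a Ha0)]. }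
    set (K := 8 * M / (R0 * R0)). assert (HK : 0 <= K) by (apply Rdiv_le_0_compat; nra).
    assert (HT : forall w, Cmod (w - a) <= R0 / 4 -> Cmod (f w - f a - l * (w - a)) <= K * Cmod (w - a) ^ 2).
    { intros w Hw. apply Rle_plus_epsilon. intros e He. pose proof (Cmod_ge_0 (w - a)) as Hp.
      destruct (Hu (e / 4)) as [N1 HN1]; [lra|]. destruct (Hl (e / (4 * (Cmod (w - a) + 1)))) as [N2 HN2]; [apply Rdiv_lt_0_compat; lra|].
      set (n := Nat.max N1 N2). specialize (HN1 n ltac:(lia)). specialize (HN2 n ltac:(lia)).
      pose proof (lb_taylor (fn n) a R0 M HR (Hd n) (HM n) a w) as T. rewrite Cmod_self in T. specialize (T ltac:(lra) Hw).
      replace (f w - f a - l * (w - a))%C with ((fn n w - fn n a - C_derive (fn n) a * (w - a)) - (fn n w - f w) + (fn n a - f a) + (C_derive (fn n) a - l) * (w - a))%C by ring.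
      pose proof (HN1 w ltac:(lra)) as U1. pose proof (HN1 a Ha0) as U2.
      assert (U3 : Cmod ((C_derive (fn n) a - l) * (w - a)) <= e / 4).
      { rewrite Cmod_mult. apply Rlt_div_r in HN2; [|lra]. pose proof (Cmod_ge_0 (C_derive (fn n) a - l)). nra. }
      eapply Rle_trans; [apply Cmod_triangle|]. eapply Rle_trans; [apply Rplus_le_compat_r, Cmod_triangle|].
      unfold Cminus at 1. eapply Rle_trans; [apply Rplus_le_compat_r, Rplus_le_compat_r, Cmod_triangle|]. rewrite Cmod_opp. fold K in T. lra. }
    intros eps He. exists (Rmin (R0 / 4) (eps / (K + 1))). split; [apply Rmin_glb_lt; [lra|apply Rdiv_lt_0_compat; lra]|].
    intros w Hw. assert (H1 := Rlt_le_trans _ _ _ Hw (Rmin_l _ _)). assert (H2 := Rlt_le_trans _ _ _ Hw (Rmin_r _ _)).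
    eapply Rle_trans; [apply HT; lra|]. apply Rlt_div_r in H2; [|lra]. pose proof (Cmod_ge_0 (w - a)). simpl. nra. }
  rewrite (C_derive_cd _ _ _ Hcd). split; assumption.
Qed.

(** By [lb_taylor] the difference quotients with steps [en n] converge to f' uniformly near a; being
    holomorphic and bounded there, they fall under [weierstrass]. *)
Lemma Cdiff_C_derive f a : (exists d, 0 < d /\ forall z, Cmod (z - a) < d -> Cdiff f z) -> Cdiff (C_derive f) a.
Proof.
  intros [d [Hd Hf]].
  assert (Ha : Cdiff f a) by (apply Hf; rewrite Cmod_self; assumption).
  destruct (Cdiff_ccont f a Ha 1 Rlt_0_1) as [d1 [Hd1 H1]].
  set (R0 := Rmin d d1). assert (HR : 0 < R0) by now apply Rmin_glb_lt.
  set (M := Cmod (f a) + 1).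
  assert (HfR : forall z, Cmod (z - a) < R0 -> Cdiff f z) by (intros z Hz; apply Hf; eapply Rlt_le_trans; [exact Hz|apply Rmin_l]).
  assert (HMR : forall z, Cmod (z - a) < R0 -> Cmod (f z) <= M).
  { intros z Hz. pose proof (H1 z (Rlt_le_trans _ _ _ Hz (Rmin_r _ _))). pose proof (Cmod_rev (f z) (f a)). unfold M. lra. }
  assert (HM0 : 0 <= M) by (unfold M; pose proof (Cmod_ge_0 (f a)); lra).
  set (en := fun n : nat => R0 / 8 * (/2)^n).
  assert (Hen : forall n, 0 < en n <= R0 / 8).
  { intros n. unfold en. pose proof (pow_lt (/2) n ltac:(lra)). assert ((/2)^n <= 1) by (rewrite <- (pow1 n); apply pow_incr; lra). nra. }
  assert (Hne : forall n, RtoC (en n) <> 0%C). { intros n E. apply RtoC_inj in E. pose proof (Hen n). lra. }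
  set (qn := fun n z => ((f (z + en n) - f z) / en n)%C).
  set (K := 8 * M / (R0 * R0)). assert (HK : 0 <= K) by (apply Rdiv_le_0_compat; nra).
  assert (HT : forall n z, Cmod (z - a) < R0 / 8 -> Cmod (qn n z - C_derive f z) <= K * en n).
  { intros n z Hz. pose proof (Hen n) as He.
    pose proof (lb_taylor f a R0 M HR HfR HMR z (z + en n)%C ltac:(lra)) as T.
    replace (z + en n - z)%C with (RtoC (en n)) in T by ring. rewrite Cmod_R, Rabs_pos_eq in T by lra.
    pose proof (Cmod_triangle (z - a) (en n)) as T2. rewrite Cmod_R, Rabs_pos_eq in T2 by lra.
    replace (z - a + en n)%C with (z + en n - a)%C in T2 by ring. specialize (T ltac:(lra)).
    unfold qn. replace ((f (z + en n) - f z) / en n - C_derive f z)%C with ((f (z + en n) - f z - C_derive f z * en n) / en n)%C by (field; auto).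
    rewrite Cmod_div, Cmod_R, Rabs_pos_eq by (auto; lra). apply Rle_div_l; [lra|]. fold K in T. nra. }
  destruct (weierstrass qn (C_derive f) a (R0 / 8)) as [HW _].
  - lra.
  - intros n z Hz. unfold qn. pose proof (Hen n). apply Cdiff_div; [|apply Cdiff_const|apply Hne]. apply Cdiff_minus; [|apply HfR; lra].
    eapply cd_Cdiff, C_derive_shift, HfR.
    pose proof (Cmod_triangle (z - a) (en n)) as T2. rewrite Cmod_R, Rabs_pos_eq in T2 by lra.
    replace (z - a + en n)%C with (z + en n - a)%C in T2 by ring. lra.
  - exists (2 * M / R0 + K * (R0 / 8)). intros n z Hz.
    pose proof (HT n z Hz) as T. pose proof (Cmod_rev (qn n z) (C_derive f z)) as T2.
    pose proof (lb_deriv f a R0 M HR HfR HMR z ltac:(lra)) as T3. pose proof (Hen n). nra.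
  - intros eps He. destruct (pow_half_lt (eps / (K * (R0 / 8) + 1))) as [N HN]; [apply Rdiv_lt_0_compat; [lra|nra]|].
    exists N. intros n Hn z Hz. specialize (HN n Hn). apply Rlt_div_r in HN; [|nra].
    eapply Rle_lt_trans; [now apply HT|]. unfold en. pose proof (pow_lt (/2) n ltac:(lra)). nra.
  - eapply cd_Cdiff, HW.
Qed.

Definition holn (f : C -> C) (a : C) : Prop := exists d, 0 < d /\ forall z, Cmod (z - a) < d -> Cdiff f z.

Lemma holn_open O f z : openC O -> (forall z, O z -> Cdiff f z) -> O z -> holn f z.
Proof. intros Ho Hf Hz. destruct (Ho z Hz) as [r [Hr H]]. exists r. split; auto. Qed.

Lemma holn_Cdiff f a : holn f a -> Cdiff f a.
Proof. intros [d [Hd H]]. apply H. rewrite Cmod_self. assumption. Qed.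

Lemma entire_holn f a : entire f -> holn f a.
Proof. intros H. exists 1. split; [lra|auto]. Qed.

Lemma taylor2 f a : holn f a -> forall eps, 0 < eps -> exists d, 0 < d /\ forall w, Cmod (w - a) < d ->
  Cmod (f w - f a - C_derive f a * (w - a) - C_derive (C_derive f) a / 2 * ((w - a) * (w - a))) <= eps * Cmod (w - a) ^ 2.
Proof.
  intros Hf eps He. destruct (cd_C_derive _ _ (Cdiff_C_derive f a Hf) eps He) as [d1 [Hd1 H1]].
  destruct Hf as [d2 [Hd2 H2]]. exists (Rmin d1 d2). split; [now apply Rmin_glb_lt|]. intros w Hw.
  assert (Hw1 := Rlt_le_trans _ _ _ Hw (Rmin_l _ _)). assert (Hw2 := Rlt_le_trans _ _ _ Hw (Rmin_r _ _)).
  set (D1 := C_derive f a) in *. set (D2 := C_derive (C_derive f) a) in *.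
  set (P := fun x => (f x - D1 * x - D2 / 2 * ((x - a) * (x - a)))%C).
  replace (f w - f a - D1 * (w - a) - D2 / 2 * ((w - a) * (w - a)))%C with (P w - P a)%C by (unfold P; field).
  replace (eps * Cmod (w - a) ^ 2) with (eps * Cmod (w - a) * Cmod (w - a)) by ring.
  assert (Hs' : forall s, 0 <= s <= 1 -> Cmod (a + s * (w - a) - a) <= Cmod (w - a)).
  { intros s Hs. replace (a + s * (w - a) - a)%C with (s * (w - a))%C by ring. rewrite Cmod_mult, Cmod_R, Rabs_pos_eq by lra.
    pose proof (Cmod_ge_0 (w - a)). nra. }
  apply (mean_value_ineq P (fun x => C_derive f x - D1 - D2 * (x - a))%C).
  - intros s Hs. specialize (Hs' s Hs). set (x := (a + s * (w - a))%C) in *. unfold P.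
    replace (C_derive f x - D1 - D2 * (x - a))%C with (C_derive f x - D1 * 1 - D2 / 2 * ((1 - 0) * (x - a) + (x - a) * (1 - 0)))%C by field.
    apply cd_minus; [apply cd_minus|].
    + apply cd_C_derive, H2. lra.
    + apply cd_scal, cd_id.
    + apply cd_scal. apply (cd_mult (fun x => x - a)%C (fun x => x - a)%C); apply (cd_minus (fun x => x) (fun _ => a)); auto using cd_id, cd_const.
  - intros s Hs. specialize (Hs' s Hs). eapply Rle_trans; [apply H1; lra|]. apply Rmult_le_compat_l; lra.
Qed.

(** The value at [a] is the removable one, so [dq f a] is again holomorphic. It serves to divide out
    zeros, to lower polynomial growth and to remove singularities. *)
Definition dq (f : C -> C) (a z : C) : C :=
  if excluded_middle_informative (z = a) then C_derive f a else ((f z - f a) / (z - a))%C.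

Lemma dq_at f a : dq f a a = C_derive f a.
Proof. unfold dq. destruct excluded_middle_informative; congruence. Qed.

Lemma dq_ne f a z : z <> a -> dq f a z = ((f z - f a) / (z - a))%C.
Proof. unfold dq. destruct excluded_middle_informative; congruence. Qed.

Lemma Cminus_neq0 (z a : C) : z <> a -> (z - a)%C <> 0%C.
Proof. intros H E. apply H. now apply Ceq_minus. Qed.

Lemma dq_eq f a z : f z = (f a + (z - a) * dq f a z)%C.
Proof.
  destruct (classic (z = a)) as [->|H]; [ring|]. rewrite dq_ne by assumption. field. now apply Cminus_neq0.
Qed.

Lemma dq_cd_at f a : holn f a -> cd (dq f a) a (C_derive (C_derive f) a / 2)%C.
Proof.
  intros Hf eps He. destruct (taylor2 f a Hf eps He) as [d [Hd H]]. exists d. split; [assumption|]. intros w Hw.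
  rewrite dq_at. destruct (classic (w = a)) as [->|Hne].
  - rewrite dq_at, Cmod_self. match goal with |- Cmod ?x <= _ => replace x with (RtoC 0) by ring end. rewrite Cmod_0. lra.
  - rewrite dq_ne by assumption. specialize (H w Hw). pose proof (Cminus_neq0 w a Hne) as Hz.
    pose proof (proj1 (Cmod_gt_0 _) Hz) as Hp.
    match goal with |- Cmod ?x <= _ => replace x with ((f w - f a - C_derive f a * (w - a) - C_derive (C_derive f) a / 2 * ((w - a) * (w - a))) / (w - a))%C by (field; exact Hz) end.
    rewrite Cmod_div by assumption. apply Rle_div_l; [assumption|]. simpl in H. lra.
Qed.

Lemma dq_Cdiff f a z : holn f a -> Cdiff f z -> Cdiff (dq f a) z.
Proof.
  intros Ha Hz. destruct (classic (z = a)) as [->|Hne].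
  - eapply cd_Cdiff, dq_cd_at, Ha.
  - pose proof (Cminus_neq0 z a Hne) as Hz0. pose proof (proj1 (Cmod_gt_0 _) Hz0) as Hp.
    apply (Cdiff_loc (fun w => (f w - f a) / (w - a))%C _ z (Cmod (z - a)) Hp).
    + intros w Hw. symmetry. apply dq_ne. intros ->. rewrite Cmod_minus_sym in Hw. lra.
    + apply Cdiff_div; auto with cdiff.
Qed.

Lemma dq_entire f a : entire f -> entire (dq f a).
Proof. intros H z. apply dq_Cdiff; [now apply entire_holn|apply H]. Qed.

(** Compactness for a bounded set [D] that need not be closed: the local condition is asked at every
    point p of the plane, in particular on the boundary. The number d is both the radius and the
    parameter of [Q]. *)
Lemma compact_unif (D : C -> Prop) B (Q : C -> R -> Prop) :
  (forall z, D z -> Cmod z <= B) -> (forall z d d', 0 < d <= d' -> Q z d' -> Q z d) ->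
  (forall p, exists d, 0 < d /\ forall z, D z -> Cmod (z - p) < d -> Q z d) ->
  exists d, 0 < d /\ forall z, D z -> Q z d.
Proof.
  intros HB Hm H.
  set (dl := fun p => proj1_sig (constructive_indefinite_description _ (H p))).
  assert (Hdl : forall p, 0 < dl p /\ forall z, D z -> Cmod (z - p) < dl p -> Q z (dl p)).
  { intros p. unfold dl. destruct constructive_indefinite_description as [d Hd]. exact Hd. }
  (* Compactness works with squares; half the radius in each coordinate keeps the modulus below the
     full radius. *)
  assert (Hpos : forall x y, 0 < dl (x, y) / 2) by (intros x y; destruct (Hdl (x, y)); lra).
  destruct (compactness_value_2d (-B) B (-B) B (fun x y => mkposreal _ (Hpos x y))) as [d Hd].
  exists d. split; [apply cond_pos|]. intros z Hz. apply NNPP. intros HN.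
  pose proof (HB z Hz) as Hb. pose proof (re_le_Cmod z) as H1. pose proof (im_le_Cmod z) as H2.
  apply (Hd (Re z) (Im z)).
  - apply Rabs_le_between. lra.
  - apply Rabs_le_between. lra.
  - intros [u [v [_ [_ [Hu [Hv Hle]]]]]]. simpl in *. apply HN.
    destruct (Hdl (u, v)) as [Hp Hq]. apply (Hm z d (dl (u, v))).
    + split; [apply cond_pos|lra].
    + apply Hq; [assumption|]. eapply Rle_lt_trans; [apply Cmod_le_ReIm|].
      change (Re (z - (u, v))) with (Re z - u). change (Im (z - (u, v))) with (Im z - v). lra.
Qed.

Lemma bounded_disc f B : (forall z, ccont f z) -> exists M, forall z, Cmod z <= B -> Cmod (f z) <= M.
Proof.
  (* An upper bound is encoded as 1/d, so that smaller d means a weaker claim, as the monotonicity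
     condition requires. *)
  intros Hf. destruct (compact_unif (fun z => Cmod z <= B) B (fun z d => Cmod (f z) <= / d)) as [d [Hd H]].
  - auto.
  - intros z d d' Hd H. eapply Rle_trans; [exact H|]. apply Rinv_le_contravar; lra.
  - intros p. destruct (Hf p 1 Rlt_0_1) as [d [Hd H]]. pose proof (Cmod_ge_0 (f p)) as Hp.
    assert (Hi : 0 < / (Cmod (f p) + 1)) by (apply Rinv_0_lt_compat; lra).
    exists (Rmin d (/ (Cmod (f p) + 1))). split; [now apply Rmin_glb_lt|]. intros z _ Hz.
    assert (Hz1 := Rlt_le_trans _ _ _ Hz (Rmin_l _ _)). specialize (H z Hz1).
    pose proof (Cmod_rev (f z) (f p)).
    apply Rle_trans with (Cmod (f p) + 1); [lra|].
    apply Rle_trans with (/ / (Cmod (f p) + 1)); [rewrite Rinv_inv; lra|]. apply Rinv_le_contravar; [apply Rmin_glb_lt; assumption|apply Rmin_r].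
  - exists (/ d). exact H.
Qed.

(* Averaging over h, ih, -h, -ih kills the first and second order cross terms of |f|^2. *)
Lemma submean f p eps d : holn f p -> 0 < eps -> 0 < d ->
  exists q, Cmod (q - p) < d /\ Cmod (f p) ^ 2 + eps * Cmod p ^ 2 < Cmod (f q) ^ 2 + eps * Cmod q ^ 2.
Proof.
  intros Hf He Hd.
  set (al := f p). set (be := C_derive f p). set (ga := (C_derive (C_derive f) p / 2)%C).
  set (K := Cmod al + Cmod be + Cmod ga).
  pose proof (Cmod_ge_0 al) as Pa. pose proof (Cmod_ge_0 be) as Pb. pose proof (Cmod_ge_0 ga) as Pg.
  assert (HK : 0 <= K) by (unfold K; lra).
  set (eta := eps / (4 * (K + 1))). assert (Heta : 0 < eta) by (apply Rdiv_lt_0_compat; lra).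
  destruct (taylor2 f p Hf eta Heta) as [d1 [Hd1 H1]].
  set (r := Rmin (Rmin d d1) 1 / 2). assert (Hr0 : 0 < Rmin (Rmin d d1) 1) by (repeat apply Rmin_glb_lt; lra).
  assert (Hr : 0 < r /\ r < d /\ r < d1 /\ r < 1).
  { unfold r. pose proof (Rmin_l (Rmin d d1) 1). pose proof (Rmin_r (Rmin d d1) 1). pose proof (Rmin_l d d1). pose proof (Rmin_r d d1). lra. }
  apply NNPP. intros HN.
  assert (HP : forall h, Cmod h = r -> Cmod (f (p + h)%C) ^ 2 + eps * Cmod (p + h) ^ 2 <= Cmod al ^ 2 + eps * Cmod p ^ 2).
  { intros h Hh. apply Rnot_lt_le. intros Hlt. apply HN. exists (p + h)%C. split; [|assumption].
    replace (p + h - p)%C with h by ring. lra. }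
  set (m := fun h => (al + be * h + ga * (h * h))%C).
  assert (HT : forall h, Cmod h = r -> Cmod (m h) ^ 2 - 2 * K * eta * r ^ 2 <= Cmod (f (p + h)%C) ^ 2).
  { intros h Hh. specialize (H1 (p + h)%C). replace (p + h - p)%C with h in H1 by ring. specialize (H1 ltac:(lra)).
    fold al be ga in H1. rewrite Hh in H1.
    assert (Hm : Cmod (m h) <= K).
    { unfold m, K. eapply Rle_trans; [apply Cmod_triangle|]. eapply Rle_trans; [apply Rplus_le_compat_r, Cmod_triangle|].
      rewrite !Cmod_mult, Hh. assert (r * r <= 1) by nra. nra. }
    replace (f (p + h)%C - al - be * h - ga * (h * h))%C with (f (p + h)%C - m h)%C in H1 by (unfold m; ring).
    pose proof (Cmod_rev (m h) (f (p + h)%C)) as Hv. rewrite Cmod_minus_sym in Hv.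
    pose proof (Cmod_ge_0 (m h)). pose proof (Cmod_ge_0 (f (p + h)%C)). 
    set (A := Cmod (m h)) in *. set (B := Cmod (f (p + h)%C)) in *. set (e := eta * r ^ 2) in *.
    replace (2 * K * eta * r ^ 2) with (2 * K * e) by (unfold e; ring).
    assert (A - e <= B) by lra. assert (0 <= e) by (unfold e; nra).
    destruct (Rle_lt_dec e A); nra. }
  set (h := RtoC r).
  assert (E0 : Cmod h = r) by (unfold h; rewrite Cmod_R, Rabs_pos_eq; lra).
  assert (E1 : Cmod (Ci * h) = r) by (rewrite Cmod_mult, Cmod_Ci, E0; ring).
  assert (E2 : Cmod (- h) = r) by (now rewrite Cmod_opp).
  assert (E3 : Cmod (- (Ci * h)) = r) by (now rewrite Cmod_opp).
  pose proof (HP _ E0) as P0. pose proof (HP _ E1) as P1. pose proof (HP _ E2) as P2. pose proof (HP _ E3) as P3.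
  pose proof (HT _ E0) as T0. pose proof (HT _ E1) as T1. pose proof (HT _ E2) as T2. pose proof (HT _ E3) as T3.
  assert (S1 : Cmod (m h) ^ 2 + Cmod (m (Ci * h)%C) ^ 2 + Cmod (m (- h)%C) ^ 2 + Cmod (m (- (Ci * h))%C) ^ 2 >= 4 * Cmod al ^ 2).
  { assert (S1 : Cmod (m h) ^ 2 + Cmod (m (Ci * h)%C) ^ 2 + Cmod (m (- h)%C) ^ 2 + Cmod (m (- (Ci * h))%C) ^ 2 =
     4 * (Cmod al ^ 2 + Cmod be ^ 2 * r ^ 2 + Cmod ga ^ 2 * r ^ 4)).
    { rewrite !Cmod2_alt. unfold m, h, Re, Im, Ci, RtoC; simpl. ring. }
    assert (0 <= Cmod be ^ 2 * r ^ 2) by (apply Rmult_le_pos; apply pow2_ge_0).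
    assert (0 <= Cmod ga ^ 2 * r ^ 4) by (apply Rmult_le_pos; [apply pow2_ge_0|apply pow_le; lra]). lra. }
  assert (S2 : Cmod (p + h) ^ 2 + Cmod (p + Ci * h) ^ 2 + Cmod (p + - h) ^ 2 + Cmod (p + - (Ci * h)) ^ 2 = 4 * Cmod p ^ 2 + 4 * r ^ 2).
  { rewrite !Cmod2_alt. unfold h, Re, Im, Ci, RtoC; simpl. ring. }
  assert (Hfin : 2 * K * eta * r ^ 2 < eps * r ^ 2).
  { apply Rmult_lt_compat_r; [apply pow_lt; lra|]. unfold eta.
    replace (2 * K * (eps / (4 * (K + 1)))) with (eps * ((2 * K) / (4 * (K + 1)))) by (field; lra).
    rewrite <- (Rmult_1_r eps) at 2. apply Rmult_lt_compat_l; [assumption|]. apply Rlt_div_l; lra. }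
  nra.
Qed.

(** * Maximum principle, removable singularities, growth of entire functions *)

(** The boundary condition is a limsup, so f may be undefined or discontinuous on the boundary. The
    perturbation u = |f|^2 + eps |z|^2 has no local maximum by [submean]. Since eps B^2 <= gap/2, u
    stays below M^2 + 3/4 gap near the boundary, hence below its supremum. *)
Theorem max_principle (D : C -> Prop) f M B : openC D -> (forall z, D z -> Cmod z <= B) ->
  (forall z, D z -> Cdiff f z) -> 0 <= M ->
  (forall p, ~ D p -> (forall d, 0 < d -> exists z, D z /\ Cmod (z - p) < d) ->
     forall e, 0 < e -> exists d, 0 < d /\ forall z, D z -> Cmod (z - p) < d -> Cmod (f z) <= M + e) ->
  forall z, D z -> Cmod (f z) <= M.
Proof.
  intros Ho HB Hf HM Hb z0 Hz0. apply Rnot_lt_le. intros Hlt.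
  assert (HB0 : 0 <= B) by (eapply Rle_trans; [apply Cmod_ge_0|apply (HB z0 Hz0)]).
  set (gap := Cmod (f z0) ^ 2 - M ^ 2). assert (Hgap : 0 < gap) by (unfold gap; nra).
  set (eps := gap / (2 * (B ^ 2 + 1))). assert (HBp : 0 <= B ^ 2) by apply pow2_ge_0.
  assert (Heps : 0 < eps) by (apply Rdiv_lt_0_compat; lra).
  assert (HepsB : eps * B ^ 2 <= gap / 2).
  { unfold eps. replace (gap / (2 * (B ^ 2 + 1)) * B ^ 2) with (gap / 2 * (B ^ 2 / (B ^ 2 + 1))) by (field; lra).
    rewrite <- (Rmult_1_r (gap / 2)) at 2. apply Rmult_le_compat_l; [lra|]. apply Rle_div_l; lra. }
  set (u := fun z => Cmod (f z) ^ 2 + eps * Cmod z ^ 2).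
  assert (HuB : forall z, D z -> u z <= Cmod (f z) ^ 2 + eps * B ^ 2).
  { intros z Hz. unfold u. apply Rplus_le_compat_l, Rmult_le_compat_l; [lra|]. apply pow_incr. split; [apply Cmod_ge_0|auto]. }
  assert (Hu0 : Cmod (f z0) ^ 2 <= u z0) by (unfold u; pose proof (pow2_ge_0 (Cmod z0)); nra).
  assert (Hint : forall p, D p -> forall c, u p < c -> exists d, 0 < d /\ forall z, D z -> Cmod (z - p) < d -> u z <= c).
  { intros p Hp c Hc.
    assert (Hcont : continuous (fun x : R => x ^ 2) (Cmod (f p))).
    { apply (ex_derive_continuous (V := R_NormedModule)). auto_derive. trivial. }
    pose proof (Cmod_ge_0 (f p)) as Q1. pose proof (Cmod_ge_0 p) as Q2.
    set (k := Rmin 1 ((c - u p) / (2 * (2 * Cmod (f p) + 1) + 2 * eps * (2 * Cmod p + 1)))).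
    assert (Hk : 0 < k). { apply Rmin_glb_lt; [lra|]. apply Rdiv_lt_0_compat; nra. }
    destruct (Cdiff_ccont f p (Hf p Hp) k Hk) as [d [Hd H]].
    exists (Rmin d k). split; [now apply Rmin_glb_lt|]. intros z _ Hz.
    assert (Hz1 := Rlt_le_trans _ _ _ Hz (Rmin_l _ _)). assert (Hz2 := Rlt_le_trans _ _ _ Hz (Rmin_r _ _)).
    specialize (H z Hz1). pose proof (Cmod_rev (f z) (f p)). pose proof (Cmod_rev z p).
    assert (Hk1 : k <= 1) by apply Rmin_l.
    assert (Hk2 : k * (2 * (2 * Cmod (f p) + 1) + 2 * eps * (2 * Cmod p + 1)) <= c - u p).
    { apply Rle_div_r; [nra|]. apply Rmin_r. }
    pose proof (Cmod_ge_0 (f z)). pose proof (Cmod_ge_0 z).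
    assert (A1 : Cmod (f z) ^ 2 <= Cmod (f p) ^ 2 + k * (2 * Cmod (f p) + 1)).
    { apply Rle_trans with ((Cmod (f p) + k) ^ 2); [apply pow_incr; lra|]. simpl. nra. }
    assert (A2 : Cmod z ^ 2 <= Cmod p ^ 2 + k * (2 * Cmod p + 1)).
    { apply Rle_trans with ((Cmod p + k) ^ 2); [apply pow_incr; lra|]. simpl. nra. }
    assert (A3 : eps * Cmod z ^ 2 <= eps * (Cmod p ^ 2 + k * (2 * Cmod p + 1))) by (apply Rmult_le_compat_l; lra).
    assert (0 <= k * (2 * Cmod (f p) + 1)) by nra. assert (0 <= k * (eps * (2 * Cmod p + 1))) by (apply Rmult_le_pos; nra).
    unfold u in *. lra. }
  assert (Hbd : forall p, ~ D p -> exists d, 0 < d /\ forall z, D z -> Cmod (z - p) < d -> u z <= M ^ 2 + 3 / 4 * gap).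
  { intros p Hp. destruct (classic (forall d, 0 < d -> exists z, D z /\ Cmod (z - p) < d)) as [Hc|Hc].
    - set (e := Rmin 1 (gap / (4 * (2 * M + 1)))). assert (He : 0 < e) by (apply Rmin_glb_lt; [lra|apply Rdiv_lt_0_compat; lra]).
      destruct (Hb p Hp Hc e He) as [d [Hd H]]. exists d. split; [assumption|]. intros z Hz Hzp.
      eapply Rle_trans; [now apply HuB|]. specialize (H z Hz Hzp). pose proof (Cmod_ge_0 (f z)).
      assert (e <= 1) by apply Rmin_l. assert (e * (4 * (2 * M + 1)) <= gap) by (apply Rle_div_r; [lra|apply Rmin_r]).
      assert (Cmod (f z) ^ 2 <= (M + e) ^ 2) by (apply pow_incr; lra). nra.
    - apply not_all_ex_not in Hc. destruct Hc as [d Hc]. apply imply_to_and in Hc. destruct Hc as [Hd Hc].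
      exists d. split; [assumption|]. intros z Hz Hzp. exfalso. apply Hc. exists z. auto. }
  (* A first use of compactness shows that u is bounded, so its supremum S exists; the second one,
     below, improves the bound S to S - d2. *)
  destruct (compact_unif D B (fun z d => u z <= / d)) as [d1 [Hd1 H1]]; [exact HB| | |].
  { intros z d d' Hd H. eapply Rle_trans; [exact H|]. apply Rinv_le_contravar; lra. }
  { intros p.
    assert (Hp : exists c d, 0 < d /\ forall z, D z -> Cmod (z - p) < d -> u z <= c).
    { destruct (classic (D p)) as [Hp|Hp].
      - destruct (Hint p Hp (u p + 1)) as [d H]; [lra|]. eauto.
      - destruct (Hbd p Hp) as [d H]. eauto. }
    destruct Hp as [c [d [Hd H]]].
    assert (Hi : 0 < / (Rabs c + 1)) by (apply Rinv_0_lt_compat; pose proof (Rabs_pos c); lra).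
    exists (Rmin d (/ (Rabs c + 1))). split; [now apply Rmin_glb_lt|]. intros z Hz Hzp.
    specialize (H z Hz (Rlt_le_trans _ _ _ Hzp (Rmin_l _ _))).
    apply Rle_trans with (Rabs c + 1); [pose proof (Rle_abs c); lra|].
    apply Rle_trans with (/ / (Rabs c + 1)); [rewrite Rinv_inv; lra|]. apply Rinv_le_contravar; [apply Rmin_glb_lt; assumption|apply Rmin_r]. }
  destruct (completeness (fun x => exists z, D z /\ x = u z)) as [S [HS1 HS2]].
  { exists (/ d1). intros x [z [Hz ->]]. auto. }
  { exists (u z0). eauto. }
  assert (HSu : forall z, D z -> u z <= S) by (intros z Hz; apply HS1; eauto).
  assert (HSgap : M ^ 2 + gap <= S).
  { specialize (HSu z0 Hz0). unfold gap in *. lra. }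
  assert (Hstrict : forall p, D p -> u p < S).
  { intros p Hp. destruct (Ho p Hp) as [d [Hd H]]. destruct (submean f p eps d) as [q [Hq Hlt']]; auto.
    - now apply (holn_open D).
    - apply Rlt_le_trans with (u q); [exact Hlt'|]. auto. }
  destruct (compact_unif D B (fun z d => u z <= S - d)) as [d2 [Hd2 H2]]; [exact HB| | |].
  { intros z d d' Hd H. lra. }
  { intros p. destruct (classic (D p)) as [Hp|Hp].
    - pose proof (Hstrict p Hp). destruct (Hint p Hp ((u p + S) / 2)) as [d [Hd H']]; [lra|].
      exists (Rmin d ((S - u p) / 2)). split; [apply Rmin_glb_lt; lra|]. intros z Hz Hzp.
      specialize (H' z Hz (Rlt_le_trans _ _ _ Hzp (Rmin_l _ _))). pose proof (Rmin_r d ((S - u p) / 2)). lra.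
    - destruct (Hbd p Hp) as [d [Hd H']]. exists (Rmin d (gap / 4)). split; [apply Rmin_glb_lt; lra|]. intros z Hz Hzp.
      specialize (H' z Hz (Rlt_le_trans _ _ _ Hzp (Rmin_l _ _))). pose proof (Rmin_r d (gap / 4)). lra. }
  assert (S <= S - d2); [|lra].
  apply HS2. intros x [z [Hz ->]]. auto.
Qed.

Lemma ccont_bound f p e : ccont f p -> 0 < e -> exists d, 0 < d /\ forall z, Cmod (z - p) < d -> Cmod (f z) <= Cmod (f p) + e.
Proof.
  intros H He. destruct (H e He) as [d [Hd H']]. exists d. split; [assumption|]. intros z Hz. specialize (H' z Hz).
  pose proof (Cmod_rev (f z) (f p)). lra.
Qed.

Lemma closure_le (D : C -> Prop) (g : C -> R) p c : (forall z w, Rabs (g z - g w) <= Cmod (z - w)) ->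
  (forall z, D z -> g z <= c) -> (forall d, 0 < d -> exists z, D z /\ Cmod (z - p) < d) -> g p <= c.
Proof.
  intros Hg HD Hc. apply Rle_plus_epsilon. intros e He. destruct (Hc e He) as [z [Hz Hzp]].
  specialize (HD z Hz). specialize (Hg z p). apply Rabs_le_between in Hg. lra.
Qed.

Lemma Cmod_lip (z w : C) : Rabs (Cmod z - Cmod w) <= Cmod (z - w).
Proof. apply Rabs_le_between. pose proof (Cmod_rev z w). pose proof (Cmod_rev w z). rewrite Cmod_minus_sym in H0. lra. Qed.

Lemma max_principle_ball f a r M : 0 < r -> (forall z, Cmod (z - a) <= r -> Cdiff f z) -> 0 <= M ->
  (forall z, Cmod (z - a) = r -> Cmod (f z) <= M) -> forall z, Cmod (z - a) <= r -> Cmod (f z) <= M.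
Proof.
  intros Hr Hf HM Hb z Hz. destruct (Req_dec (Cmod (z - a)) r) as [E|E]; [auto|].
  apply (max_principle (fun z => Cmod (z - a) < r) f M (Cmod a + r)); auto.
  - apply openC_ball.
  - intros w Hw. pose proof (Cmod_rev w a). lra.
  - intros w Hw. apply Hf. lra.
  - intros p Hp Hc e He.
    assert (Hp2 : Cmod (p - a) <= r).
    { apply (closure_le (fun z => Cmod (z - a) < r) (fun z => Cmod (z - a))); auto.
      - intros x y. replace (x - y)%C with ((x - a) - (y - a))%C by ring. apply Cmod_lip.
      - intros x Hx. lra. }
    destruct (ccont_bound f p e (Cdiff_ccont f p (Hf p Hp2)) He) as [d [Hd H]].
    exists d. split; [assumption|]. intros w _ Hw. specialize (H w Hw). specialize (Hb p ltac:(lra)). lra.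
  - lra.
Qed.

Lemma deriv0_const f a r : (forall z, Cmod (z - a) < r -> cd f z 0) -> forall z, Cmod (z - a) < r -> f z = f a.
Proof.
  intros H z Hz. apply Ceq_minus, Cmod_eq_0, Rle_antisym; [|apply Cmod_ge_0].
  rewrite <- (Rmult_0_l (Cmod (z - a))). apply (mean_value_ineq f (fun _ => RtoC 0)).
  - intros s Hs. apply H. replace (a + s * (z - a) - a)%C with (s * (z - a))%C by ring.
    rewrite Cmod_mult, Cmod_R, Rabs_pos_eq by lra. pose proof (Cmod_ge_0 (z - a)). nra.
  - intros s _. rewrite Cmod_0. lra.
Qed.

Lemma liouville f M : entire f -> (forall z, Cmod (f z) <= M) -> forall z, f z = f 0%C.
Proof.
  intros Hf HM z. apply (deriv0_const f 0%C (Cmod z + 1)).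
  - intros w _. replace (RtoC 0) with (C_derive f w); [apply cd_C_derive, Hf|].
    apply Cmod_eq_0, Rle_antisym; [|apply Cmod_ge_0]. apply Rle_plus_epsilon. intros e He. rewrite Rplus_0_l.
    assert (HM0 : 0 <= M) by (eapply Rle_trans; [apply Cmod_ge_0|apply (HM 0%C)]).
    assert (Hp : 0 < (M + 1) / e) by (apply Rdiv_lt_0_compat; lra).
    eapply Rle_trans; [apply (cauchy_est f w ((M + 1) / e) M); auto|].
    apply Rle_div_l; [assumption|]. unfold Rdiv. rewrite Rmult_comm, Rmult_assoc, Rinv_l by lra. lra.
  - replace (z - 0)%C with z by ring. lra.
Qed.

Lemma dq_growth f M k : (forall z, 1 <= Cmod z -> Cmod (f z) <= M * Cmod z ^ S k) ->
  forall z, 1 <= Cmod z -> Cmod (dq f 0 z) <= (M + Cmod (f 0%C)) * Cmod z ^ k.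
Proof.
  intros H z Hz. assert (Hne : z <> 0%C) by (apply Cmod_pos_neq; lra).
  rewrite dq_ne by assumption. replace (z - 0)%C with z by ring. rewrite Cmod_div by assumption.
  apply Rle_div_l; [lra|]. specialize (H z Hz). pose proof (Cmod_triangle (f z) (- f 0)) as T. rewrite Cmod_opp in T.
  fold (Cminus (f z) (f 0%C)) in T. pose proof (pow_R1_Rle (Cmod z) k Hz) as Hk. pose proof (Cmod_ge_0 (f 0%C)).
  simpl in H. assert (1 <= Cmod z ^ k * Cmod z) by nra. nra.
Qed.

(** Dividing twice by z through [dq] lowers the exponent to 0, and Liouville's theorem makes the
    second quotient constant. *)
Lemma growth2_quadratic f M : entire f -> (forall z, 1 <= Cmod z -> Cmod (f z) <= M * Cmod z ^ 2) ->
  exists a0 a1 a2, forall z, f z = (a0 + a1 * z + a2 * (z * z))%C.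
Proof.
  intros Hf H. set (f1 := dq f 0). set (f2 := dq f1 0).
  assert (H1 : entire f1) by now apply dq_entire. assert (H2 : entire f2) by now apply dq_entire.
  pose proof (dq_growth f M 1 H) as G1. pose proof (dq_growth f1 _ 0 G1) as G2. simpl in G2.
  destruct (bounded_disc f2 1 (fun z => Cdiff_ccont _ _ (H2 z))) as [M2 HM2].
  set (M3 := Rmax M2 (M + Cmod (f 0%C) + Cmod (f1 0%C))).
  exists (f 0%C), (f1 0%C), (f2 0%C). intros z.
  assert (E : f2 z = f2 0%C).
  { apply (liouville f2 M3); [assumption|]. intros w. destruct (Rle_lt_dec 1 (Cmod w)) as [Hw|Hw].
    - eapply Rle_trans; [apply (G2 w Hw)|]. rewrite Rmult_1_r. apply Rmax_r.
    - eapply Rle_trans; [apply HM2; lra|]. apply Rmax_l. }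
  rewrite (dq_eq f 0 z). fold f1. rewrite (dq_eq f1 0 z). fold f2. rewrite E. ring.
Qed.

(* On |z| = R one has |z^2 - R^2| = 2 R |Im z|, so multiplying by (z^2 - R^2)^2 absorbs the blow-up at the real axis. *)
Lemma entire_growth_quadratic f M : entire f -> (forall z, Im z <> 0 -> Cmod (f z) <= M * (1 + Cmod z) ^ 4 / Im z ^ 2) ->
  exists a0 a1 a2, forall z, f z = (a0 + a1 * z + a2 * (z * z))%C.
Proof.
  intros Hf H.
  assert (HM : 0 <= M).
  { specialize (H Ci). pose proof (Cmod_ge_0 (f Ci)). rewrite Cmod_Ci in H. change (Im Ci) with 1 in H.
    specialize (H ltac:(lra)). replace (M * (1 + 1) ^ 4 / 1 ^ 2) with (16 * M) in H by field. lra. }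
  (* On the circle of radius R0 = 2|z| the product is at most 64 M R0^6 = 4096 M |z|^6. At z the
     added factor is at least 9 |z|^4, and 4096/9 < 512. *)
  apply (growth2_quadratic f (512 * M)); [assumption|]. intros z Hz. set (R0 := 2 * Cmod z).
  set (g := fun w => (f w * ((w * w - R0 * R0) * (w * w - R0 * R0)))%C).
  assert (Hg : Cmod (g z) <= 64 * M * R0 ^ 6).
  { apply (max_principle_ball g 0 R0).
    - unfold R0; lra.
    - intros w _. unfold g. auto 10 with cdiff.
    - apply Rmult_le_pos; [lra|]. apply pow_le. unfold R0; lra.
    - intros w Hw. replace (w - 0)%C with w in Hw by ring. unfold g. rewrite !Cmod_mult.
      assert (E : Cmod (w * w - R0 * R0) = 2 * R0 * Rabs (Im w)).
      { replace (w * w - R0 * R0)%C with (w * ((2 * Im w)%R * Ci))%C.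
        - rewrite !Cmod_mult, Cmod_R, Cmod_Ci, Hw, Rabs_mult, (Rabs_pos_eq 2) by lra. ring.
        - rewrite <- RtoC_mult. replace (R0 * R0) with (Re w ^ 2 + Im w ^ 2).
          + unfold Re, Im, Ci, RtoC. Cext.
          + rewrite <- Cmod2_alt, Hw. ring. }
      rewrite E. destruct (Req_dec (Im w) 0) as [E0|E0].
      + rewrite E0, Rabs_R0. rewrite !Rmult_0_r. apply Rmult_le_pos; [lra|]. apply pow_le. unfold R0; lra.
      + specialize (H w E0). rewrite Hw in H.
        apply Rle_div_r in H; [|apply pow2_gt_0; assumption].
        replace (Cmod (f w) * (2 * R0 * Rabs (Im w) * (2 * R0 * Rabs (Im w)))) with (4 * R0 ^ 2 * (Cmod (f w) * Im w ^ 2)).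
        2:{ rewrite <- (pow2_abs (Im w)). ring. }
        apply Rle_trans with (4 * R0 ^ 2 * (M * (2 * R0) ^ 4)).
        * apply Rmult_le_compat_l; [pose proof (pow2_ge_0 R0); lra|]. eapply Rle_trans; [exact H|].
          apply Rmult_le_compat_l; [assumption|]. apply pow_incr. unfold R0. lra.
        * right. ring.
    - replace (z - 0)%C with z by ring. unfold R0. lra. }
  unfold g in Hg. rewrite !Cmod_mult in Hg.
  assert (E : 3 * Cmod z ^ 2 <= Cmod (z * z - R0 * R0)).
  { pose proof (Cmod_rev (R0 * R0) (z * z)) as T. rewrite Cmod_minus_sym in T. rewrite <- RtoC_mult, Cmod_R, Cmod_mult, Rabs_pos_eq in T by (unfold R0; nra).
    rewrite RtoC_mult in T. unfold R0 in *. lra. }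
  replace (64 * M * R0 ^ 6) with (4096 * M * Cmod z ^ 6) in Hg by (unfold R0; ring).
  pose proof (Cmod_ge_0 (f z)) as P. set (x := Cmod z) in *. assert (Hx : 0 < x) by lra.
  assert (Hx2 : 0 < x ^ 2) by (apply pow_lt; lra).
  assert (E2 : 9 * x ^ 4 <= Cmod (z * z - R0 * R0) * Cmod (z * z - R0 * R0)) by nra.
  assert (E3 : Cmod (f z) * (9 * x ^ 4) <= 4096 * M * x ^ 6) by nra.
  apply Rmult_le_reg_r with (9 * x ^ 4); [apply Rmult_lt_0_compat; [lra|apply pow_lt; lra]|].
  eapply Rle_trans; [exact E3|]. replace (512 * M * x ^ 2 * (9 * x ^ 4)) with (4608 * (M * x ^ 6)) by ring.
  assert (0 <= M * x ^ 6) by (apply Rmult_le_pos; [assumption|apply pow_le; lra]). lra.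
Qed.

(** The function (z - a)^2 f is differentiable at a with value and derivative 0, so it can be
    divided twice by z - a within the holomorphic functions. *)
Lemma removable f a r M : 0 < r -> (forall z, z <> a -> Cmod (z - a) < r -> Cdiff f z /\ Cmod (f z) <= M) ->
  exists g, (forall z, Cmod (z - a) < r -> Cdiff g z) /\ (forall z, z <> a -> Cmod (z - a) < r -> g z = f z).
Proof.
  intros Hr Hf. set (k := fun z => ((z - a) * (z - a) * f z)%C).
  assert (Hka : cd k a 0).
  { intros e He. exists (Rmin r (e / (Rabs M + 1))). pose proof (Rabs_pos M). pose proof (Rle_abs M).
    split; [apply Rmin_glb_lt; [assumption|apply Rdiv_lt_0_compat; lra]|]. intros w Hw.
    assert (H1 := Rlt_le_trans _ _ _ Hw (Rmin_l _ _)). assert (H2 := Rlt_le_trans _ _ _ Hw (Rmin_r _ _)).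
    apply Rlt_div_r in H2; [|lra]. unfold k. pose proof (Cmod_ge_0 (w - a)).
    match goal with |- Cmod ?x <= _ => replace x with ((w - a) * (w - a) * f w)%C by ring end.
    destruct (classic (w = a)) as [->|Hne].
    - rewrite !Cmod_mult, Cmod_self. nra.
    - destruct (Hf w Hne H1) as [_ HM]. rewrite !Cmod_mult. pose proof (Cmod_ge_0 (f w)).
      assert (Cmod (w - a) * Cmod (f w) <= e) by nra. nra. }
  assert (Hk : forall z, Cmod (z - a) < r -> Cdiff k z).
  { intros z Hz. destruct (classic (z = a)) as [->|Hne]; [eapply cd_Cdiff, Hka|].
    destruct (Hf z Hne Hz) as [Hd _]. unfold k. auto with cdiff. }
  assert (Hkn : holn k a) by (exists r; auto).
  assert (Hd1 : forall z, Cmod (z - a) < r -> Cdiff (dq k a) z) by (intros; now apply dq_Cdiff; auto).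
  exists (dq (dq k a) a). split.
  - intros z Hz. apply dq_Cdiff; auto. exists r; auto.
  - intros z Hne Hz. rewrite dq_ne, dq_at, dq_ne, (C_derive_cd _ _ _ Hka) by assumption. unfold k.
    field. now apply Cminus_neq0.
Qed.

(** Off [T] the extension is f; at a point of [T] its value is read off a chosen local extension,
    which agrees with f on a punctured disc and therefore glues. *)
Lemma removable_set (T : C -> Prop) f :
  (forall z, ~ T z -> Cdiff f z) ->
  (forall z, ~ T z -> exists r, 0 < r /\ forall w, Cmod (w - z) < r -> ~ T w) ->
  (forall t, T t -> exists r M, 0 < r /\ forall z, z <> t -> Cmod (z - t) < r -> ~ T z /\ Cmod (f z) <= M) ->
  exists g, entire g /\ forall z, ~ T z -> g z = f z.
Proof.
  intros Hf Ho Ht.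
  assert (Hl : forall t, T t -> exists g r, 0 < r /\ (forall z, Cmod (z - t) < r -> Cdiff g z) /\
     forall z, z <> t -> Cmod (z - t) < r -> ~ T z /\ g z = f z).
  { intros t Tt. destruct (Ht t Tt) as [r [M [Hr H]]]. destruct (removable f t r M Hr) as [g [Hg1 Hg2]].
    - intros z H1 H2. destruct (H z H1 H2). auto.
    - exists g, r. repeat split; auto. apply H; assumption. }
  set (G := fun t => match excluded_middle_informative (T t) with
     | left Tt => proj1_sig (constructive_indefinite_description _ (Hl t Tt)) t | right _ => f t end).
  exists G.
  assert (HG1 : forall z, ~ T z -> G z = f z).
  { intros z Hz. unfold G. destruct excluded_middle_informative; [contradiction|reflexivity]. }
  split; [|assumption]. intros z. destruct (classic (T z)) as [Tz|Tz].
  - assert (exists g r, G z = g z /\ 0 < r /\ (forall w, Cmod (w - z) < r -> Cdiff g w) /\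
      forall w, w <> z -> Cmod (w - z) < r -> ~ T w /\ g w = f w) as [g [r [E [Hr [Hg1 Hg2]]]]].
    { unfold G. destruct excluded_middle_informative as [Tt|]; [|contradiction].
      destruct constructive_indefinite_description as [g [r Hgr]]. simpl. exists g, r. tauto. }
    apply (Cdiff_loc g G z r Hr).
    + intros w Hw. destruct (classic (w = z)) as [->|Hne]; [auto|].
      destruct (Hg2 w Hne Hw) as [Tw Ew]. rewrite HG1 by assumption. exact Ew.
    + apply Hg1. rewrite Cmod_self. assumption.
  - destruct (Ho z Tz) as [r [Hr H]]. apply (Cdiff_loc f G z r Hr).
    + intros w Hw. symmetry. auto.
    + auto.
Qed.

Lemma schwarz f : (forall z, Cmod z < 1 -> Cdiff f z) -> (forall z, Cmod z < 1 -> Cmod (f z) <= 1) -> f 0%C = 0%C ->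
  forall z, Cmod z < 1 -> Cmod (f z) <= Cmod z.
Proof.
  intros Hf HM H0 z Hz.
  assert (Hn : holn f 0%C). { exists 1. split; [lra|]. intros w Hw. apply Hf. now replace (w - 0)%C with w in Hw by ring. }
  assert (H : forall r, Cmod z < r < 1 -> Cmod (dq f 0 z) * r <= 1).
  { intros r Hr. pose proof (Cmod_ge_0 z). apply Rle_div_r; [lra|].
    assert (Hi : 0 < / r) by (apply Rinv_0_lt_compat; lra).
    apply (max_principle_ball (dq f 0) 0 r); try lra.
    - intros w Hw. replace (w - 0)%C with w in Hw by ring. apply dq_Cdiff; [assumption|]. apply Hf. lra.
    - intros w Hw. replace (w - 0)%C with w in Hw by ring. assert (Hw0 : w <> 0%C) by (apply Cmod_pos_neq; lra).
      rewrite dq_ne, H0 by assumption. replace ((f w - 0) / (w - 0))%C with (f w / w)%C by (f_equal; [|f_equal]; ring).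
      rewrite Cmod_div, Hw by assumption. unfold Rdiv. apply Rmult_le_compat_r; [lra|]. apply HM. lra.
    - replace (z - 0)%C with z by ring. lra. }
  rewrite (dq_eq f 0 z), H0. replace (0 + (z - 0) * dq f 0 z)%C with (z * dq f 0 z)%C by ring. rewrite Cmod_mult.
  rewrite <- (Rmult_1_r (Cmod z)) at 2. apply Rmult_le_compat_l; [apply Cmod_ge_0|].
  apply Rnot_lt_le. intros Hlt. set (d := Cmod (dq f 0 z)) in *.
  assert (Hi : / d < 1) by (rewrite <- Rinv_1; apply Rinv_lt_contravar; lra).
  assert (Hi0 : 0 < / d) by (apply Rinv_0_lt_compat; lra).
  set (m := Rmax (Cmod z) (/ d)). assert (Hm1 : m < 1) by (apply Rmax_lub_lt; assumption).
  assert (Hm2 : Cmod z <= m) by apply Rmax_l. assert (Hm3 : / d <= m) by apply Rmax_r.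
  specialize (H ((m + 1) / 2) ltac:(lra)).
  assert (1 < d * ((m + 1) / 2)); [|lra].
  apply Rmult_lt_reg_l with (/ d); [assumption|]. rewrite <- Rmult_assoc, Rinv_l by lra. lra.
Qed.

(** Harnack's inequality in the disc: the Mobius map w -> (w - l0) / (w + conj l0) sends the right
    half plane into the unit disc and l0 to 0, so Schwarz's lemma applies to the composition. *)
Lemma positive_real_growth (l : C -> C) : (forall z, Cmod z < 1 -> Cdiff l z) -> (forall z, Cmod z < 1 -> 0 < Re (l z)) ->
  forall z, Cmod z < 1 -> Cmod (l z) <= Cmod (l 0%C) * ((1 + Cmod z) / (1 - Cmod z)).
Proof.
  intros Hl Hp z Hz. set (l0 := l 0%C). assert (H0 : 0 < Re l0) by (apply Hp; rewrite Cmod_0; lra).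
  assert (Hne : forall w, Cmod w < 1 -> (l w + Cconj l0)%C <> 0%C).
  { intros w Hw E. apply (f_equal Re) in E. change (Re (l w + Cconj l0)) with (Re (l w) + Re (Cconj l0)) in E.
    rewrite re_conj in E. specialize (Hp w Hw). simpl in E. lra. }
  set (f := fun w => ((l w - l0) / (l w + Cconj l0))%C).
  assert (Hs : Cmod (f z) <= Cmod z).
  { apply schwarz; auto.
    - intros w Hw. unfold f. apply Cdiff_div; auto with cdiff.
    - intros w Hw. unfold f. rewrite Cmod_div by auto. pose proof (proj1 (Cmod_gt_0 _) (Hne w Hw)) as Hq.
      apply Rle_div_l; [assumption|]. rewrite Rmult_1_l. apply Rsqr_incr_0_var; [|lra]. unfold Rsqr.
      assert (E : Cmod (l w + Cconj l0) ^ 2 = Cmod (l w - l0) ^ 2 + 4 * Re (l w) * Re l0).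
      { rewrite !Cmod2_alt. unfold Re, Im, Cconj; simpl. ring. }
      specialize (Hp w Hw). nra.
    - unfold f. fold l0. replace (l0 - l0)%C with (RtoC 0) by ring. unfold Cdiv. ring. }
  assert (E : (l z * (1 - f z) = l0 + Cconj l0 * f z)%C) by (unfold f; field; auto).
  assert (H1 : Cmod (l z) * (1 - Cmod z) <= Cmod l0 * (1 + Cmod z)).
  { pose proof (Cmod_triangle l0 (Cconj l0 * f z)) as T. rewrite <- E, !Cmod_mult, Cmod_conj in T.
    pose proof (Cmod_rev 1 (f z)) as T2. rewrite Cmod_1 in T2. pose proof (Cmod_ge_0 (l z)). pose proof (Cmod_ge_0 l0). nra. }
  unfold Rdiv. rewrite <- Rmult_assoc. apply Rle_div_r; [lra|assumption].
Qed.

(** * Functions of bounded type and Phragmen-Lindelof *)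

Lemma Clog_exists (c : C) : c <> 0%C -> exists k, Cexp k = c /\ Rabs (Im k) <= PI.
Proof.
  intros Hc. pose proof (proj1 (Cmod_gt_0 c) Hc) as Hp. set (m := Cmod c) in *.
  set (x := Re c / m). set (y := Im c / m).
  assert (Hxy : x ^ 2 + y ^ 2 = 1).
  { unfold x, y. replace ((Re c / m) ^ 2 + (Im c / m) ^ 2) with ((Re c ^ 2 + Im c ^ 2) / m ^ 2) by (field; lra).
    rewrite <- Cmod2_alt. fold m. field. lra. }
  assert (Hx : -1 <= x <= 1) by (split; nra).
  pose proof (acos_bound x) as Hb. pose proof PI_RGT_0.
  assert (Hs : sin (acos x) = Rabs y).
  { rewrite sin_acos by assumption. rewrite <- sqrt_Rsqr_abs. f_equal. unfold Rsqr. lra. }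
  set (t := if Rle_dec 0 y then acos x else - acos x).
  assert (Ht : cos t = x /\ sin t = y /\ Rabs t <= PI).
  { unfold t. destruct Rle_dec as [Hy|Hy].
    - rewrite cos_acos by assumption. rewrite Hs. rewrite !Rabs_pos_eq by lra. lra.
    - rewrite cos_neg, sin_neg, cos_acos, Hs, Rabs_Ropp by assumption.
      rewrite (Rabs_pos_eq (acos x)) by lra. rewrite Rabs_left by lra. lra. }
  destruct Ht as [H1 [H2 H3]]. exists (ln m, t). split; [|exact H3].
  unfold Cexp. change (Re (ln m, t)) with (ln m). change (Im (ln m, t)) with t.
  rewrite exp_ln, H1, H2 by assumption. unfold x, y. destruct c as [c1 c2]. unfold Re, Im; simpl.
  f_equal; field; lra.
Qed.

(** The logarithm is a primitive of q'/q, normalised at 0. The bound on Im L(0) ensures that |1 - L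
    0| depends only on |q 0| in the growth estimate below. *)
Lemma log_disc q r : 0 < r -> (forall z, Cmod z < r -> Cdiff q z) -> (forall z, Cmod z < r -> q z <> 0%C) ->
  exists L, (forall z, Cmod z < r -> Cdiff L z) /\ (forall z, Cmod z < r -> Cexp (L z) = q z) /\ Rabs (Im (L 0%C)) <= PI.
Proof.
  intros Hr Hq H0. set (D := fun z : C => Cmod (z - 0) < r).
  assert (HD : forall z, Cmod z < r <-> D z) by (intros z; unfold D; replace (z - 0)%C with z by ring; tauto).
  assert (Ho : openC D) by apply openC_ball. assert (Hc : convC D) by apply convC_ball.
  assert (HqD : forall z, D z -> Cdiff q z) by (intros z Hz; apply Hq, (proj2 (HD _)), Hz).
  assert (H0D : forall z, D z -> q z <> 0%C) by (intros z Hz; apply H0, (proj2 (HD _)), Hz).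
  assert (HD0 : D 0%C) by (apply (proj1 (HD _)); rewrite Cmod_0; assumption).
  destruct (hol_primitive D (fun z => C_derive q z / q z)%C 0%C Hc Ho HD0) as [P HP].
  { intros z Hz. apply Cdiff_div; auto. apply Cdiff_C_derive. now apply (holn_open D). }
  destruct (Clog_exists (q 0%C) (H0D _ HD0)) as [k [Hk Hk2]].
  set (L := fun z => (P z - P 0 + k)%C). exists L. split; [|split].
  - intros z Hz. unfold L. apply (proj1 (HD _)) in Hz. pose proof (cd_Cdiff _ _ _ (HP z Hz)). auto with cdiff.
  - intros z Hz. apply (proj1 (HD _)) in Hz.
    assert (E : (q z * Cexp (- L z))%C = (q 0 * Cexp (- L 0))%C).
    { apply (deriv0_const (fun z => q z * Cexp (- L z))%C 0%C r); [|exact Hz].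
      intros w Hw. change (D w) in Hw.
      replace (RtoC 0) with (C_derive q w * Cexp (- L w) + q w * (Cexp (- L w) * (0 - (C_derive q w / q w - 0 + 0))))%C by (field; auto).
      apply (cd_mult q (fun x => Cexp (- L x))); [apply cd_C_derive; auto|]. apply (cd_comp Cexp (fun x => - L x)%C); [apply cd_Cexp|].
      apply (cd_ext (fun x => 0 - L x)%C); [intros x; ring|]. apply cd_minus; [apply cd_const|].
      unfold L. apply cd_plus; [|apply cd_const]. apply cd_minus; [auto|apply cd_const]. }
    replace (L 0%C) with k in E by (unfold L; ring). rewrite <- Hk in E.
    replace (Cexp k * Cexp (- k))%C with (RtoC 1) in E by (rewrite Cmult_comm; symmetry; apply Cexp_opp_l).
    transitivity ((q z * Cexp (- L z)) * Cexp (L z))%C; [rewrite E; ring|].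
    rewrite <- Cmult_assoc, Cexp_opp_l. ring.
  - unfold L. replace (P 0 - P 0 + k)%C with k by ring. assumption.
Qed.

Lemma blaschke_ident (a u : C) : Cmod (1 - Cconj a * u) ^ 2 - Cmod (u - a) ^ 2 = (1 - Cmod a ^ 2) * (1 - Cmod u ^ 2).
Proof. rewrite !Cmod2_alt. unfold Re, Im, Cconj; simpl. ring. Qed.

(** Q1 is Q divided by the Blaschke factor of a. That factor has modulus 1 on the unit circle by
    [blaschke_ident], so the bound 1 survives by the maximum principle. *)
Lemma blaschke_div Q a : (forall z, Cmod z < 1 -> Cdiff Q z) -> (forall z, Cmod z < 1 -> Cmod (Q z) <= 1) ->
  Cmod a < 1 -> Q a = 0%C ->
  let Q1 := fun u => (dq Q a u * (1 - Cconj a * u))%C in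
  (forall z, Cmod z < 1 -> Cdiff Q1 z) /\ (forall z, Cmod z < 1 -> Cmod (Q1 z) <= 1) /\
  forall u, (Q u * (1 - Cconj a * u) = (u - a) * Q1 u)%C.
Proof.
  intros Hd HM Ha H0 Q1.
  assert (Hn : holn Q a).
  { exists (1 - Cmod a). split; [lra|]. intros z Hz. apply Hd. pose proof (Cmod_rev z a). lra. }
  assert (H1 : forall z, Cmod z < 1 -> Cdiff Q1 z).
  { intros z Hz. unfold Q1. apply Cdiff_mult; [apply dq_Cdiff; auto|auto with cdiff]. }
  assert (H3 : forall u, (Q u * (1 - Cconj a * u) = (u - a) * Q1 u)%C).
  { intros u. unfold Q1. rewrite (dq_eq Q a u), H0. ring. }
  split; [assumption|]. split; [|assumption].
  apply (max_principle (fun z => Cmod z < 1) Q1 1 1); auto; try lra.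
  - intros z Hz. exists (1 - Cmod z). split; [lra|]. intros w Hw. pose proof (Cmod_rev w z). lra.
  - intros z Hz. lra.
  - intros p Hp Hcl e He.
    assert (Hp1 : Cmod p = 1).
    { apply Rle_antisym; [|lra]. apply (closure_le (fun z => Cmod z < 1) Cmod); auto using Cmod_lip. intros; lra. }
    assert (Hpa : p <> a) by (intros ->; lra).
    assert (Hk : Cdiff (fun u => (1 - Cconj a * u) / (u - a))%C p).
    { apply Cdiff_div; auto with cdiff. now apply Cminus_neq0. }
    destruct (ccont_bound _ _ e (Cdiff_ccont _ _ Hk) He) as [d [Hd0 H]].
    assert (E : Cmod ((1 - Cconj a * p) / (p - a)) = 1).
    { rewrite Cmod_div by (now apply Cminus_neq0). pose proof (blaschke_ident a p) as B. rewrite Hp1 in B.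
      pose proof (proj1 (Cmod_gt_0 _) (Cminus_neq0 p a Hpa)) as Hpos. pose proof (Cmod_ge_0 (1 - Cconj a * p)).
      assert (HE : Cmod (1 - Cconj a * p) = Cmod (p - a)) by nra. rewrite HE. field. lra. }
    rewrite E in H. exists (Rmin d (1 - Cmod a)). split; [apply Rmin_glb_lt; lra|]. intros z Hz Hzp.
    assert (Hz1 := Rlt_le_trans _ _ _ Hzp (Rmin_l _ _)). assert (Hz2 := Rlt_le_trans _ _ _ Hzp (Rmin_r _ _)).
    assert (Hza : z <> a). { intros ->. pose proof (Cmod_rev p a) as HR. rewrite Cmod_minus_sym in HR. lra. }
    specialize (H z Hz1).
    replace (Q1 z) with (Q z * ((1 - Cconj a * z) / (z - a)))%C.
    2:{ transitivity ((z - a) * Q1 z / (z - a))%C; [rewrite <- H3|]; field; now apply Cminus_neq0. }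
    rewrite Cmod_mult. specialize (HM z Hz). pose proof (Cmod_ge_0 (Q z)). pose proof (Cmod_ge_0 ((1 - Cconj a * z) / (z - a))). nra.
Qed.

(* G Q = P with |P|, |Q| <= 1: Blaschke factors remove the zeros of Q in |z| < r, there being finitely
   many by r^n < |Q(0)|; the zero-free case is Harnack's inequality for 1 - log Q. *)
Lemma quotient_growth_aux G r w q0 : (forall z, Cmod z < 1 -> Cdiff G z) -> Cmod w < r < 1 -> 0 < q0 ->
  forall n P Q, (forall z, Cmod z < 1 -> Cdiff P z) -> (forall z, Cmod z < 1 -> Cmod (P z) <= 1) ->
  (forall z, Cmod z < 1 -> Cdiff Q z) -> (forall z, Cmod z < 1 -> Cmod (Q z) <= 1) ->
  (forall z, Cmod z < 1 -> (G z * Q z)%C = P z) -> q0 <= Cmod (Q 0%C) -> r ^ n < Cmod (Q 0%C) ->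
  Cmod (G w) <= exp ((1 + PI - ln q0) * (2 * r / (r - Cmod w))).
Proof.
  intros HG Hr Hq0. pose proof (Cmod_ge_0 w) as Hw0.
  induction n; intros P Q HdP HP HdQ HQ E Hq Hn.
  (* For n = 0 the assumption reads 1 < |Q(0)|, against |Q| <= 1. *)
  - simpl in Hn. specialize (HQ 0%C). rewrite Cmod_0 in HQ. specialize (HQ ltac:(lra)). lra.
  - destruct (classic (exists a, Cmod a < r /\ Q a = 0%C)) as [[a [Ha Ha0]]|Hz].
    + assert (Ha1 : Cmod a < 1) by lra.
      assert (HPa : P a = 0%C) by (rewrite <- E, Ha0 by assumption; ring).
      destruct (blaschke_div Q a HdQ HQ Ha1 Ha0) as [Q1 [Q2 Q3]].
      destruct (blaschke_div P a HdP HP Ha1 HPa) as [P1 [P2 P3]].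
      set (QQ := fun u => (dq Q a u * (1 - Cconj a * u))%C) in *. set (PP := fun u => (dq P a u * (1 - Cconj a * u))%C) in *.
      change (forall u, (Q u * (1 - Cconj a * u) = (u - a) * QQ u)%C) in Q3.
      change (forall u, (P u * (1 - Cconj a * u) = (u - a) * PP u)%C) in P3.
      assert (HQ0 : 0 < Cmod (Q 0%C)) by lra.
      (* As |a| < r, removing the zero raises |Q(0)| by more than the factor 1/r: this both lowers n
         and preserves the lower bound q0. *)
      assert (EQ : Cmod (Q 0%C) = Cmod a * Cmod (QQ 0%C)).
      { rewrite <- Cmod_mult. rewrite <- (Cmod_opp (a * QQ 0%C)). f_equal. specialize (Q3 0%C).
        transitivity (Q 0%C * (1 - Cconj a * 0))%C; [ring|]. rewrite Q3. unfold QQ. ring. }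
      pose proof (Cmod_ge_0 a). pose proof (Cmod_ge_0 (QQ 0%C)). simpl in Hn.
      apply (IHn PP QQ); auto; try nra.
      (* The relation G QQ = PP follows off a by cancelling u - a, and at a by continuity. *)
      * intros z Hz.
        assert (Hoff : forall u, Cmod u < 1 -> u <> a -> (G u * QQ u - PP u)%C = 0%C).
        { intros u Hu Hua. pose proof (Cminus_neq0 u a Hua) as Hne.
          transitivity ((u - a) * (G u * QQ u - PP u) / (u - a))%C; [field; assumption|].
          replace ((u - a) * (G u * QQ u - PP u))%C with (G u * ((u - a) * QQ u) - (u - a) * PP u)%C by ring.
          rewrite <- Q3, <- P3, <- E by assumption. field. assumption. }
        destruct (classic (z = a)) as [->|Hne]; [|apply Ceq_minus; auto].
        apply Ceq_minus, NNPP. intros Hnz.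
        assert (Hc : ccont (fun u => G u * QQ u - PP u)%C a) by (apply Cdiff_ccont; auto with cdiff).
        destruct (ccont_neq0 _ a Hc Hnz) as [d [Hd H']].
        assert (Hm : 0 < Rmin d (1 - Cmod a)) by (apply Rmin_glb_lt; lra).
        set (e := Rmin d (1 - Cmod a) / 2). assert (He : 0 < e /\ e < d /\ e < 1 - Cmod a).
        { unfold e. pose proof (Rmin_l d (1 - Cmod a)). pose proof (Rmin_r d (1 - Cmod a)). lra. }
        specialize (H' (a + e)%C). replace (a + e - a)%C with (RtoC e) in H' by ring. rewrite Cmod_R, Rabs_pos_eq in H' by lra.
        specialize (H' ltac:(lra)). rewrite (Hoff (a + e)%C) in H'.
        -- rewrite Cmod_0 in H'. pose proof (Cmod_ge_0 (G a * QQ a - PP a)). lra.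
        -- pose proof (Cmod_triangle a e) as T. rewrite Cmod_R, Rabs_pos_eq in T by lra. lra.
        -- intros Ee. assert (Ee' : RtoC e = 0%C) by (transitivity (a + e - a)%C; [ring|rewrite Ee; ring]).
           apply RtoC_inj in Ee'. lra.
    + assert (Hnz : forall z, Cmod z < r -> Q z <> 0%C) by (intros z H1 H2; apply Hz; eauto).
      assert (Hr0 : 0 < r) by lra.
      destruct (log_disc Q r Hr0) as [L [HL1 [HL2 HL3]]]; auto.
      { intros z H1. apply HdQ. lra. }
      (* Since |Q| <= 1, Re L <= 0; the added 1 makes the real part strictly positive. *)
      set (l := fun u => (1 - L (r * u))%C).
      assert (Hru : forall u, Cmod u < 1 -> Cmod (r * u) < r). { intros u Hu. rewrite Cmod_mult, Cmod_R, Rabs_pos_eq by lra. nra. }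
      assert (HRe : forall z, Cmod z < r -> Cmod (Q z) = exp (Re (L z))). { intros z H1. rewrite <- HL2 by assumption. apply Cmod_Cexp. }
      assert (HReL : forall z, Cmod z < r -> Re (L z) <= 0).
      { intros z H1. specialize (HRe z H1). assert (H2 : exp (Re (L z)) <= 1) by (rewrite <- HRe; apply HQ; lra).
        rewrite <- exp_0 in H2. apply Rnot_lt_le. intros H3. apply exp_increasing in H3. lra. }
      set (wr := (w / r)%C). assert (Hrne : RtoC r <> 0%C) by (intros Er; apply RtoC_inj in Er; lra).
      assert (Hwr : Cmod wr = Cmod w / r) by (unfold wr; rewrite Cmod_div, Cmod_R, Rabs_pos_eq by (auto; lra); reflexivity).
      assert (Hwr1 : Cmod wr < 1) by (rewrite Hwr; apply Rlt_div_l; lra).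
      pose proof (positive_real_growth l) as HH.
      assert (HH' : Cmod (l wr) <= Cmod (l 0%C) * ((1 + Cmod wr) / (1 - Cmod wr))).
      { apply HH; auto.
        - intros u Hu. unfold l. apply Cdiff_minus; [apply Cdiff_const|]. apply (Cdiff_comp L (fun u => r * u)%C); [|auto with cdiff].
          apply HL1. auto.
        - intros u Hu. unfold l. change (Re (1 - L (r * u)%C)) with (1 - Re (L (r * u)%C)). specialize (HReL (r * u)%C (Hru u Hu)). lra. }
      replace (l wr) with (1 - L w)%C in HH' by (unfold l, wr; f_equal; f_equal; f_equal; field; assumption).
      replace (l 0%C) with (1 - L 0)%C in HH' by (unfold l; f_equal; f_equal; f_equal; ring).
      assert (HL0 : Cmod (1 - L 0) <= 1 + PI - ln q0).
      { eapply Rle_trans; [apply Cmod_le_ReIm|].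
        change (Re (1 - L 0)) with (1 - Re (L 0)). change (Im (1 - L 0)) with (0 - Im (L 0)).
        assert (H0r : Cmod 0 < r) by (rewrite Cmod_0; assumption).
        specialize (HReL 0%C H0r). rewrite Rabs_pos_eq by lra. rewrite Rminus_0_l, Rabs_Ropp.
        assert (ln q0 <= Re (L 0)); [|lra]. rewrite <- (ln_exp (Re (L 0))), <- HRe by assumption. apply ln_le; assumption. }
      assert (Hfr : (1 + Cmod wr) / (1 - Cmod wr) <= 2 * r / (r - Cmod w)).
      { rewrite Hwr. replace ((1 + Cmod w / r) / (1 - Cmod w / r)) with ((r + Cmod w) / (r - Cmod w)) by (field; lra).
        unfold Rdiv. apply Rmult_le_compat_r; [left; apply Rinv_0_lt_compat; lra|lra]. }
      assert (Hfr0 : 0 <= (1 + Cmod wr) / (1 - Cmod wr)) by (pose proof (Cmod_ge_0 wr); apply Rdiv_le_0_compat; lra).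
      assert (Hfin : - Re (L w) <= (1 + PI - ln q0) * (2 * r / (r - Cmod w))).
      { apply Rle_trans with (Cmod (1 - L w)).
        - eapply Rle_trans; [|apply re_le_Cmod]. change (Re (1 - L w)) with (1 - Re (L w)). pose proof (Rle_abs (1 - Re (L w))). lra.
        - eapply Rle_trans; [exact HH'|]. apply Rmult_le_compat; auto. apply Cmod_ge_0. }
      assert (HE : Cmod (G w) * exp (Re (L w)) <= 1).
      { rewrite <- HRe, <- Cmod_mult, E by lra. apply HP. lra. }
      apply Rle_trans with (exp (- Re (L w))).
      * rewrite exp_Ropp. apply Rmult_le_reg_r with (exp (Re (L w))); [apply exp_pos|].
        rewrite Rinv_l; [assumption|]. pose proof (exp_pos (Re (L w))). lra.
      * destruct (Rle_lt_or_eq_dec _ _ Hfin) as [Hlt|Heq]; [left; now apply exp_increasing|right; now rewrite Heq].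
Qed.

Lemma exp_le_mono x y : x <= y -> exp x <= exp y.
Proof. intros [H| ->]; [left; now apply exp_increasing|lra]. Qed.

(** The auxiliary bound does not depend on n, so r may be taken halfway between |w| and 1; this
    produces the singularity 1 / (1 - |w|) with a constant determined by |Q(0)|. *)
Lemma quotient_growth G P Q : (forall z, Cmod z < 1 -> Cdiff G z) ->
  (forall z, Cmod z < 1 -> Cdiff P z) -> (forall z, Cmod z < 1 -> Cmod (P z) <= 1) ->
  (forall z, Cmod z < 1 -> Cdiff Q z) -> (forall z, Cmod z < 1 -> Cmod (Q z) <= 1) ->
  (forall z, Cmod z < 1 -> (G z * Q z)%C = P z) -> Q 0%C <> 0%C ->
  exists c, 0 <= c /\ forall w, Cmod w < 1 -> Cmod (G w) <= exp (c / (1 - Cmod w)).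
Proof.
  intros HG HdP HP HdQ HQ E H0. pose proof (proj1 (Cmod_gt_0 _) H0) as Hq.
  set (q0 := Cmod (Q 0%C)) in *. pose proof PI_RGT_0.
  assert (Hq1 : q0 <= 1) by (apply HQ; rewrite Cmod_0; lra).
  assert (Hln : ln q0 <= 0) by (rewrite <- ln_1; apply ln_le; lra).
  exists (4 * (1 + PI - ln q0)). split; [lra|]. intros w Hw. pose proof (Cmod_ge_0 w) as Hw0.
  set (r := (1 + Cmod w) / 2). assert (Hr : Cmod w < r < 1) by (unfold r; lra).
  destruct (pow_lt_1_zero r ltac:(rewrite Rabs_pos_eq; lra) q0 Hq) as [n Hn]. specialize (Hn n (le_n n)).
  rewrite Rabs_pos_eq in Hn by (apply pow_le; lra).
  eapply Rle_trans; [apply (quotient_growth_aux G r w q0 HG Hr Hq n P Q); auto; unfold q0; lra|].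
  apply exp_le_mono. replace (4 * (1 + PI - ln q0) / (1 - Cmod w)) with ((1 + PI - ln q0) * (4 / (1 - Cmod w))) by (field; lra).
  apply Rmult_le_compat_l; [lra|]. replace (r - Cmod w) with ((1 - Cmod w) / 2) by (unfold r; field).
  replace (2 * r / ((1 - Cmod w) / 2)) with (4 * r / (1 - Cmod w)) by (field; lra).
  unfold Rdiv. apply Rmult_le_compat_r; [left; apply Rinv_0_lt_compat; lra|lra].
Qed.

(** The Mobius map of the unit disc onto the upper half plane with 0 -> z0; its inverse is (z - z0)
    / (z - conj z0). *)
Definition cayley_map (z0 w : C) : C := ((z0 - Cconj z0 * w) / (1 - w))%C.

Lemma cay_ne (w : C) : Cmod w < 1 -> (1 - w)%C <> 0%C.
Proof. intros H E. apply (Cminus_neq0 1 w); [|assumption]. intros <-. rewrite Cmod_1 in H. lra. Qed.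

Lemma cay_U z0 w : in_U z0 -> Cmod w < 1 -> in_U (cayley_map z0 w).
Proof.
  intros H0 Hw. unfold in_U, cayley_map. pose proof (cay_ne w Hw) as Hne. pose proof (proj1 (Cmod_gt_0 _) Hne) as Hp.
  replace (Im ((z0 - Cconj z0 * w) / (1 - w))) with (Im z0 * (1 - Cmod w ^ 2) / Cmod (1 - w) ^ 2).
  - apply Rdiv_lt_0_compat; [apply Rmult_lt_0_compat; [assumption|pose proof (Cmod_ge_0 w); nra]|apply pow_lt; assumption].
  - assert (Hd : (1 - fst w) ^ 2 + (snd w) ^ 2 <> 0).
    { intros E. assert (Cmod (1 - w) ^ 2 = 0) by (rewrite Cmod2_alt; unfold Re, Im; simpl; simpl in E; lra).
      pose proof (pow_lt _ 2 Hp). lra. }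
    rewrite !Cmod2_alt. unfold Cdiv, Cinv, Re, Im, Cconj; simpl. field. simpl in Hd. repeat split; intros E; apply Hd; lra.
Qed.

Lemma cay_inv z0 z : in_U z0 -> in_U z -> let w := ((z - z0) / (z - Cconj z0))%C in
  cayley_map z0 w = z /\ Cmod w < 1 /\ 1 - Cmod w ^ 2 = 4 * Im z * Im z0 / Cmod (z - Cconj z0) ^ 2.
Proof.
  intros H0 Hz w. unfold in_U in *.
  assert (Hne : (z - Cconj z0)%C <> 0%C).
  { intros E. apply (f_equal Im) in E. change (Im (z - Cconj z0)) with (Im z - Im (Cconj z0)) in E. rewrite im_conj in E. simpl in E. lra. }
  pose proof (proj1 (Cmod_gt_0 _) Hne) as Hp.
  assert (E : 1 - Cmod w ^ 2 = 4 * Im z * Im z0 / Cmod (z - Cconj z0) ^ 2).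
  { unfold w. rewrite Cmod_div by assumption.
    replace (1 - (Cmod (z - z0) / Cmod (z - Cconj z0)) ^ 2) with ((Cmod (z - Cconj z0) ^ 2 - Cmod (z - z0) ^ 2) / Cmod (z - Cconj z0) ^ 2) by (field; lra).
    f_equal. rewrite !Cmod2_alt. unfold Re, Im, Cconj; simpl. ring. }
  assert (Hlt : Cmod w < 1).
  { assert (0 < 4 * Im z * Im z0 / Cmod (z - Cconj z0) ^ 2) by (apply Rdiv_lt_0_compat; [nra|apply pow_lt; assumption]).
    pose proof (Cmod_ge_0 w). nra. }
  split; [|split; assumption].
  assert (Hd : (z0 - Cconj z0)%C <> 0%C).
  { intros Ed. apply (f_equal Im) in Ed. change (Im (z0 - Cconj z0)) with (Im z0 - Im (Cconj z0)) in Ed. rewrite im_conj in Ed. simpl in Ed. lra. }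
  unfold cayley_map, w. field. split; [assumption|].
  replace (z - Cconj z0 - (z - z0))%C with (z0 - Cconj z0)%C by ring. assumption.
Qed.

Lemma cay_Cdiff z0 w : Cmod w < 1 -> Cdiff (cayley_map z0) w.
Proof. intros H. unfold cayley_map. apply Cdiff_div; auto with cdiff. now apply cay_ne. Qed.

Lemma cay_dist z0 : in_U z0 -> exists c, 0 <= c /\ forall z, in_U z ->
  / (1 - Cmod ((z - z0) / (z - Cconj z0))) <= c * ((1 + Cmod z ^ 2) / Im z).
Proof.
  intros H0. unfold in_U in *. exists ((1 + Cmod z0 ^ 2) / Im z0). pose proof (pow2_ge_0 (Cmod z0)).
  split; [apply Rdiv_le_0_compat; lra|]. intros w Hw.
  destruct (cay_inv z0 w H0 Hw) as [_ [H1 H2]]. set (v := ((w - z0) / (w - Cconj z0))%C) in *.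
  assert (Hne : (w - Cconj z0)%C <> 0%C).
  { intros E. apply (f_equal Im) in E. change (Im (w - Cconj z0)) with (Im w - Im (Cconj z0)) in E. rewrite im_conj in E. simpl in E. lra. }
  pose proof (proj1 (Cmod_gt_0 _) Hne) as Hp.
  set (m := Cmod (w - Cconj z0)) in *. pose proof (Cmod_ge_0 v).
  assert (Hm : m <= Cmod w + Cmod z0).
  { unfold m. eapply Rle_trans; [apply Cmod_triangle|]. rewrite Cmod_opp, Cmod_conj. lra. }
  pose proof (Cmod_ge_0 w). pose proof (Cmod_ge_0 z0).
  assert (Hm2 : m ^ 2 <= 2 * ((1 + Cmod z0 ^ 2) * (1 + Cmod w ^ 2))).
  { apply Rle_trans with ((Cmod w + Cmod z0) ^ 2); [apply pow_incr; lra|].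
    pose proof (pow2_ge_0 (Cmod w - Cmod z0)). pose proof (pow2_ge_0 (Cmod w * Cmod z0)). nra. }
  assert (Hlow : 2 * Im w * Im z0 / m ^ 2 <= 1 - Cmod v).
  { replace (2 * Im w * Im z0 / m ^ 2) with ((1 - Cmod v ^ 2) / 2) by (rewrite H2; field; lra). nra. }
  assert (Hpos : 0 < 2 * Im w * Im z0 / m ^ 2) by (apply Rdiv_lt_0_compat; [nra|apply pow_lt; assumption]).
  apply Rle_trans with (/ (2 * Im w * Im z0 / m ^ 2)); [now apply Rinv_le_contravar|].
  replace (/ (2 * Im w * Im z0 / m ^ 2)) with (m ^ 2 * / (2 * Im w * Im z0)) by (field; lra).
  replace ((1 + Cmod z0 ^ 2) / Im z0 * ((1 + Cmod w ^ 2) / Im w)) with (2 * ((1 + Cmod z0 ^ 2) * (1 + Cmod w ^ 2)) * / (2 * Im w * Im z0)) by (field; lra).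
  apply Rmult_le_compat_r; [left; apply Rinv_0_lt_compat; nra|assumption].
Qed.

(** Transport to the disc by the Cayley map centred at a point where the denominator is nonzero,
    after scaling numerator and denominator by a common bound. [cay_dist] rewrites 1 / (1 - |w|) in
    the half plane. *)
Lemma bounded_type_growth F : bounded_type F ->
  exists c, 0 <= c /\ forall z, in_U z -> Cmod (F z) <= exp (c * ((1 + Cmod z ^ 2) / Im z)).
Proof.
  intros [HF [G [H [HG [HH [[MG HMG] [[MH HMH] [[z0 [Hz0 Hnz]] HE]]]]]]]].
  set (M := Rmax 1 (Rmax MG MH)). assert (HM : 1 <= M) by apply Rmax_l.
  assert (HM1 : MG <= M) by (eapply Rle_trans; [apply Rmax_l|apply Rmax_r]).
  assert (HM2 : MH <= M) by (eapply Rle_trans; [apply Rmax_r|apply Rmax_r]).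
  assert (HMne : RtoC M <> 0%C) by (intros E; apply RtoC_inj in E; lra).
  assert (Hb : forall g N, N <= M -> (forall z, in_U z -> Cmod (g z) <= N) -> forall w, Cmod w < 1 -> Cmod (g (cayley_map z0 w) / M)%C <= 1).
  { intros g N HN Hg w Hw. rewrite Cmod_div, Cmod_R, Rabs_pos_eq by (auto; lra). apply Rle_div_l; [lra|].
    specialize (Hg _ (cay_U z0 w Hz0 Hw)). lra. }
  assert (Hd : forall g, analytic_on_U g -> forall w, Cmod w < 1 -> Cdiff (fun w => g (cayley_map z0 w) / M)%C w).
  { intros g Hg w Hw. apply Cdiff_div; auto with cdiff. apply (Cdiff_comp g (cayley_map z0)); [now apply Hg, cay_U|now apply cay_Cdiff]. }
  destruct (quotient_growth (fun w => F (cayley_map z0 w)) (fun w => G (cayley_map z0 w) / M)%C (fun w => H (cayley_map z0 w) / M)%C) as [c [Hc HH']].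
  - intros w Hw. apply (Cdiff_comp F (cayley_map z0)); [now apply HF, cay_U|now apply cay_Cdiff].
  - apply Hd, HG.
  - now apply (Hb G MG).
  - apply Hd, HH.
  - now apply (Hb H MH).
  - intros w Hw. simpl. rewrite <- HE by (now apply cay_U). field. assumption.
  - assert (E : cayley_map z0 0 = z0) by (unfold cayley_map; field). rewrite E. intros E2. apply Hnz.
    transitivity (H z0 / M * M)%C; [field; assumption|]. rewrite E2. ring.
  - destruct (cay_dist z0 Hz0) as [c2 [Hc2 Hcd]].
    exists (c * c2). split; [nra|]. intros z Hz. destruct (cay_inv z0 z Hz0 Hz) as [E1 [E2 _]].
    set (w := ((z - z0) / (z - Cconj z0))%C) in *.
    specialize (HH' w E2). rewrite E1 in HH'. eapply Rle_trans; [exact HH'|]. apply exp_le_mono. unfold Rdiv at 1. rewrite Rmult_assoc.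
    apply Rmult_le_compat_l; [assumption|]. apply Hcd, Hz.
Qed.

(** * Phragmen-Lindelof estimates in discs, the half plane and the quadrant *)

Lemma max_principle_cont (D : C -> Prop) f M B : openC D -> (forall z, D z -> Cmod z <= B) ->
  (forall z, D z -> Cdiff f z) -> 0 <= M ->
  (forall p, ~ D p -> (forall d, 0 < d -> exists z, D z /\ Cmod (z - p) < d) ->
     exists g d, 0 < d /\ ccont g p /\ Cmod (g p) <= M /\ forall z, D z -> Cmod (z - p) < d -> Cmod (f z) <= Cmod (g z)) ->
  forall z, D z -> Cmod (f z) <= M.
Proof.
  intros Ho HB Hf HM Hb. apply (max_principle D f M B); auto.
  intros p Hp Hc e He. destruct (Hb p Hp Hc) as [g [d0 [Hd0 [Hg [Hgp Hfg]]]]].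
  destruct (ccont_bound g p e Hg He) as [d [Hd H]]. exists (Rmin d d0). split; [now apply Rmin_glb_lt|].
  intros z Hz Hzp. specialize (H z (Rlt_le_trans _ _ _ Hzp (Rmin_l _ _))). specialize (Hfg z Hz (Rlt_le_trans _ _ _ Hzp (Rmin_r _ _))). lra.
Qed.

(* Its real part is nonnegative in the upper half plane, zero on the diameter and R0^2/Im z on |z| = R0. *)
Definition barrier (R0 : R) (z : C) : C := (- Ci * (R0 * R0) * (/ (R0 - z) - / (R0 + z)))%C.
Definition barrier_re (R0 : R) (z : C) : R := Im z * R0 ^ 2 * (/ Cmod (R0 - z) ^ 2 + / Cmod (R0 + z) ^ 2).

Lemma Im_inv (z : C) : z <> 0%C -> Im (/ z) = - Im z / Cmod z ^ 2.
Proof. intros H. rewrite Cmod2_alt. unfold Cinv, Re, Im; simpl. reflexivity. Qed.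

Lemma bar_ne (R0 : R) z : 0 < Im z -> (R0 - z)%C <> 0%C /\ (R0 + z)%C <> 0%C.
Proof.
  intros H. split; intros E; apply (f_equal Im) in E; unfold Im in *; simpl in E; lra.
Qed.

Lemma barA_Re R0 z : 0 < Im z -> Re (barrier R0 z) = barrier_re R0 z.
Proof.
  intros H. destruct (bar_ne R0 z H) as [H1 H2]. unfold barrier, barrier_re.
  rewrite <- RtoC_mult.
  replace (Re (- Ci * (R0 * R0)%R * (/ (R0 - z) - / (R0 + z)))) with (R0 ^ 2 * (Im (/ (R0 - z)) - Im (/ (R0 + z)))).
  - rewrite !Im_inv by assumption. change (Im (R0 - z)) with (0 - Im z). replace (Im (R0 + z)) with (Im z) by (unfold Im; simpl; ring). 
    field. split; apply Rgt_not_eq, Cmod_gt_0; assumption.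
  - unfold Re, Im, Ci, RtoC. simpl. ring.
Qed.

Lemma barA_Cdiff R0 z : 0 < Im z -> Cdiff (barrier R0) z.
Proof.
  intros H. destruct (bar_ne R0 z H) as [H1 H2]. unfold barrier. apply Cdiff_mult; [auto with cdiff|].
  apply Cdiff_minus.
  - apply (Cdiff_ext (fun w => 1 / (R0 - w))%C); [intros w; unfold Cdiv; ring|]. auto with cdiff.
  - apply (Cdiff_ext (fun w => 1 / (R0 + w))%C); [intros w; unfold Cdiv; ring|]. auto with cdiff.
Qed.

Lemma barRe_pos R0 z : 0 < Im z -> 0 <= barrier_re R0 z.
Proof.
  intros H. destruct (bar_ne R0 z H) as [H1 H2]. unfold barrier_re.
  apply Rmult_le_pos; [apply Rmult_le_pos; [lra|apply pow2_ge_0]|].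
  apply Rplus_le_le_0_compat; left; apply Rinv_0_lt_compat, pow_lt, Cmod_gt_0; assumption.
Qed.

Lemma barRe_arc R0 z : 0 < R0 -> Cmod z = R0 -> 0 < Im z -> barrier_re R0 z = R0 ^ 2 / Im z.
Proof.
  intros HR Hz H. assert (E : Re z ^ 2 + Im z ^ 2 = R0 ^ 2) by (rewrite <- Cmod2_alt, Hz; reflexivity).
  assert (E1 : Cmod (R0 - z) ^ 2 = 2 * R0 * (R0 - Re z)).
  { rewrite Cmod2_alt. replace (Re (R0 - z)) with (R0 - Re z) by (unfold Re; simpl; ring). replace (Im (R0 - z)) with (- Im z) by (unfold Im; simpl; ring). nra. }
  assert (E2 : Cmod (R0 + z) ^ 2 = 2 * R0 * (R0 + Re z)).
  { rewrite Cmod2_alt. replace (Re (R0 + z)) with (R0 + Re z) by (unfold Re; simpl; ring). replace (Im (R0 + z)) with (Im z) by (unfold Im; simpl; ring). nra. }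
  unfold barrier_re. rewrite E1, E2.
  assert (Hx : -R0 < Re z < R0) by (split; nra).
  assert (E3 : Im z ^ 2 = (R0 - Re z) * (R0 + Re z)) by nra.
  apply Rmult_eq_reg_r with (Im z); [|lra].
  replace (Im z * R0 ^ 2 * (/ (2 * R0 * (R0 - Re z)) + / (2 * R0 * (R0 + Re z))) * Im z) with (Im z ^ 2 * R0 ^ 2 / ((R0 - Re z) * (R0 + Re z))) by (field; lra).
  rewrite E3. field. lra.
Qed.

Lemma barRe_le R0 z : 0 < Im z -> Cmod z < R0 -> barrier_re R0 z <= 2 * Im z * (R0 / (R0 - Cmod z)) ^ 2.
Proof.
  intros H Hz. pose proof (Cmod_ge_0 z) as P. unfold barrier_re.
  assert (HRm : Cmod R0 = R0) by (rewrite Cmod_R, Rabs_pos_eq; lra).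
  pose proof (Cmod_rev R0 z) as T1. rewrite HRm in T1.
  pose proof (Cmod_rev R0 (- z)) as T2. rewrite HRm, Cmod_opp in T2. replace (R0 - - z)%C with (R0 + z)%C in T2 by ring.
  assert (I : forall m, R0 - Cmod z <= m -> / m ^ 2 <= / (R0 - Cmod z) ^ 2).
  { intros m Hm. apply Rinv_le_contravar; [apply pow_lt; lra|apply pow_incr; lra]. }
  pose proof (I _ T1). pose proof (I _ T2).
  replace (2 * Im z * (R0 / (R0 - Cmod z)) ^ 2) with (Im z * R0 ^ 2 * (/ (R0 - Cmod z) ^ 2 + / (R0 - Cmod z) ^ 2)) by (field; lra).
  apply Rmult_le_compat_l; [apply Rmult_le_pos; [lra|apply pow2_ge_0]|lra].
Qed.

(** The factor exp (- c barrier) cancels the growth on the arc. The barrier is singular at the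
    corners R0 and -R0, but there the continuous majorant f itself is used, because Re barrier >= 0
    gives |h| <= |f|. *)
Lemma phragmen_half_disc R0 c K f : 0 < R0 -> 0 <= c -> 0 <= K ->
  (forall z, 0 <= Im z -> Cmod z <= R0 -> Cdiff f z) ->
  (forall z, Im z = 0 -> Cmod z <= R0 -> Cmod (f z) <= K) ->
  (forall z, Cmod z = R0 -> 0 < Im z -> Cmod (f z) <= K * exp (c * (R0 ^ 2 / Im z))) ->
  forall z, 0 < Im z -> Cmod z < R0 -> Cmod (f z) <= K * exp (c * barrier_re R0 z).
Proof.
  intros HR Hc HK Hd Hreal Harc z Hz HzR.
  set (h := fun w => (f w * Cexp (- (c * barrier R0 w)))%C).
  assert (Hmod : forall w, 0 < Im w -> Cmod (h w) = Cmod (f w) * exp (- (c * barrier_re R0 w))).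
  { intros w Hw. unfold h. rewrite Cmod_mult, Cmod_Cexp. do 2 f_equal.
    change (Re (- (c * barrier R0 w))) with (- Re (c * barrier R0 w)). rewrite re_scal_l, barA_Re by assumption. reflexivity. }
  assert (Hhd : forall w, 0 < Im w -> Cmod w <= R0 -> Cdiff h w).
  { intros w Hw1 Hw2. unfold h. apply Cdiff_mult; [apply Hd; lra|]. apply Cdiff_Cexp, Cdiff_opp, Cdiff_mult; [apply Cdiff_const|now apply barA_Cdiff]. }
  assert (Hmain : Cmod (h z) <= K).
  { apply (max_principle_cont (fun w => 0 < Im w /\ Cmod w < R0) h K R0); auto.
    - intros w [H1 H2]. exists (Rmin (Im w) (R0 - Cmod w)). split; [apply Rmin_glb_lt; lra|]. intros v Hv.
      assert (Hv1 := Rlt_le_trans _ _ _ Hv (Rmin_l _ _)). assert (Hv2 := Rlt_le_trans _ _ _ Hv (Rmin_r _ _)).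
      pose proof (im_le_Cmod (v - w)) as T. change (Im (v - w)) with (Im v - Im w) in T. apply Rabs_le_between in T.
      pose proof (Cmod_rev v w). split; lra.
    - intros w [_ H]. lra.
    - intros w [H1 H2]. apply Hhd; lra.
    - intros p Hp Hcl.
      assert (HpI : 0 <= Im p).
      { apply Ropp_le_cancel. rewrite Ropp_0.
        apply (closure_le (fun w => 0 < Im w /\ Cmod w < R0) (fun w => - Im w)); auto; [|intros w [H _]; lra].
        intros u v. replace (- Im u - - Im v) with (- Im (u - v)) by (unfold Im; simpl; ring). rewrite Rabs_Ropp. apply im_le_Cmod. }
      assert (HpR : Cmod p <= R0).
      { apply (closure_le (fun w => 0 < Im w /\ Cmod w < R0) Cmod); auto using Cmod_lip. intros w [_ H]; lra. }
      destruct (Req_dec (Im p) 0) as [E0|E0].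
      + exists f, 1. split; [lra|]. split; [now apply Cdiff_ccont, Hd|]. split; [now apply Hreal|].
        intros w [Hw _] _. rewrite Hmod by assumption. pose proof (Cmod_ge_0 (f w)).
        assert (exp (- (c * barrier_re R0 w)) <= 1).
        { rewrite <- exp_0. apply exp_le_mono. pose proof (barRe_pos R0 w Hw). assert (0 <= c * barrier_re R0 w) by (now apply Rmult_le_pos). lra. }
        nra.
      + assert (HpP : 0 < Im p) by lra. assert (HpE : Cmod p = R0). { apply Rle_antisym; [assumption|]. apply Rnot_lt_le. intros Hl. apply Hp. auto. }
        exists h, 1. split; [lra|]. split; [now apply Cdiff_ccont, Hhd|]. split; [|intros; lra].
        rewrite Hmod by assumption. rewrite barRe_arc by assumption. specialize (Harc p HpE HpP). rewrite exp_Ropp.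
        apply Rmult_le_reg_r with (exp (c * (R0 ^ 2 / Im p))); [apply exp_pos|]. rewrite Rmult_assoc, Rinv_l, Rmult_1_r; [assumption|].
        apply Rgt_not_eq, exp_pos. }
  rewrite Hmod in Hmain by assumption. rewrite exp_Ropp in Hmain.
  apply Rmult_le_reg_r with (/ exp (c * barrier_re R0 z)); [apply Rinv_0_lt_compat, exp_pos|].
  rewrite Rmult_assoc, Rinv_r, Rmult_1_r; [assumption|apply Rgt_not_eq, exp_pos].
Qed.

(** Squaring maps the quarter disc to a half disc of radius R0^2. On the arc Im (z^2) <= R0^2, so (c
    / R0) times the barrier has real part at least c R0, enough against exponential growth. *)
Lemma phragmen_quarter_disc R0 c K f : 0 < R0 -> 0 <= c -> 0 <= K ->
  (forall z, 0 <= Re z -> 0 <= Im z -> Cmod z <= R0 -> Cdiff f z) ->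
  (forall z, 0 <= Re z -> 0 <= Im z -> Re z = 0 \/ Im z = 0 -> Cmod (f z) <= K) ->
  (forall z, Cmod z = R0 -> 0 < Re z -> 0 < Im z -> Cmod (f z) <= K * exp (c * R0)) ->
  forall z, 0 < Re z -> 0 < Im z -> Cmod z < R0 -> Cmod (f z) <= K * exp (c / R0 * barrier_re (R0 ^ 2) (z * z)).
Proof.
  intros HR Hc HK Hd Hax Harc z Hzr Hz HzR.
  assert (HR2 : 0 < R0 ^ 2) by (now apply pow_lt).
  assert (Hc' : 0 <= c / R0) by (apply Rdiv_le_0_compat; lra).
  assert (Hsq : forall w, 0 < Re w -> 0 < Im w -> 0 < Im (w * w)).
  { intros w H1 H2. replace (Im (w * w)) with (2 * (Re w * Im w)) by (unfold Re, Im; simpl; ring). nra. }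
  set (h := fun w => (f w * Cexp (- ((c / R0)%R * barrier (R0 ^ 2) (w * w))))%C).
  assert (Hmod : forall w, 0 < Re w -> 0 < Im w -> Cmod (h w) = Cmod (f w) * exp (- (c / R0 * barrier_re (R0 ^ 2) (w * w)))).
  { intros w Hw Hw'. unfold h. rewrite Cmod_mult, Cmod_Cexp. do 2 f_equal.
    change (Re (- ((c / R0)%R * barrier (R0 ^ 2) (w * w)%C))) with (- Re ((c / R0)%R * barrier (R0 ^ 2) (w * w)%C)). rewrite re_scal_l, barA_Re by auto. reflexivity. }
  assert (Hhd : forall w, 0 < Re w -> 0 < Im w -> Cmod w <= R0 -> Cdiff h w).
  { intros w Hw0 Hw1 Hw2. unfold h. apply Cdiff_mult; [apply Hd; lra|]. apply Cdiff_Cexp, Cdiff_opp, Cdiff_mult; [apply Cdiff_const|].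
    apply (Cdiff_comp (barrier (R0 ^ 2)) (fun w => w * w)%C); [apply barA_Cdiff; auto|auto with cdiff]. }
  assert (Hmain : Cmod (h z) <= K).
  { apply (max_principle_cont (fun w => 0 < Re w /\ 0 < Im w /\ Cmod w < R0) h K R0); auto.
    - intros w [H0 [H1 H2]]. exists (Rmin (Re w) (Rmin (Im w) (R0 - Cmod w))). split; [repeat apply Rmin_glb_lt; lra|]. intros v Hv.
      assert (Hv0 := Rlt_le_trans _ _ _ Hv (Rmin_l _ _)). assert (Hv' := Rlt_le_trans _ _ _ Hv (Rmin_r _ _)).
      assert (Hv1 := Rlt_le_trans _ _ _ Hv' (Rmin_l _ _)). assert (Hv2 := Rlt_le_trans _ _ _ Hv' (Rmin_r _ _)).
      pose proof (im_le_Cmod (v - w)) as T. change (Im (v - w)) with (Im v - Im w) in T. apply Rabs_le_between in T.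
      pose proof (re_le_Cmod (v - w)) as T'. change (Re (v - w)) with (Re v - Re w) in T'. apply Rabs_le_between in T'.
      pose proof (Cmod_rev v w). repeat split; lra.
    - intros w [_ [_ H]]. lra.
    - intros w [H0 [H1 H2]]. apply Hhd; lra.
    - intros p Hp Hcl.
      assert (HpI : 0 <= Im p).
      { apply Ropp_le_cancel. rewrite Ropp_0.
        apply (closure_le (fun w => 0 < Re w /\ 0 < Im w /\ Cmod w < R0) (fun w => - Im w)); auto; [|intros w [_ [H _]]; lra].
        intros u v. replace (- Im u - - Im v) with (- Im (u - v)) by (unfold Im; simpl; ring). rewrite Rabs_Ropp. apply im_le_Cmod. }
      assert (HpRe : 0 <= Re p).
      { apply Ropp_le_cancel. rewrite Ropp_0.
        apply (closure_le (fun w => 0 < Re w /\ 0 < Im w /\ Cmod w < R0) (fun w => - Re w)); auto; [|intros w [H _]; lra].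
        intros u v. replace (- Re u - - Re v) with (- Re (u - v)) by (unfold Re; simpl; ring). rewrite Rabs_Ropp. apply re_le_Cmod. }
      assert (HpR : Cmod p <= R0).
      { apply (closure_le (fun w => 0 < Re w /\ 0 < Im w /\ Cmod w < R0) Cmod); auto using Cmod_lip. intros w [_ [_ H]]; lra. }
      destruct (classic (Re p = 0 \/ Im p = 0)) as [E0|E0].
      + exists f, 1. split; [lra|]. split; [now apply Cdiff_ccont, Hd|]. split; [now apply Hax|].
        intros w [Hw0 [Hw _]] _. rewrite Hmod by assumption. pose proof (Cmod_ge_0 (f w)).
        assert (exp (- (c / R0 * barrier_re (R0 ^ 2) (w * w))) <= 1).
        { rewrite <- exp_0. apply exp_le_mono. pose proof (barRe_pos (R0 ^ 2) (w * w) (Hsq w Hw0 Hw)).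
          assert (0 <= c / R0 * barrier_re (R0 ^ 2) (w * w)) by (now apply Rmult_le_pos). lra. }
        nra.
      + assert (HpP : 0 < Im p) by (destruct HpI; [assumption|exfalso; apply E0; auto]).
        assert (HpP' : 0 < Re p) by (destruct HpRe; [assumption|exfalso; apply E0; auto]).
        assert (HpE : Cmod p = R0). { apply Rle_antisym; [assumption|]. apply Rnot_lt_le. intros Hl. apply Hp. auto. }
        exists h, 1. split; [lra|]. split; [now apply Cdiff_ccont, Hhd|]. split; [|intros; lra].
        rewrite Hmod by assumption. rewrite barRe_arc; auto.
        2:{ rewrite Cmod_mult, HpE. ring. }
        specialize (Harc p HpE HpP' HpP). rewrite exp_Ropp.
        apply Rmult_le_reg_r with (exp (c / R0 * ((R0 ^ 2) ^ 2 / Im (p * p)))); [apply exp_pos|]. rewrite Rmult_assoc, Rinv_l, Rmult_1_r.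
        * eapply Rle_trans; [exact Harc|]. apply Rmult_le_compat_l; [assumption|]. apply exp_le_mono.
          specialize (Hsq p HpP' HpP). pose proof (im_le_Cmod (p * p)) as T. rewrite Cmod_mult, HpE, Rabs_pos_eq in T by lra.
          replace (c * R0) with (c / R0 * R0 ^ 2) by (field; lra). apply Rmult_le_compat_l; [assumption|].
          apply (Rle_div_r (R0 ^ 2) ((R0 ^ 2) ^ 2) (Im (p * p))); [lra|]. replace ((R0 ^ 2) ^ 2) with (R0 ^ 2 * (R0 * R0)) by ring.
          apply Rmult_le_compat_l; lra.
        * apply Rgt_not_eq, exp_pos. }
  rewrite Hmod in Hmain by assumption. rewrite exp_Ropp in Hmain.
  apply Rmult_le_reg_r with (/ exp (c / R0 * barrier_re (R0 ^ 2) (z * z))); [apply Rinv_0_lt_compat, exp_pos|].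
  rewrite Rmult_assoc, Rinv_r, Rmult_1_r; [assumption|apply Rgt_not_eq, exp_pos].
Qed.

Lemma le_exp_eps X Y : 0 <= Y -> (forall e, 0 < e -> X <= Y * exp e) -> X <= Y.
Proof.
  intros HY H. apply Rle_plus_epsilon. intros e He.
  assert (Hp : 0 < ln (1 + e / (Y + 1))).
  { rewrite <- ln_1. apply ln_increasing; [lra|]. assert (0 < e / (Y + 1)) by (apply Rdiv_lt_0_compat; lra). lra. }
  specialize (H _ Hp). assert (0 < e / (Y + 1)) by (apply Rdiv_lt_0_compat; lra). rewrite exp_ln in H by lra.
  assert (Y * (e / (Y + 1)) <= e).
  { replace (Y * (e / (Y + 1))) with (e * (Y / (Y + 1))) by (field; lra). rewrite <- (Rmult_1_r e) at 2.
    apply Rmult_le_compat_l; [lra|]. apply Rle_div_l; lra. }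
  lra.
Qed.

Lemma sq_ratio_bound a R0 : 0 <= a -> 4 * a <= R0 -> 0 < R0 -> (R0 / (R0 - a)) ^ 2 <= 1 + 6 * a / R0.
Proof.
  intros Ha HR H0. replace ((R0 / (R0 - a)) ^ 2) with (R0 ^ 2 / (R0 - a) ^ 2) by (field; lra).
  apply Rle_div_l; [apply pow_lt; lra|]. replace ((1 + 6 * a / R0) * (R0 - a) ^ 2) with ((R0 + 6 * a) * (R0 - a) ^ 2 / R0) by (field; lra).
  apply (proj1 (Rle_div_r _ _ R0 H0)). assert (0 <= a * R0 * (4 * R0 - 11 * a)) by (repeat apply Rmult_le_pos; lra). assert (0 <= a ^ 3) by (apply pow_le; lra). lra.
Qed.

(** On the arc R0^2 / Im z >= R0, so the ratio of M to K is absorbed by raising c to c + L / R0. As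
    R0 grows this correction vanishes and the barrier tends to 2 Im z, which leaves a bound free of
    M. *)
Lemma phragmen_half_plane f K M c R1 : 0 < K -> 0 <= c -> (forall z, 0 <= Im z -> Cdiff f z) ->
  (forall x : R, Cmod (f x) <= K) ->
  (forall z, R1 <= Cmod z -> 0 < Im z -> Cmod (f z) <= M * exp (c * (Cmod z ^ 2 / Im z))) ->
  forall z, 0 < Im z -> Cmod (f z) <= K * exp (2 * c * Im z).
Proof.
  intros HK Hc Hd Hreal Hg z Hz. pose proof (Cmod_ge_0 z) as Pz.
  set (L := Rmax 0 (ln (Rmax 1 M / K))). assert (HL : 0 <= L) by apply Rmax_l.
  assert (HM1 : 1 <= Rmax 1 M) by apply Rmax_l.
  assert (HML : M <= K * exp L).
  { apply Rle_trans with (Rmax 1 M); [apply Rmax_r|]. apply Rle_trans with (K * exp (ln (Rmax 1 M / K))).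
    - rewrite exp_ln by (apply Rdiv_lt_0_compat; lra). right. field. lra.
    - apply Rmult_le_compat_l; [lra|]. apply exp_le_mono, Rmax_r. }
  apply le_exp_eps; [apply Rmult_le_pos; [lra|left; apply exp_pos]|]. intros e He.
  set (Cst := 2 * Im z * (6 * Cmod z * c + L + 6 * Cmod z * L)).
  assert (HCst : 0 <= Cst) by (unfold Cst; repeat apply Rmult_le_pos; try lra; repeat apply Rplus_le_le_0_compat; repeat apply Rmult_le_pos; lra).
  set (R0 := Rmax (Rmax R1 (4 * Cmod z + 1)) (Cst / e + 1)).
  assert (H1 : R1 <= R0) by (eapply Rle_trans; [apply Rmax_l|apply Rmax_l]).
  assert (H2 : 4 * Cmod z + 1 <= R0) by (eapply Rle_trans; [apply Rmax_r|apply Rmax_l]).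
  assert (H3 : Cst / e + 1 <= R0) by apply Rmax_r.
  assert (HR0 : 1 <= R0) by lra.
  assert (HLR : 0 <= L / R0) by (apply Rdiv_le_0_compat; lra).
  eapply Rle_trans; [apply (phragmen_half_disc R0 (c + L / R0) K f); try lra|].
  - intros w Hw _. now apply Hd.
  - intros w Hw _. replace w with (RtoC (Re w)); [apply Hreal|]. destruct w as [w1 w2]. unfold RtoC. simpl in *. congruence.
  - intros w Hw1 Hw2. specialize (Hg w ltac:(lra) Hw2). eapply Rle_trans; [exact Hg|]. rewrite Hw1.
    apply Rle_trans with (K * exp L * exp (c * (R0 ^ 2 / Im w))); [apply Rmult_le_compat_r; [left; apply exp_pos|assumption]|].
    rewrite Rmult_assoc, <- exp_plus. apply Rmult_le_compat_l; [lra|]. apply exp_le_mono. rewrite Rmult_plus_distr_r.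
    assert (L <= L / R0 * (R0 ^ 2 / Im w)); [|lra].
    replace (L / R0 * (R0 ^ 2 / Im w)) with (L * (R0 / Im w)) by (field; lra). rewrite <- (Rmult_1_r L) at 1.
    apply Rmult_le_compat_l; [assumption|]. apply Rle_div_r; [assumption|]. pose proof (im_le_Cmod w) as T. rewrite Hw1, Rabs_pos_eq in T; lra.
  - rewrite Rmult_assoc, <- exp_plus. apply Rmult_le_compat_l; [lra|]. apply exp_le_mono.
    apply Rle_trans with ((c + L / R0) * (2 * Im z * (1 + 6 * Cmod z / R0))).
    + apply Rmult_le_compat_l; [lra|]. eapply Rle_trans; [apply barRe_le; lra|]. apply Rmult_le_compat_l; [lra|]. apply sq_ratio_bound; lra.
    + apply Rle_trans with (2 * c * Im z + Cst / R0).
      * unfold Cst. apply Rminus_le.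
        replace ((c + L / R0) * (2 * Im z * (1 + 6 * Cmod z / R0)) - (2 * c * Im z + 2 * Im z * (6 * Cmod z * c + L + 6 * Cmod z * L) / R0))
          with (2 * Im z * 6 * Cmod z * L / R0 * (/ R0 - 1)) by (field; lra).
        assert (/ R0 <= 1) by (rewrite <- Rinv_1; apply Rinv_le_contravar; lra).
        assert (0 <= 2 * Im z * 6 * Cmod z * L / R0) by (apply Rdiv_le_0_compat; [repeat apply Rmult_le_pos; lra|lra]). nra.
      * apply Rplus_le_compat_l. apply Rle_div_l; [lra|]. rewrite Rmult_comm. apply Rle_div_l; lra.
Qed.

Lemma phragmen_bounded f K M : 0 < K -> (forall z, 0 <= Im z -> Cdiff f z) -> (forall x : R, Cmod (f x) <= K) ->
  (forall z, 0 < Im z -> Cmod (f z) <= M) -> forall z, 0 <= Im z -> Cmod (f z) <= K.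
Proof.
  intros HK Hd Hr HM z Hz. destruct Hz as [Hz|Hz].
  - pose proof (phragmen_half_plane f K M 0 0 HK (Rle_refl 0) Hd Hr) as H. specialize (H ltac:(intros w _ Hw; rewrite Rmult_0_l, exp_0; rewrite Rmult_1_r; now apply HM) z Hz).
    rewrite Rmult_0_r, Rmult_0_l, exp_0 in H. lra.
  - replace z with (RtoC (Re z)); [apply Hr|]. destruct z as [w1 w2]. unfold RtoC. simpl in *. congruence.
Qed.

Lemma phragmen_quadrant f K c : 0 < K -> 0 <= c -> (forall z, 0 <= Re z -> 0 <= Im z -> Cdiff f z) ->
  (forall z, 0 <= Re z -> 0 <= Im z -> Re z = 0 \/ Im z = 0 -> Cmod (f z) <= K) ->
  (forall z, 0 < Re z -> 0 < Im z -> Cmod (f z) <= K * exp (c * Cmod z)) ->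
  forall z, 0 < Re z -> 0 < Im z -> Cmod (f z) <= K.
Proof.
  intros HK Hc Hd Hax Hg z Hzr Hz. apply le_exp_eps; [lra|]. intros e He. pose proof (Cmod_ge_0 z) as Pz.
  assert (Him : 0 < Im (z * z)). { replace (Im (z * z)) with (2 * (Re z * Im z)) by (unfold Re, Im; simpl; ring). nra. }
  set (Cst := c * (2 * Im (z * z) * 4)). assert (HCst : 0 <= Cst) by (unfold Cst; apply Rmult_le_pos; lra).
  set (R0 := Rmax (2 * Cmod z + 1) (Cst / e + 1)).
  assert (H2 : 2 * Cmod z + 1 <= R0) by apply Rmax_l. assert (H3 : Cst / e + 1 <= R0) by apply Rmax_r.
  assert (HR0 : 0 < R0) by lra.
  eapply Rle_trans; [apply (phragmen_quarter_disc R0 c K f); auto; try lra|].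
  - intros w Hw1 Hw2 Hw3. rewrite <- Hw1. now apply Hg.
  - apply Rmult_le_compat_l; [lra|]. apply exp_le_mono.
    assert (HzR : Cmod (z * z) <= R0 ^ 2 / 2) by (rewrite Cmod_mult; nra).
    assert (HR2 : 0 < R0 ^ 2) by (apply pow_lt; lra).
    apply Rle_trans with (c / R0 * (2 * Im (z * z) * 4)).
    + apply Rmult_le_compat_l; [apply Rdiv_le_0_compat; lra|]. eapply Rle_trans; [apply barRe_le; lra|].
      apply Rmult_le_compat_l; [lra|]. replace 4 with (2 ^ 2) by ring. apply pow_incr.
      split; [apply Rdiv_le_0_compat; lra|apply Rle_div_l; lra].
    + replace (c / R0 * (2 * Im (z * z) * 4)) with (Cst / R0) by (unfold Cst; field; lra).
      apply Rle_div_l; [lra|]. rewrite Rmult_comm. apply Rle_div_l; lra.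
Qed.

(** The factor exp (i eps z) damps f. The mean type bounds the product on the imaginary axis, the
    two quadrants then bound it in the half plane, and [phragmen_bounded] restores K before eps
    tends to 0. *)
Lemma mean_type_bounded f K c : 0 < K -> 0 <= c -> (forall z, 0 <= Im z -> Cdiff f z) -> (forall x : R, Cmod (f x) <= K) ->
  (forall z, 0 < Im z -> Cmod (f z) <= K * exp (c * Im z)) -> mean_type_le f 0 ->
  forall z, 0 <= Im z -> Cmod (f z) <= K.
Proof.
  intros HK Hc Hd Hr Hg Hmt z [Hz|Hz].
  2:{ replace z with (RtoC (Re z)); [apply Hr|]. destruct z as [w1 w2]. unfold RtoC. simpl in *. congruence. }
  apply le_exp_eps; [lra|]. intros e0 He0. set (eps := e0 / (Im z)). assert (Heps : 0 < eps) by (apply Rdiv_lt_0_compat; lra).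
  set (h := fun w => (f w * Cexp (eps * (Ci * w)))%C).
  assert (Hmod : forall w, Cmod (h w) = Cmod (f w) * exp (- (eps * Im w))).
  { intros w. unfold h. rewrite Cmod_mult, Cmod_Cexp. do 2 f_equal. unfold Re, Im, Ci, RtoC; simpl. ring. }
  assert (Hhd : forall w, 0 <= Im w -> Cdiff h w) by (intros w Hw; unfold h; auto 8 with cdiff).
  assert (Hhf : forall w, 0 <= Im w -> Cmod (h w) <= Cmod (f w)).
  { intros w Hw. rewrite Hmod. pose proof (Cmod_ge_0 (f w)). assert (exp (- (eps * Im w)) <= 1); [|nra].
    rewrite <- exp_0. apply exp_le_mono. assert (0 <= eps * Im w) by (apply Rmult_le_pos; lra). lra. }
  destruct (Hmt eps Heps) as [Y HY].
  set (M := Rmax K (Rmax 1 (K * exp (c * Rabs Y)))).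
  assert (HMK : K <= M) by apply Rmax_l. assert (HM1 : 1 <= M) by (eapply Rle_trans; [apply Rmax_l|apply Rmax_r]).
  assert (HMY : K * exp (c * Rabs Y) <= M) by (eapply Rle_trans; [apply Rmax_r|apply Rmax_r]).
  assert (Hi : forall w, Re w = 0 -> 0 <= Im w -> Cmod (h w) <= M).
  { intros w Hw1 Hw2. destruct (Rle_lt_dec Y (Im w)) as [Hl|Hl].
    - rewrite Hmod. specialize (HY _ Hl). replace (0, Im w) with w in HY by (destruct w; simpl in *; congruence).
      rewrite Rplus_0_l in HY. apply Rle_trans with (exp (eps * Im w) * exp (- (eps * Im w))).
      + apply Rmult_le_compat_r; [left; apply exp_pos|assumption].
      + rewrite <- exp_plus, Rplus_opp_r, exp_0. assumption.
    - eapply Rle_trans; [now apply Hhf|]. destruct Hw2 as [Hw2|Hw2].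
      + eapply Rle_trans; [now apply Hg|]. eapply Rle_trans; [|exact HMY]. apply Rmult_le_compat_l; [lra|]. apply exp_le_mono.
        apply Rmult_le_compat_l; [assumption|]. pose proof (Rle_abs Y). lra.
      + replace w with (RtoC (Re w)); [eapply Rle_trans; [apply Hr|assumption]|]. destruct w as [w1 w2]. unfold RtoC. simpl in *. congruence. }
  assert (Hx : forall w, Im w = 0 -> Cmod (h w) <= K).
  { intros w Hw. eapply Rle_trans; [apply Hhf; lra|]. replace w with (RtoC (Re w)); [apply Hr|]. destruct w as [w1 w2]. unfold RtoC. simpl in *. congruence. }
  assert (Hgr : forall w, 0 < Im w -> Cmod (h w) <= M * exp (c * Cmod w)).
  { intros w Hw. eapply Rle_trans; [apply Hhf; lra|]. eapply Rle_trans; [now apply Hg|].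
    apply Rmult_le_compat; [lra|left; apply exp_pos|assumption|]. apply exp_le_mono. apply Rmult_le_compat_l; [assumption|].
    pose proof (im_le_Cmod w). pose proof (Rle_abs (Im w)). lra. }
  assert (Hb : forall w, 0 < Im w -> Cmod (h w) <= M).
  { intros w Hw. destruct (Rtotal_order (Re w) 0) as [Hl|[He|Hl]].
    (* The reflection v -> - conj v carries the left quadrant to the right one and keeps the
       imaginary axis fixed. *)
    - set (k := fun v => Cstar h (- v)%C).
      assert (Ek : forall v, Cmod (k v) = Cmod (h (- Cconj v)%C)). { intros v. unfold k, Cstar. rewrite Cmod_conj. now rewrite Copp_conj. }
      assert (Ew : w = (- Cconj (- Cconj w))%C) by (rewrite Copp_conj, Cconj_conj; ring).
      rewrite Ew, <- Ek. apply (phragmen_quadrant k M c); auto; try lra.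
      + intros v Hv1 Hv2. unfold k. apply (Cdiff_comp (Cstar h) (fun v => - v)%C); [|auto with cdiff]. apply Cdiff_star, Hhd. unfold Im in *; simpl. lra.
      + intros v Hv1 Hv2 Hv3. rewrite Ek. destruct Hv3 as [Hv3|Hv3].
        * apply Hi; unfold Re, Im in *; simpl; lra.
        * eapply Rle_trans; [apply Hx|assumption]. unfold Im in *; simpl. lra.
      + intros v Hv1 Hv2. rewrite Ek. eapply Rle_trans; [apply Hgr; unfold Im in *; simpl; lra|]. rewrite Cmod_opp, Cmod_conj. lra.
      + unfold Re in *; simpl. lra.
      + unfold Im in *; simpl. lra.
    - apply Hi; lra.
    - apply (phragmen_quadrant h M c); auto; try lra.
      intros v Hv1 Hv2 [Hv3|Hv3]; [now apply Hi|]. eapply Rle_trans; [now apply Hx|assumption]. }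
  assert (Hfin : Cmod (h z) <= K).
  { apply (phragmen_bounded h K M); auto; lra. }
  rewrite Hmod in Hfin. replace (eps * Im z) with e0 in Hfin by (unfold eps; field; lra).
  rewrite exp_Ropp in Hfin. apply Rmult_le_reg_r with (/ exp e0); [apply Rinv_0_lt_compat, exp_pos|].
  rewrite Rmult_assoc, Rinv_r, Rmult_1_r; [assumption|apply Rgt_not_eq, exp_pos].
Qed.

(** * Finite sums and the passage from window integrals to point values *)

Definition rsum (l : list R) (f : R -> R) : R := fold_right (fun t acc => f t + acc) 0 l.

Lemma rsum_le l f g : (forall t, In t l -> f t <= g t) -> rsum l f <= rsum l g.
Proof.
  induction l as [|a l IH]; intros H; simpl; [lra|]. apply Rplus_le_compat; [apply H; now left|]. apply IH. intros t Ht. apply H. now right.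
Qed.
Lemma rsum_ext l f g : (forall t, In t l -> f t = g t) -> rsum l f = rsum l g.
Proof. intros H. apply Rle_antisym; apply rsum_le; intros t Ht; rewrite H by assumption; lra. Qed.
Lemma rsum_plus l f g : rsum l (fun t => f t + g t) = rsum l f + rsum l g.
Proof. induction l as [|a l IH]; simpl; [ring|]. rewrite IH. ring. Qed.
Lemma rsum_scal l c f : rsum l (fun t => c * f t) = c * rsum l f.
Proof. induction l as [|a l IH]; simpl; [ring|]. rewrite IH. ring. Qed.
Lemma rsum_ge0 l f : (forall t, In t l -> 0 <= f t) -> 0 <= rsum l f.
Proof. intros H. replace 0 with (rsum l (fun _ => 0)) by (induction l; simpl; [reflexivity|rewrite IHl; [ring|intros; apply H; now right]]). now apply rsum_le. Qed.
Lemma rsum_app l m f : rsum (l ++ m) f = rsum l f + rsum m f.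
Proof. induction l as [|a l IH]; simpl; [ring|]. rewrite IH. ring. Qed.

Lemma Csum_bound l f : Cmod (Csum_list l f) <= rsum l (fun t => Cmod (f t)).
Proof.
  induction l as [|a l IH]; simpl; [rewrite Cmod_0; lra|]. eapply Rle_trans; [apply Cmod_triangle|]. lra.
Qed.
Lemma Csum_ext l f g : (forall t, In t l -> f t = g t) -> Csum_list l f = Csum_list l g.
Proof. induction l as [|a l IH]; intros H; simpl; [reflexivity|]. rewrite H by (now left). rewrite IH; [reflexivity|]. intros; apply H; now right. Qed.
Lemma Csum_minus l f g : Csum_list l (fun t => f t - g t)%C = (Csum_list l f - Csum_list l g)%C.
Proof. induction l as [|a l IH]; simpl; [ring|]. rewrite IH. ring. Qed.
Lemma Csum_scal l c f : Csum_list l (fun t => c * f t)%C = (c * Csum_list l f)%C.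
Proof. induction l as [|a l IH]; simpl; [ring|]. rewrite IH. ring. Qed.
Lemma Csum_app l m f : Csum_list (l ++ m) f = (Csum_list l f + Csum_list m f)%C.
Proof. induction l as [|a l IH]; simpl; [ring|]. rewrite IH. ring. Qed.
Lemma Csum_RtoC l f : Csum_list l (fun t => RtoC (f t)) = RtoC (rsum l f).
Proof. induction l as [|a l IH]; simpl; [reflexivity|]. rewrite IH, RtoC_plus. reflexivity. Qed.

Lemma cd_Csum l (f : R -> C -> C) d z : (forall t, In t l -> cd (f t) z (d t)) ->
  cd (fun z => Csum_list l (fun t => f t z)) z (Csum_list l d).
Proof.
  induction l as [|a l IH]; intros H; simpl; [apply cd_const|].
  apply (cd_plus (f a)); [apply H; now left|]. apply IH. intros t Ht. apply H. now right.
Qed.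

(** With these phases frozen at one point, a weighted sum of moduli becomes the value of a
    holomorphic function at that point. *)
Definition cphase (z : C) : C := if excluded_middle_informative (z = 0%C) then 0%C else (Cconj z / Cmod z)%C.

Lemma cphase_spec z : (cphase z * z)%C = RtoC (Cmod z) /\ Cmod (cphase z) <= 1.
Proof.
  unfold cphase. destruct excluded_middle_informative as [->|Hz].
  - rewrite Cmod_0. split; [ring|lra].
  - pose proof (proj1 (Cmod_gt_0 _) Hz) as Hp. assert (RtoC (Cmod z) <> 0%C) by (intros E; apply RtoC_inj in E; lra). split.
    + replace (Cconj z / Cmod z * z)%C with (z * Cconj z / Cmod z)%C by (field; assumption).
      rewrite <- Cmod2_conj, RtoC_pow. field. assumption.
    + rewrite Cmod_div, Cmod_conj, Cmod_R, Rabs_pos_eq by (auto; lra). right. field. lra.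
Qed.

(* Only integrals of |g| over short windows are controlled on the real line. The sums V of differences
   of a primitive P of g, with phases chosen at a given point, are bounded there, hence in the half
   plane by Phragmen-Lindelof, and Cauchy's estimate returns to g. *)
Section Window.
Variables (g P : C -> C) (eta h K M c R1 T : R) (l : list R) (w : R -> R).
Hypothesis Heta : 0 < eta.
Hypothesis Hh : 0 < h.
Hypothesis HK : 0 < K.
Hypothesis HM : 0 <= M.
Hypothesis Hc : 0 <= c.
Hypothesis Hw : forall t, 0 <= w t.
Hypothesis HP : forall z, - eta < Im z -> cd P z (g z).
Hypothesis Hgrow : forall z (u : R), R1 <= Cmod z -> 0 < Im z -> Rabs u <= T -> Cmod (g (z + u)%C) <= M * exp (c * (Cmod z ^ 2 / Im z)).
Hypothesis HT : forall t, In t l -> Rabs t + h <= T.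
Hypothesis Hreal : forall x s, 0 <= s <= h -> rsum l (fun t => w t * Cmod (P (x + t + s)%R - P (x + t)%R)%C) <= K.

Lemma window_bound z : 0 < Im z ->
  rsum l (fun t => w t * Cmod (g (z + t)%C)) <= K * exp (4 * c * Im z) * (/ h + / Im z).
Proof.
  intros Hz.
  set (th := fun t : R => (w t * cphase (g (z + t)%C))%C).
  assert (Hth : forall t, Cmod (th t) <= w t).
  { intros t. unfold th. rewrite Cmod_mult, Cmod_R, Rabs_pos_eq by auto. destruct (cphase_spec (g (z + t)%C)) as [_ H].
    specialize (Hw t). nra. }
  set (V := fun (s : R) v => Csum_list l (fun t => th t * (P (v + t + s) - P (v + t)))%C).
  set (Psi := fun v => Csum_list l (fun t => th t * g (v + t))%C).
  assert (HVd : forall s v, 0 <= Im v -> cd (V s) v (Csum_list l (fun t => th t * (g (v + t + s) - g (v + t)))%C)).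
  { intros s v Hv. unfold V. apply (cd_Csum l (fun t v => th t * (P (v + t + s) - P (v + t)))%C).
    intros t _. apply cd_scal. apply (cd_minus (fun v => P (v + t + s)%C) (fun v => P (v + t)%C)).
    - replace (g (v + t + s)%C) with (g (v + t + s) * (1 + 0 + 0))%C by ring.
      apply (cd_comp P (fun v => v + t + s)%C).
      + apply HP. unfold Im in *; simpl. lra.
      + apply (cd_plus (fun v => v + t)%C); [|apply cd_const]. apply (cd_plus (fun v => v)); [apply cd_id|apply cd_const].
    - replace (g (v + t)%C) with (g (v + t) * (1 + 0))%C by ring.
      apply (cd_comp P (fun v => v + t)%C).
      + apply HP. unfold Im in *; simpl. lra.
      + apply (cd_plus (fun v => v)); [apply cd_id|apply cd_const]. }
  assert (HVr : forall s x, 0 <= s <= h -> Cmod (V s (RtoC x)) <= K).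
  { intros s x Hs. eapply Rle_trans; [apply Csum_bound|]. eapply Rle_trans; [|apply (Hreal x s Hs)].
    apply rsum_le. intros t _. rewrite Cmod_mult, !RtoC_plus. apply Rmult_le_compat_r; [apply Cmod_ge_0|apply Hth]. }
  assert (HVU : forall s v, 0 <= s <= h -> 0 < Im v -> Cmod (V s v) <= K * exp (2 * c * Im v)).
  { intros s v Hs Hv. apply (phragmen_half_plane (V s) K (rsum l w * h * M) c R1); auto.
    - intros u Hu. eapply cd_Cdiff, HVd, Hu.
    - intros u Hu1 Hu2. eapply Rle_trans; [apply Csum_bound|].
      replace (rsum l w * h * M * exp (c * (Cmod u ^ 2 / Im u))) with (h * M * exp (c * (Cmod u ^ 2 / Im u)) * rsum l w) by ring.
      rewrite <- rsum_scal. apply rsum_le. intros t Ht. rewrite Cmod_mult, (Rmult_comm _ (w t)).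
      apply Rmult_le_compat; try apply Cmod_ge_0; [apply Hth|].
      replace (h * M * exp (c * (Cmod u ^ 2 / Im u))) with (M * exp (c * (Cmod u ^ 2 / Im u)) * h) by ring.
      eapply Rle_trans; [apply (mean_value_ineq P g (u + t)%C (u + t + s)%C (M * exp (c * (Cmod u ^ 2 / Im u))))|].
      + intros x Hx. apply HP. unfold Im in *; simpl. lra.
      + intros x Hx. replace (u + t + x * (u + t + s - (u + t)))%C with (u + (t + x * s)%R)%C by (rewrite RtoC_plus, RtoC_mult; ring).
        apply Hgrow; auto. specialize (HT t Ht). eapply Rle_trans; [apply Rabs_triang|]. rewrite (Rabs_pos_eq (x * s)) by nra. nra.
      + replace (u + t + s - (u + t))%C with (RtoC s) by ring. rewrite Cmod_R, Rabs_pos_eq by lra.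
        apply Rmult_le_compat_l; [apply Rmult_le_pos; [assumption|left; apply exp_pos]|lra]. }
  (* The disc of radius Im z around z reaches the height 2 Im z, which doubles the exponent 2 c. *)
  set (B := K * exp (4 * c * Im z)).
  assert (HB : 0 < B) by (apply Rmult_lt_0_compat; [assumption|apply exp_pos]).
  (* The increment of [Psi] over a shift s is the derivative of V s, so Cauchy's estimate bounds
     it. *)
  assert (HPsi : forall s, 0 <= s <= h -> Cmod (Psi (z + s)%C - Psi z) <= B / Im z).
  { intros s Hs. replace (Psi (z + s)%C - Psi z)%C with (C_derive (V s) z).
    - apply cauchy_est; [assumption| |].
      + intros v Hv. eapply cd_Cdiff, HVd. pose proof (im_le_Cmod (v - z)) as H. change (Im (v - z)) with (Im v - Im z) in H.
        apply Rabs_le_between in H. lra.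
      + intros v Hv. pose proof (im_le_Cmod (v - z)) as H. change (Im (v - z)) with (Im v - Im z) in H. apply Rabs_le_between in H.
        eapply Rle_trans; [apply HVU; lra|]. unfold B. apply Rmult_le_compat_l; [lra|]. apply exp_le_mono. nra.
    - rewrite (C_derive_cd _ _ _ (HVd s z ltac:(lra))). unfold Psi. rewrite <- Csum_minus. apply Csum_ext. intros t _.
      replace (z + s + t)%C with (z + t + s)%C by ring. ring. }
  (* V h z is the integral of Psi (z + s) over 0 <= s <= h; replacing the integrand by Psi z costs
     at most h times the increment bound. *)
  assert (HI : Cmod (V h z - h * Psi z) <= B / Im z * h).
  { set (W := fun v => (Csum_list l (fun t => th t * (P (z + t + v) - P (z + t))) - v * Psi z)%C).
    replace (V h z - h * Psi z)%C with (W (RtoC h) - W 0)%C.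
    - replace (B / Im z * h) with (B / Im z * Cmod (h - 0)) by (replace (h - 0)%C with (RtoC h) by ring; rewrite Cmod_R, Rabs_pos_eq by lra; ring).
      apply (mean_value_ineq W (fun v => Psi (z + v) - Psi z)%C).
      + intros s Hs. replace (0 + s * (h - 0))%C with (RtoC (s * h)) by (rewrite RtoC_mult; ring). unfold W.
        replace (Psi (z + (s * h)%R) - Psi z)%C with (Csum_list l (fun t => th t * (g (z + t + (s * h)%R) - 0)) - (1 * Psi z + (s * h)%R * 0))%C.
        * apply cd_minus.
          -- apply (cd_Csum l (fun t v => th t * (P (z + t + v) - P (z + t)))%C). intros t _. apply cd_scal.
             apply (cd_minus (fun v => P (z + t + v)%C) (fun _ => P (z + t)%C)); [|apply cd_const].
             replace (g (z + t + (s * h)%R)%C) with (g (z + t + (s * h)%R) * (0 + 1))%C by ring.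
             apply (cd_comp P (fun v => z + t + v)%C); [apply HP; unfold Im in *; simpl; lra|].
             apply (cd_plus (fun _ => z + t)%C (fun v => v)); [apply cd_const|apply cd_id].
          -- apply (cd_mult (fun v => v) (fun _ => Psi z)); [apply cd_id|apply cd_const].
        * unfold Psi. replace (1 * Csum_list l (fun t => th t * g (z + t)) + (s * h)%R * 0)%C with (Csum_list l (fun t => th t * g (z + t)))%C by ring.
          f_equal. apply Csum_ext. intros t _. replace (z + (s * h)%R + t)%C with (z + t + (s * h)%R)%C by ring. ring.
      + intros s Hs. replace (0 + s * (h - 0))%C with (RtoC (s * h)) by (rewrite RtoC_mult; ring). apply HPsi. nra.
    - unfold W, V. replace (Csum_list l (fun t => th t * (P (z + t + 0) - P (z + t))))%C with (RtoC 0).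
      + ring.
      + symmetry. apply Cmod_eq_0, Rle_antisym; [|apply Cmod_ge_0]. eapply Rle_trans; [apply Csum_bound|].
        apply Rle_trans with (rsum l (fun t => 0 * 0)); [|rewrite (rsum_scal l 0 (fun _ => 0)); lra].
        apply rsum_le. intros t _. replace (z + t + 0)%C with (z + t)%C by ring. rewrite Cmod_mult, Cmod_self. lra. }
  assert (EP : Psi z = RtoC (rsum l (fun t => w t * Cmod (g (z + t)%C)))).
  { unfold Psi. rewrite <- Csum_RtoC. apply Csum_ext. intros t _. unfold th. rewrite <- Cmult_assoc.
    destruct (cphase_spec (g (z + t)%C)) as [-> _]. rewrite RtoC_mult. reflexivity. }
  set (X := rsum l (fun t => w t * Cmod (g (z + t)%C))) in *.
  assert (HX : 0 <= X) by (apply rsum_ge0; intros t _; apply Rmult_le_pos; [auto|apply Cmod_ge_0]).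
  assert (HVh : Cmod (V h z) <= B).
  { eapply Rle_trans; [apply HVU; lra|]. unfold B. apply Rmult_le_compat_l; [lra|]. apply exp_le_mono. nra. }
  assert (Hf : h * X <= B + B / Im z * h).
  { pose proof (Cmod_rev (h * Psi z) (V h z)) as T0. rewrite Cmod_minus_sym in T0.
    rewrite EP in *. rewrite <- RtoC_mult in T0 at 1. rewrite Cmod_R, Rabs_pos_eq in T0 by (apply Rmult_le_pos; lra). lra. }
  apply Rmult_le_reg_l with h; [assumption|]. eapply Rle_trans; [exact Hf|]. right. field. lra.
Qed.
End Window.

(* On |z| = r one has |z^2 - r^2| = 2 r |Im z|, which absorbs the singularity B / |Im z|. *)
Lemma circle_absorb f r B : 0 < r -> 0 <= B -> (forall z, Cmod z <= r -> Cdiff f z) ->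
  (forall z, Cmod z <= r -> Im z <> 0 -> Cmod (f z) <= B / Rabs (Im z)) ->
  forall z, Cmod z <= r / 2 -> Cmod (f z) <= 3 * B / r.
Proof.
  intros Hr HB Hd Hb z Hz. set (g := fun v => (f v * (v * v - r * r))%C).
  assert (Hg : Cmod (g z) <= 2 * r * B).
  { apply (max_principle_ball g 0 r); auto.
    - intros v Hv. replace (v - 0)%C with v in Hv by ring. unfold g. auto with cdiff.
    - nra.
    - intros v Hv. replace (v - 0)%C with v in Hv by ring. unfold g. rewrite Cmod_mult.
      assert (E : Cmod (v * v - r * r) = 2 * r * Rabs (Im v)).
      { replace (v * v - r * r)%C with (v * ((2 * Im v)%R * Ci))%C.
        - rewrite !Cmod_mult, Cmod_R, Cmod_Ci, Hv, Rabs_mult, (Rabs_pos_eq 2) by lra. ring.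
        - rewrite <- RtoC_mult. replace (r * r) with (Re v ^ 2 + Im v ^ 2).
          + unfold Re, Im, Ci, RtoC. Cext.
          + rewrite <- Cmod2_alt, Hv. ring. }
      rewrite E. destruct (Req_dec (Im v) 0) as [E0|E0].
      + rewrite E0, Rabs_R0. rewrite !Rmult_0_r. nra.
      + specialize (Hb v ltac:(lra) E0). pose proof (Rabs_pos_lt _ E0).
        apply (proj2 (Rle_div_r _ _ _ H)) in Hb. nra.
    - replace (z - 0)%C with z by ring. lra. }
  unfold g in Hg. rewrite Cmod_mult in Hg.
  assert (E : 3 / 4 * r ^ 2 <= Cmod (z * z - r * r)).
  { pose proof (Cmod_rev (r * r) (z * z)) as T0. rewrite Cmod_minus_sym, <- RtoC_mult, Cmod_R, Cmod_mult, Rabs_pos_eq in T0 by nra.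
    rewrite RtoC_mult in T0. pose proof (Cmod_ge_0 z). nra. }
  pose proof (Cmod_ge_0 (f z)). apply (proj1 (Rle_div_r _ _ r Hr)).
  apply Rmult_le_reg_r with (3 / 4 * r); [lra|].
  assert (Cmod (f z) * (3 / 4 * r ^ 2) <= 2 * r * B) by nra. nra.
Qed.

(** * Integrals over the real line, p-th powers and separated sets *)

Lemma RInt_Rscal (f : R -> R) (k a b : R) : ex_RInt f a b -> RInt (fun x => k * f x) a b = k * RInt f a b.
Proof. intros H. exact (RInt_scal (V := R_CompleteNormedModule) f a b k H). Qed.

Lemma RInt_Rplus (f g : R -> R) (a b : R) : ex_RInt f a b -> ex_RInt g a b ->
  RInt (fun x => f x + g x) a b = RInt f a b + RInt g a b.
Proof. intros H1 H2. exact (RInt_plus (V := R_CompleteNormedModule) f g a b H1 H2). Qed.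

Lemma RInt_Rconst (c a b : R) : RInt (fun _ => c) a b = (b - a) * c.
Proof. exact (RInt_const a b c). Qed.

Lemma ex_RInt_Rscal (f : R -> R) (k a b : R) : ex_RInt f a b -> ex_RInt (fun x => k * f x) a b.
Proof. intros H. exact (ex_RInt_scal (V := R_NormedModule) f a b k H). Qed.

Lemma ex_RInt_Rplus (f g : R -> R) (a b : R) : ex_RInt f a b -> ex_RInt g a b -> ex_RInt (fun x => f x + g x) a b.
Proof. intros H1 H2. exact (ex_RInt_plus (V := R_NormedModule) f g a b H1 H2). Qed.

Lemma RInt_RChasles (f : R -> R) (a b c : R) : (forall u v, ex_RInt f u v) -> RInt f a c = RInt f a b + RInt f b c.
Proof. intros H. symmetry. exact (RInt_Chasles (V := R_CompleteNormedModule) f a b c (H _ _) (H _ _)). Qed.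

Lemma RInt_mono_interval f a' a b b' : (forall x, 0 <= f x) -> (forall u v, ex_RInt f u v) -> a' <= a -> a <= b -> b <= b' ->
  RInt f a b <= RInt f a' b'.
Proof.
  intros Hp Hex H1 H2 H3.
  rewrite <- (RInt_Chasles f a' a b') by auto. rewrite <- (RInt_Chasles f a b b') by auto.
  pose proof (RInt_ge_0 f a' a H1 (Hex _ _) (fun x _ => Hp x)).
  pose proof (RInt_ge_0 f b b' H3 (Hex _ _) (fun x _ => Hp x)). unfold plus; simpl. lra.
Qed.

Lemma RInt_gen_bound f : (forall x, 0 <= f x) -> ex_RInt_gen f (Rbar_locally m_infty) (Rbar_locally p_infty) ->
  (forall a b, ex_RInt f a b) /\ exists K, forall a b, a <= b -> RInt f a b <= K.
Proof.
  intros Hp [l Hl].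
  assert (Hloc : locally l (fun y => Rabs (y - l) < 1)) by (exists (mkposreal 1 Rlt_0_1); intros y Hy; exact Hy).
  specialize (Hl _ Hloc). destruct Hl as [Q R0 [M1 HQ] [M2 HR] H]. simpl in H.
  assert (Hbig : forall a b, a < M1 -> M2 < b -> ex_RInt f a b /\ RInt f a b < l + 1).
  { intros a b Ha Hb. destruct (H a b (HQ a Ha) (HR b Hb)) as [y [Hy1 Hy2]]. split; [exists y; exact Hy1|].
    rewrite (is_RInt_unique _ _ _ _ Hy1). apply Rabs_lt_between in Hy2. lra. }
  assert (Hex : forall a b, ex_RInt f a b).
  { assert (Hle : forall a b, a <= b -> ex_RInt f a b).
    { intros a b Hab. set (u := Rmin a (M1 - 1)). set (v := Rmax b (M2 + 1)).
      assert (u <= a) by apply Rmin_l. assert (u < M1) by (pose proof (Rmin_r a (M1 - 1)); unfold u; lra).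
      assert (b <= v) by apply Rmax_l. assert (M2 < v) by (pose proof (Rmax_r b (M2 + 1)); unfold v; lra).
      destruct (Hbig u v) as [Hx _]; auto.
      apply (ex_RInt_Chasles_2 f u); [lra|]. apply (ex_RInt_Chasles_1 f u b v); [lra|assumption]. }
    intros a b. destruct (Rle_lt_dec a b); [auto|apply ex_RInt_swap; apply Hle; lra]. }
  split; [assumption|]. exists (l + 1). intros a b Hab.
  set (u := Rmin a (M1 - 1)). set (v := Rmax b (M2 + 1)).
  assert (u <= a) by apply Rmin_l. assert (u < M1) by (pose proof (Rmin_r a (M1 - 1)); unfold u; lra).
  assert (b <= v) by apply Rmax_l. assert (M2 < v) by (pose proof (Rmax_r b (M2 + 1)); unfold v; lra).
  destruct (Hbig u v) as [_ Hx]; auto. pose proof (RInt_mono_interval f u a b v Hp Hex ltac:(lra) Hab ltac:(lra)). lra.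
Qed.

Lemma RInt_gen_intro f K : (forall x, 0 <= f x) -> (forall a b, ex_RInt f a b) -> (forall a b, a <= b -> RInt f a b <= K) ->
  ex_RInt_gen f (Rbar_locally m_infty) (Rbar_locally p_infty).
Proof.
  intros Hp Hex HK.
  destruct (completeness (fun x => exists a b, a <= b /\ x = RInt f a b)) as [S [HS1 HS2]].
  { exists K. intros x [a [b [Hab ->]]]. auto. }
  { exists (RInt f 0 0), 0, 0. split; [lra|reflexivity]. }
  exists S. intros P [eps HP].
  assert (Hex2 : exists a b, a <= b /\ S - eps < RInt f a b).
  { apply NNPP. intros HN. assert (S <= S - eps); [|pose proof (cond_pos eps); lra].
    apply HS2. intros x [a [b [Hab ->]]]. apply Rnot_lt_le. intros Hlt. apply HN. eauto. }
  destruct Hex2 as [a0 [b0 [Hab Hlt]]].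
  apply (Filter_prod _ _ _ (fun a => a < a0) (fun b => b0 < b)).
  - exists a0. auto.
  - exists b0. auto.
  - intros a b Ha Hb. simpl. exists (RInt f a b). split; [apply (RInt_correct (V := R_CompleteNormedModule)), Hex|].
    apply HP. change (Rabs (RInt f a b - S) < eps).
    assert (RInt f a b <= S) by (apply HS1; exists a, b; split; [lra|reflexivity]).
    pose proof (RInt_mono_interval f a a0 b0 b Hp Hex ltac:(lra) Hab ltac:(lra)).
    apply Rabs_def1; pose proof (cond_pos eps); lra.
Qed.

Lemma powp_ge0 x p : 0 <= powp x p.
Proof. unfold powp. destruct Rlt_dec; [left; apply exp_pos|lra]. Qed.

Lemma powp_2 x : 0 <= x -> powp x 2 = x ^ 2.
Proof.
  intros Hx. unfold powp. destruct Rlt_dec as [H|H].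
  - rewrite <- (Rpower_pow 2 x H). reflexivity.
  - assert (x = 0) by lra. subst. ring.
Qed.

Lemma powp_ge_self x p : 1 <= p -> 0 <= x -> x <= 1 + powp x p.
Proof.
  intros Hp Hx. destruct (Rle_lt_dec x 1) as [H|H]; [pose proof (powp_ge0 x p); lra|].
  unfold powp. destruct Rlt_dec; [|lra]. apply Rle_trans with (Rpower x p); [|lra].
  rewrite <- (Rpower_1 x) at 1 by lra. apply Rle_Rpower; lra.
Qed.

(** The cases are separated by x = exp (- L / p). For exp L = 1 + |t| it bounds x / (1 + |t|) by M
    x^p plus (1 + |t|)^{-(1 + 1/p)}, a substitute for Holder's inequality whose second term is
    summable over separated points. *)
Lemma young_weight x p M L : 0 < p -> 0 <= x <= M -> x * exp (- L) <= M * powp x p + exp (- ((1 + / p) * L)).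
Proof.
  intros Hp Hx. pose proof (powp_ge0 x p) as Hpw.
  destruct (Rle_lt_dec x (exp (- (/ p * L)))) as [H|H].
  - assert (x * exp (- L) <= exp (- ((1 + / p) * L))).
    { replace (- ((1 + / p) * L)) with (- (/ p * L) + - L) by ring. rewrite exp_plus.
      apply Rmult_le_compat_r; [left; apply exp_pos|assumption]. }
    assert (0 <= M * powp x p) by (apply Rmult_le_pos; lra). lra.
  - assert (Hx0 : 0 < x) by (eapply Rlt_trans; [apply exp_pos|exact H]).
    assert (exp (- L) <= powp x p).
    { unfold powp. destruct Rlt_dec; [|lra]. unfold Rpower. apply exp_le_mono.
      assert (- (/ p * L) < ln x) by (rewrite <- (ln_exp (- (/ p * L))); apply ln_increasing; [apply exp_pos|assumption]).
      apply Rmult_le_reg_l with (/ p); [now apply Rinv_0_lt_compat|]. rewrite <- Rmult_assoc, Rinv_l by lra. lra. }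
    pose proof (exp_pos (- ((1 + / p) * L))). assert (x * exp (- L) <= M * powp x p) by (apply Rmult_le_compat; try lra; left; apply exp_pos). lra.
Qed.

(** If x > s then x = x^{1-p} x^p <= s^{1-p} x^p, as p >= 1. The free threshold s is later tuned to
    the length of the window. *)
Lemma powp_split x p s : 1 <= p -> 0 <= x -> 0 < s -> x <= s + Rpower s (1 - p) * powp x p.
Proof.
  intros Hp Hx Hs. pose proof (powp_ge0 x p) as Hpw. assert (Hr : 0 < Rpower s (1 - p)) by apply exp_pos.
  destruct (Rle_lt_dec x s) as [H|H].
  - assert (0 <= Rpower s (1 - p) * powp x p) by (apply Rmult_le_pos; lra). lra.
  - assert (x <= Rpower s (1 - p) * powp x p); [|lra]. unfold powp. destruct Rlt_dec; [|lra].
    unfold Rpower. rewrite <- exp_plus. rewrite <- (exp_ln x) at 1 by lra. apply exp_le_mono.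
    assert (ln s <= ln x) by (apply ln_le; lra). nra.
Qed.

Definition separated (h : R) (l : list R) : Prop :=
  NoDup l /\ forall t t', In t l -> In t' l -> t <> t' -> h <= Rabs (t - t').

Lemma list_max (l : list R) : l <> nil -> exists m, In m l /\ forall t, In t l -> t <= m.
Proof.
  induction l as [|a l IH]; [congruence|]. intros _. destruct l as [|b l].
  - exists a. split; [now left|]. intros t [->|[]]. lra.
  - destruct IH as [m [Hm H]]; [congruence|]. destruct (Rle_lt_dec a m).
    + exists m. split; [now right|]. intros t [->|Ht]; auto.
    + exists a. split; [now left|]. intros t [->|Ht]; [lra|]. specialize (H t Ht). lra.
Qed.

(** The intervals [t, t + h] do not overlap, so the increments of a monotone function over them add
    up to at most its total increase. The induction removes the largest point m; the others lie
    below m - h. *)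
Lemma sep_sum (Om : R -> R) h A : 0 < h -> (forall x y, x <= y -> Om x <= Om y) ->
  forall n l B, length l = n -> separated h l -> (forall t, In t l -> A <= t <= B) -> A <= B + h ->
  rsum l (fun t => Om (t + h) - Om t) <= Om (B + h) - Om A.
Proof.
  intros Hh Hm. induction n; intros l B Hn [Hnd Hs] Hl HAB.
  - destruct l; [simpl|discriminate]. pose proof (Hm A (B + h) HAB). lra.
  - destruct (list_max l) as [m [Him Hmax]]; [destruct l; [discriminate|congruence]|].
    destruct (in_split _ _ Him) as [l1 [l2 E]]. subst l.
    rewrite rsum_app. simpl. pose proof (NoDup_remove _ _ _ Hnd) as [Hnd' Hni].
    assert (Hin : forall t, In t (l1 ++ l2) -> In t (l1 ++ m :: l2)).
    { intros t Ht. apply in_app_or in Ht. apply in_or_app. destruct Ht; [now left|right; now right]. }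
    assert (IH : rsum (l1 ++ l2) (fun t => Om (t + h) - Om t) <= Om ((m - h) + h) - Om A).
    { apply IHn.
      - rewrite length_app in *. simpl in Hn. lia.
      - split; [assumption|]. intros t t' Ht Ht'. apply Hs; auto.
      - intros t Ht. split; [apply Hl; auto|]. assert (t <> m) by (intros ->; contradiction).
        specialize (Hs t m (Hin t Ht) Him H). specialize (Hmax t (Hin t Ht)). rewrite Rabs_left1 in Hs by lra. lra.
      - destruct (Hl m Him). lra. }
    rewrite rsum_app in IH. replace (m - h + h) with m in IH by ring.
    destruct (Hl m Him) as [_ HmB]. pose proof (Hm (m + h) (B + h) ltac:(lra)). lra.
Qed.

Lemma list_bounded (l : list R) : exists A, 0 <= A /\ forall t, In t l -> - A <= t <= A.
Proof.
  induction l as [|a l [A [HA IH]]]; [exists 0; split; [lra|intros t []]|].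
  exists (Rmax A (Rabs a)). split; [eapply Rle_trans; [exact HA|apply Rmax_l]|]. intros t [<-|Ht].
  - apply Rabs_le_between. apply Rmax_r.
  - specialize (IH t Ht). pose proof (Rmax_l A (Rabs a)). lra.
Qed.

Lemma sep_sum_bound (Om : R -> R) C h l : 0 < h -> (forall x y, x <= y -> Om x <= Om y) ->
  (forall x y, Om y - Om x <= C) -> separated h l -> rsum l (fun t => Om (t + h) - Om t) <= C.
Proof.
  intros Hh Hm HC Hs. destruct (list_bounded l) as [A [HA Hl]].
  eapply Rle_trans; [apply (sep_sum Om h (- A) Hh Hm (length l) l A); auto; lra|apply HC].
Qed.

(** This is (1 + |t|)^{-(1 + k)}. *)
Definition wt (k t : R) : R := exp (- ((1 + k) * ln (1 + Rabs t))).

Lemma wt_pos k t : 0 < wt k t.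
Proof. apply exp_pos. Qed.

(** Mean value theorem for (1 + u)^{-k}. The intermediate point satisfies 1 + c <= 2 (1 + x) because
    h <= 1, and 2^{1 + k} <= 4. *)
Lemma neg_power_step k h x : 0 < k <= 1 -> 0 < h <= 1 -> 0 <= x ->
  k * h / 4 * wt k x <= exp (- (k * ln (1 + x))) - exp (- (k * ln (1 + (x + h)))).
Proof.
  intros Hk Hh Hx.
  destruct (MVT_gen (fun u => - exp (- (k * ln (1 + u)))) x (x + h) (fun u => exp (- (k * ln (1 + u))) * (k * / (1 + u)))) as [c [Hc E]].
  - intros u Hu. rewrite Rmin_left, Rmax_right in Hu by lra. auto_derive; [lra|]. field. lra.
  - intros u Hu. rewrite Rmin_left, Rmax_right in Hu by lra. apply continuity_pt_filterlim.
    apply (ex_derive_continuous (fun u => - exp (- (k * ln (1 + u))))) . auto_derive. lra.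
  - rewrite Rmin_left, Rmax_right in Hc by lra.
    replace (exp (- (k * ln (1 + x))) - exp (- (k * ln (1 + (x + h))))) with (exp (- (k * ln (1 + c))) * (k * / (1 + c)) * h) by lra.
    unfold wt. rewrite Rabs_pos_eq by assumption.
    replace (exp (- (k * ln (1 + c))) * (k * / (1 + c)) * h) with (k * h * exp (- ((1 + k) * ln (1 + c)))).
    2:{ replace (- ((1 + k) * ln (1 + c))) with (- (k * ln (1 + c)) + - ln (1 + c)) by ring. rewrite exp_plus, (exp_Ropp (ln _)), exp_ln by lra. ring. }
    unfold Rdiv. rewrite !Rmult_assoc. apply Rmult_le_compat_l; [lra|]. apply Rmult_le_compat_l; [lra|].
    apply Rle_trans with (exp (- ((1 + k) * ln 2)) * exp (- ((1 + k) * ln (1 + x)))).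
    + apply Rmult_le_compat_r; [left; apply exp_pos|]. rewrite exp_Ropp. apply Rinv_le_contravar; [apply exp_pos|].
      replace 4 with (exp (2 * ln 2)). 
      * apply exp_le_mono. apply Rmult_le_compat_r; [|lra]. rewrite <- ln_1. apply ln_le; lra.
      * replace (2 * ln 2) with (ln 2 + ln 2) by ring. rewrite exp_plus, exp_ln by lra. ring.
    + rewrite <- exp_plus. apply exp_le_mono.
      replace (- ((1 + k) * ln 2) + - ((1 + k) * ln (1 + x))) with (- ((1 + k) * (ln 2 + ln (1 + x)))) by ring.
      rewrite <- ln_mult by lra. apply Ropp_le_contravar, Rmult_le_compat_l; [lra|]. apply ln_le; lra.
Qed.

(** Each weight is dominated by the decrease of (1 + u)^{-k} over a step of length h, to the right
    for t >= 0 and reflected for t < 0. Both monotone functions increase by at most 1 in all, which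
    gives 2 * 4 / (k h). *)
Lemma wt_sum k h l : 0 < k <= 1 -> 0 < h <= 1 -> separated h l -> rsum l (wt k) <= 8 / (k * h).
Proof.
  intros Hk Hh Hs.
  set (N := fun x => exp (- (k * ln (1 + Rmax x 0)))).
  assert (HN : forall x y, x <= y -> N y <= N x).
  { intros x y Hxy. apply exp_le_mono. apply Ropp_le_contravar, Rmult_le_compat_l; [lra|].
    assert (Rmax x 0 <= Rmax y 0) by (apply Rmax_case; [apply Rle_trans with y; [assumption|apply Rmax_l]|apply Rmax_r]).
    apply ln_le; [|lra]. pose proof (Rmax_r x 0). lra. }
  assert (HN01 : forall x, 0 < N x <= 1).
  { intros x. split; [apply exp_pos|]. rewrite <- exp_0. apply exp_le_mono. pose proof (Rmax_r x 0).
    assert (0 <= ln (1 + Rmax x 0)) by (apply Rle_trans with (ln 1); [rewrite ln_1; lra|apply ln_le; lra]). assert (0 <= k * ln (1 + Rmax x 0)) by (apply Rmult_le_pos; lra). lra. }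
  set (O1 := fun x => - N x). set (O2 := fun x => N (- (x - h))).
  assert (S1 : rsum l (fun t => O1 (t + h) - O1 t) <= 1).
  { apply sep_sum_bound; auto; [lra| |].
    - intros x y Hxy. unfold O1. specialize (HN x y Hxy). lra.
    - intros x y. unfold O1. pose proof (HN01 x). pose proof (HN01 y). lra. }
  assert (S2 : rsum l (fun t => O2 (t + h) - O2 t) <= 1).
  { apply sep_sum_bound; auto; [lra| |].
    - intros x y Hxy. unfold O2. apply HN. lra.
    - intros x y. unfold O2. pose proof (HN01 (- (x - h))). pose proof (HN01 (- (y - h))). lra. }
  assert (Hpt : forall t, k * h / 4 * wt k t <= (O1 (t + h) - O1 t) + (O2 (t + h) - O2 t)).
  { intros t. unfold O1, O2. replace (- (t + h - h)) with (- t) by ring. replace (- (t - h)) with (- t + h) by ring.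
    destruct (Rle_lt_dec 0 t) as [Ht|Ht].
    - pose proof (neg_power_step k h t Hk Hh Ht). unfold N at 1 2. rewrite !Rmax_left by lra. pose proof (HN (- t) (- t + h) ltac:(lra)). lra.
    - pose proof (neg_power_step k h (- t) Hk Hh ltac:(lra)) as H. assert (E : wt k (- t) = wt k t) by (unfold wt; rewrite Rabs_Ropp; reflexivity). rewrite E in H.
      unfold N at 3 4. rewrite !Rmax_left by lra. pose proof (HN t (t + h) ltac:(lra)). lra. }
  assert (H : k * h / 4 * rsum l (wt k) <= 2).
  { rewrite <- rsum_scal. eapply Rle_trans; [apply rsum_le; intros t _; apply Hpt|]. rewrite rsum_plus. lra. }
  assert (0 < k * h) by (apply Rmult_lt_0_compat; lra).
  apply Rmult_le_reg_l with (k * h / 4); [lra|]. eapply Rle_trans; [exact H|]. right. field. lra.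
Qed.

Lemma Rcont_abs_RInt (P g : C -> C) (a b : R) : (forall x : R, cd P x (g x)) -> (forall x : R, ccont g x) -> a <= b ->
  ex_RInt (fun u : R => Cmod (g u)) a b /\ Cmod (P b - P a) <= RInt (fun u : R => Cmod (g u)) a b.
Proof.
  intros H1 H2 Hab.
  assert (Hr : forall s : R, rcont (fun u : R => g u) s).
  { intros s. apply (rcont_comp g (fun u => RtoC u)); [apply H2|apply rcont_RtoC]. }
  assert (Hex : ex_RInt (fun u : R => Cmod (g u)) a b).
  { apply (ex_RInt_continuous (V := R_CompleteNormedModule)). intros s _. now apply (rcont_Cmod (fun u : R => g u)). }
  split; [assumption|].
  assert (E : CI (fun s : R => g (0 + s * 1)%C * 1)%C a b = (P b - P a)%C).
  { rewrite (CI_FTC P g 0 1 a b).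
    - f_equal; [f_equal; ring|f_equal; f_equal; ring].
    - intros s _. replace (0 + s * 1)%C with (RtoC s) by ring. apply H1.
    - intros s _. replace (0 + s * 1)%C with (RtoC s) by ring. apply H2. }
  rewrite <- E. rewrite (CI_ext _ (fun s : R => g s)).
  - apply CI_le; auto. intros; lra.
  - intros s _. replace (0 + s * 1)%C with (RtoC s) by ring. ring.
Qed.

Lemma Cstar_star F : Cstar (Cstar F) = F.
Proof. apply functional_extensionality. intros z. unfold Cstar. now rewrite !Cconj_conj. Qed.

Lemma entire_star F : entire F -> entire (Cstar F).
Proof. intros H z. apply Cdiff_star, H. Qed.

Lemma Cconj_R (x : R) : Cconj x = x.
Proof. unfold Cconj, RtoC; simpl. f_equal. ring. Qed.

Lemma C_real_eq (z : C) : Im z = 0 -> z = RtoC (Re z).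
Proof. destruct z as [a b]. unfold RtoC; simpl. congruence. Qed.

Lemma convC_upper c : convC (fun z => c < Im z).
Proof.
  intros z w s Hz Hw Hs. replace (Im (z + s * (w - z))) with ((1 - s) * Im z + s * Im w) by (unfold Im; simpl; ring).
  destruct (Req_dec s 1) as [->|Hs1]; [lra|].
  assert (0 < (1 - s) * (Im z - c)) by (apply Rmult_lt_0_compat; lra).
  assert (0 <= s * (Im w - c)) by (apply Rmult_le_pos; lra). lra.
Qed.

Lemma openC_upper c : openC (fun z => c < Im z).
Proof.
  intros z Hz. exists (Im z - c). split; [lra|]. intros w Hw.
  pose proof (im_le_Cmod (w - z)) as H. change (Im (w - z)) with (Im w - Im z) in H. apply Rabs_le_between in H. lra.
Qed.

(** * Members of H^p(E^2) when Theta is bounded below in a strip *)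

Section Strip.
Variables (E : C -> C) (eta : R).
Hypothesis HE : entire E.
Hypothesis Heta : 0 < eta.
Hypothesis Hne : forall z, - eta < Im z -> E z <> 0%C.
Hypothesis Hth : forall z, 0 < Im z < eta -> Cmod (E z) / 4 <= Cmod (Cstar E z).

Definition qE (F : C -> C) (z : C) : C := (F z / Csq E z)%C.

Lemma Csq_ne z : - eta < Im z -> Csq E z <> 0%C.
Proof. intros H. unfold Csq. apply Cmult_neq_0; now apply Hne. Qed.

Lemma qE_Cdiff F z : entire F -> - eta < Im z -> Cdiff (qE F) z.
Proof.
  intros HF Hz. unfold qE. apply Cdiff_div; [apply HF| |now apply Csq_ne]. unfold Csq. apply Cdiff_mult; apply HE.
Qed.

(** |E (conj z)| is |Cstar E z|, at least |E z| / 4 in the strip; the denominator being a square,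
    the loss is 16. It turns bounds above the axis for [Cstar F] into bounds below it for F. *)
Lemma qE_conj F z : 0 < Im z < eta -> Cmod (qE F (Cconj z)) <= 16 * Cmod (qE (Cstar F) z).
Proof.
  intros Hz. unfold qE, Csq.
  assert (H1 : E (Cconj z) <> 0%C) by (apply Hne; rewrite im_conj; lra).
  assert (H2 : E z <> 0%C) by (apply Hne; lra).
  rewrite !Cmod_div, !Cmod_mult by (apply Cmult_neq_0; assumption).
  unfold Cstar at 1. rewrite Cmod_conj. specialize (Hth z Hz). unfold Cstar in Hth. rewrite Cmod_conj in Hth.
  apply Cmod_gt_0 in H1, H2. set (a := Cmod (E z)) in *. set (b := Cmod (E (Cconj z))) in *.
  pose proof (Cmod_ge_0 (F (Cconj z))). unfold Rdiv.
  replace (16 * (Cmod (F (Cconj z)) * / (a * a))) with (Cmod (F (Cconj z)) * / (a / 4 * (a / 4))) by (field; lra).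
  apply Rmult_le_compat_l; [assumption|]. apply Rinv_le_contravar; [|nra]. apply Rmult_lt_0_compat; lra.
Qed.

Lemma qE_star_real F (x : R) : Cmod (qE (Cstar F) x) = Cmod (qE F x).
Proof.
  unfold qE. assert (H : Csq E x <> 0%C) by (apply Csq_ne; simpl; lra).
  rewrite !Cmod_div by assumption. unfold Cstar. rewrite Cmod_conj, Cconj_R. reflexivity.
Qed.

(* The growth of functions of bounded type, uniform under bounded real translations. *)
Definition hgrow (M c : R) (F : C -> C) : Prop := forall T, exists R1, forall z (u : R),
  R1 <= Cmod z -> 0 < Im z -> Rabs u <= T -> Cmod (qE F (z + u)%C) <= M * exp (c * (Cmod z ^ 2 / Im z)).

Lemma hgrow_bounded M F : (forall z, 0 < Im z -> Cmod (qE F z) <= M) -> hgrow M 0 F.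
Proof.
  intros H T. exists 0. intros z u _ Hz _. rewrite Rmult_0_l, exp_0, Rmult_1_r. apply H. unfold Im in *; simpl. lra.
Qed.

Lemma hgrow_type c F : 0 <= c -> (forall z, in_U z -> Cmod (qE F z) <= exp (c * ((1 + Cmod z ^ 2) / Im z))) -> hgrow 1 (2 * c) F.
Proof.
  (* From this radius on, 1 + (|z| + |T|)^2 <= 2 |z|^2, which explains the doubled constant. *)
  intros Hc H T. exists (4 * Rabs T + 4). intros z u H1 H2 H3. pose proof (Rabs_pos T).
  assert (Hu : Rabs u <= Rabs T) by (pose proof (Rle_abs T); lra).
  rewrite Rmult_1_l. replace (Im z) with (Im (z + u)) by (unfold Im; simpl; ring).
  assert (HU : in_U (z + u)) by (unfold in_U, Im in *; simpl; lra).
  eapply Rle_trans; [now apply H|]. apply exp_le_mono. rewrite (Rmult_comm 2 c), Rmult_assoc. apply Rmult_le_compat_l; [assumption|].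
  unfold Rdiv. rewrite <- Rmult_assoc. apply Rmult_le_compat_r; [left; apply Rinv_0_lt_compat; exact HU|].
  pose proof (Cmod_triangle z u) as T0. rewrite Cmod_R in T0. pose proof (Cmod_ge_0 (z + u)).
  assert (Cmod (z + u) ^ 2 <= (Cmod z + Rabs T) ^ 2) by (apply pow_incr; lra). nra.
Qed.

Lemma qE_window F M c h K l w z : entire F -> 0 <= M -> 0 <= c -> hgrow M c F -> 0 < h -> 0 < K -> (forall t, 0 <= w t) ->
  (forall x, rsum l (fun t => w t * RInt (fun u : R => Cmod (qE F u)) (x + t) (x + t + h)) <= K) -> 0 < Im z ->
  rsum l (fun t => w t * Cmod (qE F (z + t)%C)) <= K * exp (4 * c * Im z) * (/ h + / Im z).
Proof.
  intros HF HM Hc Hg Hh HK Hw Hr Hz.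
  destruct (hol_primitive (fun z => - eta < Im z) (qE F) 0%C (convC_upper _) (openC_upper _)) as [P HP].
  { simpl. lra. }
  { intros v Hv. now apply qE_Cdiff. }
  destruct (list_bounded l) as [A [HA HlA]]. destruct (Hg (A + h)) as [R1 HR1].
  apply (window_bound (qE F) P eta h K M c R1 (A + h) l w); auto.
  - intros t Ht. specialize (HlA t Ht). assert (Rabs t <= A) by (apply Rabs_le_between; lra). lra.
  - intros x s Hs. eapply Rle_trans; [|apply (Hr x)]. apply rsum_le. intros t _. apply Rmult_le_compat_l; [auto|].
    assert (HPr : forall x : R, cd P x (qE F x)) by (intros y; apply HP; simpl; lra).
    assert (Hcr : forall x : R, ccont (qE F) x) by (intros y; apply Cdiff_ccont, qE_Cdiff; [assumption|simpl; lra]).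
    destruct (Rcont_abs_RInt P (qE F) (x + t) (x + t + s) HPr Hcr ltac:(lra)) as [E1 H1].
    destruct (Rcont_abs_RInt P (qE F) (x + t + s) (x + t + h) HPr Hcr ltac:(lra)) as [E2 H2].
    eapply Rle_trans; [exact H1|].
    pose proof (RInt_Chasles (V := R_CompleteNormedModule) (fun u : R => Cmod (qE F u)) (x + t) (x + t + s) (x + t + h) E1 E2) as EC.
    unfold plus in EC; simpl in EC. rewrite <- EC.
    pose proof (RInt_ge_0 (fun u : R => Cmod (qE F u)) (x + t + s) (x + t + h) ltac:(lra) E2 (fun u _ => Cmod_ge_0 _)). lra.
Qed.

(** [qE_window] bounds the sums above the axis with a singularity 1 / Im z, [qE_conj] below it.
    [circle_absorb] removes the singularity for every choice of phases, and Cauchy's estimate in the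
    disc of radius eta/4 yields the derivatives. *)
Lemma qE_strip F M c h K l w : entire F -> 0 <= M -> 0 <= c -> hgrow M c F -> hgrow M c (Cstar F) -> 0 < h -> 0 < K -> (forall t, 0 <= w t) ->
  (forall x, rsum l (fun t => w t * RInt (fun u : R => Cmod (qE F u)) (x + t) (x + t + h)) <= K) ->
  let B := 16 * (K * exp (4 * c * eta) * (1 + eta / h)) in
  rsum l (fun t => w t * Cmod (qE F t)) <= 6 * B / eta /\
  rsum l (fun t => w t * Cmod (C_derive (qE F) t)) <= 24 * B / (eta * eta).
Proof.
  intros HF HM Hc Hg Hg' Hh HK Hw Hr B.
  assert (Hr' : forall x, rsum l (fun t => w t * RInt (fun u : R => Cmod (qE (Cstar F) u)) (x + t) (x + t + h)) <= K).
  { intros x. erewrite rsum_ext; [apply (Hr x)|]. intros t _. cbv beta. f_equal. apply RInt_ext. intros u _. apply qE_star_real. }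
  assert (HB0 : 0 < K * exp (4 * c * eta) * (1 + eta / h)).
  { apply Rmult_lt_0_compat; [apply Rmult_lt_0_compat; [assumption|apply exp_pos]|]. assert (0 < eta / h) by (apply Rdiv_lt_0_compat; lra). lra. }
  assert (HB : 0 < B) by (unfold B; lra).
  assert (Hup : forall v, 0 < Im v < eta -> K * exp (4 * c * Im v) * (/ h + / Im v) <= B / 16 / Im v).
  { intros v Hv. unfold B. replace (16 * (K * exp (4 * c * eta) * (1 + eta / h)) / 16 / Im v) with (K * exp (4 * c * eta) * ((1 + eta / h) / Im v)) by (field; lra).
    apply Rmult_le_compat.
    - left. apply Rmult_lt_0_compat; [assumption|apply exp_pos].
    - left. apply Rplus_lt_0_compat; apply Rinv_0_lt_compat; lra.
    - apply Rmult_le_compat_l; [lra|]. apply exp_le_mono. apply Rmult_le_compat_l; lra.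
    - replace ((1 + eta / h) / Im v) with (eta / Im v * / h + / Im v) by (field; lra). apply Rplus_le_compat_r.
      rewrite <- (Rmult_1_l (/ h)) at 1. apply Rmult_le_compat_r; [left; now apply Rinv_0_lt_compat|]. apply (proj1 (Rle_div_r _ _ (Im v) (proj1 Hv))). lra. }
  assert (Hpsi : forall th : R -> C, (forall t, Cmod (th t) <= w t) -> forall v, Cmod v <= eta / 4 ->
     Cmod (Csum_list l (fun t => th t * qE F (v + t))%C) <= 6 * B / eta).
  { intros th Hth' v Hv. replace (6 * B / eta) with (3 * B / (eta / 2)) by (field; lra).
    apply (circle_absorb (fun v => Csum_list l (fun t => th t * qE F (v + t))%C)); try lra.
    - intros u Hu. pose proof (im_le_Cmod u) as Hi. apply Rabs_le_between in Hi.
      eapply cd_Cdiff. apply (cd_Csum l (fun t u => th t * qE F (u + t))%C). intros t _. apply cd_scal, cd_C_derive.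
      apply (Cdiff_comp (qE F) (fun u => u + t)%C); [apply qE_Cdiff; [assumption|unfold Im in *; simpl; lra]|auto with cdiff].
    - intros u Hu Hu0. pose proof (im_le_Cmod u) as Hi. apply Rabs_le_between in Hi.
      apply Rle_trans with (rsum l (fun t => w t * Cmod (qE F (u + t)%C))).
      { eapply Rle_trans; [apply Csum_bound|]. apply rsum_le. intros t _. rewrite Cmod_mult. apply Rmult_le_compat_r; [apply Cmod_ge_0|auto]. }
      destruct (Rtotal_order (Im u) 0) as [Hl|[He|Hl]]; [|lra|].
      + assert (Hcu : 0 < Im (Cconj u) < eta) by (rewrite im_conj; lra).
        apply Rle_trans with (16 * rsum l (fun t => w t * Cmod (qE (Cstar F) (Cconj u + t)%C))).
        * rewrite <- rsum_scal. apply rsum_le. intros t _. replace (u + t)%C with (Cconj (Cconj u + t)) by (rewrite Cplus_conj, Cconj_conj, Cconj_R; reflexivity).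
          assert (Hcut : 0 < Im (Cconj u + t) < eta) by (unfold Im in *; simpl in *; lra).
          pose proof (qE_conj F (Cconj u + t)%C Hcut). specialize (Hw t). nra.
        * pose proof (qE_window (Cstar F) M c h K l w (Cconj u) (entire_star F HF) HM Hc Hg' Hh HK Hw Hr' ltac:(lra)) as H.
          pose proof (Hup _ Hcu) as H2. rewrite Rabs_left by assumption. rewrite im_conj in *. 
          replace (B / - Im u) with (16 * (B / 16 / - Im u)) by (field; lra). lra.
      + pose proof (qE_window F M c h K l w u HF HM Hc Hg Hh HK Hw Hr ltac:(lra)) as H.
        pose proof (Hup u ltac:(lra)) as H2. rewrite Rabs_pos_eq by lra.
        apply Rle_trans with (B / 16 / Im u); [lra|]. unfold Rdiv. apply Rmult_le_compat_r; [left; now apply Rinv_0_lt_compat|lra]. }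
  assert (Hph : forall q t, Cmod (w t * cphase q) <= w t).
  { intros q t. rewrite Cmod_mult, Cmod_R, Rabs_pos_eq by auto. destruct (cphase_spec q) as [_ H]. specialize (Hw t). nra. }
  split.
  - pose proof (Hpsi (fun t => w t * cphase (qE F t))%C (fun t => Hph _ t) 0%C) as H. rewrite Cmod_0 in H. specialize (H ltac:(lra)).
    replace (Csum_list l (fun t => w t * cphase (qE F t) * qE F (0 + t))%C) with (RtoC (rsum l (fun t => w t * Cmod (qE F t)))) in H.
    + rewrite Cmod_R in H. eapply Rle_trans; [apply Rle_abs|exact H].
    + rewrite <- Csum_RtoC. apply Csum_ext. intros t _. replace (0 + t)%C with (RtoC t) by ring. rewrite <- Cmult_assoc.
      destruct (cphase_spec (qE F t)) as [-> _]. apply RtoC_mult.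
  - set (th := fun t : R => (w t * cphase (C_derive (qE F) t))%C). set (Psi := fun v => Csum_list l (fun t => th t * qE F (v + t))%C).
    assert (Hcd : forall v, - eta < Im v -> cd Psi v (Csum_list l (fun t => th t * C_derive (qE F) (v + t))%C)).
    { intros v Hv. apply (cd_Csum l (fun t u => th t * qE F (u + t))%C). intros t _. apply cd_scal.
      apply C_derive_shift, qE_Cdiff; [assumption|unfold Im in *; simpl; lra]. }
    assert (H : Cmod (C_derive Psi 0) <= (6 * B / eta) / (eta / 4)).
    { apply cauchy_est; [lra| |].
      - intros v Hv. replace (v - 0)%C with v in Hv by ring. pose proof (im_le_Cmod v) as Hi. apply Rabs_le_between in Hi. eapply cd_Cdiff, Hcd. lra.
      - intros v Hv. replace (v - 0)%C with v in Hv by ring. apply Hpsi; [intros t; apply Hph|lra]. }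
    rewrite (C_derive_cd _ _ _ (Hcd 0%C ltac:(simpl; lra))) in H.
    replace (Csum_list l (fun t => th t * C_derive (qE F) (0 + t))%C) with (RtoC (rsum l (fun t => w t * Cmod (C_derive (qE F) t)))) in H.
    + rewrite Cmod_R in H. eapply Rle_trans; [apply Rle_abs|]. eapply Rle_trans; [exact H|]. right. field. lra.
    + rewrite <- Csum_RtoC. apply Csum_ext. intros t _. replace (0 + t)%C with (RtoC t) by ring. unfold th. rewrite <- Cmult_assoc.
      destruct (cphase_spec (C_derive (qE F) t)) as [-> _]. apply RtoC_mult.
Qed.

Section Member.
Variables (p : R) (F : C -> C).
Hypothesis Hp1 : 1 <= p.
Hypothesis HF : Hp (Csq E) p F.

Let f (x : R) := powp (Cmod (qE F x)) p.

Lemma mem_entire : entire F.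
Proof. apply HF. Qed.

Lemma mem_int : (forall a b, ex_RInt f a b) /\ exists K, 0 <= K /\ forall a b, a <= b -> RInt f a b <= K.
Proof.
  destruct (RInt_gen_bound f) as [H1 [K HK]].
  - intros x. apply powp_ge0.
  - apply HF.
  - split; [assumption|]. exists K. split; [|assumption]. specialize (HK 0 0 (Rle_refl 0)). rewrite RInt_point in HK. exact HK.
Qed.

Lemma mem_abs_int a b : ex_RInt (fun u : R => Cmod (qE F u)) a b.
Proof.
  apply (ex_RInt_continuous (V := R_CompleteNormedModule)). intros s _. apply (rcont_Cmod (fun u : R => qE F u)).
  apply (rcont_comp (qE F) (fun u => RtoC u)); [|apply rcont_RtoC]. apply Cdiff_ccont, qE_Cdiff; [apply mem_entire|simpl; lra].
Qed.

Lemma mem_grow : exists c, 0 <= c /\ hgrow 1 (2 * c) F /\ hgrow 1 (2 * c) (Cstar F).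
Proof.
  destruct HF as [_ [H1 [_ [H2 _]]]].
  destruct (bounded_type_growth _ H1) as [c1 [Hc1 G1]]. destruct (bounded_type_growth _ H2) as [c2 [Hc2 G2]].
  assert (Hm : forall z, in_U z -> 0 <= (1 + Cmod z ^ 2) / Im z).
  { intros z Hz. apply Rdiv_le_0_compat; [pose proof (pow2_ge_0 (Cmod z)); lra|exact Hz]. }
  exists (c1 + c2). split; [lra|]. split; apply hgrow_type; try lra; intros z Hz.
  - eapply Rle_trans; [now apply G1|]. apply exp_le_mono, Rmult_le_compat_r; [auto|lra].
  - eapply Rle_trans; [now apply G2|]. apply exp_le_mono, Rmult_le_compat_r; [auto|lra].
Qed.

(** The strip estimate for a single point, with weight 1 and window length 1; the window integral is
    bounded through |g| <= 1 + |g|^p. *)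
Lemma mem_bounded_real : exists M, 0 < M /\ forall x : R, Cmod (qE F x) <= M.
Proof.
  destruct mem_int as [Hex [K [HK0 HK]]]. destruct mem_grow as [c [Hc [G1 G2]]].
  eexists. split; [|intros x].
  2:{ pose proof (qE_strip F 1 (2 * c) 1 (1 + K) (x :: nil) (fun _ => 1) mem_entire ltac:(lra) ltac:(lra) G1 G2 ltac:(lra) ltac:(lra) ltac:(intros; lra)) as H.
      cbv beta zeta in H. destruct H as [H _].
      - intros y. simpl. rewrite Rplus_0_r, Rmult_1_l.
        apply Rle_trans with (RInt (fun u => 1 + f u) (y + x) (y + x + 1)).
        + apply RInt_le; [lra|apply mem_abs_int|apply ex_RInt_Rplus; [apply ex_RInt_const|apply Hex]|].
          intros u _. apply powp_ge_self; [assumption|apply Cmod_ge_0].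
        + rewrite RInt_Rplus; [|apply ex_RInt_const|apply Hex].
          rewrite RInt_Rconst. specialize (HK (y + x) (y + x + 1) ltac:(lra)). lra.
      - simpl rsum in H. rewrite Rplus_0_r, Rmult_1_l in H. exact H. }
  apply Rdiv_lt_0_compat; [|assumption]. assert (0 < eta / 1) by lra.
  repeat apply Rmult_lt_0_compat; try lra. apply exp_pos.
Qed.
End Member.

Lemma mem_star p F : Hp (Csq E) p F -> Hp (Csq E) p (Cstar F).
Proof.
  intros [H1 [H2 [H3 [H4 [H5 H6]]]]]. unfold Hp. rewrite Cstar_star. repeat split; auto using entire_star.
  - apply H4.
  - apply H4.
  - apply H2.
  - apply H2.
  - eapply ex_RInt_gen_ext_eq; [|exact H6]. intros x. simpl. f_equal. symmetry. apply qE_star_real.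
Qed.

(** Boundedness on R together with the growth of bounded type gives at most exponential growth in Im
    z, and the mean type condition then excludes any growth. *)
Lemma mem_bounded p F : 1 <= p -> Hp (Csq E) p F -> exists M, 0 < M /\ forall z, 0 <= Im z -> Cmod (qE F z) <= M.
Proof.
  intros Hp HF. destruct (mem_bounded_real p F Hp HF) as [M [HM Hr]]. exists M. split; [assumption|].
  destruct (mem_grow p F HF) as [c [Hc [G _]]]. pose proof (mem_entire p F HF) as He.
  assert (Hd : forall z, 0 <= Im z -> Cdiff (qE F) z) by (intros z Hz; apply qE_Cdiff; [assumption|lra]).
  destruct (G 0) as [R1 HR1].
  assert (Hg : forall z, 0 < Im z -> Cmod (qE F z) <= M * exp (2 * (2 * c) * Im z)).
  { apply (phragmen_half_plane (qE F) M 1 (2 * c) R1); auto; [lra|]. intros z H1 H2. specialize (HR1 z 0 H1 H2).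
    replace (z + 0)%C with z in HR1 by ring. apply HR1. rewrite Rabs_R0. lra. }
  apply (mean_type_bounded (qE F) M (2 * (2 * c))); auto; [lra|]. apply HF.
Qed.

(** In each window [young_weight] replaces |g| / (1 + |t|) by M |g|^p plus [wt (/ p) t]. The windows
    are disjoint, so the first parts add up to at most M times the full integral, uniformly in the
    shift x, and the second parts are summed by [wt_sum]. *)
Lemma mem_sums p F h : 1 <= p -> Hp (Csq E) p F -> 0 < h <= 1 -> exists C0, 0 <= C0 /\ forall l, separated h l ->
  rsum l (fun t => / (1 + Rabs t) * Cmod (qE F t)) <= C0 /\ rsum l (fun t => / (1 + Rabs t) * Cmod (C_derive (qE F) t)) <= C0.
Proof.
  intros Hp HF Hh. destruct (mem_bounded p F Hp HF) as [M [HM Hb]].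
  destruct (mem_int p F HF) as [Hex [K [HK0 HK]]]. destruct (mem_grow p F HF) as [c [Hc [G1 G2]]]. pose proof (mem_entire p F HF) as He.
  assert (Hip : 0 < / p <= 1). { split; [apply Rinv_0_lt_compat; lra|]. rewrite <- Rinv_1. apply Rinv_le_contravar; lra. }
  set (KK := M * K + 8 / (/ p * h) + 1).
  assert (H8 : 0 < 8 / (/ p * h)) by (apply Rdiv_lt_0_compat; [lra|apply Rmult_lt_0_compat; lra]).
  assert (HKK : 0 < KK). { unfold KK. assert (0 <= M * K) by (apply Rmult_le_pos; lra). lra. }
  set (B := 16 * (KK * exp (4 * (2 * c) * eta) * (1 + eta / h))).
  assert (HB : 0 < B). { unfold B. assert (0 < eta / h) by (apply Rdiv_lt_0_compat; lra). repeat apply Rmult_lt_0_compat; try lra; apply exp_pos. }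
  exists (Rmax (6 * B / eta) (24 * B / (eta * eta))). split.
  { eapply Rle_trans; [|apply Rmax_l]. apply Rdiv_le_0_compat; lra. }
  intros l Hl.
  assert (Hw0 : forall t, 0 < 1 + Rabs t) by (intros t; pose proof (Rabs_pos t); lra).
  assert (Hw : forall t, 0 <= / (1 + Rabs t)) by (intros t; left; apply Rinv_0_lt_compat, Hw0).
  destruct (qE_strip F 1 (2 * c) h KK l (fun t => / (1 + Rabs t)) He ltac:(lra) ltac:(lra) G1 G2 ltac:(lra) HKK Hw) as [S1 S2].
  - intros x.
    set (fx := fun u : R => powp (Cmod (qE F u)) p) in *.
    assert (Hpt : forall t, / (1 + Rabs t) * RInt (fun u : R => Cmod (qE F u)) (x + t) (x + t + h) <=
      M * (RInt fx 0 (x + (t + h)) - RInt fx 0 (x + t)) + h * wt (/ p) t).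
    { intros t. 
      replace (RInt fx 0 (x + (t + h)) - RInt fx 0 (x + t)) with (RInt fx (x + t) (x + t + h)).
      2:{ rewrite (RInt_RChasles fx 0 (x + t) (x + (t + h)) Hex). replace (x + (t + h)) with (x + t + h) by ring. lra. }
      rewrite <- RInt_Rscal by (apply (mem_abs_int p F HF)).
      apply Rle_trans with (RInt (fun u => M * fx u + wt (/ p) t) (x + t) (x + t + h)).
      - apply RInt_le; [lra| | |].
        + apply ex_RInt_Rscal. apply (mem_abs_int p F HF).
        + apply ex_RInt_Rplus; [apply ex_RInt_Rscal, Hex|apply ex_RInt_const].
        + intros u _.
          replace (/ (1 + Rabs t)) with (exp (- ln (1 + Rabs t))) by (rewrite exp_Ropp, exp_ln by auto; reflexivity).
          rewrite Rmult_comm. unfold wt, fx. apply young_weight; [lra|]. split; [apply Cmod_ge_0|]. apply Hb. simpl. lra.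
      - rewrite RInt_Rplus; [|apply ex_RInt_Rscal, Hex|apply ex_RInt_const]. rewrite RInt_Rconst, RInt_Rscal by apply Hex. lra. }
    eapply Rle_trans; [apply rsum_le; intros t _; apply Hpt|]. rewrite rsum_plus, !rsum_scal.
    assert (H1 : rsum l (fun t => RInt fx 0 (x + (t + h)) - RInt fx 0 (x + t)) <= K).
    { apply (sep_sum_bound (fun y => RInt fx 0 (x + y)) K h l); auto; [lra| |].
      - intros u v Huv. rewrite (RInt_RChasles fx 0 (x + u) (x + v) Hex).
        pose proof (RInt_ge_0 fx (x + u) (x + v) ltac:(lra) (Hex _ _) (fun y _ => powp_ge0 _ _)). lra.
      - intros u v. destruct (Rle_lt_dec u v) as [Huv|Huv].
        + rewrite (RInt_RChasles fx 0 (x + u) (x + v) Hex). specialize (HK (x + u) (x + v) ltac:(lra)). unfold fx in *. lra.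
        + rewrite (RInt_RChasles fx 0 (x + v) (x + u) Hex).
          pose proof (RInt_ge_0 fx (x + v) (x + u) ltac:(lra) (Hex _ _) (fun y _ => powp_ge0 _ _)). lra. }
    pose proof (wt_sum (/ p) h l Hip Hh Hl) as H2.
    assert (H3 : h * rsum l (wt (/ p)) <= 8 / (/ p * h)).
    { assert (0 <= rsum l (wt (/ p))) by (apply rsum_ge0; intros; left; apply wt_pos). nra. }
    replace (rsum l (fun t => wt (/ p) t)) with (rsum l (wt (/ p))) by reflexivity.
    assert (M * rsum l (fun t => RInt fx 0 (x + (t + h)) - RInt fx 0 (x + t)) <= M * K) by (apply Rmult_le_compat_l; lra).
    unfold KK. lra.
  - split; [eapply Rle_trans; [exact S1|apply Rmax_l]|eapply Rle_trans; [exact S2|apply Rmax_r]].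
Qed.

(** A window of length y and the threshold s = y^{-1/p}, for which y s = s^{1-p}, balance both parts
    of [powp_split]. As g is bounded, the growth constant is 0 and no exponential factor appears at
    height y. *)
Lemma mem_decay p F : 1 <= p -> Hp (Csq E) p F -> exists C0, 0 <= C0 /\ forall y, 1 <= y -> Cmod (qE F (0, y)) <= C0 * Rpower y (- / p).
Proof.
  intros Hp HF. destruct (mem_bounded p F Hp HF) as [M [HM Hb]].
  destruct (mem_int p F HF) as [Hex [K [HK0 HK]]]. pose proof (mem_entire p F HF) as He.
  exists (2 * (1 + K)). split; [lra|]. intros y Hy.
  set (s := Rpower y (- / p)). assert (Hs : 0 < s) by apply exp_pos.
  assert (Hsy : y * s = Rpower s (1 - p)).
  { unfold s. rewrite Rpower_mult. rewrite <- (Rpower_1 y) at 1 by lra. rewrite <- Rpower_plus. f_equal. field. lra. }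
  set (KK := y * s * (1 + K)). assert (HKK : 0 < KK) by (unfold KK; repeat apply Rmult_lt_0_compat; lra).
  pose proof (qE_window F M 0 y KK (0 :: nil) (fun _ => 1) (0, y) He ltac:(lra) ltac:(lra)) as H.
  assert (Hg : hgrow M 0 F) by (apply hgrow_bounded; intros z Hz; apply Hb; lra).
  specialize (H Hg ltac:(lra) HKK ltac:(intros; lra)).
  set (fx := fun u : R => powp (Cmod (qE F u)) p) in *.
  assert (Hr : forall x, rsum (0 :: nil) (fun t => 1 * RInt (fun u : R => Cmod (qE F u)) (x + t) (x + t + y)) <= KK).
  { intros x. simpl. rewrite Rplus_0_r, Rmult_1_l, Rplus_0_r.
    apply Rle_trans with (RInt (fun u => s + Rpower s (1 - p) * fx u) x (x + y)).
    - apply RInt_le; [lra|apply (mem_abs_int p F HF)|apply ex_RInt_Rplus; [apply ex_RInt_const|apply ex_RInt_Rscal, Hex]|].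
      intros u _. apply powp_split; [assumption|apply Cmod_ge_0|assumption].
    - rewrite RInt_Rplus; [|apply ex_RInt_const|apply ex_RInt_Rscal, Hex]. rewrite RInt_Rconst, RInt_Rscal by apply Hex.
      specialize (HK x (x + y) ltac:(lra)). rewrite <- Hsy. unfold KK.
      assert (y * s * RInt fx x (x + y) <= y * s * K) by (apply Rmult_le_compat_l; [nra|assumption]). lra. }
  specialize (H Hr ltac:(simpl; lra)). simpl rsum in H. change (Im (0, y)) with y in H.
  replace ((0, y) + 0)%C with ((0, y) : C) in H by (Cext).
  rewrite Rmult_1_l, Rplus_0_r, Rmult_0_r, Rmult_0_l, exp_0 in H. eapply Rle_trans; [exact H|]. right. unfold KK. field. lra.
Qed.
End Strip.

(** * The phase *)

(** If all iterated quotients vanished at a, then f = (z - a)^k g_k for every k, and the maximum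
    principle on a disc of radius at least twice |z1 - a| would give |f z1| <= M 2^{-k}. *)
Lemma zero_order f a z1 : entire f -> f z1 <> 0%C ->
  exists n g, entire g /\ g a <> 0%C /\ forall z, f z = ((z - a) ^ n * g z)%C.
Proof.
  intros Hf Hz1. set (g := fix g n := match n with O => f | S n => dq (g n) a end).
  assert (Hg : forall n, entire (g n)) by (induction n; simpl; [assumption|now apply dq_entire]).
  destruct (classic (exists n, g n a <> 0%C)) as [Hex|Hno].
  - destruct (dec_inh_nat_subset_has_unique_least_element (fun n => g n a <> 0%C)) as [n [[Hn Hmin] _]]; [intros n; apply classic|assumption|].
    exists n, (g n). split; [apply Hg|]. split; [assumption|].
    assert (H : forall k, (k <= n)%nat -> forall z, f z = ((z - a) ^ k * g k z)%C).
    { induction k; intros Hk z; [simpl; ring|]. rewrite IHk by lia. rewrite (dq_eq (g k) a z).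
      assert (E : g k a = 0%C) by (apply NNPP; intros HN; specialize (Hmin k HN); lia). rewrite E. simpl. ring. }
    apply H. lia.
  - exfalso. assert (H : forall k z, f z = ((z - a) ^ k * g k z)%C).
    { induction k; intros z; [simpl; ring|]. rewrite IHk. rewrite (dq_eq (g k) a z).
      assert (E : g k a = 0%C) by (apply NNPP; intros HN; apply Hno; eauto). rewrite E. simpl. ring. }
    set (R0 := 2 * (Cmod (z1 - a) + 1)). pose proof (Cmod_ge_0 (z1 - a)) as P1.
    destruct (bounded_disc f (Cmod a + R0) (fun z => Cdiff_ccont _ _ (Hf z))) as [M HM].
    assert (HR : 2 <= R0) by (unfold R0; lra).
    assert (HM0 : 0 <= M). { eapply Rle_trans; [apply Cmod_ge_0|apply (HM a)]. lra. }
    assert (Hb : forall k, Cmod (f z1) <= M * (/2) ^ k).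
    { intros k. assert (Hp : 0 < R0 ^ k) by (apply pow_lt; lra).
      assert (Hgk : Cmod (g k z1) <= M / R0 ^ k).
      { apply (max_principle_ball (g k) a R0); try lra.
        - intros z _. apply Hg.
        - apply Rdiv_le_0_compat; lra.
        - intros z Hz. apply (proj1 (Rle_div_r _ _ _ Hp)). rewrite <- Hz, <- Cmod_pow, <- Cmod_mult, Cmult_comm, <- H.
          apply HM. pose proof (Cmod_rev z a). lra.
        - unfold R0. lra. }
      rewrite (H k z1), Cmod_mult, Cmod_pow.
      apply Rle_trans with ((R0 / 2) ^ k * (M / R0 ^ k)).
      - apply Rmult_le_compat; try apply Cmod_ge_0; [apply pow_le; apply Cmod_ge_0| |assumption]. apply pow_incr. unfold R0. lra.
      - unfold Rdiv. rewrite Rpow_mult_distr. right. field. lra. }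
    apply Hz1, Cmod_eq_0, Rle_antisym; [|apply Cmod_ge_0]. apply Rle_plus_epsilon. intros e He. rewrite Rplus_0_l.
    destruct (pow_half_lt (e / (M + 1))) as [N HN]; [apply Rdiv_lt_0_compat; lra|]. specialize (HN N (le_n N)).
    apply Rlt_div_r in HN; [|lra]. specialize (Hb N). pose proof (pow_le (/2) N ltac:(lra)). nra.
Qed.

Lemma isolated_zeros f a z1 : entire f -> f z1 <> 0%C -> exists d, 0 < d /\ forall z, z <> a -> Cmod (z - a) < d -> f z <> 0%C.
Proof.
  intros Hf Hz1. destruct (zero_order f a z1 Hf Hz1) as [n [g [Hg [Hga E]]]].
  destruct (ccont_neq0 g a (Cdiff_ccont _ _ (Hg a)) Hga) as [d [Hd H]]. exists d. split; [assumption|].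
  intros z Hne Hz. rewrite E. apply Cmult_neq_0; [apply Cpow_nz; now apply Cminus_neq0|].
  apply Cmod_pos_neq. specialize (H z Hz). pose proof (Cmod_ge_0 (g a)). lra.
Qed.

(** Serves while real zeros of E are still possible: the quotient then agrees with a continuous
    function except at isolated points, where it has some default value. *)
Lemma ex_RInt_discrete_ext (f c : R -> R) : (forall x, continuous c x) ->
  (forall x, exists e, 0 < e /\ forall y, y <> x -> Rabs (y - x) < e -> f y = c y) -> forall a b, ex_RInt f a b.
Proof.
  intros Hc Hl.
  assert (Hle : forall a b, a <= b -> ex_RInt f a b).
  { intros a b Hab.
    set (dl := fun x => proj1_sig (constructive_indefinite_description _ (Hl x))).
    assert (Hdl : forall x, 0 < dl x /\ forall y, y <> x -> Rabs (y - x) < dl x -> f y = c y).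
    { intros x. unfold dl. destruct constructive_indefinite_description as [e He]. exact He. }
    assert (Hpos : forall x, 0 < dl x / 2) by (intros x; destruct (Hdl x); lra).
    destruct (compactness_value_1d a b (fun x => mkposreal _ (Hpos x))) as [d Hd].
    assert (Hex : forall u v, ex_RInt c u v) by (intros u v; apply (ex_RInt_continuous (V := R_CompleteNormedModule)); auto).
    assert (Hsm : forall u v, a <= u <= b -> u <= v -> v - u < d -> ex_RInt f u v).
    { intros u v Hu Huv Hvu. apply NNPP. intros HN. apply (Hd u Hu). intros [t [_ [Ht1 Ht2]]]. simpl in *. apply HN.
      destruct (Hdl t) as [_ Ht]. apply Rabs_def2 in Ht1.
      assert (Heq : forall y, u <= y <= v -> y <> t -> c y = f y).
      { intros y Hy Hyt. symmetry. apply Ht; [assumption|]. apply Rabs_def1; lra. }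
      destruct (Rle_lt_dec t u) as [H1|H1]; [|destruct (Rle_lt_dec v t) as [H2|H2]].
      - apply (ex_RInt_ext c); [|apply Hex]. intros y Hy. rewrite Rmin_left, Rmax_right in Hy by lra. apply Heq; lra.
      - apply (ex_RInt_ext c); [|apply Hex]. intros y Hy. rewrite Rmin_left, Rmax_right in Hy by lra. apply Heq; lra.
      - apply (ex_RInt_Chasles f u t v).
        + apply (ex_RInt_ext c); [|apply Hex]. intros y Hy. rewrite Rmin_left, Rmax_right in Hy by lra. apply Heq; lra.
        + apply (ex_RInt_ext c); [|apply Hex]. intros y Hy. rewrite Rmin_left, Rmax_right in Hy by lra. apply Heq; lra. }
    pose proof (cond_pos d) as Hdp. set (s := d / 2).
    assert (Hs : 0 < s < d) by (unfold s; lra).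
    assert (Hn : forall n, a + INR n * s <= b -> ex_RInt f a (a + INR n * s)).
    { induction n; intros Hn.
      - simpl. rewrite Rmult_0_l, Rplus_0_r. apply ex_RInt_point.
      - rewrite S_INR in *. assert (0 <= INR n) by apply pos_INR. apply (ex_RInt_Chasles f a (a + INR n * s)); [apply IHn; nra|]. apply Hsm; nra. }
    destruct (nfloor_ex ((b - a) / s)) as [n [H1 H2]]; [apply Rdiv_le_0_compat; lra|].
    apply (proj2 (Rle_div_r _ _ s (proj1 Hs))) in H1. apply (proj1 (Rlt_div_l _ _ s (proj1 Hs))) in H2.
    apply (ex_RInt_Chasles f a (a + INR n * s)); [apply Hn; lra|]. assert (0 <= INR n) by apply pos_INR. apply Hsm; nra. }
  intros a b. destruct (Rle_lt_dec a b); [auto|apply ex_RInt_swap, Hle; lra].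
Qed.

Lemma lorentz_int (x0 v a b : R) : 0 < v -> a <= b -> ex_RInt (fun t => / ((t - x0) ^ 2 + v ^ 2)) a b /\
  RInt (fun t => / ((t - x0) ^ 2 + v ^ 2)) a b <= PI / v.
Proof.
  intros Hv Hab.
  assert (Hp : forall t, 0 < (t - x0) ^ 2 + v ^ 2) by (intros t; pose proof (pow2_ge_0 (t - x0)); pose proof (pow_lt v 2 Hv); lra).
  assert (H : is_RInt (fun t => / ((t - x0) ^ 2 + v ^ 2)) a b (atan ((b - x0) / v) / v - atan ((a - x0) / v) / v)).
  { apply (is_RInt_derive (V := R_CompleteNormedModule) (fun t => atan ((t - x0) / v) / v)).
    - intros t _. auto_derive; [trivial|]. specialize (Hp t). unfold Rsqr. field. simpl in Hp. repeat split; try lra; nra.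
    - intros t _. apply (ex_derive_continuous (fun t => / ((t - x0) ^ 2 + v ^ 2))). auto_derive. specialize (Hp t). simpl in *. lra. }
  split; [eexists; exact H|]. rewrite (is_RInt_unique _ _ _ _ H).
  pose proof (atan_bound ((b - x0) / v)). pose proof (atan_bound ((a - x0) / v)).
  unfold Rdiv. rewrite <- Rmult_minus_distr_r. apply Rmult_le_compat_r; [left; now apply Rinv_0_lt_compat|lra].
Qed.

(** * Kernels of H(E) and the absence of real zeros *)

Section HB.
Variable E : C -> C.
Hypothesis HB : Hermite_Biehler E.

Lemma hb_entire : entire E.
Proof. apply HB. Qed.
Lemma hb_lt z : 0 < Im z -> Cmod (Cstar E z) < Cmod (E z).
Proof. apply HB. Qed.
Lemma hb_ne z : 0 < Im z -> E z <> 0%C.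
Proof. intros H. apply Cmod_pos_neq. pose proof (hb_lt z H). pose proof (Cmod_ge_0 (Cstar E z)). lra. Qed.
Lemma hb_real (x : R) : Cstar E x = Cconj (E x).
Proof. unfold Cstar. now rewrite Cconj_R. Qed.
Lemma hb_le z : 0 <= Im z -> Cmod (Cstar E z) <= Cmod (E z).
Proof.
  intros [H|H]; [left; now apply hb_lt|]. symmetry in H. rewrite (C_real_eq z H), hb_real, Cmod_conj. lra.
Qed.

(** A quotient bounded in the half plane has bounded type with denominator 1 and nonpositive mean
    type, so only two pointwise bounds and one integral bound have to be checked for each function
    constructed later. *)
Lemma HdB_intro F M K : entire F -> (forall z, 0 < Im z -> Cmod (F z) <= M * (Cmod (E z) * Cmod (E z))) ->
  (forall z, 0 < Im z -> Cmod (Cstar F z) <= M * (Cmod (E z) * Cmod (E z))) ->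
  (forall a b, ex_RInt (fun x : R => Cmod (qE E F x) ^ 2) a b) -> (forall a b, a <= b -> RInt (fun x : R => Cmod (qE E F x) ^ 2) a b <= K) ->
  HdB (Csq E) F.
Proof.
  intros HF H1 H2 Hi HK.
  assert (Hne : forall z, 0 < Im z -> Csq E z <> 0%C) by (intros z Hz; unfold Csq; apply Cmult_neq_0; now apply hb_ne).
  assert (Hq : forall G, entire G -> (forall z, 0 < Im z -> Cmod (G z) <= M * (Cmod (E z) * Cmod (E z))) ->
    bounded_type (fun z => G z / Csq E z)%C /\ mean_type_le (fun z => G z / Csq E z)%C 0).
  { intros G HG HGM.
    assert (Hb : forall z, 0 < Im z -> Cmod (G z / Csq E z) <= M).
    { intros z Hz. rewrite Cmod_div by auto. apply Rle_div_l; [apply Cmod_gt_0; auto|]. unfold Csq. rewrite Cmod_mult. now apply HGM. }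
    assert (Hd : analytic_on_U (fun z => G z / Csq E z)%C).
    { intros z Hz. apply Cdiff_div; [apply HG| |now apply Hne]. unfold Csq. apply Cdiff_mult; apply hb_entire. }
    split.
    - split; [assumption|]. exists (fun z => G z / Csq E z)%C, (fun _ => RtoC 1). repeat split.
      + assumption.
      + intros z _. apply Cdiff_const.
      + exists M. exact Hb.
      + exists 1. intros z _. rewrite Cmod_1. lra.
      + exists Ci. split; [unfold in_U; simpl; lra|]. intros E1. apply RtoC_inj in E1. lra.
      + intros z _. ring.
    - intros eps He. exists (Rmax 1 (Rabs M / eps)). intros y Hy.
      assert (1 <= y) by (eapply Rle_trans; [apply Rmax_l|exact Hy]). assert (Hy2 : Rabs M / eps <= y) by (eapply Rle_trans; [apply Rmax_r|exact Hy]).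
      eapply Rle_trans; [apply Hb; simpl; lra|]. apply (proj1 (Rle_div_l _ _ _ He)) in Hy2. pose proof (Rle_abs M).
      pose proof (exp_ineq1_le ((0 + eps) * y)). lra. }
  destruct (Hq F HF H1) as [A1 A2]. destruct (Hq (Cstar F) (entire_star F HF) H2) as [A3 A4].
  assert (Ee : (fun x : R => powp (Cmod (F x / Csq E x)) 2) = (fun x : R => Cmod (qE E F x) ^ 2)).
  { apply functional_extensionality. intros x. rewrite powp_2 by apply Cmod_ge_0. reflexivity. }
  refine (conj HF (conj A1 (conj A2 (conj A3 (conj A4 _))))). rewrite Ee.
  apply (RInt_gen_intro _ K); auto. intros x. apply pow2_ge_0.
Qed.

(* [th] is the inner function E^*/E; [dk w] is a multiple of the reproducing kernel of H(E) at w. *)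
Definition th (w : C) : C := (Cstar E w / E w)%C.
Definition dk (w : C) : C -> C := dq (fun z => E z - Cconj (th w) * Cstar E z)%C (Cconj w).

Lemma th_lt w : 0 < Im w -> Cmod (th w) < 1.
Proof.
  intros H. unfold th. pose proof (hb_ne w H) as Hn. rewrite Cmod_div by assumption. apply Rlt_div_l; [now apply Cmod_gt_0|].
  rewrite Rmult_1_l. now apply hb_lt.
Qed.

Lemma dk_entire w : entire (dk w).
Proof.
  apply dq_entire. intros z. apply Cdiff_minus; [apply hb_entire|]. apply Cdiff_mult; [apply Cdiff_const|apply entire_star, hb_entire].
Qed.

Lemma dk_eq w z : 0 < Im w -> (dk w z * (z - Cconj w) = E z - Cconj (th w) * Cstar E z)%C.
Proof.
  intros H. pose proof (hb_ne w H) as Hn. unfold dk. rewrite (dq_eq (fun z => E z - Cconj (th w) * Cstar E z)%C (Cconj w) z).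
  replace (E (Cconj w) - Cconj (th w) * Cstar E (Cconj w))%C with (RtoC 0).
  - ring.
  - unfold th. rewrite Cdiv_conj by assumption. unfold Cstar. rewrite !Cconj_conj. field. intros E0.
    apply Hn. rewrite <- (Cconj_conj (E w)), E0. unfold Cconj; simpl. Cext.
Qed.

Lemma dk_bound w z : 0 < Im w -> 0 <= Im z -> Cmod (dk w z) * Cmod (z - Cconj w) <= 2 * Cmod (E z).
Proof.
  intros Hw Hz. rewrite <- Cmod_mult, dk_eq by assumption. eapply Rle_trans; [apply Cmod_triangle|].
  rewrite Cmod_opp, Cmod_mult, Cmod_conj. pose proof (th_lt w Hw). pose proof (hb_le z Hz). pose proof (Cmod_ge_0 (th w)). pose proof (Cmod_ge_0 (Cstar E z)). nra.
Qed.

Lemma dk_bound_Im w z : 0 < Im w -> 0 <= Im z -> Cmod (dk w z) <= 2 / Im w * Cmod (E z).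
Proof.
  intros Hw Hz. pose proof (dk_bound w z Hw Hz) as H. pose proof (im_le_Cmod (z - Cconj w)) as Hi.
  change (Im (z - Cconj w)) with (Im z - Im (Cconj w)) in Hi. rewrite im_conj in Hi. apply Rabs_le_between in Hi.
  replace (2 / Im w * Cmod (E z)) with (2 * Cmod (E z) / Im w) by (field; lra). apply (proj1 (Rle_div_r _ _ _ Hw)).
  pose proof (Cmod_ge_0 (dk w z)). nra.
Qed.

Lemma dk_star_eq w z : 0 < Im w -> (Cstar (dk w) z * (z - w) = Cstar E z - th w * E z)%C.
Proof.
  intros H. pose proof (dk_eq w (Cconj z) H) as E0. apply (f_equal Cconj) in E0.
  rewrite Cmult_conj, !Cminus_conj, Cmult_conj, !Cconj_conj in E0. unfold Cstar at 1. rewrite E0.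
  unfold Cstar. rewrite !Cconj_conj. reflexivity.
Qed.

(** The formula for the conjugate kernel divides by z - w, and w lies in the half plane. At distance
    Im w / 2 or more the formula suffices; inside that disc the maximum principle applies to the
    quotient by E. *)
Lemma dk_star_bound w z : 0 < Im w -> 0 < Im z -> Cmod (Cstar (dk w) z) <= 4 / Im w * Cmod (E z).
Proof.
  intros Hw Hz.
  assert (Hfar : forall z, 0 < Im z -> Im w / 2 <= Cmod (z - w) -> Cmod (Cstar (dk w) z) <= 4 / Im w * Cmod (E z)).
  { intros v Hv Hd. assert (H : Cmod (Cstar (dk w) v) * Cmod (v - w) <= 2 * Cmod (E v)).
    { rewrite <- Cmod_mult, dk_star_eq by assumption. eapply Rle_trans; [apply Cmod_triangle|].
      rewrite Cmod_opp, Cmod_mult. pose proof (th_lt w Hw). pose proof (hb_le v ltac:(lra)). pose proof (Cmod_ge_0 (th w)). pose proof (Cmod_ge_0 (E v)). nra. }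
    replace (4 / Im w * Cmod (E v)) with (2 * Cmod (E v) / (Im w / 2)) by (field; lra).
    apply Rle_div_r; [lra|]. pose proof (Cmod_ge_0 (Cstar (dk w) v)). nra. }
  destruct (Rle_lt_dec (Im w / 2) (Cmod (z - w))) as [Hd|Hd]; [auto|].
  assert (Hi : forall v, Cmod (v - w) <= Im w / 2 -> 0 < Im v).
  { intros v Hv. pose proof (im_le_Cmod (v - w)) as H. change (Im (v - w)) with (Im v - Im w) in H. apply Rabs_le_between in H. lra. }
  assert (H : Cmod (Cstar (dk w) z / E z) <= 4 / Im w).
  { apply (max_principle_ball (fun v => Cstar (dk w) v / E v)%C w (Im w / 2)); try lra.
    - intros v Hv. apply Cdiff_div; [apply entire_star, dk_entire|apply hb_entire|]. apply hb_ne. auto.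
    - apply Rdiv_le_0_compat; lra.
    - intros v Hv. assert (Hv' : 0 < Im v) by (apply Hi; lra). rewrite Cmod_div by (now apply hb_ne).
      apply Rle_div_l; [apply Cmod_gt_0; now apply hb_ne|]. apply Hfar; lra. }
  rewrite Cmod_div in H by (now apply hb_ne). apply (proj1 (Rle_div_l _ _ _ (proj1 (Cmod_gt_0 _) (hb_ne z Hz)))) in H. exact H.
Qed.

Variable phi : R -> R.
Hypothesis Hphi_c : forall x, continuous phi x.
Hypothesis Hphi : forall x : R, Im (eia (phi x) * E x)%C = 0.
Hypothesis Hclosed : forall F, HdB (Csq E) F -> exists dF, (forall z, is_derive F z (dF z)) /\ HdB (Csq E) dF.

Lemma eia_conj a : Cconj (eia a) = eia (- a).
Proof. unfold eia, Cconj; simpl. now rewrite cos_neg, sin_neg. Qed.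
Lemma eia_plus a b : (eia a * eia b)%C = eia (a + b).
Proof. unfold eia. rewrite cos_plus, sin_plus. Cext. Qed.
Lemma eia_0 : eia 0 = 1%C.
Proof. unfold eia. rewrite cos_0, sin_0. reflexivity. Qed.
Lemma Cmod_eia a : Cmod (eia a) = 1.
Proof.
  assert (H : Cmod (eia a) ^ 2 = 1). { rewrite Cmod2_alt. unfold eia, Re, Im; simpl. pose proof (sin2_cos2 a) as H. unfold Rsqr in H. lra. }
  pose proof (Cmod_ge_0 (eia a)). nra.
Qed.

Lemma star_real_phase (x : R) : Cstar E x = (eia (2 * phi x) * E x)%C.
Proof.
  rewrite hb_real. set (u := (eia (phi x) * E x)%C). assert (Hu : Cconj u = u).
  { specialize (Hphi x). fold u in Hphi. destruct u as [u1 u2]. simpl in Hphi. unfold Cconj; simpl. f_equal. rewrite Hphi. ring. }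
  transitivity (eia (phi x) * Cconj u)%C.
  - unfold u. rewrite Cmult_conj, eia_conj, Cmult_assoc, eia_plus, Rplus_opp_r, eia_0. ring.
  - rewrite Hu. unfold u. rewrite Cmult_assoc, eia_plus. replace (phi x + phi x) with (2 * phi x) by ring. reflexivity.
Qed.

Lemma eia_rcont (f : R -> R) s : continuous f s -> rcont (fun t => eia (f t)) s.
Proof.
  intros H eps He.
  assert (Hc : forall g : R -> R, continuity g -> continuous (fun t => g (f t)) s).
  { intros g Hg. apply (continuous_comp f g); [assumption|]. apply continuity_pt_filterlim, Hg. }
  pose proof (Hc cos continuity_cos) as H1. pose proof (Hc sin continuity_sin) as H2.
  assert (He2 : 0 < eps / 2) by lra.
  destruct (proj1 (filterlim_locally _ _) H1 (mkposreal _ He2)) as [d1 D1]. destruct (proj1 (filterlim_locally _ _) H2 (mkposreal _ He2)) as [d2 D2].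
  exists (Rmin d1 d2). split; [apply Rmin_glb_lt; apply cond_pos|]. intros t Ht.
  specialize (D1 t (Rlt_le_trans _ _ _ Ht (Rmin_l _ _))). specialize (D2 t (Rlt_le_trans _ _ _ Ht (Rmin_r _ _))).
  change (Rabs (cos (f t) - cos (f s)) < eps / 2) in D1. change (Rabs (sin (f t) - sin (f s)) < eps / 2) in D2.
  eapply Rle_lt_trans; [apply Cmod_le_ReIm|]. unfold eia, Re, Im; simpl. unfold Rminus in *. lra.
Qed.

Theorem no_real_zeros (x : R) : E x <> 0%C.
Proof.
  intros Hx.
  assert (Hi : 0 < Im Ci) by (simpl; lra). pose proof (hb_ne Ci Hi) as HEi.
  set (F := fun z => (E z * dk Ci z)%C).
  assert (HFe : entire F) by (intros z; apply Cdiff_mult; [apply hb_entire|apply dk_entire]).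
  assert (Hiso : forall y : R, exists d, 0 < d /\ forall s : R, s <> y -> Rabs (s - y) < d -> E s <> 0%C).
  { intros y. destruct (isolated_zeros E y Ci hb_entire HEi) as [d [Hd H]]. exists d. split; [assumption|]. intros s Hs Hsd. apply H.
    - intros E0. apply RtoC_inj in E0. contradiction.
    - rewrite <- RtoC_minus, Cmod_R. assumption. }
  set (c := fun y : R => Cmod ((1 - Cconj (th Ci) * eia (2 * phi y)) / (y + Ci)) ^ 2).
  assert (Hyi : forall y : R, (y + Ci)%C <> 0%C) by (intros y E0; apply (f_equal Im) in E0; simpl in E0; lra).
  assert (Hq : forall y : R, E y <> 0%C -> qE E F y = ((1 - Cconj (th Ci) * eia (2 * phi y)) / (y + Ci))%C).
  { intros y Hy. unfold qE, F, Csq.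
    pose proof (dk_eq Ci y Hi) as Ed. rewrite star_real_phase in Ed.
    replace (y - Cconj Ci)%C with (y + Ci)%C in Ed by (unfold Cconj, Ci, RtoC; Cext).
    replace (dk Ci y) with ((E y - Cconj (th Ci) * (eia (2 * phi y) * E y)) / (y + Ci))%C by (rewrite <- Ed; field; auto).
    field. split; auto. }
  assert (Hint : forall a b, ex_RInt (fun y : R => Cmod (qE E F y) ^ 2) a b).
  { apply (ex_RInt_discrete_ext _ c).
      + intros y. unfold c. apply (continuous_comp (fun y : R => Cmod ((1 - Cconj (th Ci) * eia (2 * phi y)) / (y + Ci))) (fun u => u ^ 2)).
        * apply (rcont_Cmod (fun y : R => (1 - Cconj (th Ci) * eia (2 * phi y)) / (y + Ci))%C).
          unfold Cdiv. apply (rcont_mult (fun y : R => 1 - Cconj (th Ci) * eia (2 * phi y))%C (fun y : R => / (y + Ci))%C).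
          -- apply (rcont_ext (fun y : R => 1 + (- Cconj (th Ci)) * eia (2 * phi y))%C); [intros t; ring|].
             apply (rcont_plus (fun _ => RtoC 1)); [apply rcont_const|]. apply rcont_scal. apply (eia_rcont (fun y => 2 * phi y)).
             apply (continuous_scal_r 2 phi), Hphi_c.
          -- apply (rcont_comp (fun z => / (z + Ci))%C (fun t => RtoC t)); [|apply rcont_RtoC]. apply Cdiff_ccont.
             apply (Cdiff_comp Cinv (fun z => z + Ci)%C); [eapply cd_Cdiff, cd_inv, Hyi|auto with cdiff].
        * apply (ex_derive_continuous (fun u => u ^ 2)). auto_derive. trivial.
      + intros y. destruct (Hiso y) as [d [Hd H]]. exists d. split; [assumption|]. intros s Hs Hsd. unfold c. rewrite Hq; auto. }
  assert (HF : HdB (Csq E) F).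
  { apply (HdB_intro F 4 (4 * PI)); auto.
    - intros z Hz. unfold F. rewrite Cmod_mult. pose proof (dk_bound_Im Ci z Hi ltac:(lra)) as H. change (Im Ci) with 1 in H. replace (2 / 1) with 2 in H by field.
      pose proof (Cmod_ge_0 (E z)). nra.
    - intros z Hz. replace (Cstar F z) with (Cstar E z * Cstar (dk Ci) z)%C by (unfold F, Cstar; now rewrite Cmult_conj).
      rewrite Cmod_mult. pose proof (dk_star_bound Ci z Hi Hz) as H. change (Im Ci) with 1 in H. replace (4 / 1) with 4 in H by field. pose proof (hb_lt z Hz).
      pose proof (Cmod_ge_0 (Cstar E z)). pose proof (Cmod_ge_0 (Cstar (dk Ci) z)).
      apply Rle_trans with (Cmod (E z) * (4 * Cmod (E z))); [apply Rmult_le_compat; lra|lra].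
    - intros a b Hab. destruct (lorentz_int 0 1 a b ltac:(lra) Hab) as [L1 L2].
      apply Rle_trans with (RInt (fun t => 4 * / ((t - 0) ^ 2 + 1 ^ 2)) a b); [|rewrite RInt_Rscal by assumption; lra].
      apply RInt_le; [assumption|apply Hint|now apply ex_RInt_Rscal|]. intros t _.
      assert (Hp : 0 < (t - 0) ^ 2 + 1 ^ 2) by (pose proof (pow2_ge_0 (t - 0)); lra).
      destruct (classic (E t = 0%C)) as [E0|E0].
      + unfold qE, F. rewrite E0. unfold Cdiv. rewrite !Cmult_0_l, Cmod_0. apply Rinv_0_lt_compat in Hp. lra.
      + rewrite Hq by assumption. rewrite Cmod_div by apply Hyi.
        assert (E1 : Cmod (t + Ci) ^ 2 = (t - 0) ^ 2 + 1 ^ 2) by (rewrite Cmod2_alt; simpl; ring).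
        unfold Rdiv. rewrite Rpow_mult_distr, pow_inv, E1. apply Rmult_le_compat_r; [left; now apply Rinv_0_lt_compat|].
        assert (H2 : Cmod (1 - Cconj (th Ci) * eia (2 * phi t)) <= 2).
        { eapply Rle_trans; [apply Cmod_triangle|]. rewrite Cmod_opp, Cmod_mult, Cmod_1, Cmod_eia, Cmod_conj.
          pose proof (th_lt Ci Hi). lra. }
        pose proof (Cmod_ge_0 (1 - Cconj (th Ci) * eia (2 * phi t))). nra. }
  (* A Riemann integrable function on [x - 1, x + 1] is bounded there, whereas |G / E^2| would be
     unbounded near x if G(x) were nonzero and E(x) = 0. *)
  assert (Hvan : forall G, HdB (Csq E) G -> G x = 0%C).
  { intros G [HG [_ [_ [_ [_ HI]]]]]. apply NNPP. intros HGx.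
    destruct (RInt_gen_bound _ (fun t => powp_ge0 _ _) HI) as [HI1 _]. specialize (HI1 (x - 1) (x + 1)).
    destruct (ex_RInt_ub _ _ _ HI1) as [M HM].
    destruct (ccont_neq0 G x (Cdiff_ccont _ _ (HG x)) HGx) as [d1 [Hd1 H1]]. destruct (Hiso x) as [d2 [Hd2 H2]].
    pose proof (proj1 (Cmod_gt_0 _) HGx) as Hg0. set (g0 := Cmod (G x)) in *.
    set (e := g0 / (2 * (Rabs M + 1))). pose proof (Rabs_pos M) as HM0.
    assert (He : 0 < e) by (apply Rdiv_lt_0_compat; lra).
    assert (HcE : ccont (Csq E) x) by (apply Cdiff_ccont; unfold Csq; apply Cdiff_mult; apply hb_entire).
    destruct (HcE e He) as [d3 [Hd3 H3]].
    set (t := x + Rmin (Rmin (d1 / 2) (d2 / 2)) (Rmin (d3 / 2) 1)).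
    assert (Ht : 0 < t - x /\ t - x < d1 /\ t - x < d2 /\ t - x < d3 /\ t - x <= 1).
    { unfold t. pose proof (Rmin_l (Rmin (d1 / 2) (d2 / 2)) (Rmin (d3 / 2) 1)). pose proof (Rmin_r (Rmin (d1 / 2) (d2 / 2)) (Rmin (d3 / 2) 1)).
      pose proof (Rmin_l (d1 / 2) (d2 / 2)). pose proof (Rmin_r (d1 / 2) (d2 / 2)). pose proof (Rmin_l (d3 / 2) 1). pose proof (Rmin_r (d3 / 2) 1).
      assert (0 < Rmin (Rmin (d1 / 2) (d2 / 2)) (Rmin (d3 / 2) 1)) by (repeat apply Rmin_glb_lt; lra). lra. }
    destruct Ht as [T0 [T1 [T2 [T3 T4]]]].
    assert (Habs : Cmod (t - x)%C = t - x) by (rewrite <- RtoC_minus, Cmod_R; apply Rabs_pos_eq; lra).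
    specialize (H1 t ltac:(rewrite Habs; lra)). specialize (H2 t ltac:(lra) ltac:(rewrite Rabs_pos_eq; lra)).
    specialize (H3 t ltac:(rewrite Habs; lra)).
    assert (Hsx : Csq E x = 0%C) by (unfold Csq; rewrite Hx; ring). rewrite Hsx in H3.
    replace (Csq E t - 0)%C with (Csq E t) in H3 by ring.
    assert (Hst : Csq E t <> 0%C) by (unfold Csq; apply Cmult_neq_0; assumption).
    specialize (HM t). rewrite Rmin_left, Rmax_right in HM by lra. specialize (HM ltac:(lra)).
    rewrite powp_2, Cmod_div in HM by (assumption || apply Cmod_ge_0).
    pose proof (proj1 (Cmod_gt_0 _) Hst) as Hs0. set (s0 := Cmod (Csq E t)) in *.
    assert (Hbig : Rabs M + 1 <= Cmod (G t) / s0).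
    { apply (proj1 (Rle_div_r _ _ _ Hs0)). apply Rle_trans with ((Rabs M + 1) * e); [apply Rmult_le_compat_l; lra|].
      unfold e. replace ((Rabs M + 1) * (g0 / (2 * (Rabs M + 1)))) with (g0 / 2) by (field; lra). lra. }
    apply Rabs_le_between in HM. pose proof (Rle_abs M). nra. }
  (* Each differentiation lowers the order of the zero at x by one and stays in the space; at order
     0 this contradicts [Hvan]. *)
  assert (Hn : forall n G g, entire g -> g x <> 0%C -> (forall z, G z = ((z - x) ^ n * g z)%C) -> ~ HdB (Csq E) G).
  { induction n; intros G g Hg Hgx HGg HGH.
    - apply Hgx. rewrite <- (Hvan G HGH), HGg. simpl. ring.
    - destruct (Hclosed G HGH) as [dG [HdG HdGH]].
      apply (IHn dG (fun z => RtoC (INR (S n)) * g z + (z - x) * C_derive g z)%C) in HdGH; [assumption| | |].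
      + intros z. apply Cdiff_plus; [apply Cdiff_mult; [apply Cdiff_const|apply Hg]|].
        apply Cdiff_mult; [auto with cdiff|]. apply Cdiff_C_derive. exists 1. split; [lra|]. intros w _. apply Hg.
      + replace (RtoC (INR (S n)) * g x + (x - x) * C_derive g x)%C with (RtoC (INR (S n)) * g x)%C by ring.
        apply Cmult_neq_0; [|assumption]. intros E0. apply RtoC_inj in E0. revert E0. apply not_0_INR. lia.
      + intros z. specialize (HdG z). apply is_derive_cd in HdG.
        apply C_derive_cd in HdG. rewrite <- HdG. apply C_derive_cd.
        apply (cd_ext (fun z => (z - x) ^ S n * g z)%C); [intros w; symmetry; apply HGg|].
        assert (Hpow : forall k, cd (fun w => (w - x) ^ S k)%C z (RtoC (INR (S k)) * (z - x) ^ k)%C).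
        { induction k.
          - apply (cd_ext (fun w => w - x)%C); [intros w; simpl; ring|]. replace (RtoC (INR 1) * (z - x) ^ 0)%C with (1 - 0)%C by (simpl; ring).
            apply cd_minus; [apply cd_id|apply cd_const].
          - apply (cd_ext (fun w => (w - x) * (w - x) ^ S k)%C); [reflexivity|].
            replace (RtoC (INR (S (S k))) * (z - x) ^ S k)%C with ((1 - 0) * (z - x) ^ S k + (z - x) * (RtoC (INR (S k)) * (z - x) ^ k))%C.
            + apply (cd_mult (fun w => w - x)%C (fun w => (w - x) ^ S k)%C); [|assumption]. apply cd_minus; [apply cd_id|apply cd_const].
            + rewrite (S_INR (S k)), RtoC_plus. simpl (Cpow _ (S _)). ring. }
        replace ((z - x) ^ n * (RtoC (INR (S n)) * g z + (z - x) * C_derive g z))%C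
          with (RtoC (INR (S n)) * (z - x) ^ n * g z + (z - x) ^ S n * C_derive g z)%C by (simpl; ring).
        apply (cd_mult (fun w => (w - x) ^ S n)%C g); [apply Hpow|]. apply cd_C_derive, Hg. }
  assert (HFi : F Ci <> 0%C).
  { unfold F. apply Cmult_neq_0; [assumption|]. intros E0. pose proof (dk_eq Ci Ci Hi) as Ed. rewrite E0, Cmult_0_l in Ed.
    pose proof (th_lt Ci Hi) as Ht. pose proof (hb_lt Ci Hi) as Hl. pose proof (Cmod_ge_0 (th Ci)).
    assert (E1 : E Ci = (Cconj (th Ci) * Cstar E Ci)%C) by (replace (E Ci) with (E Ci - Cconj (th Ci) * Cstar E Ci + Cconj (th Ci) * Cstar E Ci)%C by ring; rewrite <- Ed; ring).
    apply (f_equal Cmod) in E1. rewrite Cmod_mult, Cmod_conj in E1. pose proof (Cmod_ge_0 (Cstar E Ci)). nra. }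
  destruct (zero_order F x Ci HFe HFi) as [n [g [Hg [Hgx EF]]]].
  exact (Hn n F g Hg Hgx EF HF).
Qed.
End HB.

(** The definition provides convergence on an interval. The radius of convergence is positive, since
    otherwise the terms at r/2 could not tend to 0; the power series can then be differentiated. *)
Lemma real_analytic_derivable f : real_analytic f -> forall x, ex_derive f x.
Proof.
  intros H x. destruct (H x) as [a [r [Hr Ha]]].
  assert (HC : Rbar_lt (Rabs 0) (CV_radius a)).
  { rewrite Rabs_R0. destruct (Rbar_lt_le_dec 0 (CV_radius a)) as [H1|H1]; [assumption|exfalso].
    assert (Hx : Rabs (x + r / 2 - x) < r) by (replace (x + r / 2 - x) with (r / 2) by ring; rewrite Rabs_pos_eq; lra).
    specialize (Ha _ Hx). replace (x + r / 2 - x) with (r / 2) in Ha by ring.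
    apply (CV_disk_outside a (r / 2)).
    - eapply Rbar_le_lt_trans; [exact H1|]. simpl. rewrite Rabs_pos_eq; lra.
    - assert (Hs : ex_series (fun n => a n * (r / 2) ^ n)).
      { eexists. apply is_pseries_R. exact Ha. }
      now apply ex_series_lim_0. }
  assert (Hd : is_derive (PSeries a) (x - x) (PSeries (PS_derive a) 0)).
  { rewrite Rminus_eq_0. now apply is_derive_PSeries. }
  exists (1 * PSeries (PS_derive a) 0).
  apply (is_derive_ext_loc (fun y => PSeries a (y - x))).
  - exists (mkposreal r Hr). intros y Hy. exact (is_pseries_unique _ _ _ (Ha y Hy)).
  - apply (is_derive_comp (PSeries a) (fun y => y - x)); [exact Hd|]. auto_derive; trivial. 
Qed.

(** * Entire series with geometric majorants *)

Fixpoint Cpart (c : nat -> C) (n : nat) : C := match n with O => 0%C | S n => (Cpart c n + c n)%C end.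

Lemma Cpart_bound c X n : (forall k, Cmod (c k) <= X * (/2) ^ k) -> Cmod (Cpart c n) <= 2 * X.
Proof.
  intros H. assert (HX : 0 <= X) by (specialize (H O); pose proof (Cmod_ge_0 (c O)); simpl in H; lra).
  assert (Hs : Cmod (Cpart c n) <= X * (2 - 2 * (/2) ^ n)).
  { induction n; simpl; [rewrite Cmod_0; nra|]. eapply Rle_trans; [apply Cmod_triangle|]. specialize (H n). lra. }
  pose proof (pow_le (/2) n ltac:(lra)). nra.
Qed.

Lemma Cpart_scal c k n : Cpart (fun j => k * c j)%C n = (k * Cpart c n)%C.
Proof. induction n; simpl; [ring|rewrite IHn; ring]. Qed.

Lemma limit_le (q : nat -> C) (l v : C) X K N0 : (forall n, Cmod (q n - l) <= K * (/2) ^ n) ->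
  (forall n, (N0 <= n)%nat -> Cmod (q n - v) <= X) -> Cmod (l - v) <= X.
Proof.
  intros H1 H2. apply Rle_plus_epsilon. intros e He.
  assert (HK : 0 <= K) by (specialize (H1 O); pose proof (Cmod_ge_0 (q O - l)); simpl in H1; lra).
  destruct (pow_half_lt (e / (K + 1))) as [N HN]; [apply Rdiv_lt_0_compat; lra|].
  specialize (HN (max N N0) ltac:(apply Nat.le_max_l)). specialize (H2 (max N N0) ltac:(lia)). specialize (H1 (max N N0)).
  apply Rlt_div_r in HN; [|lra]. pose proof (pow_le (/2) (max N N0) ltac:(lra)).
  pose proof (Cmod_tri3 l (q (max N N0)) v) as Ht. rewrite (Cmod_minus_sym l (q _)) in Ht. lra.
Qed.

(** The estimate holds for every M that works at the given z, so that one sum can be compared with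
    different majorants: local bounds for differentiability, multiples of |E| in the half plane. *)
Lemma entire_series (c : nat -> C -> C) : (forall n, entire (c n)) ->
  (forall R0, exists M, forall n z, Cmod z <= R0 -> Cmod (c n z) <= M * (/2) ^ n) ->
  exists S, entire S /\ forall z M, (forall n, Cmod (c n z) <= M * (/2) ^ n) ->
    forall n, Cmod (Cpart (fun k => c k z) n - S z) <= 2 * M * (/2) ^ n.
Proof.
  intros Hc Hb.
  assert (Hstep : forall z M, (forall n, Cmod (c n z) <= M * (/2) ^ n) -> forall n, Cmod (Cpart (fun k => c k z) (Datatypes.S n) - Cpart (fun k => c k z) n) <= M * (/2) ^ n).
  { intros z M H n. simpl. replace (Cpart (fun k => c k z) n + c n z - Cpart (fun k => c k z) n)%C with (c n z) by ring. apply H. }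
  assert (Hl : forall z, exists l, forall M, (forall n, Cmod (c n z) <= M * (/2) ^ n) -> forall n, Cmod (Cpart (fun k => c k z) n - l) <= 2 * M * (/2) ^ n).
  { intros z. destruct (Hb (Cmod z)) as [M HM]. assert (HMz : forall n, Cmod (c n z) <= M * (/2) ^ n) by (intros n; apply HM; lra).
    destruct (C_geom _ M (Hstep z M HMz)) as [l Hl]. exists l. intros M' HM'.
    destruct (C_geom _ M' (Hstep z M' HM')) as [l' Hl'].
    assert (E0 : l = l').
    { apply NNPP. intros Hne. assert (Hpos : 0 < Cmod (l - l')) by (apply Cmod_gt_0; now apply Cminus_neq0).
      assert (HP : 0 <= M') by (specialize (HM' O); pose proof (Cmod_ge_0 (c O z)); simpl in HM'; lra).
      destruct (pow_half_lt (Cmod (l - l') / 2 / (2 * M' + 1))) as [N HN]; [apply Rdiv_lt_0_compat; lra|].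
      assert (Cmod (l - l') <= Cmod (l - l') / 2); [|lra].
      apply (limit_le (Cpart (fun k => c k z)) l l' _ (2 * M) N Hl). intros n Hn. eapply Rle_trans; [apply Hl'|].
      specialize (HN n Hn). apply Rlt_div_r in HN; [|lra]. pose proof (pow_le (/2) n ltac:(lra)). lra. }
    rewrite E0. exact Hl'. }
  set (S := fun z => proj1_sig (constructive_indefinite_description _ (Hl z))).
  assert (HS : forall z M, (forall n, Cmod (c n z) <= M * (/2) ^ n) -> forall n, Cmod (Cpart (fun k => c k z) n - S z) <= 2 * M * (/2) ^ n).
  { intros z. unfold S. destruct constructive_indefinite_description as [l HH]. exact HH. }
  exists S. split; [|exact HS]. intros a.
  destruct (Hb (Cmod a + 1)) as [M HM].
  assert (Hin : forall z, Cmod (z - a) < 1 -> forall n, Cmod (c n z) <= M * (/2) ^ n).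
  { intros z Hz n. apply HM. pose proof (Cmod_rev z a). lra. }
  assert (HM0 : 0 <= M) by (assert (H0 := Hin a ltac:(rewrite Cmod_self; lra) O); pose proof (Cmod_ge_0 (c O a)); simpl in H0; lra).
  exists (C_derive S a). apply is_derive_cd.
  apply (weierstrass (fun n z => Cpart (fun k => c k z) n) S a 1); [lra| | |].
  - intros n z _. induction n; simpl; [apply Cdiff_const|]. apply Cdiff_plus; [assumption|apply Hc].
  - exists (2 * M). intros n z Hz. now apply Cpart_bound, Hin.
  - intros eps He. destruct (pow_half_lt (eps / (2 * M + 1))) as [N HN]; [apply Rdiv_lt_0_compat; lra|].
    exists N. intros n Hn z Hz. eapply Rle_lt_trans; [apply (HS z M (Hin z Hz))|].
    specialize (HN n Hn). apply Rlt_div_r in HN; [|lra]. pose proof (pow_le (/2) n ltac:(lra)). lra.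
Qed.

(** * Theta and the phase on the real line *)

Section Phase.
Variable E : C -> C.
Hypothesis HB : Hermite_Biehler E.
Variable phi : R -> R.
Hypothesis Hd : forall x, ex_derive phi x.
Hypothesis Hphi : forall x : R, Im (eia (phi x) * E x)%C = 0.
Hypothesis Hclosed : forall F, HdB (Csq E) F -> exists dF, (forall z, is_derive F z (dF z)) /\ HdB (Csq E) dF.

Lemma phi_cont x : continuous phi x.
Proof. apply (ex_derive_continuous phi x), Hd. Qed.

Lemma nz_closed z : 0 <= Im z -> E z <> 0%C.
Proof.
  intros [H|H]; [now apply hb_ne|]. rewrite (C_real_eq z) by auto. apply (no_real_zeros E HB phi phi_cont Hphi Hclosed).
Qed.

Lemma th_Cdiff z : E z <> 0%C -> Cdiff (th E) z.
Proof. intros H. apply Cdiff_div; [apply entire_star, hb_entire, HB|now apply hb_entire|assumption]. Qed.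

Lemma th_holn z : E z <> 0%C -> holn (th E) z.
Proof.
  intros H. destruct (ccont_neq0 E z (Cdiff_ccont _ _ (hb_entire E HB z)) H) as [d [Hd0 Hw]]. exists d. split; [assumption|].
  intros w Hwz. apply th_Cdiff, Cmod_pos_neq. specialize (Hw w Hwz). pose proof (Cmod_ge_0 (E z)). lra.
Qed.

Lemma th_le z : 0 <= Im z -> Cmod (th E z) <= 1.
Proof.
  intros H. pose proof (nz_closed z H) as Hn. unfold th. rewrite Cmod_div by assumption.
  apply (proj2 (Rle_div_l _ _ _ (proj1 (Cmod_gt_0 _) Hn))). rewrite Rmult_1_l. now apply hb_le.
Qed.

Lemma th_real (x : R) : th E x = eia (2 * phi x).
Proof.
  unfold th. rewrite (star_real_phase E phi Hphi). field. apply nz_closed. simpl. lra.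
Qed.

(** On the real line Theta = exp (2 i phi). The components of the complex derivative are real
    derivatives along the axis, obtained with the multipliers 1 and -i. *)
Lemma th_deriv (x : R) : C_derive (th E) x = ((0, (2 * Derive phi x)%R) * th E x)%C.
Proof.
  assert (Hn : E x <> 0%C) by (apply nz_closed; simpl; lra).
  pose proof (cd_C_derive _ _ (th_Cdiff x Hn)) as H. set (l := C_derive (th E) x) in *.
  assert (Hl : forall c, is_derive (fun t : R => Re (c * th E t)%C) x (Re (c * l)%C)).
  { intros c. assert (H' : cd (th E) (0 + x * 1)%C l) by (replace (0 + x * 1)%C with (RtoC x) by ring; exact H).
    pose proof (cd_real_line (th E) 0 1 x l c H') as Hr. rewrite Cmult_1_r in Hr.
    apply (is_derive_ext (fun t : R => Re (c * th E (0 + t * 1))%C)); [|exact Hr]. intros t. do 3 f_equal. ring. }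
  assert (Hp : is_derive phi x (Derive phi x)) by (apply Derive_correct, Hd).
  rewrite th_real. unfold eia. apply injective_projections.
  - transitivity (Re (1 * l)%C); [simpl; ring|]. rewrite <- (is_derive_unique _ _ _ (Hl 1%C)).
    apply is_derive_unique. apply (is_derive_ext (fun t => cos (2 * phi t))).
    + intros t. rewrite Cmult_1_l, th_real. reflexivity.
    + evar_last. { apply (is_derive_comp cos (fun t => 2 * phi t)); [apply is_derive_cos|]. apply (is_derive_scal phi x 2), Hp. }
      simpl. unfold scal; simpl. unfold mult; simpl. ring.
  - transitivity (Re (- Ci * l)%C); [simpl; ring|]. rewrite <- (is_derive_unique _ _ _ (Hl (- Ci)%C)).
    apply is_derive_unique. apply (is_derive_ext (fun t => sin (2 * phi t))).
    + intros t. rewrite th_real. unfold eia; simpl. ring.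
    + evar_last. { apply (is_derive_comp sin (fun t => 2 * phi t)); [apply is_derive_sin|]. apply (is_derive_scal phi x 2), Hp. }
      simpl. unfold scal; simpl. unfold mult; simpl. ring.
Qed.

(* |Theta| <= 1 above the real line, where Theta' = 2 i phi' Theta. *)
Lemma phi'_ge0 x : 0 <= Derive phi x.
Proof.
  destruct (Rle_lt_dec 0 (Derive phi x)) as [H|H]; [assumption|exfalso].
  assert (Hn : E x <> 0%C) by (apply nz_closed; simpl; lra).
  pose proof (cd_C_derive _ _ (th_Cdiff x Hn)) as Hc. rewrite th_deriv in Hc.
  destruct (Hc (- Derive phi x)) as [d [Hd0 Hw]]; [lra|].
  set (D := Derive phi x) in *. set (w := (x, d / 2) : C).
  assert (Ew : (w - x)%C = (0, d / 2)) by (unfold w, RtoC; Cext).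
  assert (Em : Cmod (0, d / 2) = d / 2).
  { replace ((0, d / 2) : C) with (Ci * RtoC (d / 2))%C by (Cext).
    rewrite Cmod_mult, Cmod_R, Rabs_pos_eq by lra. rewrite Cmod_Ci. ring. }
  specialize (Hw w). rewrite Ew, Em in Hw. specialize (Hw ltac:(lra)).
  assert (Hle : Cmod (th E w) <= 1) by (apply th_le; unfold w; simpl; lra).
  replace (th E w - th E x - (0, (2 * D)%R) * th E x * (0, (d / 2)%R))%C with (th E w - (RtoC (1 - D * d)%R * th E x))%C in Hw.
  2:{ replace ((0, (2 * D)%R) * th E x * (0, (d / 2)%R))%C with (RtoC (- (D * d))%R * th E x)%C.
      - rewrite RtoC_minus, RtoC_opp. ring.
      - transitivity ((0, (2 * D)%R) * (0, (d / 2)%R) * th E x)%C; [|ring]. f_equal. apply injective_projections; simpl; field. }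
  pose proof (Cmod_rev (RtoC (1 - D * d)%R * th E x)%C (th E w)) as Hr. rewrite (Cmod_minus_sym _ (th E w)) in Hr.
  rewrite Cmod_mult, th_real, Cmod_eia, Cmod_R, Rabs_pos_eq in Hr by nra. rewrite th_real in Hw. nra.
Qed.

Lemma phi_mono x y : x <= y -> phi x <= phi y.
Proof.
  intros H. destruct (MVT_gen phi x y (Derive phi)) as [c [_ Hc]].
  - intros t _. apply Derive_correct, Hd.
  - intros t _. apply continuity_pt_filterlim, phi_cont.
  - pose proof (phi'_ge0 c). nra.
Qed.
End Phase.

Lemma Cpart_split c n N : (n < N)%nat -> Cpart c N = (Cpart (fun k => if Nat.eq_dec k n then 0 else c k) N + c n)%C.
Proof.
  assert (H0 : forall M, (M <= n)%nat -> Cpart c M = Cpart (fun k => if Nat.eq_dec k n then 0%C else c k) M).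
  { induction M; intros HM; simpl; [reflexivity|]. rewrite IHM by lia. destruct (Nat.eq_dec M n); [lia|reflexivity]. }
  induction N; intros HN; [lia|]. simpl. destruct (Nat.eq_dec N n) as [->|Hne].
  - rewrite <- H0 by lia. ring.
  - rewrite IHN by lia. ring.
Qed.

Fixpoint Rpart (c : nat -> R) (n : nat) : R := match n with O => 0 | S n => Rpart c n + c n end.

Lemma Rpart_ge0 c n : (forall k, 0 <= c k) -> 0 <= Rpart c n.
Proof. intros H. induction n; simpl; [lra|]. specialize (H n). lra. Qed.

(** Cauchy-Schwarz with weights 2^{-k} and 2^k. The induction carries the exact partial sum 2 - 2 *
    2^{-n} of the weights. *)
Lemma Cpart_sq c n : Cmod (Cpart c n) ^ 2 <= 2 * Rpart (fun k => 2 ^ k * Cmod (c k) ^ 2) n.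
Proof.
  assert (H : Cmod (Cpart c n) ^ 2 <= (2 - 2 * (/2) ^ n) * Rpart (fun k => 2 ^ k * Cmod (c k) ^ 2) n).
  { induction n; cbn [Cpart Rpart]; [rewrite Cmod_0; simpl; lra|].
    set (x := Cmod (Cpart c n)) in *. set (y := Cmod (c n)). set (S0 := Rpart _ n) in *.
    pose proof (Cmod_triangle (Cpart c n) (c n)) as Ht. fold x y in Ht. pose proof (Cmod_ge_0 (Cpart c n + c n)) as H0.
    assert (Hx : 0 <= x) by apply Cmod_ge_0. assert (Hy : 0 <= y) by apply Cmod_ge_0.
    assert (HS : 0 <= S0) by (apply Rpart_ge0; intros k; apply Rmult_le_pos; [apply pow_le; lra|apply pow2_ge_0]).
    assert (Hp : 0 < 2 ^ n) by (apply pow_lt; lra). set (h := (/2) ^ n) in *.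
    assert (Hh : h * 2 ^ n = 1) by (unfold h; rewrite pow_inv; field; lra).
    assert (Hh1 : h <= 1) by (assert (1 <= 2 ^ n) by (apply pow_R1_Rle; lra); unfold h; rewrite pow_inv; rewrite <- Rinv_1; apply Rinv_le_contravar; lra).
    assert (Hh0 : 0 < h) by (apply pow_lt; lra).
    replace ((/2) ^ S n) with (h / 2) by (unfold h; simpl; lra). set (A := 2 - 2 * h) in *. replace (2 - 2 * (h / 2)) with (A + h) by (unfold A; lra).
    assert (HA : 0 <= A) by (unfold A; lra).
    assert (Hxy : 2 * x * y <= A * (2 ^ n * y ^ 2) + h * S0).
    { destruct HA as [HA|HA].
      - assert (Hm : A * (2 * x * y) <= A * (A * (2 ^ n * y ^ 2) + h * S0)); [|apply Rmult_le_reg_l in Hm; assumption].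
        apply Rle_trans with (h * x ^ 2 + 2 ^ n * (A * y) ^ 2); [|nra].
        assert (0 <= 2 ^ n * (h * x - A * y) ^ 2) by (apply Rmult_le_pos; [lra|apply pow2_ge_0]).
        replace (2 ^ n * (h * x - A * y) ^ 2) with ((h * 2 ^ n) * (h * x ^ 2) - 2 * (h * 2 ^ n) * x * (A * y) + 2 ^ n * (A * y) ^ 2) in H by ring.
        rewrite Hh in H. lra.
      - rewrite <- HA, Rmult_0_l in *. assert (x = 0) by nra. subst. rewrite H. nra. }
    apply Rle_trans with ((x + y) ^ 2); [apply pow_incr; lra|].
    replace ((A + h) * (S0 + 2 ^ n * y ^ 2)) with (A * S0 + A * (2 ^ n * y ^ 2) + h * S0 + (h * 2 ^ n) * y ^ 2) by ring. rewrite Hh. nra. }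
  eapply Rle_trans; [exact H|]. apply Rmult_le_compat_r; [|pose proof (pow_le (/2) n); lra].
  apply Rpart_ge0; intros k; apply Rmult_le_pos; [apply pow_le; lra|apply pow2_ge_0].
Qed.

(** Uniform in w although the poles of the formula for the kernel approach the axis: at distance Im
    w or more from conj w one divides, within it the maximum principle applies. *)
Lemma dk_local E (HB : Hermite_Biehler E) R0 : exists M, 0 <= M /\ forall w, 0 < Im w <= 1 -> forall z, Cmod z <= R0 -> Cmod (dk E w z) * Im w <= M.
Proof.
  destruct (bounded_disc E (R0 + 2) (fun z => Cdiff_ccont _ _ (hb_entire E HB z))) as [M1 H1].
  destruct (bounded_disc (Cstar E) (R0 + 2) (fun z => Cdiff_ccont _ _ (entire_star E (hb_entire E HB) z))) as [M2 H2].
  exists (Rmax 0 (M1 + M2)). split; [apply Rmax_l|]. intros w Hw z Hz.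
  assert (Hfar : forall u, Cmod u <= R0 + 2 -> Im w <= Cmod (u - Cconj w) -> Cmod (dk E w u) * Im w <= Rmax 0 (M1 + M2)).
  { intros u Hu Hd. apply Rle_trans with (Cmod (dk E w u) * Cmod (u - Cconj w)); [apply Rmult_le_compat_l; [apply Cmod_ge_0|assumption]|].
    rewrite <- Cmod_mult, (dk_eq E HB w u) by lra. eapply Rle_trans; [|apply Rmax_r]. eapply Rle_trans; [apply Cmod_triangle|].
    rewrite Cmod_opp, Cmod_mult, Cmod_conj. specialize (H1 u Hu). specialize (H2 u Hu). pose proof (th_lt E HB w (proj1 Hw)).
    pose proof (Cmod_ge_0 (th E w)). pose proof (Cmod_ge_0 (Cstar E u)). nra. }
  destruct (Rle_lt_dec (Im w) (Cmod (z - Cconj w))) as [Hd|Hd]; [apply Hfar; lra|].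
  apply (proj2 (Rle_div_r _ _ _ (proj1 Hw))). apply (max_principle_ball (dk E w) (Cconj w) (Im w)); try lra.
  - intros u _. now apply dk_entire.
  - apply Rdiv_le_0_compat; [apply Rmax_l|lra].
  - intros u Hu. apply (proj1 (Rle_div_r _ _ _ (proj1 Hw))). apply Hfar; [|lra].
    pose proof (Cmod_rev u z). pose proof (Cmod_tri3 u (Cconj w) z). rewrite (Cmod_minus_sym (Cconj w) z) in H0. lra.
Qed.

(* With w_n = a_n + i 16^{-n} and coefficients 32^{-n}, the n-th kernel dominates the series S0 on
   [a_n, a_n + 16^{-n}], and there the L^2 bound on Theta' S0/E contradicts an increase of phi by 1/2. *)
Section Hump.
Variable E : C -> C.
Hypothesis HB : Hermite_Biehler E.
Variable phi : R -> R.
Hypothesis Hd : forall x, ex_derive phi x.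
Hypothesis Hphi : forall x : R, Im (eia (phi x) * E x)%C = 0.
Hypothesis Hclosed : forall F, HdB (Csq E) F -> exists dF, (forall z, is_derive F z (dF z)) /\ HdB (Csq E) dF.

Lemma nz_real (x : R) : E x <> 0%C.
Proof. apply (nz_closed E HB phi Hd Hphi Hclosed). simpl. lra. Qed.

Lemma quot_rcont F (x : R) : entire F -> rcont (fun t : R => F t / E t)%C x.
Proof.
  intros HF. apply (rcont_comp (fun z => F z / E z)%C (fun t => RtoC t)); [|apply rcont_RtoC].
  apply Cdiff_ccont, Cdiff_div; [apply HF|now apply hb_entire|apply nz_real].
Qed.

Lemma sq_ex_RInt F a b : (forall x : R, rcont (fun t : R => F t) x) -> ex_RInt (fun t : R => Cmod (F t) ^ 2) a b.
Proof.
  intros HF. apply (ex_RInt_continuous (V := R_CompleteNormedModule)). intros x _.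
  apply (continuous_comp (fun t : R => Cmod (F t)) (fun u => u ^ 2)); [apply rcont_Cmod, HF|].
  apply (ex_derive_continuous (fun u => u ^ 2)). auto_derive. trivial.
Qed.

Lemma qE_rcont F (x : R) : entire F -> rcont (fun t : R => qE E F t) x.
Proof.
  intros HF. apply (rcont_comp (qE E F) (fun t => RtoC t)); [|apply rcont_RtoC].
  unfold qE, Csq. apply Cdiff_ccont, Cdiff_div; [apply HF| |apply Cmult_neq_0; apply nz_real].
  apply Cdiff_mult; now apply hb_entire.
Qed.

Variable a : nat -> R.
(** The rates are balanced: [b n / v n] = 2^{-n} makes the series converge, 2^n b^2 / v <= 2^{-n}
    makes it square integrable, and v^{3/2} / b = 2^{-n} makes the Cauchy-Schwarz bound negligible
    against the n-th term. *)
Let v (n : nat) : R := (/16) ^ n.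
Let b (n : nat) : R := (/32) ^ n.
Let w (n : nat) : C := (a n, v n).

Lemma v_pos n : 0 < v n <= 1.
Proof. unfold v. split; [apply pow_lt; lra|]. rewrite <- (pow1 n). apply pow_incr. lra. Qed.
Lemma b_pos n : 0 < b n.
Proof. apply pow_lt; lra. Qed.
Lemma b_over_v n : b n / v n = (/2) ^ n.
Proof. unfold b, v, Rdiv. rewrite <- pow_inv, <- Rpow_mult_distr. f_equal. field. Qed.
Lemma w_im n : Im (w n) = v n.
Proof. reflexivity. Qed.

Let c (n : nat) (z : C) : C := (b n * dk E (w n) z)%C.

Lemma c_bound n z : 0 <= Im z -> Cmod (c n z) <= (2 * Cmod (E z)) * (/2) ^ n.
Proof.
  intros Hz. unfold c. rewrite Cmod_mult, Cmod_R, Rabs_pos_eq by (left; apply b_pos).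
  pose proof (dk_bound_Im E HB (w n) z (proj1 (v_pos n)) Hz) as H. rewrite w_im in H. rewrite <- b_over_v.
  replace (2 * Cmod (E z) * (b n / v n)) with (b n * (2 / v n * Cmod (E z))) by (field; pose proof (v_pos n); lra).
  apply Rmult_le_compat_l; [left; apply b_pos|assumption].
Qed.

Lemma c_star_bound n z : 0 < Im z -> Cmod (c n (Cconj z)) <= (4 * Cmod (E z)) * (/2) ^ n.
Proof.
  intros Hz. unfold c. rewrite Cmod_mult, Cmod_R, Rabs_pos_eq by (left; apply b_pos).
  pose proof (dk_star_bound E HB (w n) z (proj1 (v_pos n)) Hz) as H. rewrite w_im in H. unfold Cstar in H. rewrite Cmod_conj in H. rewrite <- b_over_v.
  replace (4 * Cmod (E z) * (b n / v n)) with (b n * (4 / v n * Cmod (E z))) by (field; pose proof (v_pos n); lra).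
  apply Rmult_le_compat_l; [left; apply b_pos|assumption].
Qed.

Lemma S0_ex : exists S, entire S /\ forall z M, (forall n, Cmod (c n z) <= M * (/2) ^ n) ->
    forall n, Cmod (Cpart (fun k => c k z) n - S z) <= 2 * M * (/2) ^ n.
Proof.
  apply entire_series.
  - intros n z. apply Cdiff_mult; [apply Cdiff_const|now apply dk_entire].
  - intros R0. destruct (dk_local E HB R0) as [M [HM0 HM]]. exists M. intros n z Hz. unfold c.
    rewrite Cmod_mult, Cmod_R, Rabs_pos_eq by (left; apply b_pos). specialize (HM (w n) (v_pos n) z Hz). rewrite w_im in HM.
    pose proof (v_pos n) as Hv. rewrite <- b_over_v. replace (b n * Cmod (dk E (w n) z)) with ((Cmod (dk E (w n) z) * v n) * (b n / v n)) by (field; lra).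
    apply Rmult_le_compat_r; [|assumption]. rewrite b_over_v. apply pow_le; lra.
Qed.

Variable S0 : C -> C.
Hypothesis HS : entire S0.
Hypothesis HSl : forall z M, (forall n, Cmod (c n z) <= M * (/2) ^ n) ->
    forall n, Cmod (Cpart (fun k => c k z) n - S0 z) <= 2 * M * (/2) ^ n.

Lemma S0_le z M : (forall n, Cmod (c n z) <= M * (/2) ^ n) -> Cmod (S0 z) <= 2 * M.
Proof.
  intros H. replace (S0 z) with (S0 z - 0)%C by ring. apply (limit_le (Cpart (fun k => c k z)) (S0 z) 0 _ (2 * M) 0).
  - intros n. now apply HSl.
  - intros n _. replace (Cpart (fun k => c k z) n - 0)%C with (Cpart (fun k => c k z) n) by ring. now apply Cpart_bound.
Qed.

(** Each term satisfies |c_k / E|^2 <= 4 b^2 / ((t - a_k)^2 + v^2), whose integral is at most 4 pi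
    b^2 / v. [Cpart_sq] adds the terms with the weights 2^k. *)
Lemma S0_L2 x y : x <= y -> RInt (fun t : R => Cmod (S0 t / E t) ^ 2) x y <= 64 * PI + 1.
Proof.
  intros Hxy.
  set (r := fun (t : R) (k : nat) => 2 ^ k * (b k ^ 2 * (4 * / ((t - a k) ^ 2 + v k ^ 2)))).
  assert (Hden : forall t k, 0 < (t - a k) ^ 2 + v k ^ 2).
  { intros t k. pose proof (pow2_ge_0 (t - a k)). pose proof (pow_lt (v k) 2 (proj1 (v_pos k))). lra. }
  assert (Hk : forall (t : R) k, Cmod (c k t / E t) ^ 2 <= b k ^ 2 * (4 * / ((t - a k) ^ 2 + v k ^ 2))).
  { intros t k. pose proof (nz_real t) as Hn. pose proof (proj1 (Cmod_gt_0 _) Hn) as Hp.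
    pose proof (dk_bound E HB (w k) t (proj1 (v_pos k)) ltac:(simpl; lra)) as H.
    rewrite Cmod_div by assumption. unfold c. rewrite Cmod_mult, Cmod_R, Rabs_pos_eq by (left; apply b_pos).
    assert (E1 : Cmod (t - Cconj (w k)) ^ 2 = (t - a k) ^ 2 + v k ^ 2) by (rewrite Cmod2_alt; simpl; ring).
    unfold Rdiv. rewrite !Rpow_mult_distr, Rmult_assoc. apply Rmult_le_compat_l; [apply pow2_ge_0|].
    rewrite <- E1. set (D := Cmod (t - Cconj (w k))) in *. set (X := Cmod (dk E (w k) t)) in *. set (e := Cmod (E t)) in *.
    assert (HD : 0 < D ^ 2) by (rewrite E1; apply Hden).
    apply (proj1 (Rle_div_r _ _ _ HD)). rewrite pow_inv. replace (X ^ 2 * / e ^ 2 * D ^ 2) with ((X * D) ^ 2 / e ^ 2) by (field; lra).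
    assert (He : 0 < e ^ 2) by (apply pow_lt; lra). apply (proj2 (Rle_div_l _ _ _ He)).
    assert (0 <= X * D) by (apply Rmult_le_pos; apply Cmod_ge_0). nra. }
  assert (Hi : forall n, ex_RInt (fun t => Rpart (r t) n) x y /\ RInt (fun t => Rpart (r t) n) x y <= 4 * PI * (2 - 2 * (/2) ^ n)).
  { induction n; simpl Rpart.
    - split; [apply ex_RInt_const|]. rewrite RInt_Rconst. simpl. lra.
    - destruct IHn as [I1 I2]. destruct (lorentz_int (a n) (v n) x y (proj1 (v_pos n)) Hxy) as [L1 L2].
      assert (I3 : ex_RInt (fun t => 2 ^ n * (b n ^ 2 * (4 * / ((t - a n) ^ 2 + v n ^ 2)))) x y) by (do 3 apply ex_RInt_Rscal; assumption).
      split; [apply ex_RInt_Rplus; assumption|]. rewrite RInt_Rplus by assumption.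
      unfold r. rewrite (RInt_Rscal (fun t => b n ^ 2 * (4 * / ((t - a n) ^ 2 + v n ^ 2)))) by (do 2 apply ex_RInt_Rscal; assumption).
      rewrite (RInt_Rscal (fun t => 4 * / ((t - a n) ^ 2 + v n ^ 2))) by (apply ex_RInt_Rscal; assumption). rewrite RInt_Rscal by assumption.
      apply Rle_trans with (4 * PI * (2 - 2 * (/2) ^ n) + 2 ^ n * (b n ^ 2 * (4 * (PI / v n)))).
      + apply Rplus_le_compat; [exact I2|]. apply Rmult_le_compat_l; [apply pow_le; lra|]. apply Rmult_le_compat_l; [apply pow2_ge_0|]. lra.
      + assert (Hb : 2 ^ n * (b n ^ 2 / v n) <= (/2) ^ n).
        { replace (b n ^ 2 / v n) with (b n * (b n / v n)) by (unfold Rdiv; ring). rewrite b_over_v, <- Rmult_assoc. rewrite <- (Rmult_1_l ((/2)^n)) at 2.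
          apply Rmult_le_compat_r; [apply pow_le; lra|]. unfold b. rewrite <- Rpow_mult_distr, <- (pow1 n). apply pow_incr. lra. }
        pose proof PI_RGT_0. replace (2 ^ n * (b n ^ 2 * (4 * (PI / v n)))) with (4 * PI * (2 ^ n * (b n ^ 2 / v n))) by (field; pose proof (v_pos n); lra).
        simpl pow at 3. simpl pow. nra. }
  assert (Hpt : forall n (t : R), Cmod (S0 t / E t) ^ 2 <= 4 * Rpart (r t) n + 32 * (/2) ^ n).
  { intros n t. pose proof (nz_real t) as Hn. pose proof (proj1 (Cmod_gt_0 _) Hn) as Hp.
    set (q := Cpart (fun k => (c k t / E t)%C) n).
    assert (Eq : q = (Cpart (fun k => c k t) n / E t)%C).
    { unfold q. transitivity (Cpart (fun k => / E t * c k t)%C n); [f_equal; apply functional_extensionality; intros k; unfold Cdiv; ring|].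
      rewrite Cpart_scal. unfold Cdiv. ring. }
    pose proof (HSl t _ (fun k => c_bound k t ltac:(simpl; lra)) n) as H1.
    assert (H2 : Cmod (q - S0 t / E t) <= 4 * (/2) ^ n).
    { rewrite Eq. replace (Cpart (fun k => c k t) n / E t - S0 t / E t)%C with ((Cpart (fun k => c k t) n - S0 t) / E t)%C by (field; assumption).
      rewrite Cmod_div by assumption. apply (proj2 (Rle_div_l _ _ _ Hp)). lra. }
    pose proof (Cpart_sq (fun k => (c k t / E t)%C) n) as H3. fold q in H3.
    assert (H4 : Rpart (fun k => 2 ^ k * Cmod (c k t / E t) ^ 2) n <= Rpart (r t) n).
    { clear - Hk. induction n; simpl Rpart; [lra|]. apply Rplus_le_compat; [assumption|]. apply Rmult_le_compat_l; [apply pow_le; lra|apply Hk]. }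
    pose proof (Cmod_rev (S0 t / E t) q) as H5. rewrite (Cmod_minus_sym _ q) in H5.
    set (h := (/2) ^ n) in *. assert (Hh : 0 <= h <= 1) by (split; [apply pow_le; lra|unfold h; rewrite <- (pow1 n); apply pow_incr; lra]).
    pose proof (Cmod_ge_0 (S0 t / E t)). pose proof (Cmod_ge_0 q). set (s := Cmod (S0 t / E t)) in *. set (q0 := Cmod q) in *.
    assert (s ^ 2 <= (q0 + 4 * h) ^ 2) by (apply pow_incr; lra).
    assert (0 <= (q0 - 4 * h) ^ 2) by apply pow2_ge_0. nra. }
  assert (HcS : ex_RInt (fun t : R => Cmod (S0 t / E t) ^ 2) x y) by (apply (sq_ex_RInt (fun t => S0 t / E t)%C); intros u; now apply (quot_rcont S0)).
  (* N depends on the interval: the uniform error 32 * 2^{-N} contributes at most the final 1 over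
     its length. *)
  destruct (pow_half_lt (1 / (32 * (y - x) + 1))) as [N HN]; [apply Rdiv_lt_0_compat; lra|]. specialize (HN N (le_n N)).
  apply Rlt_div_r in HN; [|lra]. destruct (Hi N) as [I1 I2].
  apply Rle_trans with (RInt (fun t => 4 * Rpart (r t) N + 32 * (/2) ^ N) x y).
  - apply RInt_le; [assumption|assumption| |intros; apply Hpt]. apply ex_RInt_Rplus; [now apply ex_RInt_Rscal|apply ex_RInt_const].
  - rewrite RInt_Rplus; [|now apply ex_RInt_Rscal|apply ex_RInt_const]. rewrite RInt_Rscal, RInt_Rconst by assumption.
    pose proof (pow_le (/2) N ltac:(lra)). pose proof PI_RGT_0. assert (0 <= PI * (/2) ^ N) by nra. nra.
Qed.

Lemma S0_mult_HdB G : entire G -> (forall z, 0 <= Im z -> Cmod (G z) <= Cmod (E z)) -> (forall z, 0 <= Im z -> Cmod (Cstar G z) <= Cmod (E z)) ->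
  HdB (Csq E) (fun z => G z * S0 z)%C.
Proof.
  intros HG H1 H2. assert (HF : entire (fun z => G z * S0 z)%C) by (intros z; apply Cdiff_mult; [apply HG|apply HS]).
  assert (Hint : forall x y, ex_RInt (fun t : R => Cmod (qE E (fun z => G z * S0 z)%C t) ^ 2) x y).
  { intros x y. apply (sq_ex_RInt (qE E (fun z => G z * S0 z)%C)). intros t. now apply (qE_rcont (fun z => G z * S0 z)%C). }
  apply (HdB_intro E HB _ 8 (64 * PI + 1)); [assumption| | |assumption|].
  - intros z Hz. rewrite Cmod_mult. pose proof (H1 z ltac:(lra)). pose proof (S0_le z _ (fun n => c_bound n z ltac:(lra))).
    pose proof (Cmod_ge_0 (G z)). pose proof (Cmod_ge_0 (S0 z)). pose proof (Cmod_ge_0 (E z)).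
    apply Rle_trans with (Cmod (E z) * (2 * (2 * Cmod (E z)))); [apply Rmult_le_compat; assumption|nra].
  - intros z Hz. replace (Cstar (fun z => G z * S0 z)%C z) with (Cstar G z * Cconj (S0 (Cconj z)))%C by (unfold Cstar; now rewrite Cmult_conj).
    rewrite Cmod_mult, Cmod_conj. pose proof (H2 z ltac:(lra)). pose proof (S0_le (Cconj z) _ (fun n => c_star_bound n z Hz)).
    pose proof (Cmod_ge_0 (Cstar G z)). pose proof (Cmod_ge_0 (S0 (Cconj z))). pose proof (Cmod_ge_0 (E z)).
    apply Rle_trans with (Cmod (E z) * (2 * (4 * Cmod (E z)))); [apply Rmult_le_compat; assumption|nra].
  - intros x y Hxy. eapply Rle_trans; [|apply (S0_L2 x y Hxy)]. apply RInt_le; [assumption|apply Hint| |].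
    + apply (sq_ex_RInt (fun t => S0 t / E t)%C). intros u. now apply (quot_rcont S0).
    + intros t _. apply pow_incr. split; [apply Cmod_ge_0|]. pose proof (nz_real t) as Hn. pose proof (proj1 (Cmod_gt_0 _) Hn) as Hp.
      unfold qE, Csq. rewrite !Cmod_div, !Cmod_mult by (try apply Cmult_neq_0; assumption).
      pose proof (H1 t ltac:(simpl; lra)). apply (proj2 (Rle_div_l _ _ _ (Rmult_lt_0_compat _ _ Hp Hp))).
      replace (Cmod (S0 t) / Cmod (E t) * (Cmod (E t) * Cmod (E t))) with (Cmod (E t) * Cmod (S0 t)) by (field; lra).
      apply Rmult_le_compat_r; [apply Cmod_ge_0|assumption].
Qed.

(* E^* F1' and E F2', where F1 = E S0 and F2 = E^* S0, differ by Theta' E^2 S0. *)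
Lemma theta_deriv_L2 : exists (g1 g2 : R -> R) K, 0 <= K /\ (forall t, 0 <= g1 t) /\ (forall t, 0 <= g2 t) /\
  (forall t : R, Cmod (C_derive (th E) t * (S0 t / E t)) <= g1 t + g2 t) /\
  (forall x y, ex_RInt (fun t => g1 t ^ 2) x y) /\ (forall x y, ex_RInt (fun t => g2 t ^ 2) x y) /\
  forall x y, x <= y -> RInt (fun t => g1 t ^ 2) x y + RInt (fun t => g2 t ^ 2) x y <= K.
Proof.
  assert (Hst : forall z, Cstar (Cstar E) z = E z) by (intros z; now rewrite Cstar_star).
  destruct (Hclosed _ (S0_mult_HdB E (hb_entire E HB) (fun z _ => Rle_refl _) (fun z Hz => hb_le E HB z Hz))) as [dF1 [D1 M1]].
  destruct (Hclosed _ (S0_mult_HdB (Cstar E) (entire_star E (hb_entire E HB)) (fun z Hz => hb_le E HB z Hz)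
    (fun z Hz => Req_le _ _ (f_equal Cmod (Hst z))))) as [dF2 [D2 M2]].
  destruct (RInt_gen_bound _ (fun t => powp_ge0 _ _) (proj2 (proj2 (proj2 (proj2 (proj2 M1)))))) as [I1 [K1 HK1]].
  destruct (RInt_gen_bound _ (fun t => powp_ge0 _ _) (proj2 (proj2 (proj2 (proj2 (proj2 M2)))))) as [I2 [K2 HK2]].
  assert (Ee : forall dF : C -> C, (fun t : R => powp (Cmod (dF t / Csq E t)) 2) = (fun t : R => Cmod (qE E dF t) ^ 2)).
  { intros dF. apply functional_extensionality. intros t. now rewrite powp_2 by apply Cmod_ge_0. }
  rewrite Ee in I1, HK1, I2, HK2.
  exists (fun t : R => Cmod (qE E dF1 (RtoC t))), (fun t : R => Cmod (qE E dF2 (RtoC t))), (Rmax 0 K1 + Rmax 0 K2).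
  split; [pose proof (Rmax_l 0 K1); pose proof (Rmax_l 0 K2); lra|]. split; [intros; apply Cmod_ge_0|]. split; [intros; apply Cmod_ge_0|].
  split; [|split; [assumption|split; [assumption|]]].
  - intros t. pose proof (nz_real t) as Hn.
    set (e' := C_derive E t). set (f' := C_derive (Cstar E) t). set (s' := C_derive S0 t).
    assert (A1 : dF1 (RtoC t) = (e' * S0 t + E t * s')%C).
    { rewrite <- (C_derive_cd _ _ _ (proj1 (is_derive_cd _ _ _) (D1 (RtoC t)))). apply C_derive_cd.
      apply (cd_mult E S0); apply cd_C_derive; [now apply hb_entire|apply HS]. }
    assert (A2 : dF2 (RtoC t) = (f' * S0 t + Cstar E t * s')%C).
    { rewrite <- (C_derive_cd _ _ _ (proj1 (is_derive_cd _ _ _) (D2 (RtoC t)))). apply C_derive_cd.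
      apply (cd_mult (Cstar E) S0); apply cd_C_derive; [apply entire_star; now apply hb_entire|apply HS]. }
    assert (A3 : C_derive (th E) t = ((f' * E t - Cstar E t * e') / (E t * E t))%C).
    { apply C_derive_cd. apply (cd_div (Cstar E) E); [apply cd_C_derive, entire_star, hb_entire, HB|apply cd_C_derive, hb_entire, HB|assumption]. }
    replace (C_derive (th E) t * (S0 t / E t))%C with (qE E dF2 (RtoC t) - th E t * qE E dF1 (RtoC t))%C.
    + eapply Rle_trans; [apply Cmod_triangle|]. rewrite Cmod_opp, Cmod_mult.
      pose proof (th_le E HB phi Hd Hphi Hclosed t ltac:(simpl; lra)). pose proof (Cmod_ge_0 (qE E dF1 (RtoC t))). nra.
    + rewrite A3. unfold qE, Csq, th. rewrite A1, A2. field. assumption.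
  - intros x y Hxy. specialize (HK1 x y Hxy). specialize (HK2 x y Hxy). pose proof (Rmax_r 0 K1). pose proof (Rmax_r 0 K2). lra.
Qed.

(** A phase increase of 1/2 multiplies Theta by exp i, and this is a lower bound for the resulting
    increment of Theta - conj (Theta w) Theta^2 / 2, since |Theta w| <= 1. *)
Lemma arc_const : 0 < Cmod (eia 1 - 1) * (1 - Cmod (eia 1 + 1) / 2).
Proof.
  assert (Hc : cos 1 < 1) by (rewrite <- cos_0 at 2; apply cos_decreasing_1; pose proof PI_RGT_0; pose proof PI2_1; lra).
  assert (Hs : sin 1 ^ 2 + cos 1 ^ 2 = 1) by (pose proof (sin2_cos2 1) as H; unfold Rsqr in H; lra).
  assert (H1 : Cmod (eia 1 - 1) ^ 2 = 2 - 2 * cos 1) by (rewrite Cmod2_alt; simpl; simpl in Hs; nra).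
  assert (H2 : Cmod (eia 1 + 1) ^ 2 = 2 + 2 * cos 1) by (rewrite Cmod2_alt; simpl; simpl in Hs; nra).
  pose proof (Cmod_ge_0 (eia 1 - 1)). pose proof (Cmod_ge_0 (eia 1 + 1)). apply Rmult_lt_0_compat; nra.
Qed.

Variable L : R.
Hypothesis HL : 0 < L.
Hypothesis HLc : 16 / L <= Cmod (eia 1 - 1) * (1 - Cmod (eia 1 + 1) / 2).
Hypothesis Hsep : forall n m, n <> m -> L * 2 ^ n + 1 <= Rabs (a n - a m).
Hypothesis Hhump : forall n, phi (a n) + 1 / 2 <= phi (a n + v n).

Lemma no_phase_humps : False.
Proof.
  destruct theta_deriv_L2 as [g1 [g2 [K [HK [G1 [G2 [Hg [I1 [I2 HI]]]]]]]]].
  set (c1 := Cmod (eia 1 - 1) * (1 - Cmod (eia 1 + 1) / 2)) in *.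
  pose proof arc_const as Hc1. fold c1 in Hc1.
  pose proof (phi_cont phi Hd) as Hpc.
  assert (Hth_h : forall t : R, holn (th E) t) by (intros t; apply (th_holn E HB), nz_real).
  assert (Hthc : forall t : R, ccont (th E) t) by (intros t; apply Cdiff_ccont, holn_Cdiff, Hth_h).
  assert (Hthc' : forall t : R, ccont (C_derive (th E)) t) by (intros t; apply Cdiff_ccont, Cdiff_C_derive, Hth_h).
  assert (Hmain : forall n, c1 / 2 <= (/2) ^ n * (K + 2)).
  { intros n. destruct (v_pos n) as [Hv Hv1].
    (* Shortening the interval makes the increase exactly 1/2, so both the increment of [P] and the
       integral of |Theta'| are known. *)
    destruct (IVT_gen phi (a n) (a n + v n) (phi (a n) + 1 / 2)) as [s [Hs Hps]].
    { intros t. apply continuity_pt_filterlim, Hpc. }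
    { specialize (Hhump n). rewrite Rmin_left, Rmax_right by lra. lra. }
    rewrite Rmin_left, Rmax_right in Hs by lra. set (x := a n) in *.
    set (wb := Cconj (w n)).
    set (g := fun t : R => (C_derive (th E) t * (S0 t / E t) * (t - wb))%C).
    (* Multiplied by (t - conj w_n) / E, the n-th term becomes b_n (1 - conj (Theta w_n) Theta). [P]
       is a primitive of Theta' times the bracket, and [rr] collects the other terms. *)
    set (P := fun z => (th E z - Cconj (th E (w n)) * (th E z * th E z) / 2)%C).
    set (f := fun z => (C_derive (th E) z * (1 - Cconj (th E (w n)) * th E z))%C).
    set (rr := fun t : R => (S0 t / E t * (t - wb) - b n * (1 - Cconj (th E (w n)) * th E t))%C).
    assert (Cf : forall t : R, ccont f t).
    { intros t. unfold f. apply Cdiff_ccont. apply Cdiff_mult; [apply Cdiff_C_derive, Hth_h|].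
      apply Cdiff_minus; [apply Cdiff_const|]. apply Cdiff_mult; [apply Cdiff_const|apply holn_Cdiff, Hth_h]. }
    assert (Rth' : forall t : R, rcont (fun t : R => C_derive (th E) t) t) by (intros t; apply (rcont_comp (C_derive (th E)) (fun t => RtoC t)); [apply Hthc'|apply rcont_RtoC]).
    assert (Rth : forall t : R, rcont (fun t : R => th E t) t) by (intros t; apply (rcont_comp (th E) (fun t => RtoC t)); [apply Hthc|apply rcont_RtoC]).
    assert (Rlin : forall t : R, rcont (fun t : R => (t - wb)%C) t).
    { intros t. apply (rcont_comp (fun z => z - wb)%C (fun t => RtoC t)); [|apply rcont_RtoC]. apply Cdiff_ccont. auto with cdiff. }
    assert (Rq : forall t : R, rcont (fun t : R => S0 t / E t)%C t) by (intros t; now apply (quot_rcont S0)).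
    assert (Rg : forall t : R, rcont g t) by (intros t; unfold g; apply (rcont_mult (fun t : R => C_derive (th E) t * (S0 t / E t))%C); [now apply (rcont_mult (fun t : R => C_derive (th E) t))|apply Rlin]).
    assert (Rm : forall t : R, rcont (fun t : R => RtoC (b n) * f t)%C t) by (intros t; apply (rcont_scal (b n) (fun t : R => f t)); apply (rcont_comp f (fun t => RtoC t)); [apply Cf|apply rcont_RtoC]).
    assert (Rr : forall t : R, rcont (fun t : R => C_derive (th E) t * rr t)%C t).
    { intros t. apply (rcont_ext (fun t : R => g t + (- (1)) * (RtoC (b n) * f t))%C).
      - intros u. unfold g, rr, f. ring.
      - apply (rcont_plus g); [apply Rg|]. apply (rcont_scal (- (1))%C (fun t : R => RtoC (b n) * f t)%C), Rm. }
    assert (Eg : CI g x s = (RtoC (b n) * (P s - P x) + CI (fun t : R => C_derive (th E) t * rr t) x s)%C).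
    { rewrite (CI_ext g (fun t : R => RtoC (b n) * f t + C_derive (th E) t * rr t)%C).
      - rewrite (CI_plus (fun t : R => RtoC (b n) * f t)%C); [|intros; apply Rm|intros; apply Rr]. f_equal.
        rewrite (CI_scal (b n) (fun t : R => f t)).
        2:{ intros t _. apply (rcont_comp f (fun t => RtoC t)); [apply Cf|apply rcont_RtoC]. }
        f_equal. assert (Ez : forall t : R, (0 + t * 1)%C = RtoC t) by (intros; ring).
        transitivity (CI (fun t : R => f (0 + t * 1) * 1)%C x s).
        + apply CI_ext. intros t _. rewrite Ez. ring.
        + rewrite (CI_FTC P); [now rewrite !Ez| |].
          * intros t _. rewrite Ez. pose proof (cd_C_derive _ _ (holn_Cdiff _ _ (Hth_h t))) as Hc. unfold P, f.
            apply (cd_ext (fun z => th E z - (Cconj (th E (w n)) / 2) * (th E z * th E z))%C); [intros z; field; apply C2_ne|].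
            replace (C_derive (th E) t * (1 - Cconj (th E (w n)) * th E t))%C
              with (C_derive (th E) t - (Cconj (th E (w n)) / 2) * (C_derive (th E) t * th E t + th E t * C_derive (th E) t))%C
              by (field; apply C2_ne).
            apply (cd_minus (th E)); [assumption|]. apply (cd_scal (Cconj (th E (w n)) / 2)%C (fun z => th E z * th E z)%C). now apply (cd_mult (th E) (th E)).
          * intros t _. rewrite Ez. apply Cf.
      - intros t _. unfold g, rr, f. ring. }
    (* upper bound for the integral over the short interval, by Cauchy-Schwarz in the weighted AM-GM form *)
    set (lam := (/4) ^ n). assert (Hlam : 0 < lam) by (apply pow_lt; lra).
    assert (Hlv : lam * lam = v n) by (unfold lam, v; rewrite <- Rpow_mult_distr; f_equal; field).
    assert (Hup : Cmod (CI g x s) <= v n * (lam * K) + v n * (2 * lam)).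
    { set (maj := fun t => v n * lam * (g1 t ^ 2) + (v n * lam * (g2 t ^ 2) + v n * (2 / lam))).
      assert (J1 : forall u1 u2, ex_RInt (fun t => v n * lam * (g1 t ^ 2)) u1 u2) by (intros; apply ex_RInt_Rscal, I1).
      assert (J2 : forall u1 u2, ex_RInt (fun t => v n * lam * (g2 t ^ 2)) u1 u2) by (intros; apply ex_RInt_Rscal, I2).
      assert (J3 : forall u1 u2 k, ex_RInt (fun _ : R => k : R) u1 u2) by (intros; apply ex_RInt_const).
      assert (J4 : forall u1 u2, ex_RInt (fun t => v n * lam * (g2 t ^ 2) + v n * (2 / lam)) u1 u2) by (intros; apply ex_RInt_Rplus; [apply J2|apply J3]).
      eapply Rle_trans; [apply (CI_le g maj)|].
      - lra.
      - intros t _. apply Rg.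
      - apply ex_RInt_Rplus; [apply J1|apply J4].
      - intros t Ht. unfold g. rewrite Cmod_mult.
        assert (Hd2 : Cmod (t - wb) <= 2 * v n).
        { eapply Rle_trans; [apply Cmod_le_ReIm|]. replace (Re (t - wb)) with (t - x) by (unfold wb, w; simpl; unfold x; ring).
          replace (Im (t - wb)) with (v n) by (unfold wb, w; simpl; ring). rewrite !Rabs_pos_eq by lra. lra. }
        specialize (Hg t). pose proof (Cmod_ge_0 (C_derive (th E) t * (S0 t / E t))). pose proof (Cmod_ge_0 (t - wb)).
        apply Rle_trans with ((g1 t + g2 t) * (2 * v n)); [apply Rmult_le_compat; assumption|].
        assert (Ham : forall y, 2 * y <= lam * y ^ 2 + / lam).
        { intros y. assert (0 <= (lam * y - 1) ^ 2) by apply pow2_ge_0. apply (Rmult_le_reg_l lam); [assumption|].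
          replace (lam * (lam * y ^ 2 + / lam)) with (lam ^ 2 * y ^ 2 + 1) by (field; lra). nra. }
        pose proof (Ham (g1 t)). pose proof (Ham (g2 t)). unfold maj, Rdiv. nra.
      - unfold maj. rewrite RInt_Rplus; [|apply J1|apply J4]. rewrite RInt_Rplus; [|apply J2|apply J3].
        rewrite !RInt_Rscal, RInt_Rconst by (apply I1 || apply I2). specialize (HI x s ltac:(lra)).
        assert (Hq : (s - x) * (v n * (2 / lam)) <= v n * (2 * lam)).
        { apply Rle_trans with (v n * (v n * (2 / lam))).
          - apply Rmult_le_compat_r; [|lra]. apply Rmult_le_pos; [lra|]. apply Rdiv_le_0_compat; lra.
          - rewrite <- Hlv at 2. right. field. lra. }
        assert (0 <= v n * lam) by nra. nra. }
    (* lower bound: the n-th term dominates on this interval *)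
    set (rho := 8 / L * b n).
    assert (Hbn : 0 < b n) by apply b_pos.
    assert (HbV : v n / 2 ^ n = b n).
    { rewrite <- (Rmult_1_l (2 ^ n)), <- Rmult_1_l. unfold v, b. unfold Rdiv. rewrite Rmult_1_l. rewrite Rmult_1_l, <- pow_inv, <- Rpow_mult_distr. f_equal. field. }
    assert (Hr : forall t, x <= t <= s -> Cmod (rr t) <= rho).
    { intros t Ht. pose proof (nz_real t) as Hn. pose proof (proj1 (Cmod_gt_0 _) Hn) as Hp.
      assert (Hfar : forall k, k <> n -> L * 2 ^ n <= Rabs (t - a k)).
      { intros k Hk. specialize (Hsep n k ltac:(auto)). fold x in Hsep. pose proof (Rabs_triang (x - t) (t - a k)) as Htr. replace (x - t + (t - a k)) with (x - a k) in Htr by ring.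
        assert (Rabs (x - t) <= 1) by (apply Rabs_le; lra). lra. }
      assert (H2n : 0 < 2 ^ n) by (apply pow_lt; lra). assert (HLn : 0 < L * 2 ^ n) by nra.
      set (c' := fun k => if Nat.eq_dec k n then RtoC 0 else c k t).
      assert (Hc' : forall k, Cmod (c' k) <= (2 * Cmod (E t) / (L * 2 ^ n)) * (/2) ^ k).
      { intros k. unfold c'. destruct (Nat.eq_dec k n) as [->|Hk].
        - rewrite Cmod_0. apply Rmult_le_pos; [apply Rdiv_le_0_compat; lra|apply pow_le; lra].
        - pose proof (dk_bound E HB (w k) t (proj1 (v_pos k)) ltac:(simpl; lra)) as H. specialize (Hfar k Hk).
          assert (Hre : Rabs (t - a k) <= Cmod (t - Cconj (w k))).
          { eapply Rle_trans; [|apply Rmax_Cmod]. eapply Rle_trans; [|apply Rmax_l]. right. f_equal. }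
          unfold c. rewrite Cmod_mult, Cmod_R, Rabs_pos_eq by (left; apply b_pos). rewrite Rmult_comm.
          apply Rmult_le_compat; [apply Cmod_ge_0|left; apply b_pos| |].
          + apply (proj1 (Rle_div_r _ _ _ HLn)). pose proof (Cmod_ge_0 (dk E (w k) t)). nra.
          + apply pow_incr. lra. }
      set (X := 2 * Cmod (E t) / (L * 2 ^ n)) in *.
      assert (Hlim : Cmod (S0 t - c n t) <= 2 * X).
      { apply (limit_le (Cpart (fun k => c k t)) (S0 t) (c n t) _ _ (S n) (HSl t _ (fun k => c_bound k t ltac:(simpl; lra)))).
        intros N HN. rewrite (Cpart_split (fun k => c k t) n N) by lia. fold c'.
        replace (Cpart c' N + c n t - c n t)%C with (Cpart c' N) by ring. now apply Cpart_bound. }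
      assert (Hd2 : Cmod (t - wb) <= 2 * v n).
      { eapply Rle_trans; [apply Cmod_le_ReIm|]. replace (Re (t - wb)) with (t - x) by (unfold wb, w; simpl; unfold x; ring).
        replace (Im (t - wb)) with (v n) by (unfold wb, w; simpl; ring). rewrite !Rabs_pos_eq by lra. lra. }
      replace (rr t) with ((S0 t - c n t) / E t * (t - wb))%C.
      - rewrite Cmod_mult, Cmod_div by assumption. unfold rho. rewrite <- HbV.
        apply Rle_trans with (2 * X / Cmod (E t) * (2 * v n)).
        + apply Rmult_le_compat; [apply Rdiv_le_0_compat; [apply Cmod_ge_0|assumption]|apply Cmod_ge_0| |assumption].
          apply Rmult_le_compat_r; [left; now apply Rinv_0_lt_compat|assumption].
        + unfold X. right. field. repeat split; lra.
      - unfold rr, c. pose proof (dk_eq E HB (w n) t Hv) as Ed. fold wb in Ed.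
        replace ((S0 t - b n * dk E (w n) t) / E t * (t - wb))%C with (S0 t / E t * (t - wb) - b n * (dk E (w n) t * (t - wb)) / E t)%C by (field; assumption).
        rewrite Ed. unfold th. field. assumption. }
    assert (Hrho : 0 <= rho) by (unfold rho; apply Rmult_le_pos; [apply Rdiv_le_0_compat; lra|lra]).
    assert (Hdc : forall t, continuous (Derive phi) t).
    { intros t. apply (continuous_ext (fun t : R => / 2 * Cmod (C_derive (th E) t))).
      - intros u. rewrite (th_deriv E HB phi Hd Hphi Hclosed u), Cmod_mult, (th_real E HB phi Hd Hphi Hclosed u), Cmod_eia, Rmult_1_r.
        replace ((0, 2 * Derive phi u) : C) with (Ci * RtoC (2 * Derive phi u))%C by (Cext).
        rewrite Cmod_mult, Cmod_R, Cmod_Ci.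
        pose proof (phi'_ge0 E HB phi Hd Hphi Hclosed u). rewrite Rabs_pos_eq by lra. lra.
      - apply (continuous_scal_r (/2) (fun t : R => Cmod (C_derive (th E) t))). apply rcont_Cmod, Rth'. }
    (* |Theta'| = 2 phi', whose integral over the interval is exactly 1. *)
    assert (Hlow : Cmod (CI (fun t : R => C_derive (th E) t * rr t)%C x s) <= rho).
    { assert (Hip : is_RInt (Derive phi) x s (phi s - phi x)).
      { apply (is_RInt_derive (V := R_CompleteNormedModule) phi); [intros t _; apply Derive_correct, Hd|intros t _; apply Hdc]. }
      assert (J : ex_RInt (Derive phi) x s) by (eexists; exact Hip).
      eapply Rle_trans; [apply (CI_le _ (fun t => 2 * rho * Derive phi t))|].
      - lra.
      - intros t _. apply Rr.
      - now apply ex_RInt_Rscal.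
      - intros t Ht. rewrite Cmod_mult, (th_deriv E HB phi Hd Hphi Hclosed t), Cmod_mult, (th_real E HB phi Hd Hphi Hclosed t), Cmod_eia, Rmult_1_r.
        replace ((0, 2 * Derive phi t) : C) with (Ci * RtoC (2 * Derive phi t))%C by (Cext).
        rewrite Cmod_mult, Cmod_R, Cmod_Ci.
        pose proof (phi'_ge0 E HB phi Hd Hphi Hclosed t). rewrite Rabs_pos_eq by lra. specialize (Hr t Ht). pose proof (Cmod_ge_0 (rr t)). nra.
      - rewrite RInt_Rscal by assumption. rewrite (is_RInt_unique _ _ _ _ Hip), Hps. fold x. lra. }
    assert (HP : c1 <= Cmod (P s - P x)).
    { unfold P. set (tn := Cconj (th E (w n))).
      assert (Htn : Cmod tn <= 1) by (unfold tn; rewrite Cmod_conj; left; apply th_lt; [assumption|exact Hv]).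
      rewrite !(th_real E HB phi Hd Hphi Hclosed). rewrite Hps. fold x. replace (2 * (phi x + 1 / 2)) with (2 * phi x + 1) by field. rewrite <- eia_plus.
      set (u := eia (2 * phi x)). assert (Hu : Cmod u = 1) by apply Cmod_eia.
      replace (u * eia 1 - tn * (u * eia 1 * (u * eia 1)) / 2 - (u - tn * (u * u) / 2))%C with (u * (eia 1 - 1) * (1 - tn * u * (eia 1 + 1) / 2))%C
        by (field; apply C2_ne).
      rewrite !Cmod_mult, Hu, Rmult_1_l. unfold c1. apply Rmult_le_compat_l; [apply Cmod_ge_0|].
      pose proof (Cmod_rev 1 (tn * u * (eia 1 + 1) / 2)) as Hv2. rewrite Cmod_1 in Hv2.
      assert (H2 : Cmod (tn * u * (eia 1 + 1) / 2) <= Cmod (eia 1 + 1) / 2); [|lra].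
      rewrite Cmod_div by apply C2_ne. rewrite !Cmod_mult, Hu, Cmod_R, Rabs_pos_eq by lra.
      pose proof (Cmod_ge_0 (eia 1 + 1)). pose proof (Cmod_ge_0 tn). nra. }
    assert (Hfin : b n * c1 - rho <= v n * (lam * K) + v n * (2 * lam)).
    { pose proof (Cmod_rev (RtoC (b n) * (P s - P x))%C (- CI (fun t : R => C_derive (th E) t * rr t)%C x s)%C) as Hrv.
      replace (RtoC (b n) * (P s - P x) - - CI (fun t : R => C_derive (th E) t * rr t) x s)%C with (CI g x s) in Hrv by (rewrite Eg; ring).
      rewrite Cmod_opp, Cmod_mult, Cmod_R, (Rabs_pos_eq (b n)) in Hrv by lra. nra. }
    assert (Hvl : v n * lam = b n * (/2) ^ n).
    { unfold v, lam, b. rewrite <- !Rpow_mult_distr. f_equal. field. }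
    (* The choice of L makes 8 / L at most c1 / 2, so dividing by b_n leaves c1 / 2 <= 2^{-n} (K +
       2), which fails for large n. *)
    assert (Hdiv : b n * (c1 - 8 / L) <= b n * ((/2) ^ n * (K + 2))).
    { unfold rho in Hfin. replace (b n * ((/2) ^ n * (K + 2))) with (v n * lam * (K + 2)) by (rewrite Hvl; ring). lra. }
    apply Rmult_le_reg_l in Hdiv; [|assumption]. replace (16 / L) with (2 * (8 / L)) in HLc by (field; lra). lra. }
  destruct (pow_half_lt (c1 / 2 / (K + 2))) as [N HN]; [apply Rdiv_lt_0_compat; lra|].
  specialize (HN N (le_n N)). apply Rlt_div_r in HN; [|lra]. specialize (Hmain N). lra.
Qed.
End Hump.

(** * A uniform modulus for the phase and the lower bound for Theta *)

Section Gap.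
Variable E : C -> C.
Hypothesis HB : Hermite_Biehler E.
Variable phi : R -> R.
Hypothesis Hd : forall x, ex_derive phi x.
Hypothesis Hphi : forall x : R, Im (eia (phi x) * E x)%C = 0.
Hypothesis Hclosed : forall F, HdB (Csq E) F -> exists dF, (forall z, is_derive F z (dF z)) /\ HdB (Csq E) dF.

(** On bounded sets uniform continuity forbids an increase of 1/2 over very short intervals, so
    intervals violating the claim exist arbitrarily far out. They can be chosen as sparse as
    [no_phase_humps] demands. *)
Lemma phase_gap : exists l, 0 < l /\ forall x, phi (x + l) < phi x + 1 / 2.
Proof.
  apply NNPP. intros HN.
  pose proof (phi_mono E HB phi Hd Hphi Hclosed) as Hmono.
  assert (H1 : forall l, 0 < l -> exists x, phi x + 1 / 2 <= phi (x + l)).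
  { intros l Hl. apply NNPP. intros H. apply HN. exists l. split; [assumption|]. intros x. apply Rnot_le_lt. intros Hx. apply H. now exists x. }
  assert (H2 : forall (p : R * R), 0 < snd p -> exists x, fst p <= Rabs x /\ phi x + 1 / 2 <= phi (x + snd p)).
  { intros [R0 l] Hl; simpl in Hl |- *. destruct (Rle_lt_dec R0 0) as [HR|HR].
    - destruct (H1 l Hl) as [x Hx]. exists x. split; [pose proof (Rabs_pos x); lra|assumption].
    - assert (Hpc : forall x, - R0 - 1 <= x <= R0 + 1 -> continuity_pt phi x) by (intros x _; apply continuity_pt_filterlim, (phi_cont phi Hd)).
      destruct (Heine_cor2 Hpc (mkposreal (1/2) ltac:(lra))) as [d Hu].
      pose proof (cond_pos d) as Hdp. set (l' := Rmin (Rmin l 1) (d / 2)).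
      assert (Hl' : 0 < l' /\ l' <= l /\ l' <= 1 /\ l' < d).
      { unfold l'. pose proof (Rmin_l (Rmin l 1) (d / 2)). pose proof (Rmin_r (Rmin l 1) (d / 2)). pose proof (Rmin_l l 1). pose proof (Rmin_r l 1).
        assert (0 < Rmin (Rmin l 1) (d / 2)) by (repeat apply Rmin_glb_lt; lra). lra. }
      destruct (H1 l' (proj1 Hl')) as [x Hx]. exists x. split.
      + apply Rnot_lt_le. intros Hlt. apply Rabs_def2 in Hlt.
        specialize (Hu (x + l') x ltac:(lra) ltac:(lra)). simpl in Hu. replace (x + l' - x) with l' in Hu by ring.
        rewrite Rabs_pos_eq in Hu by lra. specialize (Hu ltac:(lra)). apply Rabs_def2 in Hu. lra.
      + eapply Rle_trans; [exact Hx|]. apply Hmono. lra. }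
  assert (H3 : exists pick : R * R -> R, forall p, 0 < snd p -> fst p <= Rabs (pick p) /\ phi (pick p) + 1 / 2 <= phi (pick p + snd p)).
  { exists (fun p => epsilon (inhabits 0) (fun x => fst p <= Rabs x /\ phi x + 1 / 2 <= phi (x + snd p))).
    intros p Hp. apply epsilon_spec. now apply H2. }
  destruct H3 as [pick Hpick].
  set (c1 := Cmod (eia 1 - 1) * (1 - Cmod (eia 1 + 1) / 2)). pose proof arc_const as Hc1. fold c1 in Hc1.
  set (L := 16 / c1). assert (HL : 0 < L) by (apply Rdiv_lt_0_compat; lra).
  (* Each point is taken beyond the previous one by L 2^m + 1 in absolute value, which yields the
     separation from all earlier points at once. *)
  set (a := fix a n := match n with O => pick (0, 1) | S m => pick (Rabs (a m) + L * 2 ^ (S m) + 1, (/16) ^ (S m)) end).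
  assert (Hv : forall n, 0 < (/16) ^ n) by (intros n; apply pow_lt; lra).
  assert (Hgrow : forall n m, (n < m)%nat -> Rabs (a n) + L * 2 ^ m + 1 <= Rabs (a m)).
  { intros n m; revert n. induction m; intros n Hn; [lia|].
    assert (Hs : Rabs (a m) + L * 2 ^ (S m) + 1 <= Rabs (a (S m))).
    { apply (proj1 (Hpick (Rabs (a m) + L * 2 ^ (S m) + 1, (/16) ^ (S m)) (Hv (S m)))). }
    destruct (Nat.eq_dec n m) as [->|Hne]; [exact Hs|]. specialize (IHm n ltac:(lia)).
    assert (0 < L * 2 ^ m) by (apply Rmult_lt_0_compat; [assumption|apply pow_lt; lra]). lra. }
  destruct (S0_ex E HB a) as [S0 [HS HSl]].
  apply (no_phase_humps E HB phi Hd Hphi Hclosed a S0 HS HSl L HL).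
  - fold c1. unfold L. right. field. lra.
  - assert (Hlt : forall n m, (n < m)%nat -> L * 2 ^ n + 1 <= Rabs (a n - a m) /\ L * 2 ^ m + 1 <= Rabs (a n - a m)).
    { intros n m Hnm. pose proof (Hgrow n m Hnm) as Hg. pose proof (Rabs_triang_inv (a m) (a n)) as Ht. rewrite Rabs_minus_sym in Ht.
      assert (2 ^ n <= 2 ^ m) by (apply Rle_pow; [lra|lia]). split; nra. }
    intros n m Hne. destruct (Nat.lt_trichotomy n m) as [H|[H|H]]; [apply (Hlt n m H)|contradiction|].
    rewrite Rabs_minus_sym. apply (Hlt m n H).
  - intros n. destruct n.
    + apply (proj2 (Hpick (0, 1) ltac:(simpl; lra))).
    + apply (proj2 (Hpick (Rabs (a n) + L * 2 ^ (S n) + 1, (/16) ^ (S n)) (Hv (S n)))).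
Qed.

Lemma cos_ge_half psi : Rabs psi <= 1 -> 1 / 2 <= cos psi.
Proof.
  intros H. assert (E0 : cos psi = cos (Rabs psi)) by (unfold Rabs; destruct (Rcase_abs psi); [now rewrite cos_neg|reflexivity]).
  rewrite E0. pose proof (Rabs_pos psi). pose proof PI_RGT_0. assert (1 <= PI / 3) by (pose proof PI2_3_2; lra).
  rewrite <- cos_PI3. apply cos_decr_1; lra.
Qed.

(* The half-disc barrier applied to exp (- conj (Theta x) Theta), whose modulus is at most exp (-1/2)
   on the diameter, propagates Re (conj (Theta x) Theta) >= 1/2 into a strip. *)
Lemma th_lower : exists eta, 0 < eta /\ forall z, 0 <= Im z <= eta -> 1 / 4 <= Cmod (th E z).
Proof.
  destruct phase_gap as [l [Hl Hgap]]. pose proof (phi_mono E HB phi Hd Hphi Hclosed) as Hmono.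
  exists (l / 20). split; [lra|]. intros z [Hz0 Hz].
  destruct Hz0 as [Hz0|Hz0]; [|rewrite (C_real_eq z) by auto; rewrite (th_real E HB phi Hd Hphi Hclosed), Cmod_eia; lra].
  set (x := Re z). set (y := Im z) in *. set (u := Cconj (th E x)).
  assert (Hu : Cmod u = 1) by (unfold u; now rewrite Cmod_conj, (th_real E HB phi Hd Hphi Hclosed), Cmod_eia).
  set (f := fun w => Cexp (- (u * th E (w + x)))).
  assert (Hb : Cmod (f (0, y)) <= exp (- (1 / 2)) * exp (3 / (2 * l) * barrier_re l (0, y))).
  { assert (Hcy : Cmod (0, y) = y).
    { apply Cmod_iy. lra. }
    (* On the arc |f| <= e = exp (-1/2) exp (3/2), and 3/2 <= (3 / (2 l)) (l^2 / Im w) because Im w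
       <= l. *)
    apply (phragmen_half_disc l (3 / (2 * l)) (exp (- (1 / 2))) f); try (simpl; lra).
    - apply Rdiv_le_0_compat; lra.
    - left. apply exp_pos.
    - intros w Hw _. unfold f. apply (Cdiff_Cexp (fun w => - (u * th E (w + x)))%C). apply Cdiff_opp. apply Cdiff_mult; [apply Cdiff_const|].
      apply (Cdiff_comp (th E) (fun w => w + x)%C); [|auto with cdiff]. apply (th_Cdiff E HB). apply (nz_closed E HB phi Hd Hphi Hclosed).
      destruct w; cbn in *; lra.
    - intros w Hw Hwl. rewrite (C_real_eq w Hw) in Hwl |- *. set (s := Re w) in *. rewrite Cmod_R in Hwl. apply Rabs_le_between in Hwl.
      unfold f, u. rewrite <- RtoC_plus, !(th_real E HB phi Hd Hphi Hclosed), eia_conj, eia_plus, Cmod_Cexp. apply exp_le_mono. simpl.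
      assert (Hc : 1 / 2 <= cos (- (2 * phi x) + 2 * phi (s + x))); [|lra]. apply cos_ge_half. apply Rabs_le.
      destruct (Rle_lt_dec 0 s).
      + pose proof (Hmono x (s + x) ltac:(lra)). pose proof (Hmono (s + x) (x + l) ltac:(lra)). specialize (Hgap x). lra.
      + pose proof (Hmono (s + x) x ltac:(lra)). pose proof (Hmono x (s + x + l) ltac:(lra)). specialize (Hgap (s + x)). lra.
    - intros w Hw Hw0. unfold f. rewrite Cmod_Cexp, <- exp_plus. apply exp_le_mono.
      assert (H1 : - Re (u * th E (w + x)) <= 1).
      { pose proof (re_le_Cmod (u * th E (w + x))) as Hre. apply Rabs_le_between in Hre. rewrite Cmod_mult, Hu in Hre.
        assert (Him : 0 <= Im (w + x)) by (destruct w; simpl in *; lra).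
        pose proof (th_le E HB phi Hd Hphi Hclosed (w + x)%C Him). lra. }
      assert (H2 : 3 / 2 <= 3 / (2 * l) * (l ^ 2 / Im w)).
      { assert (Im w <= l) by (pose proof (im_le_Cmod w) as Hi; rewrite Hw in Hi; apply Rabs_le_between in Hi; lra).
        replace (3 / (2 * l) * (l ^ 2 / Im w)) with (3 / 2 * (l / Im w)) by (field; lra).
        assert (1 <= l / Im w) by (apply (proj1 (Rle_div_r _ _ _ Hw0)); lra). lra. }
      change (Re (- (u * th E (w + x)))) with (- Re (u * th E (w + x))). lra. }
  assert (Hbar : barrier_re l (0, y) <= 2 * y * (l / (l - y)) ^ 2).
  { assert (Hcy : Cmod (0, y) = y).
    { apply Cmod_iy. lra. }
    pose proof (barRe_le l (0, y) ltac:(simpl; lra) ltac:(rewrite Hcy; lra)) as H. rewrite Hcy in H. exact H. }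
  assert (Hq : (l / (l - y)) ^ 2 <= 5 / 4).
  { assert (H1 : l / (l - y) <= 20 / 19) by (apply Rle_div_l; lra). assert (0 <= l / (l - y)) by (apply Rdiv_le_0_compat; lra). nra. }
  unfold f in Hb. rewrite Cmod_Cexp, <- exp_plus in Hb.
  assert (Hex : forall s t, exp s <= exp t -> s <= t) by (intros s t [H|H]; [left; now apply exp_lt_inv|right; now apply exp_inv]).
  apply Hex in Hb. replace ((0, y) + x)%C with z in Hb by (unfold x, y; destruct z; unfold RtoC; Cext).
  change (Re (- (u * th E z))) with (- Re (u * th E z)) in Hb.
  (* Heights up to l/20 keep the barrier term at 3/16, so Re (conj (Theta x) Theta) remains at least
     1/2 - 1/4. *)
  assert (H3 : 3 / (2 * l) * barrier_re l (0, y) <= 1 / 4).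
  { apply Rle_trans with (3 / (2 * l) * (2 * (l / 20) * (5 / 4))).
    - apply Rmult_le_compat_l; [apply Rdiv_le_0_compat; lra|]. eapply Rle_trans; [exact Hbar|]. pose proof (pow2_ge_0 (l / (l - y))). nra.
    - replace (3 / (2 * l) * (2 * (l / 20) * (5 / 4))) with (3 / 16) by (field; lra). lra. }
  pose proof (re_le_Cmod (u * th E z)) as Hre. apply Rabs_le_between in Hre. rewrite Cmod_mult, Hu in Hre. lra.
Qed.
End Gap.

(** Reflection in the real axis exchanges E and [Cstar E] up to conjugation, so the lower bound for
    Theta above the axis becomes zero-freeness of E and the bound 4 for Theta below it. *)
Lemma strip_ex E phi : Hermite_Biehler E -> (forall x, ex_derive phi x) -> (forall x : R, Im (eia (phi x) * E x)%C = 0) ->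
  (forall F, HdB (Csq E) F -> exists dF, (forall z, is_derive F z (dF z)) /\ HdB (Csq E) dF) ->
  exists eta, 0 < eta /\ (forall z, - eta < Im z -> E z <> 0%C) /\
    (forall z, 0 < Im z < eta -> Cmod (E z) / 4 <= Cmod (Cstar E z)) /\ (forall z, - eta < Im z -> Cmod (th E z) <= 4).
Proof.
  intros HB Hd Hphi Hclosed. destruct (th_lower E HB phi Hd Hphi Hclosed) as [eta [He Hth]].
  assert (Hn0 : forall z, 0 <= Im z -> E z <> 0%C) by apply (nz_closed E HB phi Hd Hphi Hclosed).
  assert (Hst : forall z, 0 <= Im z < eta -> Cmod (E z) / 4 <= Cmod (Cstar E z)).
  { intros z Hz. pose proof (Hn0 z (proj1 Hz)) as Hn. pose proof (proj1 (Cmod_gt_0 _) Hn) as Hp. specialize (Hth z ltac:(lra)). unfold th in Hth. rewrite Cmod_div in Hth by assumption.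
    apply (proj2 (Rle_div_r _ _ _ Hp)) in Hth. lra. }
  assert (Hlow : forall z, - eta < Im z -> Im z < 0 -> Cmod (Cstar E z) / 4 <= Cmod (E z) /\ E z <> 0%C).
  { intros z H1 H2. assert (Hi : 0 < Im (Cconj z) < eta) by (rewrite im_conj; lra). pose proof (Hst (Cconj z) ltac:(lra)) as H.
    unfold Cstar in H. rewrite Cconj_conj, Cmod_conj in H. unfold Cstar. rewrite Cmod_conj. split; [assumption|].
    apply Cmod_pos_neq. pose proof (proj1 (Cmod_gt_0 _) (Hn0 (Cconj z) ltac:(lra))). lra. }
  assert (Hne : forall z, - eta < Im z -> E z <> 0%C).
  { intros z Hz. destruct (Rle_lt_dec 0 (Im z)) as [H|H]; [now apply Hn0|now apply Hlow]. }
  exists eta. split; [assumption|]. split; [assumption|]. split; [intros z Hz; apply Hst; lra|].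
  intros z Hz. destruct (Rle_lt_dec 0 (Im z)) as [H|H]; [pose proof (th_le E HB phi Hd Hphi Hclosed z H); lra|].
  destruct (Hlow z Hz H) as [H1 H2]. unfold th. rewrite Cmod_div by assumption. apply (proj2 (Rle_div_l _ _ _ (proj1 (Cmod_gt_0 _) H2))). lra.
Qed.

(** * The companion functions A and B *)

Section Bfacts.
Variables (E : C -> C) (alpha : R).
Hypothesis HE : entire E.
Hypothesis HB : Hermite_Biehler E.
Let A := A_alpha E alpha.
Let B := B_alpha E alpha.

Lemma A_entire : entire A.
Proof.
  intros z. unfold A, A_alpha. apply Cdiff_mult; [apply Cdiff_const|]. apply Cdiff_plus; (apply Cdiff_mult; [apply Cdiff_const|]); [apply HE|now apply entire_star].
Qed.
Lemma B_entire : entire B.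
Proof.
  intros z. unfold B, B_alpha. apply Cdiff_mult; [apply Cdiff_const|]. apply Cdiff_minus; (apply Cdiff_mult; [apply Cdiff_const|]); [apply HE|now apply entire_star].
Qed.
Lemma A_star z : Cstar A z = A z.
Proof.
  unfold A, A_alpha, Cstar. rewrite Cmult_conj, Cplus_conj, !Cmult_conj, !eia_conj, Ropp_involutive, !Cconj_conj.
  replace (Cconj (/ 2)) with (/ 2)%C by (apply injective_projections; simpl; field). ring.
Qed.
Lemma B_star z : Cstar B z = B z.
Proof.
  unfold B, B_alpha, Cstar. rewrite Cmult_conj, Cminus_conj, !Cmult_conj, !eia_conj, Ropp_involutive, !Cconj_conj.
  replace (Cconj (Ci / 2)) with (- (Ci / 2))%C by (apply injective_projections; simpl; field). ring.
Qed.
Lemma AB_E z : (eia alpha * E z)%C = (A z - Ci * B z)%C.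
Proof.
  unfold A, B, A_alpha, B_alpha. set (u := (eia alpha * E z)%C). set (v := (eia (- alpha) * Cstar E z)%C).
  assert (E2 : (Ci * (Ci / 2) = - / 2)%C) by (apply injective_projections; simpl; field).
  replace (/ 2 * (u + v) - Ci * (Ci / 2 * (u - v)))%C with (/ 2 * (u + v) - (Ci * (Ci / 2)) * (u - v))%C by ring. rewrite E2. field.
Qed.

(** The rotation of Theta for which A and B are multiples of E (1 + zt) and E (1 - zt). *)
Definition zt (z : C) : C := (eia (- (2 * alpha)) * th E z)%C.

Lemma A_zt z : E z <> 0%C -> A z = (/ 2 * eia alpha * E z * (1 + zt z))%C.
Proof.
  intros H. unfold A, A_alpha, zt, th. replace (eia (- alpha)) with (eia alpha * eia (- (2 * alpha)))%C by (rewrite eia_plus; f_equal; ring). field. assumption.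
Qed.
Lemma B_zt z : E z <> 0%C -> B z = (Ci / 2 * eia alpha * E z * (1 - zt z))%C.
Proof.
  intros H. unfold B, B_alpha, zt, th. replace (eia (- alpha)) with (eia alpha * eia (- (2 * alpha)))%C by (rewrite eia_plus; f_equal; ring). field. assumption.
Qed.
Lemma zt_mod z : Cmod (zt z) = Cmod (th E z).
Proof. unfold zt. rewrite Cmod_mult, Cmod_eia. ring. Qed.
Lemma eia_ne x : eia x <> 0%C.
Proof. apply Cmod_pos_neq. rewrite Cmod_eia. lra. Qed.
Lemma one_minus_ne z : Cmod z < 1 -> (1 - z)%C <> 0%C.
Proof. intros H. apply Cmod_pos_neq. pose proof (Cmod_rev 1 z). rewrite Cmod_1 in H0. lra. Qed.

Lemma B_ne z : Im z <> 0 -> B z <> 0%C.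
Proof.
  assert (HU : forall z, 0 < Im z -> B z <> 0%C).
  { intros u Hu. pose proof (hb_ne E HB u Hu) as Hn. rewrite B_zt by assumption. repeat apply Cmult_neq_0; try assumption.
    - apply Ci_ne.
    - intros H. apply (f_equal (fun w => w * 2)%C) in H. rewrite Cinv_l in H by apply C2_ne. rewrite Cmult_0_l in H. apply RtoC_inj in H. lra.
    - apply eia_ne.
    - apply one_minus_ne. rewrite zt_mod. now apply th_lt. }
  intros Hz. destruct (Rlt_dec 0 (Im z)) as [H|H]; [now apply HU|]. intros H0. rewrite <- B_star in H0. unfold Cstar in H0.
  apply Cconj_neq0 in H0; [assumption|]. apply HU. rewrite im_conj. lra.
Qed.

Variable phi : R -> R.
Hypothesis Hphi : forall x : R, Im (eia (phi x) * E x)%C = 0.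

Lemma B_real (x : R) : B x = (eia (phi x) * E x * sin (phi x - alpha))%C.
Proof.
  unfold B, B_alpha. rewrite (star_real_phase E phi Hphi).
  replace (Ci / 2 * (eia alpha * E x - eia (- alpha) * (eia (2 * phi x) * E x)))%C with (E x * (Ci / 2 * (eia alpha - eia (- alpha) * eia (2 * phi x))))%C by ring.
  rewrite (Cmult_comm (eia (phi x))), <- Cmult_assoc. f_equal. rewrite eia_plus.
  replace (eia alpha) with (eia (phi x) * eia (- (phi x - alpha)))%C by (rewrite eia_plus; f_equal; ring).
  replace (eia (- alpha + 2 * phi x)) with (eia (phi x) * eia (phi x - alpha))%C by (rewrite eia_plus; f_equal; ring).
  replace (Ci / 2 * (eia (phi x) * eia (- (phi x - alpha)) - eia (phi x) * eia (phi x - alpha)))%C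
    with (eia (phi x) * (Ci / 2 * (eia (- (phi x - alpha)) - eia (phi x - alpha))))%C by ring.
  f_equal. unfold eia. rewrite cos_neg, sin_neg. apply injective_projections; simpl; field.
Qed.

Hypothesis Hnr : forall x : R, E x <> 0%C.

Lemma B_zero_iff (x : R) : B x = 0%C <-> T_set phi alpha x.
Proof.
  rewrite B_real. split.
  - intros H. destruct (Ceq_dec (sin (phi x - alpha)) 0) as [Hs|Hs].
    + apply RtoC_inj in Hs. destruct (sin_eq_0_0 _ Hs) as [k Hk]. exists k. lra.
    + exfalso. revert H. repeat apply Cmult_neq_0; [apply eia_ne|apply Hnr|assumption].
  - intros [k Hk]. replace (phi x - alpha) with (IZR k * PI) by lra. rewrite (sin_eq_0_1 (IZR k * PI)) by (now exists k). ring.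
Qed.

Lemma B_zero z : B z = 0%C -> exists t, T_set phi alpha t /\ z = RtoC t.
Proof.
  intros H. destruct (Req_dec (Im z) 0) as [H0|H0]; [|now apply B_ne in H0].
  exists (Re z). rewrite <- (C_real_eq z H0). split; [|reflexivity]. apply B_zero_iff. now rewrite <- (C_real_eq z H0).
Qed.
End Bfacts.

(* With B = E b and F = E^2 g, the coefficients at a zero t of B are g/b'^2 and (g' b' - g b'')/b'^3. *)
Section Coef.
Variables (E : C -> C) (alpha eta delta : R) (phi : R -> R).
Hypothesis HB : Hermite_Biehler E.
Hypothesis Heta : 0 < eta.
Hypothesis Hne : forall z, - eta < Im z -> E z <> 0%C.
Hypothesis Hth4 : forall z, - eta < Im z -> Cmod (th E z) <= 4.
Hypothesis Hphi : forall x : R, Im (eia (phi x) * E x)%C = 0.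
Hypothesis Hth' : forall x : R, C_derive (th E) x = ((0, (2 * Derive phi x)%R) * th E x)%C.
Hypothesis Hdelta : 0 < delta.
Hypothesis Hphi' : forall x, T_set phi alpha x -> delta <= Derive phi x.
Let A := A_alpha E alpha.
Let B := B_alpha E alpha.
Let bq (z : C) : C := (Ci / 2 * (eia alpha - eia (- alpha) * th E z))%C.

Lemma coef_no_real_zero (x : R) : E x <> 0%C.
Proof. apply Hne. simpl. lra. Qed.

Lemma th_holn_strip z : - eta < Im z -> holn (th E) z.
Proof. intros Hz. apply (th_holn E HB). now apply Hne. Qed.

Lemma Ehol : entire E.
Proof. apply (hb_entire E HB). Qed.

Lemma bq_eq z : - eta < Im z -> B z = (E z * bq z)%C.
Proof. intros Hz. unfold B, B_alpha, bq, th. field. now apply Hne. Qed.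

Lemma bq_cd z : - eta < Im z -> cd bq z (- (Ci / 2 * eia (- alpha)) * C_derive (th E) z)%C.
Proof.
  intros Hz. replace (- (Ci / 2 * eia (- alpha)) * C_derive (th E) z)%C with (Ci / 2 * (0 - eia (- alpha) * C_derive (th E) z))%C by ring.
  apply (cd_scal (Ci / 2)%C (fun z => eia alpha - eia (- alpha) * th E z)%C). apply (cd_minus (fun _ => eia alpha)); [apply cd_const|].
  apply (cd_scal (eia (- alpha)) (th E)). apply cd_C_derive, holn_Cdiff, th_holn_strip, Hz.
Qed.

(** Two Cauchy estimates, each spending half the width of the strip in which |Theta| <= 4. *)
Lemma th''_bound (x : R) : Cmod (C_derive (C_derive (th E)) x) <= 16 / (eta * eta).
Proof.
  replace (16 / (eta * eta)) with ((4 / (eta / 2)) / (eta / 2)) by (field; lra).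
  assert (Him : forall z a : C, Rabs (Im z - Im a) <= Cmod (z - a)) by (intros z a; apply (im_le_Cmod (z - a))).
  apply (cauchy_est (C_derive (th E)) x (eta / 2)); [lra| |].
  - intros z Hz. pose proof (Him z x) as H. simpl in H. apply Rabs_le_between in H.
    apply Cdiff_C_derive, (holn_open (fun z => - eta < Im z)); [apply openC_upper|intros w Hw; apply holn_Cdiff; now apply th_holn_strip|unfold Im in *; lra].
  - intros z Hz. pose proof (Him z x) as H. simpl in H. apply Rabs_le_between in H.
    apply (cauchy_est (th E) z (eta / 2)); [lra| |]; intros w Hw; pose proof (Him w z) as H2; apply Rabs_le_between in H2.
    + apply holn_Cdiff, th_holn_strip. unfold Im in *; lra.
    + apply Hth4. unfold Im in *; lra.
Qed.

Lemma half_unit x : Cmod (- (Ci / 2 * eia x)) = / 2.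
Proof.
  rewrite Cmod_opp, Cmod_mult, Cmod_eia, Rmult_1_r, Cmod_div by apply C2_ne.
  rewrite Cmod_R, Rabs_pos_eq by lra. rewrite Cmod_Ci. field.
Qed.

(** |b'(t)| is half of |Theta'(t)| = 2 phi'(t), so the lower bound on phi' over T(alpha) enters here
    as a bound below for b'. *)
Lemma bq1_mod t : T_set phi alpha t -> delta <= Cmod (C_derive bq t).
Proof.
  intros Ht. specialize (Hphi' t Ht). rewrite (C_derive_cd _ _ _ (bq_cd t ltac:(simpl; lra))), Cmod_mult, half_unit, Hth', Cmod_mult.
  replace ((0, 2 * Derive phi t) : C) with (Ci * RtoC (2 * Derive phi t))%C by (Cext).
  replace (th E t) with (eia (2 * phi t)) by (unfold th; rewrite (star_real_phase E phi Hphi); field; apply coef_no_real_zero).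
  rewrite Cmod_eia, Cmod_mult, Cmod_R. rewrite Cmod_Ci, Rabs_pos_eq by lra. lra.
Qed.

Lemma bq2_mod (t : R) : Cmod (C_derive (C_derive bq) t) <= 8 / (eta * eta).
Proof.
  assert (Hc : cd (C_derive bq) t (- (Ci / 2 * eia (- alpha)) * C_derive (C_derive (th E)) t)%C).
  { apply (cd_loc (fun z => - (Ci / 2 * eia (- alpha)) * C_derive (th E) z)%C _ _ _ eta Heta).
    - intros w Hw. symmetry. apply C_derive_cd, bq_cd. pose proof (im_le_Cmod (w - t)) as H. apply Rabs_le_between in H. simpl in H. unfold Im. lra.
    - apply cd_scal. apply cd_C_derive, Cdiff_C_derive, th_holn_strip. simpl. lra. }
  rewrite (C_derive_cd _ _ _ Hc), Cmod_mult, half_unit. pose proof (th''_bound t). replace (8 / (eta * eta)) with (/ 2 * (16 / (eta * eta))) by (field; lra). lra.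
Qed.

Lemma bq_zero t : T_set phi alpha t -> bq t = 0%C.
Proof.
  intros Ht. apply (proj2 (B_zero_iff E alpha phi Hphi coef_no_real_zero t)) in Ht. fold B in Ht. rewrite bq_eq in Ht by (simpl; lra).
  destruct (Ceq_dec (bq t) 0) as [H|H]; [assumption|]. exfalso. revert Ht. apply Cmult_neq_0; [apply coef_no_real_zero|assumption].
Qed.

Lemma B_deriv_strip z : - eta < Im z -> C_derive B z = (C_derive E z * bq z + E z * C_derive bq z)%C.
Proof.
  intros Hz. apply C_derive_cd. destruct (openC_upper (- eta) z Hz) as [r [Hr Hin]].
  apply (cd_loc (fun z => E z * bq z)%C _ _ _ r Hr).
  - intros w Hw. symmetry. apply bq_eq. now apply Hin.
  - apply (cd_mult E bq); [apply cd_C_derive, Ehol|]. apply cd_C_derive. eapply cd_Cdiff, bq_cd, Hz.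
Qed.

Lemma B1_at t : T_set phi alpha t -> C_derive B t = (E t * C_derive bq t)%C.
Proof. intros Ht. rewrite B_deriv_strip by (simpl; lra). rewrite (bq_zero t Ht). ring. Qed.

Lemma B2_at t : T_set phi alpha t -> C_derive (C_derive B) t = (2 * C_derive E t * C_derive bq t + E t * C_derive (C_derive bq) t)%C.
Proof.
  intros Ht. apply C_derive_cd. apply (cd_loc (fun z => C_derive E z * bq z + E z * C_derive bq z)%C _ _ _ eta Heta).
  - intros w Hw. symmetry. apply B_deriv_strip. pose proof (im_le_Cmod (w - t)) as H. apply Rabs_le_between in H. simpl in H. unfold Im. lra.
  - assert (Hbh : holn bq t).
    { apply (holn_open (fun z => - eta < Im z)); [apply openC_upper|intros z Hz; eapply cd_Cdiff, bq_cd, Hz|simpl; lra]. }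
    replace (2 * C_derive E t * C_derive bq t + E t * C_derive (C_derive bq) t)%C
      with ((C_derive (C_derive E) t * bq t + C_derive E t * C_derive bq t) + (C_derive E t * C_derive bq t + E t * C_derive (C_derive bq) t))%C
      by (rewrite (bq_zero t Ht); ring).
    apply (cd_plus (fun z => C_derive E z * bq z)%C (fun z => E z * C_derive bq z)%C).
    + apply (cd_mult (C_derive E) bq); apply cd_C_derive; [apply Cdiff_C_derive, entire_holn, Ehol|now apply holn_Cdiff].
    + apply (cd_mult E (C_derive bq)); apply cd_C_derive; [apply Ehol|now apply Cdiff_C_derive].
Qed.

Lemma bq1_ne t : T_set phi alpha t -> C_derive bq t <> 0%C.
Proof. intros Ht. apply Cmod_pos_neq. pose proof (bq1_mod t Ht). lra. Qed.

Lemma B1_ne t : T_set phi alpha t -> C_derive B t <> 0%C.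
Proof. intros Ht. rewrite (B1_at t Ht). apply Cmult_neq_0; [apply coef_no_real_zero|now apply bq1_ne]. Qed.

(** The derivative of E cancels from the second coefficient once F = E^2 g is inserted, so a
    constant built from delta and eta serves all nodes and all F. *)
Lemma coef_bounds : exists K, 0 < K /\ forall t, T_set phi alpha t ->
  Cmod (A t / C_derive B t) <= K /\ forall F, entire F ->
  Cmod (F t / (C_derive B t * C_derive B t)) <= K * Cmod (qE E F t) /\
  Cmod ((C_derive F t * C_derive B t - F t * C_derive (C_derive B) t) / (C_derive B t * C_derive B t * C_derive B t))
    <= K * (Cmod (qE E F t) + Cmod (C_derive (qE E F) t)).
Proof.
  set (M2 := 8 / (eta * eta)). assert (HM2 : 0 < M2) by (apply Rdiv_lt_0_compat; nra).
  set (K := / delta + / delta ^ 2 + M2 / delta ^ 3).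
  assert (H1 : 0 < / delta) by now apply Rinv_0_lt_compat.
  assert (H2 : 0 < / delta ^ 2) by (apply Rinv_0_lt_compat, pow_lt; lra).
  assert (H3 : 0 < M2 / delta ^ 3) by (apply Rdiv_lt_0_compat; [|apply pow_lt]; lra).
  exists K. split; [unfold K; lra|]. intros t Ht. pose proof (bq1_mod t Ht) as Hb1. pose proof (bq1_ne t Ht) as Hbn. pose proof (bq2_mod t) as Hb2. fold M2 in Hb2.
  set (b1 := C_derive bq t) in *. set (b2 := C_derive (C_derive bq) t) in *. pose proof (coef_no_real_zero t) as Hn. pose proof (proj1 (Cmod_gt_0 _) Hn) as Hp.
  assert (Hdb : 0 < Cmod b1) by lra.
  assert (Hi : / Cmod b1 <= / delta) by (apply Rinv_le_contravar; lra).
  assert (Hi0 : 0 < / Cmod b1) by now apply Rinv_0_lt_compat.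
  assert (Hi2 : / Cmod b1 ^ 2 <= / delta ^ 2) by (apply Rinv_le_contravar; [apply pow_lt; lra|apply pow_incr; lra]).
  assert (Hi3 : / Cmod b1 ^ 3 <= / delta ^ 3) by (apply Rinv_le_contravar; [apply pow_lt; lra|apply pow_incr; lra]).
  split.
  - unfold A. rewrite (A_zt E alpha t Hn), (B1_at t Ht). fold b1.
    replace (/ 2 * eia alpha * E t * (1 + zt E alpha t) / (E t * b1))%C with (eia alpha * ((1 + zt E alpha t) / 2) / b1)%C by (field; repeat split; try assumption; apply C2_ne).
    rewrite Cmod_div, Cmod_mult, Cmod_eia, Rmult_1_l by assumption.
    assert (Cmod ((1 + zt E alpha t) / 2) <= 1).
    { rewrite Cmod_div by apply C2_ne. rewrite Cmod_R, Rabs_pos_eq by lra. apply Rle_div_l; [lra|]. eapply Rle_trans; [apply Cmod_triangle|]. rewrite Cmod_1, zt_mod.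
      unfold th. rewrite (star_real_phase E phi Hphi). replace (eia (2 * phi t) * E t / E t)%C with (eia (2 * phi t)) by (field; assumption). rewrite Cmod_eia. lra. }
    unfold Rdiv, K. pose proof (Cmod_ge_0 ((1 + zt E alpha t) / 2)). nra.
  - intros F HF. set (g := qE E F t). set (g' := C_derive (qE E F) t).
    assert (EF : F t = (E t * E t * g)%C) by (unfold g, qE, Csq; field; assumption).
    assert (EF' : C_derive F t = (2 * C_derive E t * E t * g + E t * E t * g')%C).
    { apply C_derive_cd. apply (cd_loc (fun z => E z * E z * qE E F z)%C _ _ _ eta Heta).
      - intros w Hw. unfold qE, Csq. field. apply Hne. pose proof (im_le_Cmod (w - t)) as H. apply Rabs_le_between in H. simpl in H. unfold Im. lra.
      - replace (2 * C_derive E t * E t * g + E t * E t * g')%C with ((C_derive E t * E t + E t * C_derive E t) * g + E t * E t * g')%C by ring.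
        apply (cd_mult (fun z => E z * E z)%C (qE E F)).
        + apply (cd_mult E E); apply cd_C_derive, Ehol.
        + apply cd_C_derive, (qE_Cdiff E eta Ehol Hne); [assumption|simpl; lra]. }
    rewrite EF, EF', (B1_at t Ht), (B2_at t Ht). fold b1 b2. split.
    + replace (E t * E t * g / (E t * b1 * (E t * b1)))%C with (g / (b1 * b1))%C by (field; split; assumption).
      rewrite Cmod_div, Cmod_mult by now apply Cmult_neq_0. replace (Cmod g / (Cmod b1 * Cmod b1)) with (/ Cmod b1 ^ 2 * Cmod g) by (field; lra).
      apply Rmult_le_compat_r; [apply Cmod_ge_0|]. unfold K. lra.
    + replace (((2 * C_derive E t * E t * g + E t * E t * g') * (E t * b1) - E t * E t * g * (2 * C_derive E t * b1 + E t * b2)) / (E t * b1 * (E t * b1) * (E t * b1)))%C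
        with (g' / (b1 * b1) - g * b2 / (b1 * b1 * b1))%C by (field; split; assumption).
      eapply Rle_trans; [apply Cmod_triangle|]. rewrite Cmod_opp, !Cmod_div, !Cmod_mult by (repeat apply Cmult_neq_0; assumption).
      pose proof (Cmod_ge_0 g). pose proof (Cmod_ge_0 g'). pose proof (Cmod_ge_0 b2).
      replace (Cmod g' / (Cmod b1 * Cmod b1)) with (Cmod g' * / Cmod b1 ^ 2) by (field; lra).
      replace (Cmod g * Cmod b2 / (Cmod b1 * Cmod b1 * Cmod b1)) with (Cmod g * (Cmod b2 * / Cmod b1 ^ 3)) by (field; lra).
      assert (Cmod b2 * / Cmod b1 ^ 3 <= M2 / delta ^ 3) by (unfold Rdiv; apply Rmult_le_compat; try assumption; left; apply Rinv_0_lt_compat, pow_lt; lra).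
      unfold K. nra.
Qed.
End Coef.

(** * Partial fractions over a separated set *)

Lemma Csum_perm l l' f : Permutation l l' -> Csum_list l f = Csum_list l' f.
Proof.
  induction 1; simpl; [reflexivity|now rewrite IHPermutation|ring|now transitivity (Csum_list l' f)].
Qed.

Definition ldiff (l l0 : list R) : list R := filter (fun t => if in_dec Req_EM_T t l0 then false else true) l.

Lemma ldiff_in l l0 t : In t (ldiff l l0) <-> In t l /\ ~ In t l0.
Proof.
  unfold ldiff. rewrite filter_In. destruct (in_dec Req_EM_T t l0); intuition congruence.
Qed.

Lemma ldiff_perm l l0 : NoDup l -> NoDup l0 -> incl l0 l -> Permutation l (l0 ++ ldiff l l0).
Proof.
  intros H H0 Hi. apply NoDup_Permutation; [assumption| |].
  - apply NoDup_app; [assumption|now apply NoDup_filter|]. intros t H1 H2. apply ldiff_in in H2. tauto.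
  - intros t. rewrite in_app_iff, ldiff_in. destruct (in_dec Req_EM_T t l0) as [Hin|Hin]; [|tauto]. pose proof (Hi t Hin). tauto.
Qed.

Definition sub (T : R -> Prop) (l : list R) : Prop := NoDup l /\ forall t, In t l -> T t.

Lemma sub_union T l l0 : sub T l -> sub T l0 -> sub T (l0 ++ ldiff l l0).
Proof.
  intros [H1 H2] [H3 H4]. split.
  - apply NoDup_app; [assumption|now apply NoDup_filter|]. intros t Ha Hb. apply ldiff_in in Hb. tauto.
  - intros t. rewrite in_app_iff, ldiff_in. intros [H|[H _]]; auto.
Qed.

Section ML.
Variables (T : R -> Prop) (h : R) (om : R -> R) (C0 : R) (r : R -> C -> C).
Hypothesis Hh : 0 < h <= 1.
Hypothesis Hsep : forall t t', T t -> T t' -> t <> t' -> h <= Rabs (t - t').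

Lemma sub_separated l : sub T l -> separated h l.
Proof. intros [H1 H2]. split; [assumption|]. intros t t' Ht Ht' Hne. apply Hsep; auto. Qed.

(** Separation bounds the length of lists of nodes in [-R0, R0]; a list of maximal length must
    contain every node there, since a missing one could be added. *)
Lemma finite_window R0 : exists l, sub T l /\ forall t, T t -> Rabs t <= R0 -> In t l.
Proof.
  destruct (Rle_lt_dec 0 R0) as [HR|HR].
  2:{ exists nil. split; [split; [constructor|intros t []]|]. intros t _ Ht. pose proof (Rabs_pos t). lra. }
  set (ok := fun l => sub T l /\ forall t, In t l -> Rabs t <= R0).
  assert (Hlen : forall l, ok l -> INR (length l) * h <= 2 * R0 + h).
  { intros l [Hl Hb].
    assert (Es : rsum l (fun t => (t + h) - t) = INR (length l) * h).
    { clear. induction l; [simpl; ring|]. change (rsum (a :: l) (fun t => t + h - t)) with ((a + h - a) + rsum l (fun t => t + h - t)). rewrite IHl. simpl length. rewrite S_INR. ring. }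
    rewrite <- Es. eapply Rle_trans; [apply (sep_sum (fun t => t) h (- R0) (proj1 Hh) (fun x y Hxy => Hxy) (length l) l R0 eq_refl (sub_separated l Hl))|]; [|lra|lra].
    intros t Ht. apply Rabs_le_between. now apply Hb. }
  destruct (nfloor_ex ((2 * R0 + h) / h)) as [N [_ HN]]; [apply Rdiv_le_0_compat; lra|].
  assert (Hb : forall l, ok l -> (length l <= N)%nat).
  { intros l Hl. specialize (Hlen l Hl). apply Nat.lt_succ_r, INR_lt. rewrite S_INR. eapply Rle_lt_trans; [|exact HN]. apply (proj1 (Rle_div_r _ _ _ (proj1 Hh))). exact Hlen. }
  assert (Hmax : forall k, (exists l, ok l /\ (N - length l <= k)%nat) -> exists l, ok l /\ forall l', ok l' -> (length l' <= length l)%nat).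
  { induction k; intros [l [Hl Hk]].
    - exists l. split; [assumption|]. intros l' Hl'. specialize (Hb l' Hl'). lia.
    - destruct (classic (exists l', ok l' /\ (length l < length l')%nat)) as [[l' [Hl' Hlt]]|Hno].
      + apply IHk. exists l'. split; [assumption|]. specialize (Hb l' Hl'). lia.
      + exists l. split; [assumption|]. intros l' Hl'. destruct (Nat.le_gt_cases (length l') (length l)) as [Hle|Hgt]; [assumption|]. exfalso. apply Hno. eauto. }
  destruct (Hmax N) as [l [[Hl Hlb] Hm]].
  { exists nil. split; [|simpl; lia]. split; [split; [constructor|]|]; intros t []. }
  exists l. split; [assumption|]. intros t Ht HtR. destruct (in_dec Req_EM_T t l) as [Hin|Hin]; [assumption|exfalso].
  assert (Hok : ok (t :: l)).
  { destruct Hl as [Hl1 Hl2]. split; [split|].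
    - now constructor.
    - intros u [<-|Hu]; auto.
    - intros u [<-|Hu]; auto. }
  specialize (Hm _ Hok). simpl in Hm. lia.
Qed.

Definition Tc (z : C) : Prop := exists t, T t /\ z = RtoC t.

Lemma off_T z : ~ Tc z -> exists rho, 0 < rho <= 1 /\ forall t, T t -> rho <= Cmod (z - t).
Proof.
  intros Hz. destruct (classic (exists t0, T t0 /\ Cmod (z - t0) < h / 2)) as [[t0 [Ht0 Hd]]|Hno].
  - assert (Hp : 0 < Cmod (z - t0)) by (apply Cmod_gt_0, Cminus_neq0; intros E0; apply Hz; now exists t0).
    exists (Cmod (z - t0)). split; [lra|]. intros t Ht. destruct (Req_dec t t0) as [->|Hne]; [lra|].
    specialize (Hsep t t0 Ht Ht0 Hne). pose proof (Cmod_tri3 t z t0) as H3. rewrite <- RtoC_minus, Cmod_R, (Cmod_minus_sym t z) in H3. lra.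
  - exists (h / 2). split; [lra|]. intros t Ht. apply Rnot_lt_le. intros H. apply Hno. eauto.
Qed.

Lemma near_T t0 z : T t0 -> Cmod (z - t0) < h / 2 -> forall t, T t -> t <> t0 -> h / 2 <= Cmod (z - t).
Proof.
  intros Ht0 Hz t Ht Hne. specialize (Hsep t t0 Ht Ht0 Hne). pose proof (Cmod_tri3 t z t0) as H3. rewrite <- RtoC_minus, Cmod_R, (Cmod_minus_sym t z) in H3. lra.
Qed.

Hypothesis Hom : forall t, 0 <= om t.
Hypothesis HC : forall l, sub T l -> rsum l om <= C0.
Hypothesis Hr : forall t z, T t -> z <> RtoC t -> Cdiff (r t) z.
Hypothesis HK : forall t z rho, T t -> 0 < rho <= 1 -> rho <= Cmod (z - t) -> Cmod (r t z) <= om t * ((1 + Cmod z) ^ 2 / rho ^ 2).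

(** A finite list whose sum is within eps of the supremum leaves at most eps for any disjoint
    list. *)
Lemma sum_tail eps : 0 < eps -> exists L, sub T L /\ forall d, sub T d -> (forall t, In t d -> ~ In t L) -> rsum d om <= eps.
Proof.
  intros He. set (X := fun x => exists l, sub T l /\ x = rsum l om).
  assert (Hnil : sub T nil) by (split; [constructor|intros t []]).
  destruct (completeness X) as [s [Hs1 Hs2]].
  - exists C0. intros x [l [Hl ->]]. now apply HC.
  - exists 0. exists nil. split; [assumption|reflexivity].
  - destruct (classic (exists L, sub T L /\ s - eps < rsum L om)) as [[L [HL Hlt]]|Hno].
    + exists L. split; [assumption|]. intros d Hd Hdis.
      assert (Hu : sub T (L ++ d)).
      { destruct HL as [H1 H2], Hd as [H3 H4]. split.
        - apply NoDup_app; [assumption|assumption|]. intros t Ha Hb. exact (Hdis t Hb Ha).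
        - intros t Ht. apply in_app_iff in Ht. destruct Ht; auto. }
      assert (Hle : rsum (L ++ d) om <= s) by (apply Hs1; now exists (L ++ d)). rewrite rsum_app in Hle. lra.
    + exfalso. assert (s <= s - eps); [|lra]. apply Hs2. intros x [l [Hl ->]]. apply Rnot_lt_le. intros H. apply Hno. eauto.
Qed.

(** The lists chosen for the tails 2^{-n} are accumulated, so that the approximants form an
    increasing sequence. *)
Lemma nested_lists_ex : exists L : nat -> list R, (forall n, sub T (L n)) /\ (forall n, incl (L n) (L (S n))) /\
  forall n d, sub T d -> (forall t, In t d -> ~ In t (L n)) -> rsum d om <= (/2) ^ n.
Proof.
  assert (Hp : forall n, 0 < (/2) ^ n) by (intros n; apply pow_lt; lra).
  set (pk := fun n => proj1_sig (constructive_indefinite_description _ (sum_tail _ (Hp n)))).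
  assert (Hpk : forall n, sub T (pk n) /\ forall d, sub T d -> (forall t, In t d -> ~ In t (pk n)) -> rsum d om <= (/2) ^ n).
  { intros n. unfold pk. destruct constructive_indefinite_description as [l Hl]. exact Hl. }
  set (L := fix L n := match n with O => pk O | S m => L m ++ ldiff (pk (S m)) (L m) end).
  assert (HL : forall n, sub T (L n)).
  { induction n; [apply (Hpk O)|]. change (L (S n)) with (L n ++ ldiff (pk (S n)) (L n)). apply sub_union; [apply (Hpk (S n))|assumption]. }
  exists L. split; [assumption|]. split.
  - intros n t Ht. change (L (S n)) with (L n ++ ldiff (pk (S n)) (L n)). apply in_app_iff. now left.
  - intros n d Hd Hdis. apply (proj2 (Hpk n)); [assumption|]. intros t Ht Hin. apply (Hdis t Ht). destruct n; [exact Hin|].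
    change (L (S n)) with (L n ++ ldiff (pk (S n)) (L n)). apply in_app_iff. rewrite ldiff_in. destruct (in_dec Req_EM_T t (L n)); tauto.
Qed.

Lemma block_bound_gen d z Y X : 0 <= Y -> (forall t, In t d -> Cmod (r t z) <= om t * Y) -> rsum d om <= X ->
  Cmod (Csum_list d (fun t => r t z)) <= X * Y.
Proof.
  intros HY Hd HX. eapply Rle_trans; [apply Csum_bound|].
  apply Rle_trans with (rsum d (fun t => Y * om t)).
  - apply rsum_le. intros t Ht. rewrite Rmult_comm. now apply Hd.
  - rewrite rsum_scal, Rmult_comm. now apply Rmult_le_compat_r.
Qed.

Lemma kernel_nonneg (z : C) rho : 0 < rho <= 1 -> 0 <= (1 + Cmod z) ^ 2 / rho ^ 2.
Proof. intros H. apply Rdiv_le_0_compat; [apply pow2_ge_0|apply pow_lt; lra]. Qed.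

Lemma block_bound d z rho X : sub T d -> 0 < rho <= 1 -> (forall t, In t d -> rho <= Cmod (z - t)) -> rsum d om <= X ->
  Cmod (Csum_list d (fun t => r t z)) <= X * ((1 + Cmod z) ^ 2 / rho ^ 2).
Proof.
  intros [_ Hd] Hrho Hdz HX. apply block_bound_gen; [now apply kernel_nonneg| |assumption]. intros t Ht. apply HK; auto.
Qed.

(** The sum is the limit along the nested lists. Its error is stated for any larger list [l] and any
    bound [Y] on the terms outside [l], so that nodes near z may be put into [l] and sharper kernel
    bounds used where they exist. *)
Lemma ml_sum : exists (S : C -> C) (L : nat -> list R), (forall n, sub T (L n)) /\
  (forall z n l Y, ~ Tc z -> sub T l -> incl (L n) l -> 0 <= Y -> (forall t, T t -> ~ In t l -> Cmod (r t z) <= om t * Y) ->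
    Cmod (S z - Csum_list l (fun t => r t z)) <= (/2) ^ n * Y).
Proof.
  destruct nested_lists_ex as [L [HL [Hinc Htail]]].
  assert (Hdiff : forall l l0 z, sub T l -> sub T l0 -> incl l0 l -> (Csum_list l (fun t => r t z) - Csum_list l0 (fun t => r t z) = Csum_list (ldiff l l0) (fun t => r t z))%C).
  { intros l l0 z [H1 _] [H2 _] Hi. rewrite (Csum_perm l (l0 ++ ldiff l l0)) by now apply ldiff_perm. rewrite Csum_app. ring. }
  assert (Hsubd : forall l l0, sub T l -> sub T (ldiff l l0)).
  { intros l l0 [H1 H2]. split; [now apply NoDup_filter|]. intros t Ht. apply ldiff_in in Ht. apply H2, Ht. }
  assert (Hstep : forall z Y, 0 <= Y -> (forall t, T t -> Cmod (r t z) <= om t * Y) -> forall n l, sub T l -> incl (L n) l ->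
    Cmod (Csum_list l (fun t => r t z) - Csum_list (L n) (fun t => r t z)) <= Y * (/2) ^ n).
  { intros z Y HY Hz n l Hl Hi. rewrite Hdiff by auto. rewrite Rmult_comm. apply block_bound_gen; auto.
    - intros t Ht. apply ldiff_in in Ht. apply Hz. apply Hl, Ht.
    - apply Htail; auto. intros t Ht. apply ldiff_in in Ht. tauto. }
  assert (HS : forall z, exists s, ~ Tc z -> forall n l Y, sub T l -> incl (L n) l -> 0 <= Y -> (forall t, T t -> ~ In t l -> Cmod (r t z) <= om t * Y) ->
    Cmod (s - Csum_list l (fun t => r t z)) <= (/2) ^ n * Y).
  { intros z. destruct (classic (Tc z)) as [Hz|Hz]; [exists 0%C; intros; contradiction|].
    destruct (off_T z Hz) as [rho0 [Hr0 Hz0]]. set (X0 := (1 + Cmod z) ^ 2 / rho0 ^ 2).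
    assert (HX0 : 0 <= X0) by now apply kernel_nonneg.
    assert (HX1 : forall t, T t -> Cmod (r t z) <= om t * X0) by (intros t Ht; apply HK; auto).
    destruct (C_geom (fun n => Csum_list (L n) (fun t => r t z)) X0) as [s Hs].
    { intros n. apply (Hstep z X0 HX0 HX1); auto. }
    exists s. intros _ n l Y Hl Hi HY Hfar.
    (* The unions of [L m] with [l] have the same limit, and differ from [l] by a list disjoint from
       [L n]. *)
    apply (limit_le (fun m => Csum_list (L m ++ ldiff l (L m)) (fun t => r t z)) s _ _ (3 * X0) 0).
    - intros m. assert (Hu := sub_union T l (L m) Hl (HL m)).
      pose proof (Hstep z X0 HX0 HX1 m _ Hu (incl_appl _ (incl_refl (L m)))) as H1. specialize (Hs m).
      pose proof (Cmod_tri3 (Csum_list (L m ++ ldiff l (L m)) (fun t => r t z)) (Csum_list (L m) (fun t => r t z)) s). lra.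
    - intros m _. assert (Hu := sub_union T l (L m) Hl (HL m)).
      assert (Hiu : incl l (L m ++ ldiff l (L m))).
      { intros t Ht. apply in_app_iff. rewrite ldiff_in. destruct (in_dec Req_EM_T t (L m)); tauto. }
      rewrite Hdiff by auto. apply block_bound_gen; auto.
      + intros t Ht. apply ldiff_in in Ht. apply Hfar; [apply Hu, Ht|apply Ht].
      + apply Htail; auto. intros t Ht Hin. apply ldiff_in in Ht. apply (proj2 Ht), Hi, Hin. }
  exists (fun z => proj1_sig (constructive_indefinite_description _ (HS z))), L. split; [assumption|].
  intros z n l Y Hz Hl Hi HY Hfar. destruct constructive_indefinite_description as [s Hs]. simpl. now apply Hs.
Qed.

Variables (S : C -> C) (L : nat -> list R).
Hypothesis HL : forall n, sub T (L n).
Hypothesis HS : forall z n l Y, ~ Tc z -> sub T l -> incl (L n) l -> 0 <= Y -> (forall t, T t -> ~ In t l -> Cmod (r t z) <= om t * Y) ->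
    Cmod (S z - Csum_list l (fun t => r t z)) <= (/2) ^ n * Y.

Lemma ml_sum_rho z n l rho : ~ Tc z -> sub T l -> incl (L n) l -> 0 < rho <= 1 -> (forall t, T t -> ~ In t l -> rho <= Cmod (z - t)) ->
    Cmod (S z - Csum_list l (fun t => r t z)) <= (/2) ^ n * ((1 + Cmod z) ^ 2 / rho ^ 2).
Proof. intros Hz Hl Hi Hrho Hd. apply HS; auto. now apply kernel_nonneg. Qed.

Lemma ml_sum_le z M : ~ Tc z -> (forall l, sub T l -> Cmod (Csum_list l (fun t => r t z)) <= M) -> Cmod (S z) <= M.
Proof.
  intros Hz HM. destruct (off_T z Hz) as [rho [Hrho Hd]]. replace (S z) with (S z - 0)%C by ring.
  apply (limit_le (fun n => Csum_list (L n) (fun t => r t z)) (S z) 0 M ((1 + Cmod z) ^ 2 / rho ^ 2) 0).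
  - intros n. rewrite Cmod_minus_sym, Rmult_comm. apply (ml_sum_rho z n (L n) rho); auto. apply incl_refl.
  - intros n _. replace (Csum_list (L n) (fun t => r t z) - 0)%C with (Csum_list (L n) (fun t => r t z)) by ring. now apply HM.
Qed.

Lemma C0_ge0 : 0 <= C0.
Proof. apply (HC nil). split; [constructor|intros t []]. Qed.

Lemma ml_sum_growth z rho : 0 < rho <= 1 -> (forall t, T t -> rho <= Cmod (z - t)) -> Cmod (S z) <= C0 * ((1 + Cmod z) ^ 2 / rho ^ 2).
Proof.
  intros Hrho Hd. apply ml_sum_le.
  - intros [t [Ht ->]]. specialize (Hd t Ht). rewrite Cmod_self in Hd. lra.
  - intros l Hl. apply block_bound; auto. intros t Ht. apply Hd. now apply Hl.
Qed.

Lemma ml_sum_Cdiff z : ~ Tc z -> Cdiff S z.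
Proof.
  intros Hz. destruct (off_T z Hz) as [rho [Hrho Hd]]. exists (C_derive S z). apply is_derive_cd.
  assert (Hball : forall w, Cmod (w - z) < rho / 2 -> forall t, T t -> rho / 2 <= Cmod (w - t)).
  { intros w Hw t Ht. specialize (Hd t Ht). pose proof (Cmod_tri3 z w t). rewrite (Cmod_minus_sym z w) in H. lra. }
  assert (Hoff : forall w, Cmod (w - z) < rho / 2 -> ~ Tc w).
  { intros w Hw [t [Ht ->]]. specialize (Hball _ Hw t Ht). rewrite Cmod_self in Hball. lra. }
  set (X := (2 + Cmod z) ^ 2 / (rho / 2) ^ 2).
  assert (HX0 : 0 <= X) by (apply Rdiv_le_0_compat; [apply pow2_ge_0|apply pow_lt; lra]).
  assert (HX : forall w, Cmod (w - z) < rho / 2 -> (1 + Cmod w) ^ 2 / (rho / 2) ^ 2 <= X).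
  { intros w Hw. unfold X, Rdiv. apply Rmult_le_compat_r; [left; apply Rinv_0_lt_compat, pow_lt; lra|]. pose proof (Cmod_rev w z). pose proof (Cmod_ge_0 w). apply pow_incr. lra. }
  apply (weierstrass (fun n z => Csum_list (L n) (fun t => r t z)) S z (rho / 2)); [lra| | |].
  - intros n w Hw. eapply cd_Cdiff. apply (cd_Csum (L n) r (fun t => C_derive (r t) w)). intros t Ht. apply cd_C_derive, Hr; [now apply (proj2 (HL n))|].
    intros E0. apply (Hoff w Hw). exists t. split; [now apply (proj2 (HL n))|assumption].
  - exists (C0 * X). intros n w Hw. eapply Rle_trans; [apply (block_bound (L n) w (rho / 2) C0)|]; auto.
    + lra.
    + intros t Ht. apply Hball; [assumption|now apply (proj2 (HL n))].
    + apply Rmult_le_compat_l; [apply C0_ge0|now apply HX].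
  - intros eps He. destruct (pow_half_lt (eps / (X + 1))) as [N HN]; [apply Rdiv_lt_0_compat; lra|]. exists N. intros n Hn w Hw.
    rewrite Cmod_minus_sym. eapply Rle_lt_trans; [apply (ml_sum_rho w n (L n) (rho / 2))|]; auto.
    + apply incl_refl.
    + lra.
    + specialize (HN n Hn). apply Rlt_div_r in HN; [|lra]. specialize (HX w Hw). pose proof (pow_le (/2) n ltac:(lra)). nra.
Qed.

Variables (f : C -> C) (Cf : R).
Hypothesis Hf : forall z, ~ Tc z -> Cdiff f z.
Hypothesis Hpole : forall t, T t -> exists d M, 0 < d /\ forall z, z <> RtoC t -> Cmod (z - t) < d -> Cmod (f z - r t z) <= M.
Hypothesis Hgrow : forall z, Im z <> 0 -> Cmod (f z) <= Cf * (1 + Cmod z) ^ 4 / Im z ^ 2.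

(** The difference f - S has removable singularities at the nodes and inherits a growth bound (1 +
    |z|)^4 / (Im z)^2, to which [entire_growth_quadratic] applies. *)
Lemma mittag_leffler : exists a0 a1 a2, forall z, ~ Tc z -> f z = (S z + (a0 + a1 * z + a2 * (z * z)))%C.
Proof.
  destruct (removable_set Tc (fun z => f z - S z)%C) as [g [Hg Heq]].
  - intros z Hz. apply Cdiff_minus; [now apply Hf|now apply ml_sum_Cdiff].
  - intros z Hz. destruct (off_T z Hz) as [rho [Hrho Hd]]. exists rho. split; [lra|]. intros w Hw [t [Ht ->]].
    specialize (Hd t Ht). rewrite Cmod_minus_sym in Hd. lra.
  - intros tc [t [Ht ->]]. destruct (Hpole t Ht) as [d [M [Hd HM]]].
    (* With the node t put into the list, its term cancels the pole of f; all other nodes stay at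
       distance h/2 from z. *)
    set (l := (if in_dec Req_EM_T t (L O) then L O else t :: L O)).
    assert (Hl : sub T l /\ incl (L O) l /\ In t l).
    { unfold l. destruct in_dec as [Hin|Hin]; [split; [apply HL|split; [apply incl_refl|assumption]]|].
      split; [split|split].
      - constructor; [assumption|apply HL].
      - intros u [<-|Hu]; [assumption|now apply (HL O)].
      - apply incl_tl, incl_refl.
      - now left. }
    destruct Hl as [Hl1 [Hl2 Hl3]].
    set (X := (2 + Rabs t) ^ 2 / (h / 2) ^ 2).
    exists (Rmin d (h / 2)), (M + (C0 * X + X)). split; [apply Rmin_glb_lt; lra|]. intros z Hzt Hz.
    assert (Hz1 : Cmod (z - t) < d) by (eapply Rlt_le_trans; [exact Hz|apply Rmin_l]).
    assert (Hz2 : Cmod (z - t) < h / 2) by (eapply Rlt_le_trans; [exact Hz|apply Rmin_r]).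
    pose proof (near_T t z Ht Hz2) as Hfar.
    assert (Hoff : ~ Tc z).
    { intros [u [Hu E0]]. destruct (Req_dec u t) as [->|Hne]; [contradiction|]. specialize (Hfar u Hu Hne). rewrite E0, Cmod_self in Hfar. lra. }
    split; [assumption|].
    assert (HX : (1 + Cmod z) ^ 2 / (h / 2) ^ 2 <= X).
    { unfold X, Rdiv. apply Rmult_le_compat_r; [left; apply Rinv_0_lt_compat, pow_lt; lra|]. pose proof (Cmod_rev z t). rewrite Cmod_R in H. pose proof (Cmod_ge_0 z). apply pow_incr. lra. }
    assert (Hs1 : sub T (t :: nil)) by (split; [constructor; [intros []|constructor]|intros u [<-|[]]; assumption]).
    assert (Hi1 : incl (t :: nil) l) by (intros u [<-|[]]; assumption).
    assert (E1 : Csum_list l (fun t => r t z) = (r t z + Csum_list (ldiff l (t :: nil)) (fun t => r t z))%C).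
    { rewrite (Csum_perm l ((t :: nil) ++ ldiff l (t :: nil))) by (apply ldiff_perm; [apply Hl1|apply Hs1|assumption]). reflexivity. }
    assert (Hsd : sub T (ldiff l (t :: nil))).
    { split; [apply NoDup_filter, Hl1|]. intros u Hu. apply ldiff_in in Hu. now apply Hl1. }
    assert (B1 : Cmod (Csum_list (ldiff l (t :: nil)) (fun t => r t z)) <= C0 * X).
    { eapply Rle_trans; [apply (block_bound _ z (h / 2) C0 Hsd)|]; auto.
      - lra.
      - intros u Hu. apply ldiff_in in Hu. apply Hfar; [now apply Hl1|]. intros ->. apply (proj2 Hu). now left.
      - apply Rmult_le_compat_l; [apply C0_ge0|assumption]. }
    assert (B2 : Cmod (S z - Csum_list l (fun t => r t z)) <= X).
    { eapply Rle_trans; [apply (ml_sum_rho z O l (h / 2))|]; auto.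
      - lra.
      - intros u Hu Hnin. apply Hfar; [assumption|]. intros ->. contradiction.
      - simpl. simpl in HX. lra. }
    replace (f z - S z)%C with ((f z - r t z) + (- Csum_list (ldiff l (t :: nil)) (fun t => r t z) + - (S z - Csum_list l (fun t => r t z))))%C by (rewrite E1; ring).
    eapply Rle_trans; [apply Cmod_triangle|]. apply Rplus_le_compat; [now apply HM|].
    eapply Rle_trans; [apply Cmod_triangle|]. rewrite !Cmod_opp. lra.
  - destruct (entire_growth_quadratic g (Rabs Cf + C0)) as [a0 [a1 [a2 Hq]]]; [assumption| |].
    + intros z Hz. assert (Hoff : ~ Tc z) by (intros [t [_ ->]]; apply Hz; reflexivity).
      rewrite Heq by assumption. eapply Rle_trans; [apply Cmod_triangle|]. rewrite Cmod_opp.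
      pose proof (im_le_Cmod z) as Hi. assert (Hy : 0 < Rabs (Im z)) by (now apply Rabs_pos_lt).
      set (y := Rabs (Im z)) in *. assert (Hy2 : Im z ^ 2 = y ^ 2) by (unfold y; now rewrite pow2_abs).
      pose proof (Hgrow z Hz) as H1. rewrite Hy2 in H1 |- *. assert (Hyp : 0 < y ^ 2) by (apply pow_lt; assumption).
      (* Every real node has distance at least |Im z| from z, and the kernel bound asks for a
         distance at most 1. *)
      set (rho := Rmin 1 y). assert (Hrho : 0 < rho <= 1) by (split; [apply Rmin_glb_lt; lra|apply Rmin_l]).
      assert (Hd : forall t, T t -> rho <= Cmod (z - t)).
      { intros t _. eapply Rle_trans; [apply Rmin_r|]. pose proof (im_le_Cmod (z - t)) as H. replace (Im (z - t)) with (Im z) in H by (unfold Im; simpl; lra). exact H. }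
      pose proof (ml_sum_growth z rho Hrho Hd) as H2. set (m := 1 + Cmod z) in *.
      assert (Hm : 1 <= m) by (unfold m; pose proof (Cmod_ge_0 z); lra).
      assert (H3 : m ^ 2 / rho ^ 2 <= m ^ 4 / y ^ 2).
      { apply (proj2 (Rle_div_l _ _ _ (pow_lt rho 2 (proj1 Hrho)))). replace (m ^ 4 / y ^ 2 * rho ^ 2) with (m ^ 2 * ((m * rho / y) ^ 2)) by (field; lra).
        rewrite <- (Rmult_1_r (m ^ 2)) at 1. apply Rmult_le_compat_l; [apply pow2_ge_0|]. rewrite <- (pow1 2). apply pow_incr. split; [lra|].
        apply (proj1 (Rle_div_r _ _ _ Hy)). unfold rho, Rmin. destruct (Rle_dec 1 y); unfold m in *; nra. }
      assert (H4 : 0 <= m ^ 4 / y ^ 2) by (apply Rdiv_le_0_compat; [apply pow_le; lra|assumption]).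
      pose proof C0_ge0. pose proof (Rle_abs Cf). unfold Rdiv in *. nra.
    + exists a0, a1, a2. intros z Hz. rewrite <- Hq, Heq by assumption. ring.
Qed.
End ML.

(** The disc inequality transported by the Cayley map centred at z0, using (1 + |w|) / (1 - |w|) <=
    4 / (1 - |w|^2) and the explicit value of 1 - |w|^2. *)
Lemma harnack k z0 z : (forall z, in_U z -> Cdiff k z) -> (forall z, in_U z -> 0 < Re (k z)) -> in_U z0 -> in_U z ->
  Cmod (k z) <= Cmod (k z0) * (Cmod (z - Cconj z0) ^ 2 / (Im z * Im z0)).
Proof.
  intros Hk Hpos Hz0 Hz. destruct (cay_inv z0 z Hz0 Hz) as [E1 [Hw Hw2]]. set (w := ((z - z0) / (z - Cconj z0))%C) in *.
  pose proof (positive_real_growth (fun w => k (cayley_map z0 w))) as H. cbv beta in H.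
  specialize (H (fun u Hu => Cdiff_comp k (cayley_map z0) u (Hk _ (cay_U z0 u Hz0 Hu)) (cay_Cdiff z0 u Hu)) (fun u Hu => Hpos _ (cay_U z0 u Hz0 Hu)) w Hw).
  rewrite E1 in H. replace (cayley_map z0 0) with z0 in H.
  2:{ unfold cayley_map. field. }
  eapply Rle_trans; [exact H|]. apply Rmult_le_compat_l; [apply Cmod_ge_0|].
  unfold in_U in *. set (D := Cmod (z - Cconj z0)) in *. pose proof (Cmod_ge_0 w) as Hw0.
  assert (HD : 0 < D).
  { pose proof (im_le_Cmod (z - Cconj z0)) as Hi. fold D in Hi. replace (Im (z - Cconj z0)) with (Im z + Im z0) in Hi by (unfold Im; simpl; lra).
    rewrite Rabs_pos_eq in Hi by lra. lra. }
  assert (HD2 : 0 < D ^ 2) by (apply pow_lt; assumption).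
  assert (Hq : 0 < 1 - Cmod w ^ 2) by nra.
  apply Rle_trans with (4 / (1 - Cmod w ^ 2)).
  - apply (proj2 (Rle_div_l _ _ (1 - Cmod w) ltac:(lra))). replace (4 / (1 - Cmod w ^ 2) * (1 - Cmod w)) with (4 / (1 + Cmod w)) by (field; split; [lra|nra]).
    apply (proj1 (Rle_div_r _ _ (1 + Cmod w) ltac:(lra))). nra.
  - rewrite Hw2. right. field. repeat split; lra.
Qed.

(** * Kernel estimates and local expansions at poles *)

Lemma inv_dist (z : C) (t rho : R) : 0 < rho <= 1 -> rho <= Cmod (z - t) -> / Cmod (z - t) <= 2 * (1 + Cmod z) / rho * / (1 + Rabs t).
Proof.
  intros Hrho Hd. pose proof (Rabs_pos t) as Ht. pose proof (Cmod_ge_0 z) as Hz.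
  assert (Htz : Rabs t <= Cmod z + Cmod (z - t)) by (pose proof (Cmod_rev t z) as H; rewrite Cmod_R, (Cmod_minus_sym t z) in H; lra).
  set (d := Cmod (z - t)) in *. apply (Rmult_le_reg_l d); [lra|]. rewrite Rinv_r by lra.
  apply (Rmult_le_reg_r (rho * (1 + Rabs t))); [nra|].
  replace (d * (2 * (1 + Cmod z) / rho * / (1 + Rabs t)) * (rho * (1 + Rabs t))) with (2 * (1 + Cmod z) * d) by (field; lra). nra.
Qed.

Lemma wt1 (t : R) : wt 1 t = / (1 + Rabs t) ^ 2.
Proof.
  unfold wt. pose proof (Rabs_pos t). rewrite exp_Ropp. f_equal. replace ((1 + 1) * ln (1 + Rabs t)) with (ln (1 + Rabs t) + ln (1 + Rabs t)) by ring.
  rewrite exp_plus, exp_ln by lra. ring.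
Qed.

(** The minimum of two numbers is at most their geometric mean with exponents kap and 1 - kap. *)
Lemma min_interp (y t kap : R) : 1 <= y -> 0 < kap <= 1 -> Rmin y (1 + Rabs t) * / (1 + Rabs t) ^ 2 <= Rpower y kap * wt kap t.
Proof.
  intros Hy Hk. pose proof (Rabs_pos t) as Ht. set (a := Rmin y (1 + Rabs t)). assert (Ha : 1 <= a) by (apply Rmin_glb; lra).
  rewrite <- wt1. unfold wt, Rpower. rewrite <- exp_plus. rewrite <- (exp_ln a) by lra. rewrite <- exp_plus. apply exp_le_mono.
  assert (H1 : ln a <= ln y) by (apply ln_le; [lra|apply Rmin_l]).
  assert (H2 : ln a <= ln (1 + Rabs t)) by (apply ln_le; [lra|apply Rmin_r]). nra.
Qed.

Lemma kernel_iy (y t : R) : 1 <= y -> Cmod (1 + t * (0, y)) <= 2 * Rmin y (1 + Rabs t) * Cmod ((0, y) - t).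
Proof.
  intros Hy. pose proof (Rabs_pos t) as Ht.
  assert (E1 : Cmod (1 + t * (0, y)) ^ 2 = 1 + t ^ 2 * y ^ 2) by (rewrite Cmod2_alt; simpl; ring).
  assert (E2 : Cmod ((0, y) - t) ^ 2 = y ^ 2 + t ^ 2) by (rewrite Cmod2_alt; simpl; ring).
  assert (E3 : Rabs t ^ 2 = t ^ 2) by apply pow2_abs. set (s := Rabs t) in *. rewrite <- E3 in *.
  pose proof (Cmod_ge_0 (1 + t * (0, y))) as P1. pose proof (Cmod_ge_0 ((0, y) - t)) as P2.
  set (u := Cmod (1 + t * (0, y))) in *. set (v := Cmod ((0, y) - t)) in *.
  assert (Hm : 0 <= Rmin y (1 + s)) by (apply Rmin_glb; lra).
  apply Rsqr_incr_0_var; [|repeat apply Rmult_le_pos; lra]. unfold Rsqr.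
  replace (u * u) with (u ^ 2) by ring. replace (2 * Rmin y (1 + s) * v * (2 * Rmin y (1 + s) * v)) with (4 * Rmin y (1 + s) ^ 2 * v ^ 2) by ring.
  rewrite E1, E2. assert (Hs2 : 0 <= s ^ 2) by apply pow2_ge_0. assert (Hy2 : 1 <= y ^ 2) by nra.
  unfold Rmin. destruct (Rle_dec y (1 + s)); nra.
Qed.

Lemma simple_pole G B t : entire G -> entire B -> B t = 0%C -> C_derive B t <> 0%C ->
  exists d M, 0 < d /\ forall z, z <> t -> Cmod (z - t) < d -> Cmod (G z / B z - G t / C_derive B t / (z - t)) <= M.
Proof.
  intros HG HBe Hz Hn. set (be := dq B t). assert (Hbe : entire be) by now apply dq_entire.
  assert (Hbt : be t = C_derive B t) by apply dq_at.
  destruct (ccont_neq0 be t (Cdiff_ccont _ _ (Hbe t))) as [d1 [Hd1 H1]]; [now rewrite Hbt|].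
  assert (Hbn : forall z, Cmod (z - t) < d1 -> be z <> 0%C) by (intros z Hzd; apply Cmod_pos_neq; specialize (H1 z Hzd); pose proof (Cmod_ge_0 (be t)); lra).
  set (psi := fun z => (G z / be z)%C).
  assert (Hh : holn psi t) by (exists d1; split; [assumption|]; intros z Hzd; apply Cdiff_div; [apply HG|apply Hbe|now apply Hbn]).
  destruct (ccont_bound (dq psi t) t 1 (Cdiff_ccont _ _ (dq_Cdiff psi t t Hh (holn_Cdiff _ _ Hh))) ltac:(lra)) as [d2 [Hd2 H2]].
  exists (Rmin d1 d2), (Cmod (dq psi t t) + 1). split; [now apply Rmin_glb_lt|]. intros z Hne Hzd.
  assert (Hz1 : Cmod (z - t) < d1) by (eapply Rlt_le_trans; [exact Hzd|apply Rmin_l]).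
  assert (Hz2 : Cmod (z - t) < d2) by (eapply Rlt_le_trans; [exact Hzd|apply Rmin_r]).
  replace (G z / B z - G t / C_derive B t / (z - t))%C with (dq psi t z); [now apply H2|].
  rewrite dq_ne by assumption. unfold psi. rewrite (dq_eq B t z), Hz, Hbt. fold be. field.
  repeat split; try assumption; [now apply Cminus_neq0|now apply Hbn].
Qed.

(** With B = (z - t) be, the function psi = G / be^2 is holomorphic near t, and two difference
    quotients extract its value and derivative there. The second derivative of B enters as be'(t) =
    B''(t) / 2. *)
Lemma double_pole G B t : entire G -> entire B -> B t = 0%C -> C_derive B t <> 0%C ->
  let B1 := C_derive B t in let B2 := C_derive (C_derive B) t in
  exists d M, 0 < d /\ forall z, z <> t -> Cmod (z - t) < d ->
    Cmod (G z / (B z * B z) - (G t / (B1 * B1 * ((z - t) * (z - t))) + (C_derive G t * B1 - G t * B2) / (B1 * B1 * B1 * (z - t)))) <= M.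
Proof.
  intros HG HBe Hz Hn B1 B2. set (be := dq B t). assert (Hbe : entire be) by now apply dq_entire.
  assert (Hbt : be t = B1) by apply dq_at.
  destruct (ccont_neq0 be t (Cdiff_ccont _ _ (Hbe t))) as [d1 [Hd1 H1]]; [now rewrite Hbt|].
  assert (Hbn : forall z, Cmod (z - t) < d1 -> be z <> 0%C) by (intros z Hzd; apply Cmod_pos_neq; specialize (H1 z Hzd); pose proof (Cmod_ge_0 (be t)); lra).
  set (psi := fun z => (G z / (be z * be z))%C).
  assert (Hd : forall z, Cmod (z - t) < d1 -> Cdiff psi z).
  { intros z Hzd. apply Cdiff_div; [apply HG|apply Cdiff_mult; apply Hbe|apply Cmult_neq_0; now apply Hbn]. }
  assert (Hh : holn psi t) by (exists d1; now split).
  set (chi := dq psi t). assert (Hhc : holn chi t) by (exists d1; split; [assumption|]; intros z Hzd; apply dq_Cdiff; auto).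
  destruct (ccont_bound (dq chi t) t 1 (Cdiff_ccont _ _ (dq_Cdiff chi t t Hhc (holn_Cdiff _ _ Hhc))) ltac:(lra)) as [d2 [Hd2 H2]].
  assert (Hct : chi t = ((C_derive G t * B1 - G t * B2) / (B1 * B1 * B1))%C).
  { unfold chi. rewrite dq_at. apply C_derive_cd.
    replace ((C_derive G t * B1 - G t * B2) / (B1 * B1 * B1))%C
      with ((C_derive G t * (be t * be t) - G t * (B2 / 2 * be t + be t * (B2 / 2))) / ((be t * be t) * (be t * be t)))%C by (rewrite Hbt; field; assumption).
    assert (Hcb : cd be t (B2 / 2)%C) by (apply dq_cd_at, entire_holn, HBe).
    apply (cd_div G (fun z => be z * be z)%C).
    - apply cd_C_derive, HG.
    - now apply (cd_mult be be).
    - rewrite Hbt. now apply Cmult_neq_0. }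
  exists (Rmin d1 d2), (Cmod (dq chi t t) + 1). split; [now apply Rmin_glb_lt|]. intros z Hne Hzd.
  assert (Hz1 : Cmod (z - t) < d1) by (eapply Rlt_le_trans; [exact Hzd|apply Rmin_l]).
  assert (Hz2 : Cmod (z - t) < d2) by (eapply Rlt_le_trans; [exact Hzd|apply Rmin_r]).
  pose proof (Cminus_neq0 z t Hne) as Hzt. pose proof (Hbn z Hz1) as Hbz.
  match goal with |- Cmod ?X <= _ => replace X with (dq chi t z); [now apply H2|] end.
  rewrite dq_ne by assumption. rewrite Hct. unfold chi. rewrite dq_ne by assumption. unfold psi. rewrite Hbt, (dq_eq B t z), Hz. fold be. field.
  repeat split; assumption.
Qed.

(** * The quotient A/B *)

Section Herglotz.
Variables (E : C -> C) (alpha eta delta h : R) (phi : R -> R).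
Hypothesis HB : Hermite_Biehler E.
Hypothesis Heta : 0 < eta.
Hypothesis Hne : forall z, - eta < Im z -> E z <> 0%C.
Hypothesis Hth4 : forall z, - eta < Im z -> Cmod (th E z) <= 4.
Hypothesis Hphi : forall x : R, Im (eia (phi x) * E x)%C = 0.
Hypothesis Hth' : forall x : R, C_derive (th E) x = ((0, (2 * Derive phi x)%R) * th E x)%C.
Hypothesis Hdelta : 0 < delta.
Hypothesis Hphi' : forall x, T_set phi alpha x -> delta <= Derive phi x.
Hypothesis Hh : 0 < h <= 1.
Let T := T_set phi alpha.
Let A := A_alpha E alpha.
Let B := B_alpha E alpha.
Hypothesis Hsep : forall t t', T t -> T t' -> t <> t' -> h <= Rabs (t - t').
Hypothesis HnAB : ~ HdB (Csq E) (fun z => A z * B z)%C.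

Lemma herglotz_no_real_zero (x : R) : E x <> 0%C.
Proof. apply Hne. simpl. lra. Qed.
Lemma offT_B z : ~ Tc T z -> B z <> 0%C.
Proof. intros H H0. apply H. exact (B_zero E alpha HB phi Hphi herglotz_no_real_zero z H0). Qed.
Lemma nonreal_off z : Im z <> 0 -> ~ Tc T z.
Proof. intros H [t [_ ->]]. apply H. reflexivity. Qed.
Lemma T_B t : T t -> B t = 0%C.
Proof. intros H. exact (proj2 (B_zero_iff E alpha phi Hphi herglotz_no_real_zero t) H). Qed.
Lemma zt_lt z : 0 < Im z -> Cmod (zt E alpha z) < 1.
Proof. intros H. rewrite zt_mod. now apply th_lt. Qed.

(** i A/B is the Cayley transform of [zt], so it has positive real part in the upper half plane; and
    A/B - i = exp (i alpha) E / B carries its bounds over to E/B. *)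
Definition mer (z : C) : C := (A z / B z)%C.

Lemma mer_EB z : B z <> 0%C -> (eia alpha * E z / B z)%C = (mer z - Ci)%C.
Proof. intros H. rewrite (AB_E E alpha z). unfold mer. fold A B. field. assumption. Qed.

Lemma mer_zt z : 0 < Im z -> (Ci * mer z)%C = ((1 + zt E alpha z) / (1 - zt E alpha z))%C.
Proof.
  intros Hz. pose proof (hb_ne E HB z Hz) as Hn. unfold mer, A, B. rewrite (A_zt E alpha z Hn), (B_zt E alpha z Hn). field.
  split; [apply one_minus_ne; now apply zt_lt|]. split; [assumption|]. split; [apply eia_ne|apply Ci_ne].
Qed.

Lemma cayley_re (u : C) : Cmod u < 1 -> 0 < Re ((1 + u) / (1 - u)).
Proof.
  intros Hu. pose proof (one_minus_ne u Hu) as Hn. pose proof (proj1 (Cmod_gt_0 _) Hn) as Hp.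
  assert (E1 : ((1 + u) / (1 - u))%C = (RtoC (/ Cmod (1 - u) ^ 2) * ((1 + u) * Cconj (1 - u)))%C).
  { assert (E2 : ((1 - u) * Cconj (1 - u))%C = RtoC (Cmod (1 - u) ^ 2)) by (rewrite Cmod2_conj; reflexivity).
    rewrite RtoC_inv by (apply pow_nonzero; lra). rewrite <- E2.
    pose proof (Cconj_neq0 _ Hn) as Hcn.
    field. split; assumption. }
  rewrite E1. assert (Hu2 : Cmod u ^ 2 < 1) by (pose proof (Cmod_ge_0 u); nra). rewrite Cmod2_alt in Hu2.
  assert (Hi : 0 < / Cmod (1 - u) ^ 2) by (apply Rinv_0_lt_compat, pow_lt; assumption).
  set (i := / Cmod (1 - u) ^ 2) in *. destruct u as [u1 u2]. simpl in *. nra.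
Qed.

Lemma mer_Cdiff z : B z <> 0%C -> Cdiff mer z.
Proof. intros H. apply Cdiff_div; [apply A_entire, hb_entire, HB|apply B_entire, hb_entire, HB|assumption]. Qed.

Lemma mer_conj z : mer (Cconj z) = Cconj (mer z).
Proof.
  unfold mer. destruct (Ceq_dec (B z) 0) as [H0|H0].
  - assert (H1 : B (Cconj z) = 0%C).
    { pose proof (B_star E alpha z) as Hs. fold B in Hs. unfold Cstar in Hs. rewrite H0 in Hs. rewrite <- (Cconj_conj (B (Cconj z))), Hs. unfold Cconj; simpl. Cext. }
    rewrite H0, H1. unfold Cdiv. apply injective_projections; simpl; unfold Rdiv; rewrite !Rmult_0_l, !Ropp_0, ?Rmult_0_l; ring.
  - rewrite Cdiv_conj by assumption. f_equal.
    + pose proof (A_star E alpha z) as Hs. unfold Cstar in Hs. fold A in Hs. rewrite <- Hs, Cconj_conj. reflexivity.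
    + pose proof (B_star E alpha z) as Hs. unfold Cstar in Hs. fold B in Hs. rewrite <- Hs, Cconj_conj. reflexivity.
Qed.

Lemma mer_growth : exists Cm, 0 <= Cm /\ forall z, Im z <> 0 -> Cmod (mer z) <= Cm * ((1 + Cmod z) ^ 2 / Rabs (Im z)).
Proof.
  exists (Cmod (mer Ci)). split; [apply Cmod_ge_0|].
  assert (HU : forall z, 0 < Im z -> Cmod (mer z) <= Cmod (mer Ci) * ((1 + Cmod z) ^ 2 / Im z)).
  { intros z Hz. pose proof (harnack (fun z => Ci * mer z)%C Ci z) as H. cbv beta in H. rewrite !Cmod_mult in H.
    pose proof Cmod_Ci as Hci. rewrite Hci, !Rmult_1_l in H.
    eapply Rle_trans; [apply H|].
    - intros w Hw. apply Cdiff_mult; [apply Cdiff_const|]. apply mer_Cdiff. apply (B_ne E alpha HB). unfold in_U in Hw. lra.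
    - intros w Hw. rewrite mer_zt by exact Hw. apply cayley_re. now apply zt_lt.
    - unfold in_U. simpl. lra.
    - exact Hz.
    - apply Rmult_le_compat_l; [apply Cmod_ge_0|]. change (Im Ci) with 1. rewrite Rmult_1_r. unfold Rdiv. apply Rmult_le_compat_r; [left; now apply Rinv_0_lt_compat|].
      apply pow_incr. split; [apply Cmod_ge_0|]. eapply Rle_trans; [apply Cmod_triangle|]. rewrite Cmod_opp, Cmod_conj, Hci. lra. }
  intros z Hz. destruct (Rlt_dec 0 (Im z)) as [H|H]; [rewrite Rabs_pos_eq by lra; now apply HU|].
  specialize (HU (Cconj z)). rewrite mer_conj, !Cmod_conj, im_conj in HU. rewrite Rabs_left by lra. apply HU. lra.
Qed.

Definition res (t : R) : C := (A t / C_derive B t)%C.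
(** The kernel equals 1 / (z - t) + t / (1 + t^2). The added constant makes it decay like t^{-2}, as
    the residues are merely bounded. *)
Definition mterm (t : R) (z : C) : C := (res t * ((1 + t * z) / ((z - t) * (1 + t * t))))%C.

Variable K : R.
Hypothesis HK : 0 < K.
Hypothesis Hres : forall t, T t -> Cmod (res t) <= K.

Lemma t2_ne (t : R) : (1 + t * t)%C <> 0%C.
Proof. intros H. apply (f_equal Re) in H. simpl in H. nra. Qed.

Lemma t2_mod (t : R) : (1 + Rabs t) ^ 2 / 2 <= Cmod (1 + t * t).
Proof.
  replace (1 + t * t)%C with (RtoC (1 + t * t)) by (now rewrite RtoC_plus, RtoC_mult). assert (H : Rabs t ^ 2 = t ^ 2) by apply pow2_abs. replace (t * t) with (Rabs t ^ 2) by (rewrite H; ring). pose proof (pow2_ge_0 (Rabs t)).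
  rewrite Cmod_R, (Rabs_pos_eq (1 + Rabs t ^ 2)) by lra. pose proof (Rabs_pos t). pose proof (pow2_ge_0 (Rabs t - 1)). lra.
Qed.

Lemma mterm_mod t z X : T t -> z <> RtoC t -> 0 <= X -> Cmod (1 + t * z) <= X * Cmod (z - t) -> Cmod (mterm t z) <= K * (X * (2 * / (1 + Rabs t) ^ 2)).
Proof.
  intros Ht Hzt HX H. pose proof (Cminus_neq0 z t Hzt) as Hn. pose proof (proj1 (Cmod_gt_0 _) Hn) as Hp.
  unfold mterm. rewrite Cmod_mult, Cmod_div, Cmod_mult by (apply Cmult_neq_0; [assumption|apply t2_ne]).
  apply Rmult_le_compat; [apply Cmod_ge_0| |now apply Hres|].
  - apply Rdiv_le_0_compat; [apply Cmod_ge_0|]. apply Rmult_lt_0_compat; [assumption|]. apply Cmod_gt_0, t2_ne.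
  - pose proof (t2_mod t) as H2. pose proof (Rabs_pos t). assert (H3 : 0 < (1 + Rabs t) ^ 2) by (apply pow_lt; lra).
    set (w := Cmod (1 + t * t)) in *. set (d := Cmod (z - t)) in *. set (s := (1 + Rabs t) ^ 2) in *.
    apply (proj2 (Rle_div_l _ _ (d * w) ltac:(nra))). eapply Rle_trans; [exact H|].
    assert (1 <= 2 * / s * w).
    { apply (Rmult_le_reg_l s); [assumption|]. replace (s * (2 * / s * w)) with (2 * w) by (field; lra). lra. }
    assert (0 <= X * d) by nra. replace (X * (2 * / s) * (d * w)) with ((X * d) * (2 * / s * w)) by ring. nra.
Qed.

Lemma mterm_kernel t z rho : T t -> 0 < rho <= 1 -> rho <= Cmod (z - t) ->
  Cmod (mterm t z) <= (4 * K * wt 1 t) * ((1 + Cmod z) ^ 2 / rho ^ 2).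
Proof.
  intros Ht Hrho Hd. pose proof (Rabs_pos t) as Hs. pose proof (Cmod_ge_0 z) as Hz.
  assert (Hzt : z <> RtoC t) by (intros ->; rewrite Cmod_self in Hd; lra).
  set (X := 2 * (1 + Cmod z) ^ 2 / rho).
  assert (HX : 0 <= X) by (apply Rdiv_le_0_compat; [pose proof (pow2_ge_0 (1 + Cmod z)); lra|lra]).
  eapply Rle_trans; [apply (mterm_mod t z X Ht Hzt HX)|].
  - pose proof (inv_dist z t rho Hrho Hd) as Hi. set (d := Cmod (z - t)) in *.
    assert (H1 : 1 + Rabs t <= 2 * (1 + Cmod z) / rho * d).
    { apply (Rmult_le_reg_r (/ d * / (1 + Rabs t))); [apply Rmult_lt_0_compat; apply Rinv_0_lt_compat; lra|].
      replace ((1 + Rabs t) * (/ d * / (1 + Rabs t))) with (/ d) by (field; lra).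
      replace (2 * (1 + Cmod z) / rho * d * (/ d * / (1 + Rabs t))) with (2 * (1 + Cmod z) / rho * / (1 + Rabs t)) by (field; lra). exact Hi. }
    eapply Rle_trans; [apply Cmod_triangle|]. rewrite Cmod_1, Cmod_mult, Cmod_R.
    apply Rle_trans with ((1 + Cmod z) * (1 + Rabs t)); [nra|].
    replace (X * d) with ((1 + Cmod z) * (2 * (1 + Cmod z) / rho * d)) by (unfold X; field; lra). apply Rmult_le_compat_l; lra.
  - rewrite wt1. set (s := / (1 + Rabs t) ^ 2). assert (0 < s) by (apply Rinv_0_lt_compat, pow_lt; lra).
    assert (H2 : X <= 2 * ((1 + Cmod z) ^ 2 / rho ^ 2)).
    { unfold X. replace (2 * (1 + Cmod z) ^ 2 / rho) with (2 * ((1 + Cmod z) ^ 2 / rho ^ 2) * rho) by (field; lra).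
      assert (0 <= (1 + Cmod z) ^ 2 / rho ^ 2) by (now apply kernel_nonneg). nra. }
    apply Rle_trans with (K * (2 * ((1 + Cmod z) ^ 2 / rho ^ 2) * (2 * s))); [|right; ring].
    apply Rmult_le_compat_l; [lra|]. apply Rmult_le_compat_r; lra.
Qed.

Lemma mterm_iy t y kap : T t -> 1 <= y -> 0 < kap <= 1 -> Cmod (mterm t (0, y)) <= 4 * K * Rpower y kap * wt kap t.
Proof.
  intros Ht Hy Hk. pose proof (Rabs_pos t) as Hs. pose proof (min_interp y t kap Hy Hk) as Hm.
  assert (H0 : 0 <= Rmin y (1 + Rabs t)) by (apply Rmin_glb; lra).
  eapply Rle_trans; [apply (mterm_mod t (0, y) (2 * Rmin y (1 + Rabs t)) Ht)|].
  - intros E0. apply (f_equal Im) in E0. simpl in E0. lra.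
  - lra.
  - now apply kernel_iy.
  - nra.
Qed.

Lemma sub_wt kap l : 0 < kap <= 1 -> sub T l -> rsum l (wt kap) <= 8 / (kap * h).
Proof. intros Hk Hl. apply wt_sum; auto. now apply (sub_separated T h Hsep). Qed.

(** Bounded residues and the t^{-2} decay give convergence over the separated nodes. On iy the
    kernel is at most a multiple of y^kap (1 + |t|)^{-(1 + kap)} by [kernel_iy] and [min_interp],
    hence the bound for every exponent. *)
Lemma mer_expansion : exists S a0 a1 a2, (forall z, ~ Tc T z -> mer z = (S z + (a0 + a1 * z + a2 * (z * z)))%C) /\
  forall kap, 0 < kap <= 1 -> exists Ck, 0 <= Ck /\ forall y, 1 <= y -> Cmod (S (0, y)) <= Ck * Rpower y kap.
Proof.
  set (om := fun t => 4 * K * wt 1 t).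
  assert (HC : forall l, sub T l -> rsum l om <= 4 * K * (8 / (1 * h))).
  { intros l Hl. unfold om. rewrite rsum_scal. apply Rmult_le_compat_l; [lra|]. apply sub_wt; [lra|assumption]. }
  assert (Hker : forall t z rho, T t -> 0 < rho <= 1 -> rho <= Cmod (z - t) -> Cmod (mterm t z) <= om t * ((1 + Cmod z) ^ 2 / rho ^ 2)) by (intros; now apply mterm_kernel).
  assert (Hcd : forall t z, T t -> z <> RtoC t -> Cdiff (mterm t) z).
  { intros t z _ Hzt. unfold mterm. apply Cdiff_mult; [apply Cdiff_const|]. apply Cdiff_div; [| |apply Cmult_neq_0; [now apply Cminus_neq0|apply t2_ne]].
    - apply Cdiff_plus; [apply Cdiff_const|]. apply Cdiff_mult; [apply Cdiff_const|apply Cdiff_id].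
    - apply Cdiff_mult; [|apply Cdiff_const]. apply Cdiff_minus; [apply Cdiff_id|apply Cdiff_const]. }
  destruct (ml_sum T h om _ mterm Hh Hsep HC Hker) as [S [L [HL HS]]].
  destruct mer_growth as [Cm [HCm Hg]].
  destruct (mittag_leffler T h om _ mterm Hh Hsep HC Hcd Hker S L HL HS mer Cm) as [a0 [a1 [a2 Hex]]].
  - intros z Hz. apply mer_Cdiff. now apply offT_B.
  - intros t Ht. destruct (simple_pole A B t) as [d [M [Hd HM]]].
    + apply A_entire, hb_entire, HB.
    + apply B_entire, hb_entire, HB.
    + now apply T_B.
    + exact (B1_ne E alpha eta delta phi HB Heta Hne Hphi Hth' Hdelta Hphi' t Ht).
    + exists d, (M + Cmod (res t * (t / (1 + t * t)))). split; [assumption|]. intros z Hzt Hz. pose proof (Cminus_neq0 z t Hzt) as Hn.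
      replace (mer z - mterm t z)%C with ((A z / B z - A t / C_derive B t / (z - t)) + - (res t * (t / (1 + t * t))))%C.
      * eapply Rle_trans; [apply Cmod_triangle|]. rewrite Cmod_opp. apply Rplus_le_compat_r. now apply HM.
      * unfold mterm. fold (res t). unfold mer. set (q := (A z / B z)%C). field. split; [apply t2_ne|assumption].
  - intros z Hz. eapply Rle_trans; [now apply Hg|]. assert (Hy : 0 < Rabs (Im z)) by now apply Rabs_pos_lt.
    rewrite <- (pow2_abs (Im z)). pose proof (im_le_Cmod z) as Hi. set (y := Rabs (Im z)) in *. set (m := 1 + Cmod z).
    assert (Hm : 1 <= m) by (unfold m; pose proof (Cmod_ge_0 z); lra). unfold Rdiv. rewrite Rmult_assoc. apply Rmult_le_compat_l; [assumption|].
    replace (m ^ 2 * / y) with ((m ^ 2 * / y ^ 2) * y) by (field; lra). replace (m ^ 4 * / y ^ 2) with ((m ^ 2 * / y ^ 2) * m ^ 2) by (field; lra).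
    apply Rmult_le_compat_l; [apply Rmult_le_pos; [apply pow2_ge_0|left; apply Rinv_0_lt_compat, pow_lt; assumption]|]. unfold m in *. nra.
  - exists S, a0, a1, a2. split; [exact Hex|]. intros kap Hk. exists (4 * K * (8 / (kap * h))). split; [apply Rmult_le_pos; [lra|]; apply Rdiv_le_0_compat; nra|].
    intros y Hy. apply (ml_sum_le T h om mterm Hh Hsep Hker S L HL HS); [apply nonreal_off; simpl; lra|].
    intros l Hl. eapply Rle_trans; [apply Csum_bound|]. apply Rle_trans with (rsum l (fun t => 4 * K * Rpower y kap * wt kap t)).
    + apply rsum_le. intros t Ht. apply mterm_iy; [now apply Hl|assumption|assumption].
    + rewrite rsum_scal. pose proof (sub_wt kap l Hk Hl) as Hs. assert (0 < Rpower y kap) by apply exp_pos.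
      assert (0 < 4 * K * Rpower y kap) by (apply Rmult_lt_0_compat; lra).
      replace (4 * K * (8 / (kap * h)) * Rpower y kap) with (4 * K * Rpower y kap * (8 / (kap * h))) by ring. apply Rmult_le_compat_l; lra.
Qed.

Lemma cd_real_int (P f : C -> C) (X : R) : 0 <= X -> (forall x : R, cd P x (f x)) -> (forall x : R, ccont f x) ->
  is_RInt (fun t : R => Re (f t)) (- X) X (Re (P X) - Re (P (- X)%R)).
Proof.
  intros HX HP Hc. apply (is_RInt_derive (V := R_CompleteNormedModule) (fun t : R => Re (P t))).
  - intros t _. assert (H' : cd P (0 + t * 1)%C (f t)) by (replace (0 + t * 1)%C with (RtoC t) by ring; apply HP).
    pose proof (cd_real_line P 0 1 t _ 1 H') as H. rewrite Cmult_1_l, Cmult_1_r in H.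
    apply (is_derive_ext (fun s : R => Re (1 * P (0 + s * 1))%C)); [|exact H]. intros s. rewrite Cmult_1_l. do 2 f_equal. ring.
  - intros t _. apply continuous_R_eps. intros eps He. destruct (Hc t eps He) as [d [Hd H]]. exists d. split; [assumption|]. intros s Hs.
    eapply Rle_lt_trans; [|apply (H s); rewrite <- RtoC_minus, Cmod_R; exact Hs].
    eapply Rle_trans; [|apply re_le_Cmod]. right. reflexivity.
Qed.

(* The factor (X^2 - z^2)/X^2 makes up for the singularity C2/Im z at the corners of [-X, X] x [0, X]. *)
Lemma contour_bound (k : C -> C) C2 X : (forall z, - eta < Im z -> Cdiff k z) -> 0 < X -> 0 <= C2 ->
  (forall z, 0 < Im z -> X <= Cmod z -> Cmod (k z) <= C2 / Im z) ->
  (forall x, 0 <= Re (k (RtoC x))) -> RInt (fun t : R => Re (k t)) (- (X / 2)) (X / 2) <= 16 * C2.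
Proof.
  intros Hk HX HC2 Hb Hpos.
  set (f := fun z => (k z * ((X * X - z * z) / (X * X)))%C).
  assert (HXX : (RtoC X * RtoC X)%C <> 0%C) by (apply Cmult_neq_0; intros E0; apply RtoC_inj in E0; lra).
  assert (Hf : forall z, - eta < Im z -> Cdiff f z).
  { intros z Hz. apply Cdiff_mult; [now apply Hk|]. apply Cdiff_div; [|apply Cdiff_const|assumption].
    apply Cdiff_minus; [apply Cdiff_const|apply Cdiff_mult; apply Cdiff_id]. }
  destruct (hol_primitive (fun z => - eta < Im z) f 0 (convC_upper _) (openC_upper _) ltac:(simpl; lra) Hf) as [P HP].
  (* The sign selects the right or left side. At height s X one has |X^2 - z^2| <= 3 s X^2, which
     cancels the singularity C2 / (s X). *)
  assert (Hside : forall sg : R, sg ^ 2 = 1 -> forall s, 0 <= s <= 1 -> Cmod (f (sg * X, s * X)) <= 3 * C2 / X).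
  { intros sg Hsg s Hs. unfold f. rewrite Cmod_mult, Cmod_div by assumption.
    destruct (Req_dec s 0) as [->|Hs0].
    - replace (X * X - ((sg * X)%R, (0 * X)%R) * ((sg * X)%R, (0 * X)%R))%C with (RtoC 0).
      + rewrite Cmod_0. replace (0 / Cmod (X * X)) with 0 by (unfold Rdiv; ring). rewrite Rmult_0_r. apply Rdiv_le_0_compat; lra.
      + apply injective_projections; simpl; [|ring]. replace (sg * X * (sg * X)) with (sg ^ 2 * (X * X)) by ring. rewrite Hsg. ring.
    - assert (H1 : Cmod (k (sg * X, s * X)) <= C2 / (s * X)).
      { apply Hb; simpl; [nra|]. eapply Rle_trans; [|apply Rmax_Cmod]. eapply Rle_trans; [|apply Rmax_l]. simpl. rewrite Rabs_mult, (Rabs_pos_eq X) by lra.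
        assert (Rabs sg = 1) by (pose proof (pow2_abs sg); pose proof (Rabs_pos sg); nra). nra. }
      assert (H2 : Cmod (X * X - ((sg * X)%R, (s * X)%R) * ((sg * X)%R, (s * X)%R)) <= 3 * s * X ^ 2).
      { eapply Rle_trans; [apply Cmod_le_ReIm|]. simpl. replace (X * X - 0 * 0 + - (sg * X * (sg * X) - s * X * (s * X))) with ((s * X) ^ 2 + (1 - sg ^ 2) * X ^ 2) by ring.
        replace (X * 0 + 0 * X + - (sg * X * (s * X) + s * X * (sg * X))) with (- 2 * (sg * (s * X ^ 2))) by ring. rewrite Hsg.
        replace ((s * X) ^ 2 + (1 - 1) * X ^ 2) with ((s * X) ^ 2) by ring. rewrite !Rabs_mult. rewrite (Rabs_left (-2)) by lra.
        assert (Hsg1 : Rabs sg = 1) by (pose proof (pow2_abs sg); pose proof (Rabs_pos sg); nra). rewrite Hsg1.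
        assert (0 <= X ^ 2) by apply pow2_ge_0. rewrite (Rabs_pos_eq ((s * X) ^ 2)) by apply pow2_ge_0. rewrite (Rabs_pos_eq s), (Rabs_pos_eq (X ^ 2)) by lra. nra. }
      assert (H3 : Cmod (X * X) = X ^ 2) by (rewrite Cmod_mult, Cmod_R, Rabs_pos_eq by lra; ring). rewrite H3.
      assert (HX2 : 0 < X ^ 2) by (apply pow_lt; lra).
      apply Rle_trans with (C2 / (s * X) * (3 * s * X ^ 2 / X ^ 2)).
      + apply Rmult_le_compat; [apply Cmod_ge_0|apply Rdiv_le_0_compat; [apply Cmod_ge_0|assumption]|exact H1|].
        unfold Rdiv. apply Rmult_le_compat_r; [left; now apply Rinv_0_lt_compat|exact H2].
      + right. field. lra. }
  assert (Htop : forall s, 0 <= s <= 1 -> Cmod (f (X - 2 * s * X, X)) <= 3 * C2 / X).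
  { intros s Hs. unfold f. rewrite Cmod_mult, Cmod_div by assumption. set (z := (X - 2 * s * X, X) : C).
    assert (Hz1 : X <= Cmod z) by (eapply Rle_trans; [|apply Rmax_Cmod]; eapply Rle_trans; [|apply Rmax_r]; simpl; rewrite Rabs_pos_eq; lra).
    assert (Hz2 : Cmod z ^ 2 <= 2 * X ^ 2).
    { rewrite Cmod2_alt. unfold z; simpl. assert (0 <= s * (1 - s) * X ^ 2) by (repeat apply Rmult_le_pos; try lra; apply pow2_ge_0). nra. }
    pose proof (Hb z ltac:(unfold z; simpl; lra) Hz1) as H1. change (Im z) with X in H1.
    assert (H3 : Cmod (X * X) = X ^ 2) by (rewrite Cmod_mult, Cmod_R, Rabs_pos_eq by lra; ring).
    assert (HX2 : 0 < X ^ 2) by (apply pow_lt; lra).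
    assert (H2 : Cmod (X * X - z * z) <= 3 * X ^ 2).
    { eapply Rle_trans; [apply Cmod_triangle|]. rewrite Cmod_opp, H3, Cmod_mult. simpl in Hz2 |- *. lra. }
    rewrite H3. apply Rle_trans with (C2 / X * (3 * X ^ 2 / X ^ 2)).
    - apply Rmult_le_compat; [apply Cmod_ge_0|apply Rdiv_le_0_compat; [apply Cmod_ge_0|assumption]|exact H1|].
      unfold Rdiv. apply Rmult_le_compat_r; [left; now apply Rinv_0_lt_compat|exact H2].
    - right. field. lra. }
  assert (HC3 : 0 <= 3 * C2 / X) by (apply Rdiv_le_0_compat; lra).
  set (zr := (X, X) : C). set (zl := (- X, X) : C).
  assert (Hv : forall sg : R, sg ^ 2 = 1 -> Cmod (P (sg * X, X) - P (sg * X)%R) <= 3 * C2).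
  { intros sg Hsg. replace (3 * C2) with (3 * C2 / X * Cmod ((sg * X, X) - (sg * X)%R)).
    - assert (Ep : forall s : R, ((sg * X)%R + s * (((sg * X)%R, X) - (sg * X)%R))%C = (sg * X, s * X)) by (intros s; Cext).
      apply (mean_value_ineq P f); intros s Hs; rewrite Ep; [|now apply Hside].
      apply HP. simpl. nra.
    - replace (((sg * X)%R, X) - (sg * X)%R)%C with (0, X) by (Cext). rewrite Cmod_iy by lra. field. lra. }
  assert (Ht : Cmod (P zl - P zr) <= 6 * C2).
  { replace (6 * C2) with (3 * C2 / X * Cmod (zl - zr)).
    - assert (Ep : forall s : R, (zr + s * (zl - zr))%C = (X - 2 * s * X, X)) by (intros s; unfold zr, zl; Cext).
      apply (mean_value_ineq P f); intros s Hs; rewrite Ep; [|now apply Htop]. apply HP. simpl. lra.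
    - replace (zl - zr)%C with (RtoC (- 2 * X)) by (unfold zr, zl; Cext). rewrite Cmod_R, Rabs_mult, (Rabs_left (-2)), (Rabs_pos_eq X) by lra. field. lra. }
  assert (Hre : forall x : R, - eta < Im x) by (intros x; simpl; lra).
  pose proof (cd_real_int P f X ltac:(lra) (fun x => HP x (Hre x)) (fun x => Cdiff_ccont _ _ (Hf x (Hre x)))) as HI.
  assert (Hend : Re (P X) - Re (P (- X)%R) <= 12 * C2).
  { pose proof (Hv 1 ltac:(ring)) as V1. pose proof (Hv (-1) ltac:(ring)) as V2. rewrite Rmult_1_l in V1. replace (-1 * X) with (- X) in V2 by ring.
    fold zr in V1. fold zl in V2. pose proof (re_le_Cmod (P X - P (- X)%R)) as H1. apply Rabs_le_between in H1.
    pose proof (Cmod_tri3 (P X) (P zr) (P (- X)%R)) as T1. pose proof (Cmod_tri3 (P zr) (P zl) (P (- X)%R)) as T2.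
    rewrite (Cmod_minus_sym (P X) (P zr)) in T1. rewrite (Cmod_minus_sym (P zr) (P zl)) in T2.
    change (Re (P X - P (- X)%R)) with (Re (P X) + - Re (P (- X)%R)) in H1. lra. }
  assert (Hfr : forall t : R, Re (f t) = Re (k t) * (1 - t ^ 2 / X ^ 2)).
  { intros t. unfold f. replace ((X * X - t * t) / (X * X))%C with (RtoC (1 - t ^ 2 / X ^ 2)).
    - assert (Hgen : forall (z : C) (c : R), Re (z * c) = Re z * c) by (intros [z1 z2] c; simpl; ring). apply Hgen.
    - replace (1 - t ^ 2 / X ^ 2) with ((X * X - t * t) / (X * X)) by (field; lra). rewrite RtoC_div by nra. now rewrite RtoC_minus, !RtoC_mult. }
  assert (Hexf : forall a b, ex_RInt (fun t : R => Re (f t)) a b /\ ex_RInt (fun t : R => Re (k t)) a b).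
  { assert (Hcc : forall (q : C -> C), (forall z, - eta < Im z -> Cdiff q z) -> forall a b, ex_RInt (fun t : R => Re (q t)) a b).
    { intros q Hq a b. apply (ex_RInt_continuous (V := R_CompleteNormedModule)). intros t _. apply continuous_R_eps. intros eps He.
      destruct (Cdiff_ccont _ _ (Hq t (Hre t)) eps He) as [d [Hd H]]. exists d. split; [assumption|]. intros s Hs.
      eapply Rle_lt_trans; [|apply (H s); rewrite <- RtoC_minus, Cmod_R; exact Hs]. eapply Rle_trans; [|apply re_le_Cmod]. right. reflexivity. }
    intros a b. split; apply Hcc; assumption. }
  (* For |t| <= X/2 the factor 1 - t^2 / X^2 is at least 3/4, and the outer intervals contribute
     nonnegatively. The three sides cost 12 C2, and dividing by 3/4 gives 16 C2. *)
  assert (Hsm : RInt (fun t : R => 3 / 4 * Re (k t)) (- (X / 2)) (X / 2) <= 12 * C2).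
  { apply Rle_trans with (RInt (fun t : R => Re (f t)) (- (X / 2)) (X / 2)).
    - apply RInt_le; [lra|apply ex_RInt_Rscal, Hexf|apply Hexf|]. intros t Ht0. rewrite Hfr. rewrite Rmult_comm. apply Rmult_le_compat_l; [apply Hpos|].
      assert (t ^ 2 <= X ^ 2 / 4) by nra. assert (t ^ 2 / X ^ 2 <= 1 / 4); [|lra]. apply Rle_div_l; [apply pow_lt; lra|lra].
    - eapply Rle_trans; [|exact Hend]. rewrite <- (is_RInt_unique _ _ _ _ HI).
      rewrite (RInt_RChasles (fun t : R => Re (f t)) (- X) (- (X / 2)) X) by (intros; apply Hexf).
      rewrite (RInt_RChasles (fun t : R => Re (f t)) (- (X / 2)) (X / 2) X) by (intros; apply Hexf).
      assert (Hge : forall a b, - X <= a -> a <= b -> b <= X -> 0 <= RInt (fun t : R => Re (f t)) a b).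
      { intros a b Ha Hab Hbx. apply RInt_ge_0; [assumption|apply Hexf|]. intros t Ht0. rewrite Hfr. apply Rmult_le_pos; [apply Hpos|].
        assert (t ^ 2 / X ^ 2 <= 1); [|lra]. apply Rle_div_l; [apply pow_lt; lra|assert (0 <= (X - t) * (X + t)) by (apply Rmult_le_pos; lra); lra]. }
      pose proof (Hge (- X) (- (X / 2)) ltac:(lra) ltac:(lra) ltac:(lra)). pose proof (Hge (X / 2) X ltac:(lra) ltac:(lra) ltac:(lra)).
      lra. }
  rewrite RInt_Rscal in Hsm by apply Hexf. lra.
Qed.

Lemma unit_re (u : C) : Cmod u = 1 -> Cmod (1 - u) ^ 2 = 2 * Re (1 - u).
Proof.
  intros H. assert (H2 : Cmod u ^ 2 = 1) by (rewrite H; ring). rewrite Cmod2_alt in *. destruct u as [u1 u2]. simpl in *. lra.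
Qed.

Lemma zt_real_mod (x : R) : Cmod (zt E alpha x) = 1.
Proof.
  rewrite zt_mod. unfold th. rewrite (star_real_phase E phi Hphi).
  replace (eia (2 * phi x) * E x / E x)%C with (eia (2 * phi x)) by (field; apply herglotz_no_real_zero). apply Cmod_eia.
Qed.

Lemma A_le z : 0 <= Im z -> Cmod (A z) <= Cmod (E z).
Proof.
  intros Hz. unfold A, A_alpha. rewrite Cmod_mult. replace (Cmod (/ 2)) with (/ 2) by (rewrite <- RtoC_inv by lra; rewrite Cmod_R, Rabs_pos_eq; lra).
  pose proof (hb_le E HB z Hz). pose proof (Cmod_triangle (eia alpha * E z) (eia (- alpha) * Cstar E z)) as H1.
  rewrite !Cmod_mult, !Cmod_eia in H1. lra.
Qed.

Lemma B_le z : 0 <= Im z -> Cmod (B z) <= Cmod (E z).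
Proof.
  intros Hz. unfold B, B_alpha. rewrite Cmod_mult, Cmod_div, Cmod_Ci by apply C2_ne. rewrite Cmod_R, Rabs_pos_eq by lra.
  pose proof (hb_le E HB z Hz). pose proof (Cmod_triangle (eia alpha * E z) (- (eia (- alpha) * Cstar E z))) as H1.
  rewrite Cmod_opp, !Cmod_mult, !Cmod_eia in H1. unfold Cminus. lra.
Qed.

(* If E/B grew linearly on iy then y |B/E|(iy) would be bounded, and |B/E|^2 = Re (1 - e^{-2 i alpha} Theta)/2
   would be integrable on R, so that A B would lie in H(E^2). *)
Lemma no_linear c Y : 0 < c -> ~ (forall y, Y <= y -> c * y <= Cmod (mer (0, y) - Ci)).
Proof.
  intros Hc Hlin. apply HnAB.
  set (k := fun z => (1 - zt E alpha z)%C).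
  assert (Hkd : forall z, - eta < Im z -> Cdiff k z).
  { intros z Hz. apply Cdiff_minus; [apply Cdiff_const|]. apply Cdiff_mult; [apply Cdiff_const|]. apply (th_Cdiff E HB). now apply Hne. }
  (* B is (i/2) exp (i alpha) E k, so k is small exactly where E/B is large. *)
  assert (Hke : forall z, 0 < Im z -> Cmod (mer z - Ci) * Cmod (k z) = 2).
  { intros z Hz. pose proof (hb_ne E HB z Hz) as Hn. assert (HBz : B z <> 0%C) by (apply (B_ne E alpha HB); lra).
    rewrite <- mer_EB by assumption. rewrite <- Cmod_mult.
    assert (Hk1 : k z <> 0%C) by (apply one_minus_ne; now apply zt_lt).
    assert (E1 : (eia alpha * E z / B z * k z)%C = (2 / Ci)%C).
    { unfold B. rewrite (B_zt E alpha z Hn). fold (k z). field. repeat split; try assumption; try apply eia_ne; apply Ci_ne. }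
    rewrite E1, Cmod_div, Cmod_Ci, Cmod_R by apply Ci_ne. rewrite Rabs_pos_eq; lra. }
  assert (Hkre : forall z, 0 < Im z -> 0 < Re (k z)).
  { intros z Hz. pose proof (zt_lt z Hz) as H. pose proof (re_le_Cmod (zt E alpha z)) as Hr. apply Rabs_le_between in Hr. unfold k. change (Re (1 - zt E alpha z)) with (1 + - Re (zt E alpha z)). lra. }
  (* Harnack's inequality carries the bound 2 / (c |z|) at i |z| over to z; the factor it costs is
     at most 4 |z| / Im z. *)
  set (C2 := 8 / c). assert (HC2 : 0 < C2) by (apply Rdiv_lt_0_compat; lra).
  assert (Hkb : forall z, 0 < Im z -> Y <= Cmod z -> Cmod (k z) <= C2 / Im z).
  { intros z Hz HY. assert (Hm : 0 < Cmod z) by (pose proof (im_le_Cmod z) as H; rewrite Rabs_pos_eq in H; lra).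
    set (z0 := (0, Cmod z) : C). assert (Hz0 : 0 < Im z0) by (unfold z0; simpl; lra).
    pose proof (harnack k z0 z (fun w Hw => Hkd w ltac:(unfold in_U in Hw; lra)) Hkre Hz0 Hz) as H. change (Im z0) with (Cmod z) in H.
    assert (Hd : Cmod (z - Cconj z0) <= 2 * Cmod z).
    { eapply Rle_trans; [apply Cmod_triangle|]. rewrite Cmod_opp, Cmod_conj. unfold z0. rewrite Cmod_iy; lra. }
    assert (Hk0 : Cmod (k z0) <= 2 / (c * Cmod z)).
    { pose proof (Hke z0 Hz0) as E0. specialize (Hlin (Cmod z) HY). fold z0 in Hlin. apply (proj1 (Rle_div_r _ _ (c * Cmod z) ltac:(nra))).
      rewrite <- E0, Rmult_comm. apply Rmult_le_compat_r; [apply Cmod_ge_0|assumption]. }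
    eapply Rle_trans; [exact H|]. apply Rle_trans with (2 / (c * Cmod z) * ((2 * Cmod z) ^ 2 / (Im z * Cmod z))).
    - apply Rmult_le_compat; [apply Cmod_ge_0| |assumption|].
      + apply Rdiv_le_0_compat; [apply pow2_ge_0|nra].
      + unfold Rdiv. apply Rmult_le_compat_r; [left; apply Rinv_0_lt_compat; nra|]. apply pow_incr. split; [apply Cmod_ge_0|assumption].
    - right. unfold C2. field. lra. }
  assert (Hkpos : forall x : R, 0 <= Re (k x)).
  { intros x. pose proof (zt_real_mod x) as H. pose proof (re_le_Cmod (zt E alpha x)) as Hr. apply Rabs_le_between in Hr. unfold k. change (Re (1 - zt E alpha x)) with (1 + - Re (zt E alpha x)). lra. }
  assert (HAe : entire A) by apply A_entire, hb_entire, HB. assert (HBe : entire B) by apply B_entire, hb_entire, HB.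
  assert (Hbd : forall z, 0 < Im z -> Cmod (A z * B z) <= 1 * (Cmod (E z) * Cmod (E z))).
  { intros z Hz. rewrite Cmod_mult, Rmult_1_l. apply Rmult_le_compat; try apply Cmod_ge_0; [apply A_le|apply B_le]; lra. }
  assert (HFe : entire (fun z => A z * B z)%C) by (intros z; now apply Cdiff_mult).
  (* |A| <= |E| and |B/E|^2 = |k|^2 / 4 = Re k / 2, the last step because [zt] is unimodular on
     R. *)
  assert (Hptw : forall x : R, Cmod (qE E (fun z => A z * B z)%C x) ^ 2 <= 1 / 2 * Re (k x)).
  { intros x. pose proof (herglotz_no_real_zero x) as Hn. pose proof (proj1 (Cmod_gt_0 _) Hn) as Hp.
    assert (H1 : Cmod (B x) = Cmod (E x) * (Cmod (k x) / 2)).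
    { unfold B. rewrite (B_zt E alpha x Hn). fold (k x). rewrite !Cmod_mult, Cmod_div, Cmod_Ci, Cmod_eia, Cmod_R, Rabs_pos_eq by (apply C2_ne || lra). field. }
    pose proof (A_le x ltac:(simpl; lra)) as H2. pose proof (unit_re (zt E alpha x) (zt_real_mod x)) as H3. fold (k x) in H3.
    unfold qE, Csq. rewrite Cmod_div, !Cmod_mult by now apply Cmult_neq_0. rewrite H1.
    replace (Cmod (A x) * (Cmod (E x) * (Cmod (k x) / 2)) / (Cmod (E x) * Cmod (E x))) with (Cmod (A x) / Cmod (E x) * (Cmod (k x) / 2)) by (field; lra).
    rewrite Rpow_mult_distr. replace ((Cmod (k x) / 2) ^ 2) with (1 / 2 * Re (k x)) by (replace ((Cmod (k x) / 2) ^ 2) with (Cmod (k x) ^ 2 / 4) by field; rewrite H3; field).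
    specialize (Hkpos x). rewrite <- (Rmult_1_l (1 / 2 * Re (k x))) at 2. apply Rmult_le_compat_r; [lra|].
    rewrite <- (pow1 2). apply pow_incr. split; [apply Rdiv_le_0_compat; [apply Cmod_ge_0|assumption]|]. apply Rle_div_l; lra. }
  assert (Hrc : forall (q : C -> C), (forall z, - eta < Im z -> Cdiff q z) -> forall x : R, rcont (fun t : R => q t) x).
  { intros q Hq x. apply (rcont_comp q (fun t => RtoC t)); [|apply rcont_RtoC]. apply Cdiff_ccont, Hq. simpl. lra. }
  assert (Hexk : forall a b, ex_RInt (fun t : R => Re (k t)) a b).
  { intros a b. apply (ex_RInt_continuous (V := R_CompleteNormedModule)). intros t _. apply continuous_R_eps. intros eps He.
    destruct (Hrc k Hkd t eps He) as [d [Hd H]]. exists d. split; [assumption|]. intros s Hs.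
    eapply Rle_lt_trans; [|apply (H s Hs)]. eapply Rle_trans; [|apply re_le_Cmod]. right. reflexivity. }
  assert (Hexq : forall a b, ex_RInt (fun x : R => Cmod (qE E (fun z => A z * B z)%C x) ^ 2) a b).
  { intros a b. apply (sq_ex_RInt (qE E (fun z => A z * B z)%C)). apply Hrc. intros z Hz. apply (qE_Cdiff E eta (hb_entire E HB) Hne); assumption. }
  apply (HdB_intro E HB _ 1 (8 * C2)); try assumption.
  - intros z Hz. replace (Cstar (fun z => A z * B z)%C z) with (A z * B z)%C; [now apply Hbd|].
    pose proof (A_star E alpha z) as S1. pose proof (B_star E alpha z) as S2. fold A in S1. fold B in S2.
    unfold Cstar in S1, S2 |- *. now rewrite Cmult_conj, S1, S2.
  - intros a b Hab. set (X := 2 * (Rabs a + Rabs b + Rabs Y + 1)).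
    assert (HX : - (X / 2) <= a /\ b <= X / 2 /\ Y <= X /\ 0 < X).
    { unfold X. pose proof (Rabs_pos a). pose proof (Rabs_pos b). pose proof (Rabs_pos Y). pose proof (Rle_abs (- a)). rewrite Rabs_Ropp in H2. pose proof (Rle_abs b). pose proof (Rle_abs Y). lra. }
    destruct HX as [X1 [X2 [X3 X4]]].
    eapply Rle_trans; [apply (RInt_mono_interval _ (- (X / 2)) a b (X / 2)); auto; intros; apply pow2_ge_0|].
    apply Rle_trans with (RInt (fun t : R => 1 / 2 * Re (k t)) (- (X / 2)) (X / 2)).
    + apply RInt_le; [lra|apply Hexq|now apply ex_RInt_Rscal|intros; apply Hptw].
    + rewrite RInt_Rscal by apply Hexk. pose proof (contour_bound k C2 X Hkd X4 ltac:(lra) (fun z Hz HXz => Hkb z Hz ltac:(lra)) Hkpos). lra.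
Qed.

Lemma Rpower_half_small c0 c1 : 0 < c1 -> exists Y, 1 <= Y /\ forall y, Y <= y -> c0 * Rpower y (1 / 2) <= c1 * y.
Proof.
  intros Hc. exists (Rmax 1 ((c0 / c1) ^ 2)). split; [apply Rmax_l|]. intros y Hy.
  assert (H1 : 1 <= y) by (eapply Rle_trans; [apply Rmax_l|exact Hy]). assert (H2 : (c0 / c1) ^ 2 <= y) by (eapply Rle_trans; [apply Rmax_r|exact Hy]).
  replace (1 / 2) with (/ 2) by field. rewrite Rpower_sqrt by lra. pose proof (sqrt_sqrt y ltac:(lra)) as Hs. pose proof (sqrt_lt_R0 y ltac:(lra)) as Hsp.
  assert (H3 : c0 / c1 <= sqrt y).
  { destruct (Rle_lt_dec (c0 / c1) 0); [lra|]. rewrite <- (sqrt_pow2 (c0 / c1)) by lra. now apply sqrt_le_1_alt. }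
  apply (proj1 (Rle_div_l _ _ _ Hc)) in H3. nra.
Qed.

(** Once both nonconstant polynomial coefficients vanish, only the sum [S] and a constant remain on
    iy, and [S] obeys the bound with exponent kap. *)
Lemma mer_subpower kap : 0 < kap <= 1 -> exists Ck, 0 <= Ck /\ forall y, 1 <= y -> Cmod (mer (0, y)) <= Ck * Rpower y kap.
Proof.
  destruct mer_expansion as [S [a0 [a1 [a2 [Hex HSb]]]]]. destruct mer_growth as [Cm [HCm Hg]].
  assert (Hoff : forall y, 1 <= y -> ~ Tc T (0, y)) by (intros y Hy; apply nonreal_off; simpl; lra).
  destruct (HSb (1 / 2) ltac:(lra)) as [C1 [HC1 HS1]].
  assert (Hsq : forall y, 1 <= y -> Rpower y (1 / 2) <= y) by (intros y Hy; rewrite <- (Rpower_1 y) at 2 by lra; apply Rle_Rpower; lra).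
  (* [mer_growth] allows at most linear growth on iy. *)
  assert (Ha2 : a2 = 0%C).
  { apply NNPP. intros Hn. pose proof (proj1 (Cmod_gt_0 _) Hn) as Hp.
    set (c := 4 * Cm + C1 + Cmod a0 + Cmod a1). assert (Hc : 0 <= c) by (unfold c; pose proof (Cmod_ge_0 a0); pose proof (Cmod_ge_0 a1); lra).
    set (y := 1 + c / Cmod a2). assert (Hy : 1 <= y) by (unfold y; assert (0 <= c / Cmod a2) by (apply Rdiv_le_0_compat; lra); lra).
    assert (Hyc : c < Cmod a2 * y) by (unfold y; replace (Cmod a2 * (1 + c / Cmod a2)) with (Cmod a2 + c) by (field; lra); lra).
    pose proof (Hex _ (Hoff y Hy)) as E1. pose proof (Hg (0, y) ltac:(simpl; lra)) as H1. rewrite Cmod_iy in H1 by lra. simpl Im in H1. rewrite Rabs_pos_eq in H1 by lra.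
    assert (H2 : (1 + y) ^ 2 / y <= 4 * y) by (apply Rle_div_l; nra).
    specialize (HS1 y Hy). specialize (Hsq y Hy).
    assert (E2 : (a2 * ((0, y) * (0, y)))%C = (mer (0, y) - S (0, y) - a0 - a1 * (0, y))%C) by (rewrite E1; ring).
    apply (f_equal Cmod) in E2. rewrite !Cmod_mult, !Cmod_iy in E2 by lra.
    assert (H3 : Cmod (mer (0, y) - S (0, y) - a0 - a1 * (0, y)) <= Cmod (mer (0, y)) + Cmod (S (0, y)) + Cmod a0 + Cmod a1 * y).
    { unfold Cminus. eapply Rle_trans; [apply Cmod_triangle|]. rewrite Cmod_opp, Cmod_mult, Cmod_iy by lra. apply Rplus_le_compat_r.
      eapply Rle_trans; [apply Cmod_triangle|]. rewrite Cmod_opp. apply Rplus_le_compat_r. eapply Rle_trans; [apply Cmod_triangle|]. rewrite Cmod_opp. lra. }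
    assert (H4 : Cmod a2 * (y * y) <= c * y).
    { rewrite E2. eapply Rle_trans; [exact H3|]. pose proof (Cmod_ge_0 a0). unfold c. nra. }
    nra. }
  (* As [S] grows at most like the square root of y, a nonzero a1 would force linear growth of |mer
     - i|, excluded by [no_linear]. *)
  assert (Ha1 : a1 = 0%C).
  { apply NNPP. intros Hn. pose proof (proj1 (Cmod_gt_0 _) Hn) as Hp.
    destruct (Rpower_half_small C1 (Cmod a1 / 4) ltac:(lra)) as [Y1 [HY1 HY2]].
    apply (no_linear (Cmod a1 / 2) (Rmax Y1 (4 * (Cmod a0 + 1) / Cmod a1)) ltac:(lra)). intros y Hy.
    assert (Hy1 : Y1 <= y) by (eapply Rle_trans; [apply Rmax_l|exact Hy]). assert (Hy2 : 4 * (Cmod a0 + 1) / Cmod a1 <= y) by (eapply Rle_trans; [apply Rmax_r|exact Hy]).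
    apply (proj1 (Rle_div_l _ _ _ Hp)) in Hy2. specialize (HY2 y Hy1). specialize (HS1 y ltac:(lra)).
    pose proof (Hex _ (Hoff y ltac:(lra))) as E1. rewrite Ha2 in E1.
    pose proof (Cmod_rev (a1 * (0, y)) (- (S (0, y) + (a0 + - Ci)))) as H. rewrite Cmod_opp, Cmod_mult, Cmod_iy in H by lra.
    replace (a1 * (0, y) - - (S (0, y) + (a0 + - Ci)))%C with (mer (0, y) - Ci)%C in H by (rewrite E1; ring).
    pose proof (Cmod_triangle (S (0, y)) (a0 + - Ci)) as H1. pose proof (Cmod_triangle a0 (- Ci)) as H2. rewrite Cmod_opp, Cmod_Ci in H2. lra. }
  intros Hk. destruct (HSb kap Hk) as [Ck [HCk HSk]]. exists (Ck + Cmod a0). split; [pose proof (Cmod_ge_0 a0); lra|]. intros y Hy.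
  rewrite (Hex _ (Hoff y Hy)), Ha1, Ha2. replace (S (0, y) + (a0 + 0 * (0, y) + 0 * ((0, y) * (0, y))))%C with (S (0, y) + a0)%C by ring.
  eapply Rle_trans; [apply Cmod_triangle|]. specialize (HSk y Hy).
  assert (1 <= Rpower y kap) by (rewrite <- (Rpower_O y) by lra; apply Rle_Rpower; lra). pose proof (Cmod_ge_0 a0). nra.
Qed.
End Herglotz.

(** The second difference of the values at y, 2 y, 3 y isolates -2 y^2 a2, and a first difference
    then isolates a1. *)
Lemma quadratic_vanishes a0 a1 a2 : (forall eps, 0 < eps -> exists Y, forall y, Y <= y -> Cmod (a0 + a1 * (0, y) + a2 * ((0, y) * (0, y))) <= eps) ->
  a0 = 0%C /\ a1 = 0%C /\ a2 = 0%C.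
Proof.
  intros H. set (Q := fun y : R => (a0 + a1 * (0, y) + a2 * ((0, y) * (0, y)))%C).
  assert (Hz : forall a : C, (forall eps, 0 < eps -> Cmod a <= eps) -> a = 0%C).
  { intros a Ha. apply Cmod_eq_0, Rle_antisym; [|apply Cmod_ge_0]. apply Rle_plus_epsilon. intros e He. rewrite Rplus_0_l. now apply Ha. }
  assert (Hs : forall y : R, ((0, y) : C) = (Ci * y)%C) by (intros y; Cext).
  pose proof Cmod_Ci as Hci.
  assert (H2 : a2 = 0%C).
  { apply Hz. intros eps He. destruct (H eps He) as [Y HY]. set (y := Rmax Y 2).
    assert (Hy : 2 <= y /\ Y <= y) by (split; [apply Rmax_r|apply Rmax_l]).
    pose proof (HY y ltac:(lra)) as Q1. pose proof (HY (2 * y) ltac:(lra)) as Q2. pose proof (HY (3 * y) ltac:(lra)) as Q3. fold (Q y) in Q1. fold (Q (2 * y)) in Q2. fold (Q (3 * y)) in Q3.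
    assert (E1 : (RtoC (- 2 * y ^ 2) * a2)%C = (Q y - (Q (2 * y)%R + Q (2 * y)%R) + Q (3 * y)%R)%C).
    { unfold Q. destruct a0, a1, a2. Cext. }
    apply (f_equal Cmod) in E1. rewrite Cmod_mult, Cmod_R in E1.
    assert (H3 : Cmod (Q y - (Q (2 * y)%R + Q (2 * y)%R) + Q (3 * y)%R) <= Cmod (Q y) + (Cmod (Q (2 * y)) + Cmod (Q (2 * y))) + Cmod (Q (3 * y))).
    { eapply Rle_trans; [apply Cmod_triangle|]. apply Rplus_le_compat_r. eapply Rle_trans; [apply Cmod_triangle|]. rewrite Cmod_opp. apply Rplus_le_compat_l. apply Cmod_triangle. }
    assert (Hy2 : 4 <= y ^ 2) by nra. rewrite Rabs_left in E1 by lra. pose proof (Cmod_ge_0 a2).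
    assert (0 <= (y ^ 2 - 4) * Cmod a2) by (apply Rmult_le_pos; lra). lra. }
  assert (H1 : a1 = 0%C).
  { apply Hz. intros eps He. destruct (H eps He) as [Y HY]. set (y := Rmax Y 2).
    assert (Hy : 2 <= y /\ Y <= y) by (split; [apply Rmax_r|apply Rmax_l]).
    pose proof (HY y ltac:(lra)) as Q1. pose proof (HY (2 * y) ltac:(lra)) as Q2. fold (Q y) in Q1. fold (Q (2 * y)) in Q2.
    assert (E1 : (Ci * y * a1)%C = (Q (2 * y)%R - Q y)%C).
    { unfold Q. rewrite H2. destruct a0, a1. Cext. }
    apply (f_equal Cmod) in E1. rewrite !Cmod_mult, Hci, Cmod_R, Rabs_pos_eq in E1 by lra.
    pose proof (Cmod_triangle (Q (2 * y)) (- Q y)) as H3. rewrite Cmod_opp in H3. unfold Cminus in E1. pose proof (Cmod_ge_0 a1). nra. }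
  split; [|split; assumption]. apply Hz. intros eps He. destruct (H eps He) as [Y HY]. specialize (HY Y (Rle_refl _)). rewrite H1, H2 in HY.
  replace (a0 + 0 * (0, Y) + 0 * ((0, Y) * (0, Y)))%C with a0 in HY by ring. exact HY.
Qed.

(** * The interpolation formula *)

Section Final.
Variables (E : C -> C) (alpha eta delta h : R) (phi : R -> R).
Hypothesis HB : Hermite_Biehler E.
Hypothesis Heta : 0 < eta.
Hypothesis Hne : forall z, - eta < Im z -> E z <> 0%C.
Hypothesis Hth14 : forall z, 0 < Im z < eta -> Cmod (E z) / 4 <= Cmod (Cstar E z).
Hypothesis Hth4 : forall z, - eta < Im z -> Cmod (th E z) <= 4.
Hypothesis Hphi : forall x : R, Im (eia (phi x) * E x)%C = 0.
Hypothesis Hth' : forall x : R, C_derive (th E) x = ((0, (2 * Derive phi x)%R) * th E x)%C.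
Hypothesis Hdelta : 0 < delta.
Hypothesis Hphi' : forall x, T_set phi alpha x -> delta <= Derive phi x.
Hypothesis Hh : 0 < h <= 1.
Let T := T_set phi alpha.
Let A := A_alpha E alpha.
Let B := B_alpha E alpha.
Hypothesis Hsep : forall t t', T t -> T t' -> t <> t' -> h <= Rabs (t - t').
Hypothesis HnAB : ~ HdB (Csq E) (fun z => A z * B z)%C.
Variables (p : R) (F : C -> C).
Hypothesis Hp1 : 1 <= p.
Hypothesis HF : Hp (Csq E) p F.

Let B1 := C_derive B.
Let B2 := C_derive B1.
Let rr (t : R) (z : C) : C := interp_term F (C_derive F) B B1 B2 t z.
Let pt (t : R) : C := (F t / (B1 t * B1 t))%C.
Let qt (t : R) : C := ((C_derive F t * B1 t - F t * B2 t) / (B1 t * B1 t * B1 t))%C.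

Lemma rr_bound t z : T t -> z <> RtoC t -> Cmod (rr t z) <= Cmod (pt t) * / Cmod (z - t) ^ 2 + Cmod (qt t) * / Cmod (z - t).
Proof.
  intros Ht Hzt. pose proof (Cminus_neq0 z t Hzt) as Hn. pose proof (proj1 (Cmod_gt_0 _) Hn) as Hp.
  assert (HB1 : B1 t <> 0%C) by exact (B1_ne E alpha eta delta phi HB Heta Hne Hphi Hth' Hdelta Hphi' t Ht).
  replace (rr t z) with (pt t / ((z - t) * (z - t)) + qt t / (z - t))%C.
  - eapply Rle_trans; [apply Cmod_triangle|]. rewrite !Cmod_div by (try apply Cmult_neq_0; assumption). rewrite Cmod_mult. right. field. lra.
  - unfold rr, interp_term, pt, qt. field. split; assumption.
Qed.

(** Up to a unimodular constant F / B^2 = g (A/B - i)^2 with g bounded, so the bound of [mer_growth]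
    enters squared; the lower half plane follows by passing to [Cstar F]. *)
Lemma f_growth : exists Cf, forall z, Im z <> 0 -> Cmod (F z / (B z * B z)) <= Cf * (1 + Cmod z) ^ 4 / Im z ^ 2.
Proof.
  destruct (mer_growth E alpha HB) as [Cm [HCm Hg]]. fold A B in Hg.
  pose proof (hb_entire E HB) as HE.
  destruct (mem_bounded E eta HE Heta Hne Hth14 p F Hp1 HF) as [M1 [HM1 H1]].
  destruct (mem_bounded E eta HE Heta Hne Hth14 p (Cstar F) Hp1 (mem_star E eta Heta Hne p F HF)) as [M2 [HM2 H2]].
  set (M := Rmax M1 M2). exists (M * (Cm + 1) ^ 2).
  assert (HM : 0 < M) by (unfold M; eapply Rlt_le_trans; [exact HM1|apply Rmax_l]).
  assert (HU : forall G, (forall z, 0 <= Im z -> Cmod (qE E G z) <= M) -> forall z, 0 < Im z -> Cmod (G z / (B z * B z)) <= M * (Cm + 1) ^ 2 * (1 + Cmod z) ^ 4 / Im z ^ 2).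
  { intros G HG z Hz. pose proof (hb_ne E HB z Hz) as Hn. assert (HBz : B z <> 0%C) by (apply (B_ne E alpha HB); lra).
    assert (Ee : (G z / (B z * B z))%C = (qE E G z * ((eia alpha * E z / B z) * (eia alpha * E z / B z)) / (eia alpha * eia alpha))%C).
    { unfold qE, Csq. field. repeat split; try assumption. apply eia_ne. }
    rewrite Ee, Cmod_div by (apply Cmult_neq_0; apply eia_ne). rewrite !Cmod_mult, Cmod_eia. unfold Rdiv at 1. rewrite Rmult_1_l, Rinv_1, Rmult_1_r.
    unfold B. rewrite (mer_EB E alpha z HBz). specialize (Hg z ltac:(lra)). rewrite Rabs_pos_eq in Hg by lra.
    pose proof (Cmod_triangle (mer E alpha z) (- Ci)) as Ht. rewrite Cmod_opp in Ht. rewrite Cmod_Ci in Ht.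
    pose proof (im_le_Cmod z) as Hi. rewrite Rabs_pos_eq in Hi by lra. set (m := 1 + Cmod z) in *. set (y := Im z) in *.
    assert (H3 : 1 <= m ^ 2 / y) by (apply (proj1 (Rle_div_r _ _ _ Hz)); unfold m in *; nra).
    assert (H4 : Cmod (mer E alpha z - Ci) <= (Cm + 1) * (m ^ 2 / y)) by (unfold Cminus; nra).
    set (d := Cmod (mer E alpha z - Ci)) in *. assert (Hd : 0 <= d) by apply Cmod_ge_0.
    specialize (HG z (Rlt_le _ _ Hz)).
    replace (M * (Cm + 1) ^ 2 * m ^ 4 / y ^ 2) with (M * (((Cm + 1) * (m ^ 2 / y)) * ((Cm + 1) * (m ^ 2 / y)))) by (field; unfold y in *; lra).
    apply Rmult_le_compat; [apply Cmod_ge_0|nra|assumption|]. apply Rmult_le_compat; assumption. }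
  assert (HG1 : forall z, 0 <= Im z -> Cmod (qE E F z) <= M) by (intros z Hz; eapply Rle_trans; [now apply H1|apply Rmax_l]).
  assert (HG2 : forall z, 0 <= Im z -> Cmod (qE E (Cstar F) z) <= M) by (intros z Hz; eapply Rle_trans; [now apply H2|apply Rmax_r]).
  intros z Hz. destruct (Rlt_dec 0 (Im z)) as [Hpos|Hneg]; [now apply HU|].
  pose proof (HU (Cstar F) HG2 (Cconj z) ltac:(rewrite im_conj; lra)) as H3. rewrite Cmod_conj, im_conj in H3. replace ((- Im z) ^ 2) with (Im z ^ 2) in H3 by ring.
  replace (Cmod (F z / (B z * B z))) with (Cmod (Cstar F (Cconj z) / (B (Cconj z) * B (Cconj z)))); [exact H3|].
  assert (HBz : B z <> 0%C) by (now apply (B_ne E alpha HB)). assert (HBz' : B (Cconj z) <> 0%C) by (apply (B_ne E alpha HB); rewrite im_conj; lra).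
  pose proof (B_star E alpha z) as Hs. fold B in Hs. unfold Cstar in Hs. unfold Cstar. rewrite Cconj_conj.
  rewrite !Cmod_div, !Cmod_mult, Cmod_conj by (now apply Cmult_neq_0). rewrite <- Hs, Cmod_conj. reflexivity.
Qed.

(** With kap = 1 / (4 p), the decay y^{-1/p} of g beats the growth y^{2 kap} of (E/B)^2 and leaves
    y^{-1/(2 p)}. *)
Lemma f_decay : forall eps, 0 < eps -> exists Y, forall y, Y <= y -> Cmod (F (0, y) / (B (0, y) * B (0, y))) <= eps.
Proof.
  intros eps He. pose proof (hb_entire E HB) as HE.
  destruct (coef_bounds E alpha eta delta phi HB Heta Hne Hth4 Hphi Hth' Hdelta Hphi') as [K [HK Hc]].
  set (kap := / (4 * p)). assert (Hk : 0 < kap <= 1).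
  { unfold kap. split; [apply Rinv_0_lt_compat; lra|]. rewrite <- Rinv_1. apply Rinv_le_contravar; lra. }
  destruct (mer_subpower E alpha eta delta h phi HB Heta Hne Hphi Hth' Hdelta Hphi' Hh Hsep HnAB K HK (fun t Ht => proj1 (Hc t Ht)) kap Hk) as [Ck [HCk Hm]].
  destruct (mem_decay E eta HE Heta Hne Hth14 p F Hp1 HF) as [C0 [HC0 Hd]].
  set (c := C0 * (Ck + 1) ^ 2 + 1). assert (Hcp : 0 < c) by (unfold c; assert (0 <= C0 * (Ck + 1) ^ 2) by (apply Rmult_le_pos; [lra|apply pow2_ge_0]); lra).
  exists (Rmax 1 (Rpower (c / eps) (2 * p))). intros y Hy.
  assert (H1 : 1 <= y) by (eapply Rle_trans; [apply Rmax_l|exact Hy]). assert (H2 : Rpower (c / eps) (2 * p) <= y) by (eapply Rle_trans; [apply Rmax_r|exact Hy]).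
  set (z := (0, y) : C). assert (Hz : 0 < Im z) by (unfold z; simpl; lra).
  pose proof (hb_ne E HB z Hz) as Hn. assert (HBz : B z <> 0%C) by (apply (B_ne E alpha HB); apply Rgt_not_eq; exact Hz).
  assert (Ee : (F z / (B z * B z))%C = (qE E F z * ((eia alpha * E z / B z) * (eia alpha * E z / B z)) / (eia alpha * eia alpha))%C).
  { unfold qE, Csq. field. repeat split; try assumption. apply eia_ne. }
  rewrite Ee, Cmod_div by (apply Cmult_neq_0; apply eia_ne). rewrite !Cmod_mult, Cmod_eia. unfold Rdiv at 1. rewrite Rmult_1_l, Rinv_1, Rmult_1_r.
  unfold B. rewrite (mer_EB E alpha z HBz). specialize (Hm y H1). fold z in Hm. specialize (Hd y H1). fold z in Hd.
  pose proof (Cmod_triangle (mer E alpha z) (- Ci)) as Ht. rewrite Cmod_opp, Cmod_Ci in Ht. 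
  assert (Hr1 : 1 <= Rpower y kap) by (rewrite <- (Rpower_O y) by lra; apply Rle_Rpower; lra).
  assert (H4 : Cmod (mer E alpha z - Ci) <= (Ck + 1) * Rpower y kap) by (change (mer E alpha z - Ci)%C with (mer E alpha z + - Ci)%C; nra).
  set (d := Cmod (mer E alpha z - Ci)) in *. assert (Hd0 : 0 <= d) by apply Cmod_ge_0.
  apply Rle_trans with (C0 * Rpower y (- / p) * (((Ck + 1) * Rpower y kap) * ((Ck + 1) * Rpower y kap))).
  { apply Rmult_le_compat; [apply Cmod_ge_0|nra|assumption|]. apply Rmult_le_compat; assumption. }
  assert (Hpw : Rpower y (- / p) * (Rpower y kap * Rpower y kap) = Rpower y (- / (2 * p))).
  { rewrite <- !Rpower_plus. f_equal. unfold kap. field. lra. }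
  replace (C0 * Rpower y (- / p) * ((Ck + 1) * Rpower y kap * ((Ck + 1) * Rpower y kap))) with (C0 * (Ck + 1) ^ 2 * (Rpower y (- / p) * (Rpower y kap * Rpower y kap))) by ring.
  rewrite Hpw. apply Rle_trans with (c * Rpower y (- / (2 * p))).
  { apply Rmult_le_compat_r; [left; apply exp_pos|unfold c; lra]. }
  assert (Hce : 0 < c / eps) by (apply Rdiv_lt_0_compat; lra).
  rewrite Rpower_Ropp. assert (H5 : c / eps <= Rpower y (/ (2 * p))).
  { rewrite <- (Rpower_1 (c / eps)) by assumption. replace 1 with (2 * p * / (2 * p)) by (field; lra). rewrite <- Rpower_mult.
    apply Rle_Rpower_l; [left; apply Rinv_0_lt_compat; lra|]. split; [apply exp_pos|assumption]. }
  set (u := Rpower y (/ (2 * p))) in *. assert (Hu : 0 < u) by apply exp_pos.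
  apply (proj2 (Rle_div_l c eps u Hu)). apply (proj1 (Rle_div_l c u eps He)) in H5. lra.
Qed.

Lemma interp_main : exists (S : C -> C) (L : nat -> list R), (forall n, sub T (L n)) /\
  (forall z n l rho, ~ Tc T z -> sub T l -> incl (L n) l -> 0 < rho <= 1 -> (forall t, T t -> ~ In t l -> rho <= Cmod (z - t)) ->
    Cmod (S z - Csum_list l (fun t => rr t z)) <= (/2) ^ n * ((1 + Cmod z) ^ 2 / rho ^ 2)) /\
  forall z, ~ Tc T z -> F z = (B z * B z * S z)%C.
Proof.
  pose proof (hb_entire E HB) as HE. pose proof (proj1 HF) as HFe.
  assert (HBe : entire B) by (apply B_entire; assumption).
  destruct (coef_bounds E alpha eta delta phi HB Heta Hne Hth4 Hphi Hth' Hdelta Hphi') as [K [HK Hc]].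
  destruct (mem_sums E eta HE Heta Hne Hth14 p F h Hp1 HF Hh) as [C0 [HC0 Hsum]].
  (* The two coefficients at t are at most K |g| and K (|g| + |g'|), and the kernel contributes the
     factor 2 / (1 + |t|); [mem_sums] makes the product summable. *)
  set (om := fun t => 2 * K * (2 * (/ (1 + Rabs t) * Cmod (qE E F t)) + / (1 + Rabs t) * Cmod (C_derive (qE E F) t))).
  assert (HC : forall l, sub T l -> rsum l om <= 2 * K * (2 * C0 + C0)).
  { intros l Hl. unfold om. rewrite rsum_scal, rsum_plus, rsum_scal. destruct (Hsum l (sub_separated T h Hsep l Hl)) as [S1 S2].
    apply Rmult_le_compat_l; lra. }
  assert (Hpq : forall t, T t -> (Cmod (pt t) + Cmod (qt t)) * (2 * / (1 + Rabs t)) <= om t).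
  { intros t Ht. destruct (proj2 (Hc t Ht) F HFe) as [P1 P2]. fold B B1 in P1, P2. fold B2 in P2. fold (pt t) in P1. fold (qt t) in P2.
    unfold om. pose proof (Rabs_pos t). assert (Hi : 0 < / (1 + Rabs t)) by (apply Rinv_0_lt_compat; lra). set (i := / (1 + Rabs t)) in *.
    replace (2 * K * (2 * (i * Cmod (qE E F t)) + i * Cmod (C_derive (qE E F) t))) with ((K * Cmod (qE E F t) + K * (Cmod (qE E F t) + Cmod (C_derive (qE E F) t))) * (2 * i)) by ring.
    apply Rmult_le_compat_r; lra. }
  assert (Hker : forall t z rho, T t -> 0 < rho <= 1 -> rho <= Cmod (z - t) -> Cmod (rr t z) <= om t * ((1 + Cmod z) ^ 2 / rho ^ 2)).
  { intros t z rho Ht Hrho Hd. assert (Hzt : z <> RtoC t) by (intros ->; rewrite Cmod_self in Hd; lra).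
    eapply Rle_trans; [now apply rr_bound|]. pose proof (inv_dist z t rho Hrho Hd) as Hi. specialize (Hpq t Ht).
    pose proof (Cmod_ge_0 (pt t)). pose proof (Cmod_ge_0 (qt t)). set (a := Cmod (pt t)) in *. set (b := Cmod (qt t)) in *. set (d := Cmod (z - t)) in *.
    assert (Hd1 : / d <= / rho) by (apply Rinv_le_contravar; lra). assert (Hd0 : 0 < / d) by (apply Rinv_0_lt_compat; lra).
    assert (Hr1 : 1 <= / rho) by (rewrite <- Rinv_1; apply Rinv_le_contravar; lra).
    set (m := 1 + Cmod z) in *. assert (Hm : 1 <= m) by (unfold m; pose proof (Cmod_ge_0 z); lra). set (i := / (1 + Rabs t)) in *.
    assert (Hip : 0 < i) by (apply Rinv_0_lt_compat; pose proof (Rabs_pos t); lra).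
    apply Rle_trans with ((a + b) * (/ rho * / d)).
    - replace (/ d ^ 2) with (/ d * / d) by (field; lra). rewrite Rmult_plus_distr_r. apply Rplus_le_compat; apply Rmult_le_compat_l; try assumption; nra.
    - apply Rle_trans with ((a + b) * (/ rho * (2 * m / rho * i))).
      + apply Rmult_le_compat_l; [lra|]. apply Rmult_le_compat_l; lra.
      + replace ((a + b) * (/ rho * (2 * m / rho * i))) with ((a + b) * (2 * i) * (m / rho ^ 2)) by (field; lra).
        apply Rmult_le_compat; [apply Rmult_le_pos; lra|apply Rdiv_le_0_compat; [lra|apply pow_lt; lra]|assumption|].
        unfold Rdiv. apply Rmult_le_compat_r; [left; apply Rinv_0_lt_compat, pow_lt; lra|nra]. }
  assert (Hcd : forall t z, T t -> z <> RtoC t -> Cdiff (rr t) z).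
  { intros t z Ht Hzt. pose proof (Cminus_neq0 z t Hzt) as Hn.
    assert (HB1 : B1 t <> 0%C) by exact (B1_ne E alpha eta delta phi HB Heta Hne Hphi Hth' Hdelta Hphi' t Ht).
    assert (Hd : Cdiff (fun z => z - t)%C z) by (apply Cdiff_minus; [apply Cdiff_id|apply Cdiff_const]).
    unfold rr, interp_term. apply Cdiff_plus; (apply Cdiff_div; [apply Cdiff_const| |]).
    - apply Cdiff_mult; [apply Cdiff_const|]. apply Cdiff_mult; exact Hd.
    - repeat apply Cmult_neq_0; assumption.
    - apply Cdiff_mult; [apply Cdiff_const|exact Hd].
    - repeat apply Cmult_neq_0; assumption. }
  destruct (ml_sum T h om _ rr Hh Hsep HC Hker) as [S [L [HL HS]]].
  destruct f_growth as [Cf Hg].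
  set (f := fun z => (F z / (B z * B z))%C).
  destruct (mittag_leffler T h om _ rr Hh Hsep HC Hcd Hker S L HL HS f Cf) as [a0 [a1 [a2 Hex]]].
  - intros z Hz. assert (HBz : B z <> 0%C) by exact (offT_B E alpha eta phi HB Heta Hne Hphi z Hz).
    apply Cdiff_div; [apply HFe|apply Cdiff_mult; apply HBe|now apply Cmult_neq_0].
  - intros t Ht. apply (double_pole F B t HFe HBe).
    + exact (T_B E alpha eta phi Heta Hne Hphi t Ht).
    + exact (B1_ne E alpha eta delta phi HB Heta Hne Hphi Hth' Hdelta Hphi' t Ht).
  - exact Hg.
  - destruct (quadratic_vanishes a0 a1 a2) as [Z0 [Z1 Z2]].
    (* On iy the polynomial is F / B^2 - S. The first part tends to 0 by [f_decay], the finite part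
       of S over [L n] is O(1/y), and the remainder is at most 2^{-n}. *)
    + intros eps He. destruct (pow_half_lt (eps / 4)) as [n Hn]; [lra|]. specialize (Hn n (le_n n)).
      destruct (f_decay (eps / 4) ltac:(lra)) as [Y1 HY1].
      set (Mn := rsum (L n) (fun t => Cmod (pt t) + Cmod (qt t))).
      assert (HMn : 0 <= Mn) by (apply rsum_ge0; intros t _; pose proof (Cmod_ge_0 (pt t)); pose proof (Cmod_ge_0 (qt t)); lra).
      exists (Rmax (Rmax 1 Y1) (Mn / (eps / 4))). intros y Hy.
      assert (H0 : Rmax 1 Y1 <= y) by (eapply Rle_trans; [apply Rmax_l|exact Hy]). assert (H2 : Mn / (eps / 4) <= y) by (eapply Rle_trans; [apply Rmax_r|exact Hy]).
      assert (H1 : 1 <= y) by (eapply Rle_trans; [apply Rmax_l|exact H0]). assert (H3 : Y1 <= y) by (eapply Rle_trans; [apply Rmax_r|exact H0]).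
      assert (Hoff : ~ Tc T (0, y)) by (apply nonreal_off; simpl; lra).
      pose proof (Hex _ Hoff) as E1. specialize (HY1 y H3). change (F (0, y) / (B (0, y) * B (0, y)))%C with (f (0, y)) in HY1.
      assert (Hdist : forall t : R, y <= Cmod ((0, y) - t) /\ Rabs t <= Cmod ((0, y) - t)).
      { intros t. split.
        - pose proof (im_le_Cmod ((0, y) - t)) as H. replace (Im ((0, y) - t)) with y in H by (unfold Im; simpl; ring). rewrite Rabs_pos_eq in H by lra. exact H.
        - pose proof (re_le_Cmod ((0, y) - t)) as H. replace (Re ((0, y) - t)) with (- t) in H by (simpl; ring). rewrite Rabs_Ropp in H. exact H. }
      assert (Hrr : forall t, T t -> Cmod (rr t (0, y)) <= (Cmod (pt t) + Cmod (qt t)) * / Cmod ((0, y) - t)).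
      { intros t Ht. destruct (Hdist t) as [D1 D2]. eapply Rle_trans; [apply rr_bound; [assumption|]|].
        - intros E0. apply (f_equal Im) in E0. simpl in E0. lra.
        - set (d := Cmod ((0, y) - t)) in *. assert (Hd0 : 0 < / d) by (apply Rinv_0_lt_compat; lra).
          assert (Hd1 : / d <= 1) by (rewrite <- Rinv_1; apply Rinv_le_contravar; lra).
          replace (/ d ^ 2) with (/ d * / d) by (field; lra). rewrite Rmult_plus_distr_r. apply Rplus_le_compat_r. apply Rmult_le_compat_l; [apply Cmod_ge_0|nra]. }
      (* Since |iy - t| >= max (y, |t|) >= (1 + |t|) / 2, each term is at most [om t], so the tail
         estimate holds with Y = 1 uniformly in y; the general kernel bound would grow like y^2. *)
      assert (Hb1 : Cmod (S (0, y) - Csum_list (L n) (fun t => rr t (0, y))) <= (/2) ^ n * 1).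
      { apply HS; auto; [apply incl_refl|lra|]. intros t Ht _. destruct (Hdist t) as [D1 D2]. rewrite Rmult_1_r. eapply Rle_trans; [now apply Hrr|].
        eapply Rle_trans; [|now apply Hpq]. apply Rmult_le_compat_l; [pose proof (Cmod_ge_0 (pt t)); pose proof (Cmod_ge_0 (qt t)); lra|].
        pose proof (Rabs_pos t). replace (2 * / (1 + Rabs t)) with (/ ((1 + Rabs t) / 2)) by (field; lra). apply Rinv_le_contravar; lra. }
      assert (Hb2 : Cmod (Csum_list (L n) (fun t => rr t (0, y))) <= eps / 4).
      { eapply Rle_trans; [apply Csum_bound|]. apply Rle_trans with (rsum (L n) (fun t => / y * (Cmod (pt t) + Cmod (qt t)))).
        - apply rsum_le. intros t Ht. destruct (Hdist t) as [D1 D2]. eapply Rle_trans; [apply Hrr; now apply (proj2 (HL n))|]. rewrite Rmult_comm.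
          apply Rmult_le_compat_r; [pose proof (Cmod_ge_0 (pt t)); pose proof (Cmod_ge_0 (qt t)); lra|]. apply Rinv_le_contravar; lra.
        - rewrite rsum_scal. fold Mn. apply (proj1 (Rle_div_l _ _ (eps / 4) ltac:(lra))) in H2.
          apply (Rmult_le_reg_l y); [lra|]. rewrite <- Rmult_assoc, Rinv_r by lra. lra. }
      replace (a0 + a1 * (0, y) + a2 * ((0, y) * (0, y)))%C with (f (0, y) + - ((S (0, y) - Csum_list (L n) (fun t => rr t (0, y))) + Csum_list (L n) (fun t => rr t (0, y))))%C by (rewrite E1; ring).
      eapply Rle_trans; [apply Cmod_triangle|]. rewrite Cmod_opp. pose proof (Cmod_triangle (S (0, y) - Csum_list (L n) (fun t => rr t (0, y))) (Csum_list (L n) (fun t => rr t (0, y)))). lra.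
    + exists S, L. split; [assumption|]. split.
      * intros z n l rho. apply (ml_sum_rho T om rr Hker S L HS).
      * intros z Hz. assert (HBz : B z <> 0%C) by exact (offT_B E alpha eta phi HB Heta Hne Hphi z Hz).
        specialize (Hex z Hz). rewrite Z0, Z1, Z2 in Hex. replace (S z) with (f z) by (rewrite Hex; ring). unfold f. field. assumption.
Qed.

(** The starting list contains all nodes in [-R0 - 1, R0 + 1], so the remaining nodes have distance
    at least 1 from the disc. Multiplying by B^2, bounded there, keeps the estimate uniform up to
    the excluded nodes. *)
Lemma interp_uniform R0 : 0 < R0 ->
  unif_sum_conv T (fun t z => B z * B z * rr t z)%C F (fun z => Cmod z <= R0 /\ ~ (exists t : R, T t /\ z = RtoC t)).
Proof.
  intros HR eps He. destruct interp_main as [S [L [HL [HS Heq]]]].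
  assert (HBe : entire B) by (apply B_entire, hb_entire, HB).
  destruct (bounded_disc B R0 (fun z => Cdiff_ccont _ _ (HBe z))) as [M HM].
  set (X := M ^ 2 * (1 + R0) ^ 2). assert (HX : 0 <= X) by (apply Rmult_le_pos; apply pow2_ge_0).
  destruct (pow_half_lt (eps / (X + 1))) as [n Hn]; [apply Rdiv_lt_0_compat; lra|]. specialize (Hn n (le_n n)). apply Rlt_div_r in Hn; [|lra].
  destruct (finite_window T h Hh Hsep (R0 + 1)) as [W [HW HWin]].
  pose proof (sub_union T W (L n) HW (HL n)) as Hl0. set (l0 := L n ++ ldiff W (L n)) in *.
  exists l0. split; [apply Hl0|]. split; [apply Hl0|]. intros l Hnd HlT Hinc z [Hz Hoff].
  assert (Hinc1 : incl (L n) l) by (intros t Ht; apply Hinc; unfold l0; apply in_app_iff; now left).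
  assert (HincW : incl W l).
  { intros t Ht. apply Hinc. unfold l0. apply in_app_iff. rewrite ldiff_in. destruct (in_dec Req_EM_T t (L n)); tauto. }
  pose proof (HS z n l 1 Hoff (conj Hnd HlT) Hinc1 ltac:(lra)) as Hb.
  rewrite (Csum_scal l (B z * B z)%C (fun t => rr t z)), (Heq z Hoff).
  replace (B z * B z * S z - B z * B z * Csum_list l (fun t => rr t z))%C with (B z * B z * (S z - Csum_list l (fun t => rr t z)))%C by ring.
  rewrite !Cmod_mult. specialize (HM z Hz). pose proof (Cmod_ge_0 (B z)) as H0.
  assert (Hfar : forall t, T t -> ~ In t l -> 1 <= Cmod (z - t)).
  { intros t Ht Hnin. assert (Ht2 : R0 + 1 < Rabs t) by (apply Rnot_le_lt; intros H; apply Hnin, HincW; now apply HWin).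
    pose proof (Cmod_rev t z) as H. rewrite Cmod_R, (Cmod_minus_sym t z) in H. lra. }
  specialize (Hb Hfar). apply Rle_lt_trans with (M * M * ((/2) ^ n * (1 + R0) ^ 2)).
  - apply Rmult_le_compat; [nra|apply Cmod_ge_0|apply Rmult_le_compat; assumption|]. eapply Rle_trans; [exact Hb|].
    apply Rmult_le_compat_l; [apply pow_le; lra|]. replace ((1 + Cmod z) ^ 2 / 1 ^ 2) with ((1 + Cmod z) ^ 2) by field. apply pow_incr. pose proof (Cmod_ge_0 z). lra.
  - pose proof (pow_le (/2) n ltac:(lra)). replace (M * M * ((/2) ^ n * (1 + R0) ^ 2)) with ((/2) ^ n * X) by (unfold X; ring). lra.
Qed.
End Final.

Theorem theorem1 (E : C -> C) (alpha : R) (phi : R -> R)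
  (dB ddB : C -> C) :
  Hermite_Biehler E ->
  (forall F : C -> C, HdB (Csq E) F ->
     exists dF : C -> C, (forall z, is_derive F z (dF z)) /\ HdB (Csq E) dF) ->
  ~ HdB (Csq E) (fun z => (A_alpha E alpha z * B_alpha E alpha z)%C) ->
  phase_function E phi ->
  (exists delta : R, 0 < delta /\
     forall x : R, T_set phi alpha x -> delta <= Derive phi x) ->
  (forall z, is_derive (B_alpha E alpha) z (dB z)) ->
  (forall z, is_derive dB z (ddB z)) ->
  forall (p : R) (F dF : C -> C),
    1 <= p ->
    (p <= 2 \/ mean_type_lt (fun z => (Cstar E z / E z)%C) 0) ->
    Hp (Csq E) p F ->
    (forall z, is_derive F z (dF z)) ->
    forall r : R, 0 < r ->
      unif_sum_conv (T_set phi alpha)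
        (fun t z => (B_alpha E alpha z * B_alpha E alpha z *
                     interp_term F dF (B_alpha E alpha) dB ddB t z)%C)
        F
        (fun z => Cmod z <= r /\ ~ (exists t : R, T_set phi alpha t /\ z = RtoC t)).
Proof.
  intros HB Hclosed HnAB [Hra Hphi] [delta [Hdelta Hphi']] HdB1 HdB2 p F dF Hp1 _ HF HdF r Hr.
  pose proof (real_analytic_derivable phi Hra) as Hd.
  destruct (strip_ex E phi HB Hd Hphi Hclosed) as [eta [Heta [Hne [H14 H4]]]].
  destruct (phase_gap E HB phi Hd Hphi Hclosed) as [l [Hl Hgap]].
  pose proof (phi_mono E HB phi Hd Hphi Hclosed) as Hmono.
  set (h := Rmin l 1). assert (Hh : 0 < h <= 1) by (split; [apply Rmin_glb_lt; lra|apply Rmin_r]).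
  (* Over a distance below l the phase increases by less than 1/2, hence by no nonzero multiple of
     pi. Two nodes that close would share the value of phi, making phi constant between them,
     against phi'(t) >= delta. *)
  assert (Hlt : forall t t', T_set phi alpha t -> T_set phi alpha t' -> t < t' -> h <= t' - t).
  { intros t t' [k Hk] [k' Hk'] Hlt. apply Rnot_lt_le. intros Hc.
    assert (Hc2 : t' - t < l) by (eapply Rlt_le_trans; [exact Hc|apply Rmin_l]).
    pose proof (Hmono t t' ltac:(lra)) as M1. pose proof (Hmono t' (t + l) ltac:(lra)) as M2. specialize (Hgap t).
    assert (Hkk : k' = k).
    { pose proof PI2_1 as HP. assert (HP2 : 0 < PI) by apply PI_RGT_0.
      assert (U1 : IZR k <= IZR k') by nra. apply le_IZR in U1. assert (U2 : IZR k' < IZR k + 1) by nra. rewrite <- plus_IZR in U2. apply lt_IZR in U2. lia. }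
    subst k'. assert (Heq : phi t' = phi t) by lra.
    specialize (Hphi' t (ex_intro _ k Hk)). set (D := Derive phi t) in *.
    assert (Hder : derivable_pt_lim phi t D) by (apply is_derive_Reals, Derive_correct, Hd).
    destruct (Hder D ltac:(lra)) as [d Hdd]. pose proof (cond_pos d) as Hdp.
    set (u := Rmin (d / 2) (t' - t)). assert (Hu : 0 < u /\ u < d /\ u <= t' - t).
    { unfold u. pose proof (Rmin_l (d / 2) (t' - t)). pose proof (Rmin_r (d / 2) (t' - t)). assert (0 < Rmin (d / 2) (t' - t)) by (apply Rmin_glb_lt; lra). lra. }
    specialize (Hdd u ltac:(lra) ltac:(rewrite Rabs_pos_eq; lra)).
    pose proof (Hmono t (t + u) ltac:(lra)) as N1. pose proof (Hmono (t + u) t' ltac:(lra)) as N2.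
    replace ((phi (t + u) - phi t) / u - D) with (- D) in Hdd by (replace (phi (t + u)) with (phi t) by lra; field; lra).
    rewrite Rabs_Ropp, Rabs_pos_eq in Hdd; lra. }
  assert (Hsep : forall t t', T_set phi alpha t -> T_set phi alpha t' -> t <> t' -> h <= Rabs (t - t')).
  { intros t t' Ht Ht' Hne'. destruct (Rtotal_order t t') as [H|[H|H]]; [|contradiction|].
    - rewrite Rabs_minus_sym. eapply Rle_trans; [now apply (Hlt t t')|apply Rle_abs].
    - eapply Rle_trans; [now apply (Hlt t' t)|apply Rle_abs]. }
  (* The derivatives in the statement are given as functions; uniqueness identifies them with
     [C_derive], in whose terms the estimates are written. *)
  assert (EF : dF = C_derive F) by (apply functional_extensionality; intros z; symmetry; apply C_derive_cd, is_derive_cd, HdF).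
  assert (EB : dB = C_derive (B_alpha E alpha)) by (apply functional_extensionality; intros z; symmetry; apply C_derive_cd, is_derive_cd, HdB1).
  subst dF dB.
  assert (EBB : ddB = C_derive (C_derive (B_alpha E alpha))) by (apply functional_extensionality; intros z; symmetry; apply C_derive_cd, is_derive_cd, HdB2).
  subst ddB.
  exact (interp_uniform E alpha eta delta h phi HB Heta Hne H14 H4 Hphi (th_deriv E HB phi Hd Hphi Hclosed) Hdelta Hphi' Hh Hsep HnAB p F Hp1 HF r Hr).
Qed.
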